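(* Let $\wp,\zeta$ be the Weierstrass functions of the torus $$\wp'(\alpha)^2=4\Big(\wp(\alpha)-\tfrac{\sqrt2}{3}\Big)\Big(\wp(\alpha)+\tfrac{3+\sqrt2}{6}\Big)\Big(\wp(\alpha)-\tfrac{3-\sqrt2}{6}\Big),$$ and let $\varkappa$ be such that $\wp(\varkappa)=-\frac72-\frac{13}{6}\sqrt2$ and $\wp'(\varkappa)=\sqrt[4]{32}\,(7+5\sqrt2)\,i$. Consider the Fuchsian equation of Whittaker's uniformization of the curve $y^2=x^5-x$, $$\Psi_{xx}=-\frac3{16}\,\frac{x^8+14x^4+1}{(x^5-x)^2}\,\Psi,$$ and the change of variables $(x,\Psi)\mapsto(\alpha,\Xi)$ given by $$\wp(\alpha)=-\frac{3+\sqrt2}{6}+\frac{1+\sqrt2}{x-i}-i\,\frac{1+\sqrt2}{x+1},\qquad \Xi(\alpha)=\sqrt{\alpha_x}\,\Psi(x).$$ Then the orbifold corresponding to Whittaker's uniformization of Burnside's Riemann surface (the Riemann surface of $y^2=x^5-x$, represented by this cover of the torus) is defined by the Fuchsian equation on the torus, obtained from the equation $\Psi_{xx}=-\frac3{16}\,\frac{x^8+14x^4+1}{(x^5-x)^2}\,\Psi$ by this change of variables, with two singularities $\alpha=\pm\varkappa$ (modulo periods) and three accessory parameters: $$\Xi_{\alpha\alpha}=-\tfrac3{16}\Big\{\wp(\alpha-\varkappa)+\wp(\alpha+\varkappa)-32^{-1/4}\,i\,\zeta(\alpha-\varkappa)+32^{-1/4}\,i\,\zeta(\alpha+\varkappa)-\big(2^{-1/4}\,i\,\zeta(\varkappa)+\sqrt2+1\big)\Big\}\,\Xi,$$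 or, equivalently, $$\Xi_{\alpha\alpha}=-\tfrac3{16}\Big\{\wp(\alpha-\varkappa)+\wp(\alpha+\varkappa)+\frac{7+5\sqrt2}{\wp(\alpha)-\wp(\varkappa)}-\sqrt2-1\Big\}\,\Xi .$$
   Context: $\wp,\zeta$ are the Weierstrass functions with invariants $g_2=\frac53$, $g_3=-\frac{7}{27}\sqrt2$. Subscripts denote derivatives; $\alpha_x=d\alpha/dx$. Roots of positive numbers are positive. The accessory parameters of an equation $\Xi_{\alpha\alpha}=\frac12Q(\alpha)\Xi$ on a torus are the coefficients of the $\zeta$-functions in $Q$ and the free constant term. The Whittaker equation $\Psi_{xx}=-\frac3{16}\,\frac{x^8+14x^4+1}{(x^5-x)^2}\,\Psi$ is the equation $\Psi_{xx}=-\frac{3}{16}\big\{\sum_{k=1}^5\frac1{(x-e_k)^2}-\frac{4x^3+A_1x^2+A_2x+A_3}{(x-e_1)\cdots(x-e_5)}\big\}\Psi$ with $\{e_k\}=\{0,\pm1,\pm i\}$ and $A_1=A_2=A_3=0$ (known, by a result of Rankin, to be the correct accessory parameters for this curve). The orbifold defined by an equation on the torus is the one uniformized by the ratio of two of its independent solutions, i.e. given by its monodromy group. *)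

(* Defs.v *)
From Stdlib Require Import Reals ZArith Lra.
From Coquelicot Require Import Coquelicot.

Set Implicit Arguments.

Open Scope C_scope.

Definition holo_at (f : C -> C) (z : C) : Prop :=
  ex_derive (K := C_AbsRing) (V := C_NormedModule) f z.

Record lattice := Lattice {
  om1 : C;
  om2 : C;
  om_indep : Im (om2 / om1) <> 0%R  (* forces [om1 <> 0], since [/ 0 = 0] *)
}.

Definition lattice_pt (L : lattice) (m n : Z) : C :=
  RtoC (IZR m) * om1 L + RtoC (IZR n) * om2 L.

Definition in_lattice (L : lattice) (z : C) : Prop :=
  exists m n : Z, z = lattice_pt L m n.

(* Sum of [F l] over the nonzero [l = m om1 + n om2] with [|m|, |n| <= N]. *)
Definition box_sum (L : lattice) (F : C -> C) (N : nat) : C :=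
  sum_n (fun i => sum_n (fun j =>
    let m := (Z.of_nat i - Z.of_nat N)%Z in
    let n := (Z.of_nat j - Z.of_nat N)%Z in
    if ((m =? 0) && (n =? 0))%Z%bool then RtoC 0 else F (lattice_pt L m n))
    (2 * N)) (2 * N).

(* All the lattice series below converge absolutely, so that the choice of
   the exhaustion by boxes does not affect their values. *)
Definition lattice_sum (L : lattice) (F : C -> C) : C :=
  (real (Lim_seq (fun N => Re (box_sum L F N))),
   real (Lim_seq (fun N => Im (box_sum L F N)))).

Definition lattice_g2 (L : lattice) : C :=
  RtoC 60 * lattice_sum L (fun l => / l ^ 4).

Definition lattice_g3 (L : lattice) : C :=
  RtoC 140 * lattice_sum L (fun l => / l ^ 6).

(* The values of [wp] and [wzeta] at lattice points are meaningless. *)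
Definition wp (L : lattice) (z : C) : C :=
  / z ^ 2 + lattice_sum L (fun l => / (z - l) ^ 2 - / l ^ 2).

Definition wzeta (L : lattice) (z : C) : C :=
  / z + lattice_sum L (fun l => / (z - l) + / l + z / l ^ 2).

(* The cubic [4 X^3 - g2 X - g3] for [g2 = 5/3], [g3 = - 7 sqrt 2 / 27]. *)
Lemma torus_cubic_factorization (X : C) :
  RtoC 4 * X ^ 3 - RtoC (5 / 3) * X - RtoC (- (7 / 27) * sqrt 2)
  = RtoC 4 * (X - RtoC (sqrt 2 / 3)) * (X + RtoC ((3 + sqrt 2) / 6))
    * (X - RtoC ((3 - sqrt 2) / 6)).
Proof.
assert (H : (sqrt 2 * sqrt 2 = 2)%R) by (apply sqrt_sqrt; lra).
set (r := sqrt 2) in *; clearbody r.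
destruct X as [a b]; unfold Cpow, RtoC, Cminus, Cplus, Copp, Cmult; simpl.
f_equal; field [H].
Qed.

Definition solution_at (q f : C -> C) (z0 : C) : Prop :=
  locally z0 (fun z => holo_at f z /\
    is_derive (K := C_AbsRing) (V := C_NormedModule)
      (C_derive f) z (q z * f z)).

Definition independent_at (f1 f2 : C -> C) (z0 : C) : Prop :=
  forall c1 c2 : C, locally z0 (fun z => c1 * f1 z + c2 * f2 z = 0) ->
    c1 = 0 /\ c2 = 0.

Definition in01 (t : R) : Prop := (0 <= t <= 1)%R.

Definition is_path (g : R -> C) : Prop :=
  forall t, in01 t -> filterlim g (within in01 (locally t)) (locally (g t)).

(* The germs of [F t] at [g t] form an analytic continuation, along the path
   [g], of the germ of [f] at [g 0]; each of them has the property [P]. *)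
Definition continuation (P : (C -> C) -> C -> Prop)
    (g : R -> C) (F : R -> C -> C) (f : C -> C) : Prop :=
  locally (g 0%R) (fun z => F 0%R z = f z) /\
  forall t, in01 t -> P (F t) (g t) /\
    locally t (fun s => in01 s -> locally (g s) (fun z => F s z = F t z)).

Record mat2 := Mat2 { m11 : C; m12 : C; m21 : C; m22 : C }.

Definition mat2_det (M : mat2) : C := m11 M * m22 M - m12 M * m21 M.

Definition mat2_scale (k : C) (M : mat2) : mat2 :=
  Mat2 (k * m11 M) (k * m12 M) (k * m21 M) (k * m22 M).

Definition regular_singular_at (q : C -> C) (a : C) : Prop :=
  (exists h, locally a (fun z =>
     holo_at h z /\ (z <> a -> q z = h z / (z - a) ^ 2))) /\
  ~ (exists h, locally a (fun z => holo_at h z /\ (z <> a -> q z = h z))).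

(* [f'' = q f] is a Fuchsian equation on [C / L], with [Sing] as its set of
   singularities. *)
Definition fuchsian_on_torus (L : lattice) (q : C -> C) (Sing : C -> Prop)
    : Prop :=
  (forall l z, in_lattice L l -> (Sing (z + l) <-> Sing z)) /\
  (forall l z, in_lattice L l -> ~ Sing z -> q (z + l) = q z) /\
  (forall z, ~ Sing z -> locally z (holo_at q)) /\
  (forall z, Sing z -> regular_singular_at q z).

(* [M] is the monodromy matrix of the basis [xi1, xi2] of solutions at [a0]
   along some loop of [C / L] that avoids the singularities: such a loop is
   the projection of a path from [a0] to [a0 + l] with [l] in [L]. *)
Definition torus_monodromy (L : lattice) (q : C -> C) (Sing : C -> Prop)
    (a0 : C) (xi1 xi2 : C -> C) (M : mat2) : Prop :=
  exists (g : R -> C) (F1 F2 : R -> C -> C) (l : C),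
    is_path g /\ (forall t, in01 t -> ~ Sing (g t)) /\
    in_lattice L l /\ g 0%R = a0 /\ g 1%R = a0 + l /\
    continuation (solution_at q) g F1 xi1 /\
    continuation (solution_at q) g F2 xi2 /\
    locally a0 (fun z =>
      F1 1%R (z + l) = m11 M * xi1 z + m12 M * xi2 z /\
      F2 1%R (z + l) = m21 M * xi1 z + m22 M * xi2 z).

(* The orbifold defined by the equation is given by the group of the linear
   fractional transformations of the ratio [xi1 / xi2] that come from the
   monodromy, i.e. by the monodromy matrices up to a nonzero factor. *)
Definition torus_orbifold_group (L : lattice) (q : C -> C) (Sing : C -> Prop)
    (a0 : C) (xi1 xi2 : C -> C) (M : mat2) : Prop :=
  mat2_det M <> 0 /\
  exists k : C, k <> 0 /\
    torus_monodromy L q Sing a0 xi1 xi2 (mat2_scale k M).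

(* The form with accessory parameters [A1], [A2] (the coefficients of the
   zeta functions) and [A0] (the free constant), normalized by the common
   factor [-3/16]. *)
Definition torus_coeff (L : lattice) (kappa A1 A2 A0 : C) (z : C) : C :=
  - RtoC (3 / 16) *
    (wp L (z - kappa) + wp L (z + kappa)
     + A1 * wzeta L (z - kappa) + A2 * wzeta L (z + kappa) + A0).

Definition torus_coeff_wp (L : lattice) (kappa B A0 : C) (z : C) : C :=
  - RtoC (3 / 16) *
    (wp L (z - kappa) + wp L (z + kappa) + B / (wp L z - wp L kappa) + A0).

Definition pm_mod (L : lattice) (kappa z : C) : Prop :=
  in_lattice L (z - kappa) \/ in_lattice L (z + kappa).

Definition whittaker_coeff (x : C) : C :=
  - RtoC (3 / 16) * ((x ^ 8 + RtoC 14 * x ^ 4 + 1) / (x ^ 5 - x) ^ 2).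

Definition cover_map (x : C) : C :=
  - RtoC ((3 + sqrt 2) / 6) + RtoC (1 + sqrt 2) / (x - Ci)
  - Ci * (RtoC (1 + sqrt 2) / (x + 1)).

(* [al] is, near [x0], a holomorphic branch of [x |-> alpha], and it is a local
   coordinate there. *)
Definition cover_branch_at (L : lattice) (al : C -> C) (x0 : C) : Prop :=
  x0 ^ 5 - x0 <> 0 /\
  locally x0 (fun x =>
    holo_at al x /\ ~ in_lattice L (al x) /\ wp L (al x) = cover_map x) /\
  C_derive al x0 <> 0.

(* [Xi = sqrt (alpha_x) Psi] near [x0], where [s] is a holomorphic branch of
   [sqrt (alpha_x)] and [Xi] is a function of [alpha]. *)
Definition changed_by (al s psi xi : C -> C) (x0 : C) : Prop :=
  locally x0 (fun x =>
    holo_at s x /\ s x ^ 2 = C_derive al x /\ xi (al x) = s x * psi x).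

(* The transformations, along loops of the torus, of the ratio [psi1 / psi2]
   of solutions of Whittaker's equation, considered as a multivalued function
   on Burnside's surface [y^2 = x^5 - x], which covers the torus by [alpha].
   A loop of the torus (off the branch points of the cover) is the projection
   of a path [(x, y)] of the surface, along which [alpha] is continued by [A]
   and changes by a period [l].  The points [(x 0, y 0)] and [(x 1, y 1)]
   need not coincide: they are just over the same point of the torus.  The last
   clause is
     [F1 / F2 (w) = (m11 psi1 + m12 psi2) / (m21 psi1 + m22 psi2) (z)]
   whenever [z] near [x 0] and [w] near [x 1] correspond to the same point
   of the torus. *)
Definition whittaker_orbifold_group (L : lattice) (x0 : C)
    (al psi1 psi2 : C -> C) (M : mat2) : Prop :=
  mat2_det M <> 0 /\
  exists (x y : R -> C) (A F1 F2 : R -> C -> C) (l : C),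
    is_path x /\ is_path y /\
    (forall t, in01 t -> y t ^ 2 = x t ^ 5 - x t) /\
    x 0%R = x0 /\
    continuation (cover_branch_at L) x A al /\
    continuation (solution_at whittaker_coeff) x F1 psi1 /\
    continuation (solution_at whittaker_coeff) x F2 psi2 /\
    in_lattice L l /\ A 1%R (x 1%R) = al x0 + l /\
    exists eps : posreal, forall z w : C,
      ball x0 eps z -> ball (x 1%R) eps w -> A 1%R w = al z + l ->
      F1 1%R w * (m21 M * psi1 z + m22 M * psi2 z)
      = F2 1%R w * (m11 M * psi1 z + m12 M * psi2 z).

(* Main.v *)
Require Import Defs.
From Stdlib Require Import Reals ZArith Lra Lia Psatz Classical ClassicalEpsilon.
From Coquelicot Require Import Coquelicot.

(** Write [W_k(z)] for the sum of [(z - l)^-k] over the lattice, regularised for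
[k = 1, 2], so that [zeta = W_1] and [wp = W_2].  Liouville's theorem gives the
differential equation of [wp] and the addition formulas, and these make the
coefficient of the torus equation a rational function of [wp(alpha)].

Put [xk = - (1 - i) / sqrt 2].  The map [x |-> wp(alpha)] has degree 2, the deck
involution [x |-> - i / x] and the critical points [xk] and [- xk], which lie over
[wp(varkappa)] and over a root of the cubic.  The fibres over the other two roots
and over infinity are the six branch points of the curve.  Hence
[alpha_x ^ 2 = (1 - i) / 2 (x - xk)^2 / (x^5 - x)], and the behaviour of the equation
under the change of variables is an identity of rational functions.

Germs of solutions therefore correspond under [Xi = sqrt (alpha_x) Psi], up to a
common sign.  A path on the curve projects to a path on the torus that avoids
[+- varkappa].  Conversely, a path on the torus that avoids [+- varkappa] is first
pushed off the half periods; there [Xi] is regular, so that the side on which it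
passes is immaterial.  The pushed path lifts to the [x]-plane, and its end point
is one of the two points [x0] and [- i / x0] of the fibre, up to a small move. *)

Set Implicit Arguments.
Open Scope R_scope.
Open Scope C_scope.
Implicit Types (f g : C -> C) (z w a b : C).

(** * Complex differentiation *)

(** Why only [+- varkappa] are singular. At each branch point of the curve the Whittaker equation
    has exponents 1/4 and 3/4. There [x |-> wp(alpha)] is unramified while [wp] itself is ramified,
    so that the coordinate at the branch point is quadratic in [alpha], and the exponent difference
    1/2 becomes 1. Conversely [xk] is an ordinary point, but [wp'(varkappa) <> 0], so that
    [alpha - varkappa] is quadratic in [x - xk] and the difference 1 becomes 1/2. At [- xk] both
    maps are ramified: [alpha] is a local coordinate, yet [alpha_x] appears as a quotient of two
    zeros and has to be found by limits.

    Only ratios of solutions are compared, hence matrices count up to a factor. The factor absorbs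
    the sign that [sqrt (alpha_x)] may acquire along a loop, provided that both solutions are
    carried with the same root; therefore germs are always continued in pairs.

    Holomorphy means differentiability alone and no integral formula is used: the continuity of a
    derivative is each time read off from an explicit expression for it. *)

Definition D (f : C -> C) (z d : C) : Prop :=
  is_derive (K := C_AbsRing) (V := C_NormedModule) f z d.

Lemma locally_Cmod (z : C) (P : C -> Prop) :
  locally z P <->
  exists r : R, (0 < r)%R /\ forall w, (Cmod (w - z) < r)%R -> P w.
Proof.
split; intro H.
- destruct H as [r Hr]. exists r. split; [apply cond_pos|].
  intros w Hw. apply Hr. exact (@C_NormedModule_mixin_compat1 z w r Hw).
- destruct H as (r & Hr & H).
  assert (Hr2 : (0 < r / 2)%R) by lra.
  exists (mkposreal _ Hr2). intros w Hw. apply H.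
  (* A product ball of radius [r / 2] lies in the disc of radius [sqrt 2 * (r / 2)], which is at
     most [r]. *)
  refine (Rlt_le_trans _ _ _ (@C_NormedModule_mixin_compat2 z w (mkposreal _ Hr2) Hw) _).
  simpl. assert (sqrt 2 <= 2)%R; [|nra].
  rewrite <- (sqrt_square 2) at 2 by lra. apply sqrt_le_1_alt; lra.
Qed.

(** [is_derive] filters over the discs of the absolute ring, [locally] on [C] over product balls.
    Both reduce to the same condition on [Cmod], and from here on only that condition is handled. *)
Lemma locally_CAR (z : C) (P : C -> Prop) :
  locally (T := AbsRing_UniformSpace C_AbsRing) z P <->
  exists r : R, (0 < r)%R /\ forall w, (Cmod (w - z) < r)%R -> P w.
Proof.
rewrite <- locally_Cmod. split; intro H; apply (locally_C z P); exact H.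
Qed.

Lemma D_eps (f : C -> C) (z d : C) :
  D f z d <->
  forall eps : R, (0 < eps)%R -> exists r : R, (0 < r)%R /\
    forall w, (Cmod (w - z) < r)%R ->
      (Cmod (f w - f z - d * (w - z)) <= eps * Cmod (w - z))%R.
Proof.
split.
- intros [_ H] eps Heps.
  assert (Hz : is_filter_lim (locally (T := AbsRing_UniformSpace C_AbsRing) z) z)
    by (intros P HP; exact HP).
  specialize (H z Hz (mkposreal _ Heps)).
  apply locally_CAR in H. destruct H as (r & Hr & H). exists r; split; [exact Hr|].
  intros w Hw. specialize (H w Hw). simpl in H.
  replace (f w - f z - d * (w - z)) with
    (@minus C_NormedModule (minus (f w) (f z)) (scal (minus w z) d)).
  exact H.
  change (f w - f z - (w - z) * d = f w - f z - d * (w - z)). ring.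
- intro H. split; [apply is_linear_scal_l|].
  intros x Hx.
  assert (x = z) as ->.
  { symmetry. apply (is_filter_lim_locally_unique (K:=C_AbsRing) (V:=AbsRing_NormedModule C_AbsRing) z x). exact Hx. }
  intros eps. apply locally_CAR.
  destruct (H eps (cond_pos eps)) as (r & Hr & K). exists r; split; [exact Hr|].
  intros w Hw. specialize (K w Hw).
  replace (f w - f z - d * (w - z)) with
    (@minus C_NormedModule (minus (f w) (f z)) (scal (minus w z) d)) in K.
  exact K.
  change (f w - f z - (w - z) * d = f w - f z - d * (w - z)). ring.
Qed.

Lemma D_const (c z : C) : D (fun _ => c) z 0.
Proof. exact (is_derive_const (K:=C_AbsRing) (V:=C_NormedModule) c z). Qed.

Lemma D_id (z : C) : D (fun w => w) z 1.
Proof.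
apply D_eps. intros eps He. exists 1%R. split; [lra|]. intros w Hw.
replace (w - z - 1 * (w - z)) with (RtoC 0) by ring. rewrite Cmod_0.
apply Rmult_le_pos; [lra|apply Cmod_ge_0].
Qed.

Lemma D_plus f g z a b : D f z a -> D g z b -> D (fun w => f w + g w) z (a + b).
Proof. exact (fun H K => @is_derive_plus C_AbsRing C_NormedModule f g z a b H K). Qed.

Lemma D_opp f z a : D f z a -> D (fun w => - f w) z (- a).
Proof. exact (fun H => @is_derive_opp C_AbsRing C_NormedModule f z a H). Qed.

Lemma D_minus f g z a b : D f z a -> D g z b -> D (fun w => f w - g w) z (a - b).
Proof. exact (fun H K => @is_derive_minus C_AbsRing C_NormedModule f g z a b H K). Qed.

Lemma D_eq f z a b : a = b -> D f z a -> D f z b.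
Proof. intros ->. trivial. Qed.

Lemma D_ext_loc f g z a : locally z (fun w => f w = g w) -> D f z a -> D g z a.
Proof.
intros H K. refine (@is_derive_ext_loc C_AbsRing C_NormedModule f g z a _ K).
apply locally_CAR. apply locally_Cmod. exact H.
Qed.

Lemma D_ext f g z a : (forall w, f w = g w) -> D f z a -> D g z a.
Proof. intros H. apply D_ext_loc. apply locally_Cmod. exists 1%R; split; [lra|]; auto. Qed.

Lemma D_bound f z a : D f z a -> exists r : R, (0 < r)%R /\
   forall w, (Cmod (w - z) < r)%R -> (Cmod (f w - f z) <= (Cmod a + 1) * Cmod (w - z))%R.
Proof.
intro H. apply D_eps with (eps := 1%R) in H; [|lra]. destruct H as (r & Hr & H).
exists r; split; auto. intros w Hw. specialize (H w Hw).
replace (f w - f z) with (a * (w - z) + (f w - f z - a * (w - z))) by ring.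
eapply Rle_trans; [apply Cmod_triangle|]. rewrite Cmod_mult. lra.
Qed.

Definition contC (f : C -> C) (z : C) : Prop :=
  forall eps : R, (0 < eps)%R -> exists r : R, (0 < r)%R /\
    forall w, (Cmod (w - z) < r)%R -> (Cmod (f w - f z) < eps)%R.

Lemma D_cont f z a : D f z a -> contC f z.
Proof.
intros H eps He. destruct (D_bound H) as (r & Hr & K).
assert (Ha := Cmod_ge_0 a).
exists (Rmin r (eps / (Cmod a + 1))). split.
- apply Rmin_pos; [lra|]. apply Rdiv_lt_0_compat; lra.
- intros w Hw. eapply Rle_lt_trans; [apply K|].
  + eapply Rlt_le_trans; [exact Hw|apply Rmin_l].
  + assert (Cmod (w - z) < eps / (Cmod a + 1))%R by (eapply Rlt_le_trans; [exact Hw|apply Rmin_r]).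
    apply Rmult_lt_compat_l with (r := (Cmod a + 1)%R) in H0; [|lra].
    replace ((Cmod a + 1) * (eps / (Cmod a + 1)))%R with eps in H0 by (field; lra). exact H0.
Qed.

Lemma D_AR f z a :
  D f z a <-> is_derive (K := C_AbsRing) (V := AbsRing_NormedModule C_AbsRing) f z a.
Proof.
split; intros [_ H]; (split; [apply is_linear_scal_l|exact H]).
Qed.

Lemma D_mult f g z a b : D f z a -> D g z b ->
  D (fun w => f w * g w) z (a * g z + f z * b).
Proof.
intros H K. apply D_AR. apply D_AR in H. apply D_AR in K.
exact (@is_derive_mult C_AbsRing f g z a b H K Cmult_comm).
Qed.

Lemma D_scal c f z a : D f z a -> D (fun w => c * f w) z (c * a).
Proof.
intro H. eapply D_eq; [|apply D_mult; [apply D_const|exact H]]. simpl; ring.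
Qed.

Lemma D_comp f g z a b : D f (g z) a -> D g z b -> D (fun w => f (g w)) z (b * a).
Proof.
intros H K. apply D_AR in K.
exact (@is_derive_comp C_AbsRing C_NormedModule f g z a b H K).
Qed.

Lemma Cmod_minus_sym a b : Cmod (a - b) = Cmod (b - a).
Proof. rewrite <- Cmod_opp. f_equal. ring. Qed.

Lemma Cmod_sub_ge a b : (Cmod a - Cmod b <= Cmod (a - b))%R.
Proof.
assert (Cmod a <= Cmod (a - b) + Cmod b)%R; [|lra].
replace a with ((a - b) + b) at 1 by ring. apply Cmod_triangle.
Qed.

Lemma Cmod_add_ge a b : (Cmod a - Cmod b <= Cmod (a + b))%R.
Proof.
replace (a + b) with (a - - b) by ring. rewrite <- (Cmod_opp b). apply Cmod_sub_ge.
Qed.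

Lemma D_inv_id (z : C) : z <> 0 -> D (fun w => / w) z (- / z ^ 2).
Proof.
intro Hz. assert (Hm : (0 < Cmod z)%R) by (apply Cmod_gt_0; auto).
apply D_eps. intros eps He.
exists (Rmin (Cmod z / 2) (eps * Cmod z ^ 3 / 2)). split.
- apply Rmin_pos; [lra|]. apply Rdiv_lt_0_compat; [|lra].
  apply Rmult_lt_0_compat; [lra|]. apply pow_lt; lra.
- intros w Hw.
  assert (H1 : (Cmod (w - z) < Cmod z / 2)%R) by (eapply Rlt_le_trans; [exact Hw|apply Rmin_l]).
  assert (H2 : (Cmod (w - z) < eps * Cmod z ^ 3 / 2)%R) by (eapply Rlt_le_trans; [exact Hw|apply Rmin_r]).
  assert (H3 : (Cmod z / 2 < Cmod w)%R).
  { assert (K := Cmod_sub_ge z (z - w)). replace (z - (z - w)) with w in K by ring.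
    rewrite (Cmod_minus_sym z w) in K. lra. }
  assert (Hw0 : w <> 0). { apply Cmod_gt_0. lra. }
  replace (/ w - / z - - / z ^ 2 * (w - z)) with ((w - z) * ((w - z) / (z ^ 2 * w)))
    by (field; auto).
  rewrite Cmod_mult, Rmult_comm. apply Rmult_le_compat_r; [apply Cmod_ge_0|].
  rewrite Cmod_div; [|apply Cmult_neq_0; [apply Cpow_nz|]; auto].
  rewrite Cmod_mult, Cmod_pow.
  assert (0 < Cmod z ^ 2)%R by (apply pow_lt; lra).
  apply Rle_div_l; [apply Rmult_gt_0_compat; lra|].
  apply Rle_trans with (eps * Cmod z ^ 3 / 2)%R; [lra|].
  replace (eps * Cmod z ^ 3 / 2)%R with (eps * (Cmod z ^ 2 * (Cmod z / 2)))%R by (simpl; field).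
  apply Rmult_le_compat_l; [lra|]. apply Rmult_le_compat_l; lra.
Qed.

Lemma D_inv f z a : f z <> 0 -> D f z a -> D (fun w => / f w) z (- a / f z ^ 2).
Proof.
intros H K. eapply D_eq; [|apply (@D_comp (fun w => / w) f z _ a (D_inv_id H) K)].
unfold Cdiv. ring.
Qed.

Lemma D_div f g z a b : g z <> 0 -> D f z a -> D g z b ->
  D (fun w => f w / g w) z ((a * g z - f z * b) / g z ^ 2).
Proof.
intros H K1 K2. eapply D_eq; [|apply (D_mult K1 (D_inv H K2))].
simpl. field. auto.
Qed.

Lemma D_pow f z a n : D f z a -> D (fun w => f w ^ n) z (RtoC (INR n) * f z ^ (pred n) * a).
Proof.
intro H. induction n as [|n IH].
- simpl. eapply D_eq; [|apply D_const]. ring.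
- eapply D_eq; [|apply (D_mult H IH)].
  rewrite S_INR, RtoC_plus. destruct n; simpl; ring.
Qed.

Lemma D_unique f z a b : D f z a -> D f z b -> a = b.
Proof.
intros H K. rewrite <- (is_C_derive_unique _ _ _ H). apply is_C_derive_unique. exact K.
Qed.

Lemma D_C_derive f z a : D f z a -> C_derive f z = a.
Proof. apply is_C_derive_unique. Qed.

Lemma holo_D f z : holo_at f z <-> D f z (C_derive f z).
Proof.
split; intro H.
- apply C_derive_correct; [exact z|exact H].
- exists (C_derive f z). exact H.
Qed.

Lemma D_holo f z a : D f z a -> holo_at f z.
Proof. intro H. exists a. exact H. Qed.

(** * Curves with a real parameter and the mean value inequality *)

Definition DR (p : R -> C) (t : R) (v : C) : Prop :=
  forall eps : R, (0 < eps)%R -> exists r : R, (0 < r)%R /\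
    forall s : R, (Rabs (s - t) < r)%R ->
      (Cmod (p s - p t - v * RtoC (s - t)) <= eps * Rabs (s - t))%R.

Lemma is_derive_R_eps (f : R -> R) (t d : R) :
  is_derive f t d <->
  forall eps : R, (0 < eps)%R -> exists r : R, (0 < r)%R /\
    forall s : R, (Rabs (s - t) < r)%R ->
      (Rabs (f s - f t - d * (s - t)) <= eps * Rabs (s - t))%R.
Proof.
split.
- intros [_ H] eps Heps.
  assert (Hz : is_filter_lim (locally t) t) by (intros P HP; exact HP).
  specialize (H t Hz (mkposreal _ Heps)).
  destruct H as (r & H). exists r; split; [apply cond_pos|].
  intros w Hw. specialize (H w Hw). simpl in H.
  replace (f w - f t - d * (w - t))%R with
    (@minus R_NormedModule (minus (f w) (f t)) (scal (minus w t) d)).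
  exact H.
  change ((f w - f t - (w - t) * d = f w - f t - d * (w - t))%R). ring.
- intro H. split; [apply is_linear_scal_l|].
  intros x Hx.
  assert (x = t) as ->.
  { symmetry. apply (is_filter_lim_locally_unique t x). exact Hx. }
  intros eps.
  destruct (H eps (cond_pos eps)) as (r & Hr & K). exists (mkposreal _ Hr).
  intros w Hw. specialize (K w Hw).
  replace (f w - f t - d * (w - t))%R with
    (@minus R_NormedModule (minus (f w) (f t)) (scal (minus w t) d)) in K.
  exact K.
  change ((f w - f t - (w - t) * d = f w - f t - d * (w - t))%R). ring.
Qed.

Lemma im_le_Cmod z : (Rabs (Im z) <= Cmod z)%R.
Proof. eapply Rle_trans; [|apply Rmax_Cmod]. apply Rmax_r. Qed.

Lemma Cmod_le_ReIm z : (Cmod z <= Rabs (Re z) + Rabs (Im z))%R.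
Proof.
replace z with (RtoC (Re z) + Ci * RtoC (Im z)) at 1.
- eapply Rle_trans; [apply Cmod_triangle|].
  rewrite Cmod_mult, Cmod_Ci, !Cmod_R. lra.
- destruct z as [x y]. unfold RtoC, Ci, Cplus, Cmult; simpl. f_equal; ring.
Qed.

Lemma DR_Re p t v : DR p t v -> is_derive (fun s => Re (p s)) t (Re v).
Proof.
intro H. apply is_derive_R_eps. intros eps He.
destruct (H eps He) as (r & Hr & K). exists r; split; auto. intros s Hs.
eapply Rle_trans; [|apply (K s Hs)].
eapply Rle_trans; [|apply re_le_Cmod].
right. f_equal. destruct (p s), (p t), v; simpl. ring.
Qed.

Lemma DR_Im p t v : DR p t v -> is_derive (fun s => Im (p s)) t (Im v).
Proof.
intro H. apply is_derive_R_eps. intros eps He.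
destruct (H eps He) as (r & Hr & K). exists r; split; auto. intros s Hs.
eapply Rle_trans; [|apply (K s Hs)].
eapply Rle_trans; [|apply im_le_Cmod].
right. f_equal. destruct (p s), (p t), v; simpl. ring.
Qed.

Lemma DR_intro p t v : is_derive (fun s => Re (p s)) t (Re v) ->
  is_derive (fun s => Im (p s)) t (Im v) -> DR p t v.
Proof.
intros H K eps He. assert (He2 : (0 < eps / 2)%R) by lra.
destruct (proj1 (is_derive_R_eps _ _ _) H _ He2) as (r1 & Hr1 & H1).
destruct (proj1 (is_derive_R_eps _ _ _) K _ He2) as (r2 & Hr2 & H2).
exists (Rmin r1 r2). split; [apply Rmin_pos; lra|]. intros s Hs.
assert (Hs1 : (Rabs (s - t) < r1)%R) by (eapply Rlt_le_trans; [exact Hs|apply Rmin_l]).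
assert (Hs2 : (Rabs (s - t) < r2)%R) by (eapply Rlt_le_trans; [exact Hs|apply Rmin_r]).
specialize (H1 s Hs1). specialize (H2 s Hs2).
eapply Rle_trans; [apply Cmod_le_ReIm|].
replace (Re (p s - p t - v * RtoC (s - t))) with (Re (p s) - Re (p t) - Re v * (s - t))%R
  by (destruct (p s), (p t), v; simpl; ring).
replace (Im (p s - p t - v * RtoC (s - t))) with (Im (p s) - Im (p t) - Im v * (s - t))%R
  by (destruct (p s), (p t), v; simpl; ring).
lra.
Qed.

Lemma DR_comp f p t v d : DR p t v -> D f (p t) d -> DR (fun s => f (p s)) t (d * v).
Proof.
intros H K eps He.
assert (Hd := Cmod_ge_0 d). assert (Hv := Cmod_ge_0 v).
(* The error is the remainder of [f] at [p t], with tolerance [e2], plus [d] times the remainder of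
   [p], with tolerance [e1]; adding 1 to the moduli avoids a division by zero. The radius [r3]
   serves to bound [p s - p t] by [(Cmod v + 1) |s - t|]. *)
set (e1 := (eps / (2 * (Cmod d + 1)))%R).
assert (He1 : (0 < e1)%R) by (apply Rdiv_lt_0_compat; lra).
set (e2 := (eps / (2 * (Cmod v + 1)))%R).
assert (He2 : (0 < e2)%R) by (apply Rdiv_lt_0_compat; lra).
destruct (proj1 (D_eps _ _ _) K e2 He2) as (r2 & Hr2 & K2).
destruct (H e1 He1) as (r1 & Hr1 & K1).
destruct (H 1%R Rlt_0_1) as (r3 & Hr3 & K3).
exists (Rmin r1 (Rmin r3 (r2 / (Cmod v + 1)))). split.
{ repeat apply Rmin_pos; try lra. apply Rdiv_lt_0_compat; lra. }
intros s Hs.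
assert (Hs1 : (Rabs (s - t) < r1)%R) by (eapply Rlt_le_trans; [exact Hs|apply Rmin_l]).
assert (Hs' : (Rabs (s - t) < Rmin r3 (r2 / (Cmod v + 1)))%R) by (eapply Rlt_le_trans; [exact Hs|apply Rmin_r]).
assert (Hs3 : (Rabs (s - t) < r3)%R) by (eapply Rlt_le_trans; [exact Hs'|apply Rmin_l]).
assert (Hs2 : (Rabs (s - t) < r2 / (Cmod v + 1))%R) by (eapply Rlt_le_trans; [exact Hs'|apply Rmin_r]).
specialize (K1 s Hs1). specialize (K3 s Hs3).
assert (B : (Cmod (p s - p t) <= (Cmod v + 1) * Rabs (s - t))%R).
{ replace (p s - p t) with ((p s - p t - v * RtoC (s - t)) + v * RtoC (s - t)) by ring.
  eapply Rle_trans; [apply Cmod_triangle|]. rewrite Cmod_mult, Cmod_R. lra. }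
assert (B2 : (Cmod (p s - p t) < r2)%R).
{ eapply Rle_lt_trans; [exact B|]. apply Rmult_lt_compat_l with (r := (Cmod v + 1)%R) in Hs2; [|lra].
  replace ((Cmod v + 1) * (r2 / (Cmod v + 1)))%R with r2 in Hs2 by (field; lra). exact Hs2. }
specialize (K2 _ B2).
replace (f (p s) - f (p t) - d * v * RtoC (s - t)) with
  ((f (p s) - f (p t) - d * (p s - p t)) + d * (p s - p t - v * RtoC (s - t))) by ring.
eapply Rle_trans; [apply Cmod_triangle|]. rewrite Cmod_mult.
assert (e2 * Cmod (p s - p t) <= eps / 2 * Rabs (s - t))%R.
{ replace (eps / 2 * Rabs (s - t))%R with (e2 * ((Cmod v + 1) * Rabs (s - t)))%R
    by (unfold e2; field; lra). apply Rmult_le_compat_l; lra. }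
assert (Cmod d * Cmod (p s - p t - v * RtoC (s - t)) <= eps / 2 * Rabs (s - t))%R.
{ apply Rle_trans with ((Cmod d + 1) * (e1 * Rabs (s - t)))%R.
  - apply Rmult_le_compat; try lra. apply Cmod_ge_0.
  - right. unfold e1. field. lra. }
lra.
Qed.

Lemma DR_line z h t : DR (fun s => z + RtoC s * h) t h.
Proof.
intros eps He. exists 1%R; split; [lra|]. intros s _.
replace (z + RtoC s * h - (z + RtoC t * h) - h * RtoC (s - t)) with (RtoC 0)
  by (rewrite RtoC_minus; ring).
rewrite Cmod_0. apply Rmult_le_pos; [lra|apply Rabs_pos].
Qed.

Lemma Re_le_Cmod z : (Re z <= Cmod z)%R.
Proof. eapply Rle_trans; [apply Rle_abs|apply re_le_Cmod]. Qed.

(* Apply the real mean value theorem to [Re (conj (f z - f w) * f)]. *)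
Lemma mvt_segment f (d : R -> C) z w (M : R) :
  (forall t, 0 <= t <= 1 -> D f (w + RtoC t * (z - w)) (d t) /\ Cmod (d t) <= M)%R ->
  (Cmod (f z - f w) <= M * Cmod (z - w))%R.
Proof.
intro H. set (e := f z - f w). set (c := Cconj e).
assert (Hd : forall t, (0 <= t <= 1)%R ->
  is_derive (fun s => Re (c * f (w + RtoC s * (z - w)))) t (Re (c * (d t * (z - w))))).
{ intros t Ht. apply (@DR_Re (fun s => c * f (w + RtoC s * (z - w)))).
  rewrite Cmult_assoc.
  apply (@DR_comp (fun x => c * f x) (fun s => w + RtoC s * (z - w)) t (z - w) (c * d t)).
  - apply DR_line.
  - apply D_scal. apply (H t Ht). }
destruct (MVT_gen (fun s => Re (c * f (w + RtoC s * (z - w)))) 0 1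
   (fun t => Re (c * (d t * (z - w))))) as (t & Ht & E).
- intros x Hx. rewrite Rmin_left, Rmax_right in Hx by lra. apply Hd. lra.
- intros x Hx. rewrite Rmin_left, Rmax_right in Hx by lra.
  apply continuity_pt_filterlim. apply (ex_derive_continuous (K := R_AbsRing) (V := R_NormedModule)).
  eexists. apply Hd. lra.
- rewrite Rmin_left, Rmax_right in Ht by lra. cbv beta in E.
  replace (w + RtoC 1 * (z - w)) with z in E by ring.
  replace (w + RtoC 0 * (z - w)) with w in E by ring.
  assert (E2 : (Re (c * f z) - Re (c * f w) = Cmod e ^ 2)%R).
  { rewrite Cmod2_alt. unfold c. subst e. destruct (f z), (f w). simpl. ring. }
  assert (E3 : (Cmod e ^ 2 <= Cmod e * (M * Cmod (z - w)))%R).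
  { rewrite <- E2, E. rewrite Rminus_0_r, Rmult_1_r. eapply Rle_trans; [apply Re_le_Cmod|].
    rewrite !Cmod_mult. unfold c. rewrite Cmod_conj. apply Rmult_le_compat_l; [apply Cmod_ge_0|].
    apply Rmult_le_compat_r; [apply Cmod_ge_0|]. apply H; auto. }
  assert (He := Cmod_ge_0 e).
  destruct (Req_dec (Cmod e) 0) as [E0|E0].
  + rewrite E0. assert (0 <= M)%R by (destruct (H t Ht) as [_ ?]; assert (K := Cmod_ge_0 (d t)); lra).
    apply Rmult_le_pos; auto. apply Cmod_ge_0.
  + apply Rmult_le_reg_l with (Cmod e); [lra|]. simpl in E3. lra.
Qed.

Lemma segment_ball z0 r z w (t : R) : (Cmod (z - z0) < r)%R -> (Cmod (w - z0) < r)%R ->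
  (0 <= t <= 1)%R -> (Cmod (w + RtoC t * (z - w) - z0) < r)%R.
Proof.
intros Hz Hw Ht.
replace (w + RtoC t * (z - w) - z0) with (RtoC t * (z - z0) + RtoC (1 - t) * (w - z0))
  by (rewrite RtoC_minus; ring).
eapply Rle_lt_trans; [apply Cmod_triangle|]. rewrite !Cmod_mult, !Cmod_R, !Rabs_pos_eq by lra.
destruct (Req_dec t 0) as [->|?]; [|nra]. lra.
Qed.

Lemma mvt_ball f (f' : C -> C) z0 r (M : R) :
  (forall z, Cmod (z - z0) < r -> D f z (f' z) /\ Cmod (f' z) <= M)%R ->
  forall z w, (Cmod (z - z0) < r -> Cmod (w - z0) < r -> Cmod (f z - f w) <= M * Cmod (z - w))%R.
Proof.
intros H z w Hz Hw.
apply mvt_segment with (d := fun t => f' (w + RtoC t * (z - w))).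
intros t Ht. apply H. apply segment_ball; auto.
Qed.

Lemma const_ball f z0 r :
  (forall z, (Cmod (z - z0) < r)%R -> D f z 0) ->
  forall z, (Cmod (z - z0) < r)%R -> f z = f z0.
Proof.
intros H z Hz.
assert (Hr : (Cmod (z0 - z0) < r)%R).
{ replace (z0 - z0) with (RtoC 0) by ring. rewrite Cmod_0. eapply Rle_lt_trans; [apply Cmod_ge_0|exact Hz]. }
assert (K := @mvt_ball f (fun _ => RtoC 0) z0 r 0%R).
specialize (K (fun z Hz => conj (H z Hz) (Req_le _ _ Cmod_0)) z z0 Hz Hr).
rewrite Rmult_0_l in K. apply Ceq_minus. apply Cmod_eq_0. apply Rle_antisym; auto. apply Cmod_ge_0.
Qed.

(** * Limits of complex sequences *)

Definition CL (u : nat -> C) (l : C) : Prop :=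
  forall eps : R, (0 < eps)%R -> exists N, forall n, (N <= n)%nat -> (Cmod (u n - l) < eps)%R.

Lemma CL_unique u l1 l2 : CL u l1 -> CL u l2 -> l1 = l2.
Proof.
intros H K. apply Ceq_minus. apply Cmod_eq_0. apply Rle_antisym; [|apply Cmod_ge_0].
apply le_epsilon. intros eps He.
destruct (H (eps/2)%R ltac:(lra)) as (N & HN). destruct (K (eps/2)%R ltac:(lra)) as (N' & HN').
specialize (HN (max N N') ltac:(lia)). specialize (HN' (max N N') ltac:(lia)).
replace (l1 - l2) with (- (u (max N N') - l1) + (u (max N N') - l2)) by ring.
eapply Rle_trans; [apply Cmod_triangle|]. rewrite Cmod_opp. lra.
Qed.

Lemma CL_ext u v l : (forall n, u n = v n) -> CL u l -> CL v l.
Proof. intros H K eps He. destruct (K eps He) as (N & HN). exists N. intros. rewrite <- H. auto. Qed.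

Lemma CL_const l : CL (fun _ => l) l.
Proof.
intros eps He. exists O. intros. replace (l - l) with (RtoC 0) by ring. rewrite Cmod_0. exact He.
Qed.

Lemma CL_plus u v l m : CL u l -> CL v m -> CL (fun n => u n + v n) (l + m).
Proof.
intros H K eps He.
destruct (H (eps/2)%R ltac:(lra)) as (N & HN). destruct (K (eps/2)%R ltac:(lra)) as (N' & HN').
exists (max N N'). intros n Hn. specialize (HN n ltac:(lia)). specialize (HN' n ltac:(lia)).
replace (u n + v n - (l + m)) with ((u n - l) + (v n - m)) by ring.
eapply Rle_lt_trans; [apply Cmod_triangle|]. lra.
Qed.

Lemma CL_scal c u l : CL u l -> CL (fun n => c * u n) (c * l).
Proof.
intros H eps He. assert (Hc := Cmod_ge_0 c).
destruct (H (eps / (Cmod c + 1))%R ltac:(apply Rdiv_lt_0_compat; lra)) as (N & HN).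
exists N. intros n Hn. specialize (HN n Hn).
replace (c * u n - c * l) with (c * (u n - l)) by ring. rewrite Cmod_mult.
apply Rle_lt_trans with ((Cmod c) * (eps / (Cmod c + 1)))%R.
- apply Rmult_le_compat_l; lra.
- apply Rlt_le_trans with ((Cmod c + 1) * (eps / (Cmod c + 1)))%R.
  + apply Rmult_lt_compat_r; [apply Rdiv_lt_0_compat|]; lra.
  + right. field. lra.
Qed.

Lemma CL_minus u v l m : CL u l -> CL v m -> CL (fun n => u n - v n) (l - m).
Proof.
intros H K. apply CL_ext with (fun n => u n + (-(1)) * v n); [intro; ring|].
replace (l - m) with (l + (-(1)) * m) by ring. apply CL_plus; auto. apply CL_scal; auto.
Qed.

Lemma CL_Cmod_le u l M (N : nat) : CL u l -> (forall n, (N <= n)%nat -> (Cmod (u n) <= M)%R) ->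
  (Cmod l <= M)%R.
Proof.
intros H K. apply le_epsilon. intros eps He. destruct (H eps He) as (N' & HN).
specialize (HN (max N N') ltac:(lia)). specialize (K (max N N') ltac:(lia)).
replace l with (u (max N N') - (u (max N N') - l)) by ring.
unfold Cminus at 1. eapply Rle_trans; [apply Cmod_triangle|]. rewrite Cmod_opp. lra.
Qed.

(** The modulus [T] survives in the limit; this rate keeps the limit of the iteration of
    [local_inverse] inside its ball. *)
Lemma CL_cauchy (u : nat -> C) (T : nat -> R) :
  (forall n m, (n <= m)%nat -> (Cmod (u m - u n) <= T n)%R) -> is_lim_seq T 0 ->
  exists l, CL u l /\ forall n, (Cmod (l - u n) <= T n)%R.
Proof.
intros H HT.
assert (HT' : forall eps, (0 < eps)%R -> exists N, forall n, (N <= n)%nat -> (T n < eps)%R).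
{ intros eps He. apply is_lim_seq_spec in HT. destruct (HT (mkposreal _ He)) as (N & HN).
  exists N. intros n Hn. specialize (HN n Hn). simpl in HN. rewrite Rminus_0_r in HN.
  eapply Rle_lt_trans; [apply Rle_abs|exact HN]. }
assert (HC : forall q : C -> R, (forall z, (Rabs (q z) <= Cmod z)%R) ->
   (forall z w, q (z - w) = (q z - q w)%R) -> {l | Un_cv (fun n => q (u n)) l}).
{ intros q Hq Hl. apply Rcomplete.R_complete. intros eps He. destruct (HT' eps He) as (N & HN).
  exists N. intros n m Hn Hm. unfold Rdist. rewrite <- Hl.
  eapply Rle_lt_trans; [apply Hq|].
  destruct (Nat.le_ge_cases n m) as [L|L].
  - rewrite Cmod_minus_sym. eapply Rle_lt_trans; [apply (H n m L)|apply HN; lia].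
  - eapply Rle_lt_trans; [apply (H m n L)|apply HN; lia]. }
destruct (HC Re re_le_Cmod) as (lx & Hx). { intros [? ?] [? ?]; reflexivity. }
destruct (HC Im im_le_Cmod) as (ly & Hy). { intros [? ?] [? ?]; reflexivity. }
assert (L : CL u (lx, ly)).
{ intros eps He. destruct (Hx (eps/2)%R ltac:(lra)) as (N1 & H1).
  destruct (Hy (eps/2)%R ltac:(lra)) as (N2 & H2). exists (max N1 N2). intros n Hn.
  specialize (H1 n ltac:(lia)). specialize (H2 n ltac:(lia)). unfold Rdist in *.
  eapply Rle_lt_trans; [apply Cmod_le_ReIm|].
  replace (Re (u n - (lx, ly))) with (Re (u n) - lx)%R by (destruct (u n); reflexivity).
  replace (Im (u n - (lx, ly))) with (Im (u n) - ly)%R by (destruct (u n); reflexivity). lra. }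
exists (lx, ly). split; [exact L|]. intro n.
apply CL_Cmod_le with (u := fun m => u m - u n) (N := n); auto.
apply CL_minus; [exact L|apply CL_const].
Qed.

(** [lattice_sum] is built from the total operator [Lim_seq], whose value says something only once
    convergence is known. This is the passage from convergence to that value. *)
Lemma CL_Lim u l : CL u l ->
  (real (Lim_seq (fun N => Re (u N))), real (Lim_seq (fun N => Im (u N)))) = l.
Proof.
intro H. destruct l as [lx ly].
assert (Hx : is_lim_seq (fun N => Re (u N)) lx).
{ apply is_lim_seq_spec. intros eps. destruct (H eps (cond_pos eps)) as (N & HN). exists N. intros n Hn.
  eapply Rle_lt_trans; [|apply (HN n Hn)]. eapply Rle_trans; [|apply re_le_Cmod].
  right; f_equal. }
assert (Hy : is_lim_seq (fun N => Im (u N)) ly).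
{ apply is_lim_seq_spec. intros eps. destruct (H eps (cond_pos eps)) as (N & HN). exists N. intros n Hn.
  eapply Rle_lt_trans; [|apply (HN n Hn)]. eapply Rle_trans; [|apply im_le_Cmod].
  right; f_equal. }
rewrite (is_lim_seq_unique _ _ Hx), (is_lim_seq_unique _ _ Hy). reflexivity.
Qed.

Lemma is_lim_seq_geom_half (c : R) : is_lim_seq (fun n => (c * (/ 2) ^ n)%R) 0.
Proof.
replace (Finite 0) with (Rbar_mult c 0) by (simpl; f_equal; ring).
apply is_lim_seq_scal_l. apply is_lim_seq_geom. rewrite Rabs_pos_eq; lra.
Qed.

(* Newton's iteration with the frozen slope [f' z0] is a contraction. *)
Lemma local_inverse f (f' : C -> C) z0 r0 :
  (0 < r0)%R -> (forall z, (Cmod (z - z0) < r0)%R -> D f z (f' z)) ->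
  contC f' z0 -> f' z0 <> 0 ->
  exists (r s : R) (g : C -> C), (0 < r <= r0)%R /\ (0 < s)%R /\
    (forall z, (Cmod (z - z0) < r)%R -> f' z <> 0) /\
    (forall z w, (Cmod (z - z0) < r)%R -> (Cmod (w - z0) < r)%R -> f z = f w -> z = w) /\
    (forall v, (Cmod (v - f z0) < s)%R ->
       (Cmod (g v - z0) < r)%R /\ f (g v) = v /\ D g v (/ f' (g v))).
Proof.
intros Hr0 HD Hc Ha. set (a := f' z0) in *.
assert (Ha' : (0 < Cmod a)%R) by (apply Cmod_gt_0; auto).
destruct (Hc (Cmod a / 2)%R ltac:(lra)) as (r1 & Hr1 & H1). fold a in H1.
set (r := Rmin r0 r1).
assert (Hr : (0 < r <= r0)%R) by (split; [apply Rmin_pos; lra|apply Rmin_l]).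
assert (Hrr1 : (r <= r1)%R) by apply Rmin_r.
assert (K : forall z w, (Cmod (z - z0) < r)%R -> (Cmod (w - z0) < r)%R ->
   (Cmod ((z - f z / a) - (w - f w / a)) <= /2 * Cmod (z - w))%R).
{ apply (@mvt_ball (fun z => z - f z / a) (fun z => 1 - f' z / a)). intros z Hz. split.
  - apply D_minus; [apply D_id|]. unfold Cdiv. eapply D_eq; [|eapply D_ext; [|apply (@D_scal (/ a) f z (f' z))]].
    + ring. + intro w. simpl. ring. + apply HD; lra.
  - replace (1 - f' z / a) with (- (f' z - a) / a) by (field; auto).
    rewrite Cmod_div, Cmod_opp by auto. apply Rle_div_l; [lra|].
    specialize (H1 z ltac:(lra)). lra. }
(* The contraction bound read backwards: [f] expands distances by at least [Cmod a / 2]. This gives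
   injectivity, and at the end the Lipschitz bound for [g] that its derivative requires. *)
assert (Low : forall z w, (Cmod (z - z0) < r)%R -> (Cmod (w - z0) < r)%R ->
   (Cmod a / 2 * Cmod (z - w) <= Cmod (f z - f w))%R).
{ intros z w Hz Hw. specialize (K z w Hz Hw).
  replace (f z - f w) with (a * ((z - w) - ((z - f z / a) - (w - f w / a)))) by (field; auto).
  rewrite Cmod_mult.
  assert (B := Cmod_sub_ge (z - w) ((z - f z / a) - (w - f w / a))).
  replace (Cmod a / 2 * Cmod (z - w))%R with (Cmod a * (/2 * Cmod (z - w)))%R by field.
  apply Rmult_le_compat_l; lra. }
assert (Hnz : forall z, (Cmod (z - z0) < r)%R -> f' z <> 0).
{ intros z Hz E. specialize (H1 z ltac:(lra)). rewrite E in H1.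
  replace (0 - a) with (- a) in H1 by ring. rewrite Cmod_opp in H1. lra. }
assert (Inj : forall z w, (Cmod (z - z0) < r)%R -> (Cmod (w - z0) < r)%R -> f z = f w -> z = w).
{ intros z w Hz Hw E. specialize (Low z w Hz Hw). rewrite E in Low.
  replace (f w - f w) with (RtoC 0) in Low by ring. rewrite Cmod_0 in Low.
  apply Ceq_minus. apply Cmod_eq_0. apply Rle_antisym; [|apply Cmod_ge_0].
  apply Rmult_le_reg_l with (Cmod a / 2)%R; lra. }
(* For [v] this close to [f z0] the first step of the iteration is shorter than [r / 4]. The steps
   halve each time, so the iteration stays within [r / 2] of [z0]. *)
set (s := (Cmod a * r / 4)%R).
assert (Hs : (0 < s)%R) by (unfold s; apply Rdiv_lt_0_compat; [apply Rmult_lt_0_compat|]; lra).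
assert (Hz00 : (Cmod (z0 - z0) < r)%R).
{ replace (z0 - z0) with (RtoC 0) by ring. rewrite Cmod_0. lra. }
assert (Ex : forall v, exists z, (Cmod (v - f z0) < s)%R -> (Cmod (z - z0) < r)%R /\ f z = v).
{ intro v. destruct (Rlt_dec (Cmod (v - f z0)) s) as [Hv|Hv]; [|exists z0; tauto].
  set (F := fun z => z - f z / a + v / a).
  set (u := fix u n := match n with O => z0 | S n => F (u n) end).
  set (e := Cmod (u 1%nat - u O)).
  assert (He : (e < r / 4)%R).
  { unfold e. simpl. unfold F. replace (z0 - f z0 / a + v / a - z0) with ((v - f z0) / a) by (field; auto).
    rewrite Cmod_div by auto. apply Rlt_div_l; [lra|]. unfold s in Hv. lra. }
  assert (He0 : (0 <= e)%R) by apply Cmod_ge_0.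
  assert (Q : forall n, (Cmod (u (S n) - u n) <= e * (/2)^n)%R /\
                        (Cmod (u n - z0) <= 2 * e * (1 - (/2)^n))%R).
  { assert (P : forall n, (0 < (/2)^n <= 1)%R).
    { intro n. split; [apply pow_lt; lra|]. rewrite <- (pow1 n). apply pow_incr; lra. }
    induction n as [|n [IH1 IH2]].
    - split; [simpl; fold e; unfold e; simpl; lra|]. simpl. replace (z0 - z0) with (RtoC 0) by ring.
      rewrite Cmod_0. lra.
    - assert (Pn := P n). assert (B : (Cmod (u (S n) - z0) <= 2 * e * (1 - (/2)^S n))%R).
      { replace (u (S n) - z0) with ((u (S n) - u n) + (u n - z0)) by ring.
        eapply Rle_trans; [apply Cmod_triangle|]. simpl pow. nra. }
      split; [|exact B].
      assert (PS := P (S n)).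
      change (u (S (S n))) with (F (u (S n))). change (u (S n)) with (F (u n)) at 2.
      unfold F.
      replace (u (S n) - f (u (S n)) / a + v / a - (u n - f (u n) / a + v / a)) with
        ((u (S n) - f (u (S n)) / a) - (u n - f (u n) / a)) by ring.
      eapply Rle_trans; [apply K|].
      + eapply Rle_lt_trans; [exact B|]. nra.
      + eapply Rle_lt_trans; [exact IH2|]. nra.
      + simpl pow. nra. }
  destruct (@CL_cauchy u (fun n => (2 * e * (/2)^n)%R)) as (z & Lz & Tz).
  { intros n m Hnm. assert (Cmod (u m - u n) <= 2 * e * ((/2)^n - (/2)^m))%R.
    { induction Hnm as [|m Hnm IH].
      - replace (u n - u n) with (RtoC 0) by ring. rewrite Cmod_0. right; ring.
      - replace (u (S m) - u n) with ((u (S m) - u m) + (u m - u n)) by ring.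
        eapply Rle_trans; [apply Cmod_triangle|]. destruct (Q m) as [Q1 _]. simpl pow. lra. }
    assert (0 < (/2)^m)%R by (apply pow_lt; lra). nra. }
  { apply is_lim_seq_geom_half. }
  exists z. intros _.
  assert (Hz : (Cmod (z - z0) < r)%R).
  { specialize (Tz O). simpl in Tz. lra. }
  split; [exact Hz|].
  assert (Cf := D_cont (HD z ltac:(lra))).
  assert (Lf : CL (fun n => f (u n)) (f z)).
  { intros eps Heps. destruct (Cf eps Heps) as (d & Hd & Kd). destruct (Lz d Hd) as (N & HN).
    exists N. intros n Hn. apply Kd, HN, Hn. }
  assert (LF : CL (fun n => F (u n)) (F z)).
  { unfold F. apply CL_plus; [|apply CL_const]. apply CL_minus; auto.
    apply CL_ext with (fun n => / a * f (u n)); [intro; unfold Cdiv; ring|].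
    replace (f z / a) with (/ a * f z) by (unfold Cdiv; ring). apply CL_scal; auto. }
  assert (LS : CL (fun n => F (u n)) z).
  { intros eps Heps. destruct (Lz eps Heps) as (N & HN). exists N. intros n Hn.
    apply (HN (S n)). lia. }
  assert (E := CL_unique LF LS). unfold F in E.
  replace (f z) with (a * (f z / a)) by (field; auto).
  replace (f z / a) with (z - (z - f z / a + v / a) + v / a) by ring.
  rewrite E. field; auto. }
destruct (choice _ Ex) as (g & Hg).
exists r, s, g. split; [exact Hr|]. split; [exact Hs|]. split; [exact Hnz|]. split; [exact Inj|].
intros v Hv. destruct (Hg v Hv) as [G1 G2]. split; [exact G1|]. split; [exact G2|].
assert (Hb := Hnz _ G1). set (b := f' (g v)) in *.
assert (Hb' : (0 < Cmod b)%R) by (apply Cmod_gt_0; auto).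
apply D_eps. intros eps Heps.
set (e' := (eps * Cmod b * Cmod a / 2)%R).
assert (He' : (0 < e')%R) by (unfold e'; repeat apply Rmult_lt_0_compat; lra).
destruct (proj1 (D_eps _ _ _) (HD (g v) ltac:(lra)) e' He') as (d & Hd & Kd). fold b in Kd.
exists (Rmin (s - Cmod (v - f z0)) (d * Cmod a / 2)). split.
{ apply Rmin_pos; [lra|]. repeat apply Rmult_lt_0_compat; lra. }
intros w Hw.
assert (Hw1 : (Cmod (w - v) < s - Cmod (v - f z0))%R) by (eapply Rlt_le_trans; [exact Hw|apply Rmin_l]).
assert (Hw2 : (Cmod (w - v) < d * Cmod a / 2)%R) by (eapply Rlt_le_trans; [exact Hw|apply Rmin_r]).
assert (Hws : (Cmod (w - f z0) < s)%R).
{ replace (w - f z0) with ((w - v) + (v - f z0)) by ring. eapply Rle_lt_trans; [apply Cmod_triangle|]. lra. }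
destruct (Hg w Hws) as [W1 W2].
assert (L := Low _ _ W1 G1). rewrite W2, G2 in L.
assert (B : (Cmod (g w - g v) < d)%R) by nra.
specialize (Kd _ B). rewrite W2, G2 in Kd.
replace (g w - g v - / b * (w - v)) with (- (w - v - b * (g w - g v)) / b) by (field; auto).
rewrite Cmod_div, Cmod_opp by auto. apply Rle_div_l; [lra|].
eapply Rle_trans; [exact Kd|]. unfold e'.
replace (eps * Cmod b * Cmod a / 2 * Cmod (g w - g v))%R with
  (eps * Cmod b * (Cmod a / 2 * Cmod (g w - g v)))%R by field.
replace (eps * Cmod (w - v) * Cmod b)%R with (eps * Cmod b * Cmod (w - v))%R by ring.
apply Rmult_le_compat_l; [|exact L]. apply Rmult_le_pos; lra.
Qed.

(** * Second order linear equations *)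

(** The equation as a first order system. The derivative is carried as a function of its own,
    because it can then be combined, shifted and composed without recomputing a [C_derive]. *)
Definition sol_on (q f f1 : C -> C) z0 (r : R) : Prop :=
  forall z, (Cmod (z - z0) < r)%R -> D f z (f1 z) /\ D f1 z (q z * f z).

Lemma ball_center z0 (r : R) : (0 < r)%R -> (Cmod (z0 - z0) < r)%R.
Proof. intro H. replace (z0 - z0) with (RtoC 0) by ring. rewrite Cmod_0. exact H. Qed.

Lemma locally_ball (P : C -> Prop) z0 (r : R) z : (Cmod (z - z0) < r)%R ->
  (forall w, (Cmod (w - z0) < r)%R -> P w) -> locally z P.
Proof.
intros Hz H. apply locally_Cmod. exists (r - Cmod (z - z0))%R. split; [lra|].
intros w Hw. apply H. replace (w - z0) with ((w - z) + (z - z0)) by ring.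
eapply Rle_lt_trans; [apply Cmod_triangle|]. lra.
Qed.

Lemma solution_at_iff q f z0 :
  solution_at q f z0 <-> exists (r : R) (f1 : C -> C), (0 < r)%R /\ sol_on q f f1 z0 r.
Proof.
split.
- intro H. apply locally_Cmod in H. destruct H as (r & Hr & H).
  exists r, (C_derive f). split; auto. intros z Hz. destruct (H z Hz) as [H1 H2].
  split; [apply holo_D; exact H1|exact H2].
- intros (r & f1 & Hr & H). apply locally_Cmod. exists r. split; auto. intros z Hz.
  destruct (H z Hz) as [H1 H2]. split; [exact (D_holo H1)|].
  apply D_ext_loc with f1; [|exact H2].
  apply (@locally_ball _ z0 r z Hz). intros w Hw. symmetry. apply D_C_derive. apply (H w Hw).
Qed.

Lemma solution_at_near q f z0 : solution_at q f z0 -> locally z0 (solution_at q f).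
Proof.
intro H. apply locally_locally in H. exact H.
Qed.

Lemma sol_on_cont0 q f f1 z0 r : (0 < r)%R -> sol_on q f f1 z0 r -> contC f z0.
Proof. intros Hr H. eapply D_cont. apply (H z0). apply ball_center; auto. Qed.

Lemma solution_at_ext q f g z0 : locally z0 (fun z => f z = g z) ->
  solution_at q f z0 -> solution_at q g z0.
Proof.
intros E H. apply solution_at_iff in H. destruct H as (r & f1 & Hr & H).
apply locally_Cmod in E. destruct E as (r' & Hr' & E).
apply solution_at_iff. exists (Rmin r r'), f1. split; [apply Rmin_pos; auto|].
intros z Hz. assert (Hz1 := Rlt_le_trans _ _ _ Hz (Rmin_l _ _)).
assert (Hz2 := Rlt_le_trans _ _ _ Hz (Rmin_r _ _)).
destruct (H z Hz1) as [H1 H2]. rewrite <- (E z Hz2). split; auto.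
apply D_ext_loc with f; auto. apply (@locally_ball _ z0 r' z Hz2). exact E.
Qed.

Definition wronsk (f f1 g g1 : C -> C) (z : C) : C := f z * g1 z - f1 z * g z.

Lemma wronsk_const q f f1 g g1 z0 r : sol_on q f f1 z0 r -> sol_on q g g1 z0 r ->
  forall z, (Cmod (z - z0) < r)%R -> wronsk f f1 g g1 z = wronsk f f1 g g1 z0.
Proof.
intros H K. apply const_ball. intros z Hz. destruct (H z Hz) as [H1 H2]. destruct (K z Hz) as [K1 K2].
eapply D_eq; [|apply D_minus; apply D_mult; eassumption]. ring.
Qed.

Lemma sol_on_sub q f f1 z0 (r : R) z1 (r1 : R) :
  (Cmod (z1 - z0) + r1 <= r)%R -> sol_on q f f1 z0 r -> sol_on q f f1 z1 r1.
Proof.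
intros Hr H z Hz. apply H. replace (z - z0) with ((z - z1) + (z1 - z0)) by ring.
eapply Rle_lt_trans; [apply Cmod_triangle|]. lra.
Qed.

Lemma sol_on_shrink q f f1 z0 (r r1 : R) : (r1 <= r)%R -> sol_on q f f1 z0 r -> sol_on q f f1 z0 r1.
Proof.
intros Hr. apply sol_on_sub. replace (z0 - z0) with (RtoC 0) by ring. rewrite Cmod_0. lra.
Qed.

(* If [|f| <= M] on a small ball, integrating the equation twice gives [|f| <= M / 2]. *)
Lemma sol_unique q f f1 z0 r : (0 < r)%R -> sol_on q f f1 z0 r -> contC q z0 ->
  f z0 = 0 -> f1 z0 = 0 -> locally z0 (fun z => f z = 0).
Proof.
intros Hr H Hq E0 E1.
destruct (Hq 1%R Rlt_0_1) as (rq & Hrq & Kq).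
destruct (@sol_on_cont0 _ _ _ _ _ Hr H 1%R Rlt_0_1) as (rf & Hrf & Kf).
set (K := (Cmod (q z0) + 1)%R). assert (HK : (1 <= K)%R) by (unfold K; assert (T := Cmod_ge_0 (q z0)); lra).
(* On the ball of radius [p] one has [|q| <= K], [|f| <= 1] and [p <= 1], so that two integrations
   multiply a bound for [f] by at most [K p <= 1 / 2]. *)
set (p := Rmin (Rmin r (/ (2 * K))) (Rmin rq (Rmin rf 1))).
assert (Hp : (0 < p)%R).
{ unfold p. repeat apply Rmin_pos; try lra. apply Rinv_0_lt_compat. lra. }
assert (Hp1 : (p <= r /\ p <= / (2 * K) /\ p <= rq /\ p <= rf /\ p <= 1)%R).
{ assert (A := Rmin_l (Rmin r (/ (2 * K))) (Rmin rq (Rmin rf 1))).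
  assert (A' := Rmin_r (Rmin r (/ (2 * K))) (Rmin rq (Rmin rf 1))). fold p in A, A'.
  assert (B := Rmin_l r (/ (2 * K))). assert (B' := Rmin_r r (/ (2 * K))).
  assert (B2 := Rmin_l rq (Rmin rf 1)). assert (B3 := Rmin_r rq (Rmin rf 1)).
  assert (B4 := Rmin_l rf 1). assert (B5 := Rmin_r rf 1). repeat split; lra. }
destruct Hp1 as (P1 & P2 & P3 & P4 & P5).
assert (HpK : (p * K <= / 2)%R).
{ apply Rmult_le_compat_r with (r := K) in P2; [|lra]. replace (/ (2 * K) * K)%R with (/2)%R in P2 by (field; lra). exact P2. }
assert (Step : forall M : R, (forall z, (Cmod (z - z0) < p)%R -> (Cmod (f z) <= M)%R) ->
   forall z, (Cmod (z - z0) < p)%R -> (Cmod (f z) <= M / 2)%R).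
{ intros M HM z Hz.
  assert (HM0 : (0 <= M)%R) by (eapply Rle_trans; [apply Cmod_ge_0|apply (HM z Hz)]).
  assert (B1 : forall w, (Cmod (w - z0) < p)%R -> (Cmod (f1 w) <= K * M)%R).
  { intros w Hw.
    assert (T := @mvt_ball f1 (fun x => q x * f x) z0 p (K * M)%R).
    specialize (T ltac:(intros x Hx; split; [apply H; lra|]; rewrite Cmod_mult; apply Rmult_le_compat;
      [apply Cmod_ge_0|apply Cmod_ge_0| |apply HM; auto];
      specialize (Kq x ltac:(lra)); unfold K;
      replace (q x) with ((q x - q z0) + q z0) by ring;
      eapply Rle_trans; [apply Cmod_triangle|lra]) w z0 Hw (ball_center _ Hp)).
    rewrite E1 in T. replace (f1 w - 0) with (f1 w) in T by ring.
    eapply Rle_trans; [exact T|]. assert (0 <= K * M)%R by nra.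
    assert (0 <= Cmod (w - z0))%R by apply Cmod_ge_0. nra. }
  assert (T := @mvt_ball f f1 z0 p (K * M)%R).
  specialize (T ltac:(intros x Hx; split; [apply H; lra|]; apply B1; auto) z z0 Hz (ball_center _ Hp)).
  rewrite E0 in T. replace (f z - 0) with (f z) in T by ring.
  eapply Rle_trans; [exact T|].
  apply Rle_trans with (K * M * p)%R; [apply Rmult_le_compat_l; [nra|lra]|]. nra. }
assert (It : forall n z, (Cmod (z - z0) < p)%R -> (Cmod (f z) <= (/ 2) ^ n)%R).
{ induction n as [|n IH]; intros z Hz.
  - simpl. specialize (Kf z ltac:(lra)). rewrite E0 in Kf. replace (f z - 0) with (f z) in Kf by ring. lra.
  - eapply Rle_trans; [apply (Step _ IH z Hz)|]. simpl. lra. }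
apply locally_Cmod. exists p. split; auto. intros z Hz.
apply Cmod_eq_0. apply Rle_antisym; [|apply Cmod_ge_0].
apply le_epsilon. intros eps He.
destruct (pow_lt_1_zero (/2) ltac:(rewrite Rabs_pos_eq; lra) eps He) as (N & HN).
specialize (HN N (Nat.le_refl _)). specialize (It N z Hz).
rewrite Rabs_pos_eq in HN by (apply pow_le; lra). lra.
Qed.

(** If the Wronskian vanished, the combinations with coefficients [(g1 z0, - f1 z0)] and
    [(g z0, - f z0)] would have zero initial data. By [sol_unique] and independence all four numbers
    would then be zero, and so would every combination of [f] and [g] near [z0]. *)
Lemma independent_wronsk q f f1 g g1 z0 r : (0 < r)%R -> contC q z0 ->
  sol_on q f f1 z0 r -> sol_on q g g1 z0 r -> independent_at f g z0 ->
  wronsk f f1 g g1 z0 <> 0.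
Proof.
intros Hr Hq H K Hi E. unfold wronsk in E.
assert (Z : forall c1 c2, c1 * f z0 + c2 * g z0 = 0 -> c1 * f1 z0 + c2 * g1 z0 = 0 -> c1 = 0 /\ c2 = 0).
{ intros c1 c2 A B. apply Hi.
  apply (@sol_unique q (fun z => c1 * f z + c2 * g z) (fun z => c1 * f1 z + c2 * g1 z) z0 r Hr); auto.
  intros z Hz. destruct (H z Hz) as [H1 H2], (K z Hz) as [K1 K2]. split.
  - apply D_plus; apply D_scal; auto.
  - eapply D_eq; [|apply D_plus; apply D_scal; eassumption]. ring. }
destruct (Z (g1 z0) (- f1 z0)) as [A1 A2].
{ rewrite <- E. ring. } { ring. }
destruct (Z (g z0) (- f z0)) as [A3 A4].
{ ring. } { replace (g z0 * f1 z0 + - f z0 * g1 z0) with (- (f z0 * g1 z0 - f1 z0 * g z0)) by ring. rewrite E. ring. }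
assert (F1 : f1 z0 = 0) by (replace (f1 z0) with (- - f1 z0) by ring; rewrite A2; ring).
assert (F0 : f z0 = 0) by (replace (f z0) with (- - f z0) by ring; rewrite A4; ring).
destruct (Z 1 0) as [X _].
{ rewrite F0, A3; ring. } { rewrite F1, A1. ring. }
apply C1_nz. exact X.
Qed.

(** Cramer's rule; the coefficients are constant because the Wronskians are. *)
Lemma sol_basis q f f1 g g1 h h1 z0 r : (0 < r)%R ->
  sol_on q f f1 z0 r -> sol_on q g g1 z0 r -> sol_on q h h1 z0 r ->
  wronsk f f1 g g1 z0 <> 0 ->
  exists c1 c2 : C, forall z, (Cmod (z - z0) < r)%R ->
    h z = c1 * f z + c2 * g z /\ h1 z = c1 * f1 z + c2 * g1 z.
Proof.
intros Hr H K L W. set (w0 := wronsk f f1 g g1 z0) in *.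
exists (wronsk h h1 g g1 z0 / w0), (wronsk f f1 h h1 z0 / w0). intros z Hz.
rewrite <- (wronsk_const L K z Hz), <- (wronsk_const H L z Hz).
assert (E : w0 = wronsk f f1 g g1 z) by (symmetry; apply (wronsk_const H K z Hz)).
rewrite E in *. unfold wronsk in *. split; field; auto.
Qed.

(** Equality of two ratios of solutions becomes, after clearing denominators, a quadratic relation
    in [f] and [g]. Together with its first two derivatives at [z0] it is a linear system for [a],
    [b], [c], the symmetric square of the Wronskian matrix, hence invertible. *)
Lemma quadratic_form_zero q f f1 g g1 z0 r a b c : (0 < r)%R ->
  sol_on q f f1 z0 r -> sol_on q g g1 z0 r -> wronsk f f1 g g1 z0 <> 0 ->
  (forall z, (Cmod (z - z0) < r)%R -> a * f z ^ 2 + b * (f z * g z) + c * g z ^ 2 = 0) ->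
  a = 0 /\ b = 0 /\ c = 0.
Proof.
intros Hr H K W Q.
assert (Q1 : forall z, (Cmod (z - z0) < r)%R ->
  2 * a * (f z * f1 z) + b * (f1 z * g z + f z * g1 z) + 2 * c * (g z * g1 z) = 0).
{ intros z Hz. destruct (H z Hz) as [H1 H2], (K z Hz) as [K1 K2].
  apply (@D_unique (fun z => a * (f z * f z) + b * (f z * g z) + c * (g z * g z)) z).
  - eapply D_eq; [|apply D_plus; [apply D_plus|]; apply D_scal; apply D_mult; eassumption]. ring.
  - apply D_ext_loc with (fun _ => RtoC 0); [|apply D_const].
    apply (@locally_ball _ z0 r z Hz). intros w Hw. rewrite <- (Q w Hw). ring. }
assert (Q2 : a * f1 z0 ^ 2 + b * (f1 z0 * g1 z0) + c * g1 z0 ^ 2 = 0).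
{ assert (Hz := ball_center z0 Hr). destruct (H z0 Hz) as [H1 H2], (K z0 Hz) as [K1 K2].
  assert (E : 2 * (a * f1 z0 ^ 2 + b * (f1 z0 * g1 z0) + c * g1 z0 ^ 2) +
     2 * q z0 * (a * f z0 ^ 2 + b * (f z0 * g z0) + c * g z0 ^ 2) = 0).
  { apply (@D_unique (fun z => (2 * a) * (f z * f1 z) + b * (f1 z * g z + f z * g1 z) + (2 * c) * (g z * g1 z)) z0).
    - eapply D_eq; [|apply D_plus; [apply D_plus|]; apply D_scal; [|apply D_plus|]; apply D_mult; eassumption]. ring.
    - apply D_ext_loc with (fun _ => RtoC 0); [|apply D_const].
      apply (@locally_ball _ z0 r z0 Hz). intros w Hw. symmetry. exact (Q1 w Hw). }
  rewrite (Q z0 Hz) in E.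
  assert (T : RtoC 2 <> 0) by (intro T; apply RtoC_inj in T; lra).
  replace (a * f1 z0 ^ 2 + b * (f1 z0 * g1 z0) + c * g1 z0 ^ 2) with
    ((2 * (a * f1 z0 ^ 2 + b * (f1 z0 * g1 z0) + c * g1 z0 ^ 2) + 2 * q z0 * 0) / 2) by (field; auto).
  rewrite E. field. }
specialize (Q z0 (ball_center z0 Hr)). specialize (Q1 z0 (ball_center z0 Hr)).
unfold wronsk in W. revert Q Q1 Q2 W. generalize (f z0) (f1 z0) (g z0) (g1 z0).
intros u1 v1 u2 v2 Q Q1 Q2 W.
assert (T : (u1 * v2 - v1 * u2) ^ 2 <> 0) by (apply Cpow_nz; exact W).
assert (A : forall x, x * (u1 * v2 - v1 * u2) ^ 2 = 0 -> x = 0).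
{ intros x Hx. replace x with (x * (u1 * v2 - v1 * u2) ^ 2 / (u1 * v2 - v1 * u2) ^ 2) by (field; auto).
  rewrite Hx. field; auto. }
(* The multipliers are the rows of the inverse of the symmetric square, scaled by the squared
   Wronskian. *)
repeat split; apply A.
- transitivity (v2 ^ 2 * (a * u1 ^ 2 + b * (u1 * u2) + c * u2 ^ 2) -
    v2 * u2 * (2 * a * (u1 * v1) + b * (v1 * u2 + u1 * v2) + 2 * c * (u2 * v2)) +
    u2 ^ 2 * (a * v1 ^ 2 + b * (v1 * v2) + c * v2 ^ 2)); [ring|]. rewrite Q, Q1, Q2. ring.
- transitivity (- 2 * v1 * v2 * (a * u1 ^ 2 + b * (u1 * u2) + c * u2 ^ 2) +
    (u1 * v2 + u2 * v1) * (2 * a * (u1 * v1) + b * (v1 * u2 + u1 * v2) + 2 * c * (u2 * v2))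
    - 2 * u1 * u2 * (a * v1 ^ 2 + b * (v1 * v2) + c * v2 ^ 2)); [ring|]. rewrite Q, Q1, Q2. ring.
- transitivity (v1 ^ 2 * (a * u1 ^ 2 + b * (u1 * u2) + c * u2 ^ 2) -
    v1 * u1 * (2 * a * (u1 * v1) + b * (v1 * u2 + u1 * v2) + 2 * c * (u2 * v2)) +
    u1 ^ 2 * (a * v1 ^ 2 + b * (v1 * v2) + c * v2 ^ 2)); [ring|]. rewrite Q, Q1, Q2. ring.
Qed.

(* Apply the vanishing of the quadratic form in the basis [M (f, g)]. *)
Lemma ratio_matrix q f f1 g g1 z0 r (M N : mat2) : (0 < r)%R ->
  sol_on q f f1 z0 r -> sol_on q g g1 z0 r -> wronsk f f1 g g1 z0 <> 0 ->
  mat2_det M <> 0 ->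
  (forall z, (Cmod (z - z0) < r)%R ->
     (m11 N * f z + m12 N * g z) * (m21 M * f z + m22 M * g z)
     = (m21 N * f z + m22 N * g z) * (m11 M * f z + m12 M * g z)) ->
  exists k, N = mat2_scale k M.
Proof.
intros Hr H K W HM E. destruct M as [a b c d], N as [a' b' c' d']. unfold mat2_det in HM. simpl in *.
set (det := a * d - b * c) in *.
(* These are the entries of [N] times the inverse of [M]. The hypothesis on the ratios says that
   this product acts as a scalar. *)
set (k11 := (a' * d - b' * c) / det). set (k12 := (b' * a - a' * b) / det).
set (k21 := (c' * d - d' * c) / det). set (k22 := (d' * a - c' * b) / det).
destruct (@quadratic_form_zero q (fun z => a * f z + b * g z) (fun z => a * f1 z + b * g1 z)
  (fun z => c * f z + d * g z) (fun z => c * f1 z + d * g1 z) z0 r (- k21) (k11 - k22) k12 Hr) as (A1 & A2 & A3).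
- intros z Hz. destruct (H z Hz) as [H1 H2], (K z Hz) as [K1 K2]. split.
  + apply D_plus; apply D_scal; auto.
  + eapply D_eq; [|apply D_plus; apply D_scal; eassumption]. ring.
- intros z Hz. destruct (H z Hz) as [H1 H2], (K z Hz) as [K1 K2]. split.
  + apply D_plus; apply D_scal; auto.
  + eapply D_eq; [|apply D_plus; apply D_scal; eassumption]. ring.
- unfold wronsk in *. replace ((a * f z0 + b * g z0) * (c * f1 z0 + d * g1 z0) -
    (a * f1 z0 + b * g1 z0) * (c * f z0 + d * g z0)) with (det * (f z0 * g1 z0 - f1 z0 * g z0))
    by (unfold det; ring). apply Cmult_neq_0; auto.
- intros z Hz. specialize (E z Hz).
  transitivity ((a' * f z + b' * g z) * (c * f z + d * g z) - (c' * f z + d' * g z) * (a * f z + b * g z)).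
  + unfold k11, k12, k21, k22. unfold det in *. field. exact HM.
  + rewrite E. ring.
- exists k11.
  assert (B1 : k21 = 0) by (replace k21 with (- - k21) by ring; rewrite A1; ring).
  assert (B2 : k22 = k11) by (replace k22 with (k11 - (k11 - k22)) by ring; rewrite A2; ring).
  unfold mat2_scale. simpl. f_equal.
  + replace a' with (k11 * a + k12 * c) by (unfold k11, k12, det in *; field; auto). rewrite A3; ring.
  + replace b' with (k11 * b + k12 * d) by (unfold k11, k12, det in *; field; auto). rewrite A3; ring.
  + replace c' with (k21 * a + k22 * c) by (unfold k21, k22, det in *; field; auto). rewrite B1, B2; ring.
  + replace d' with (k21 * b + k22 * d) by (unfold k21, k22, det in *; field; auto). rewrite B1, B2; ring.
Qed.

(** * Liouville's theorem for elliptic functions *)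

Lemma real_induction (P : R -> Prop) :
  P 0%R ->
  (forall t, (0 <= t < 1)%R -> P t ->
     exists d, (0 < d)%R /\ forall s, (t < s < t + d)%R -> (s <= 1)%R -> P s) ->
  (forall t, (0 < t <= 1)%R -> (forall s, (0 <= s < t)%R -> P s) -> P t) ->
  forall t, (0 <= t <= 1)%R -> P t.
Proof.
intros H0 Ho Hc.
set (Q := fun t => (0 <= t <= 1)%R /\ forall s, (0 <= s <= t)%R -> P s).
assert (Q0 : Q 0%R) by (split; [lra|]; intros s Hs; replace s with 0%R by lra; auto).
destruct (completeness Q) as (m & Hm1 & Hm2).
{ exists 1%R. intros t [Ht _]. lra. }
{ exists 0%R. exact Q0. }
assert (M0 : (0 <= m)%R) by (apply Hm1; exact Q0).
assert (M1 : (m <= 1)%R) by (apply Hm2; intros t [Ht _]; lra).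
assert (Lt : forall s, (0 <= s < m)%R -> P s).
{ intros s Hs. apply NNPP. intro N.
  assert (m <= s)%R; [|lra]. apply Hm2. intros t [Ht1 Ht2].
  destruct (Rle_lt_dec t s); auto. exfalso. apply N. apply Ht2. lra. }
assert (Pm : P m).
{ destruct (Req_dec m 0) as [->|Hm]; auto. apply Hc; auto. lra. }
assert (Qm : Q m).
{ split; [lra|]. intros s Hs. destruct (Req_dec s m) as [->|?]; auto. apply Lt. lra. }
destruct (Req_dec m 1) as [E|N].
- subst m. intros t Ht. apply Qm. auto.
- exfalso. destruct (Ho m ltac:(lra) Pm) as (d & Hd & K).
  set (t := Rmin 1 (m + d / 2)).
  assert (T : (m < t <= 1 /\ t < m + d)%R).
  { unfold t. split; [split|]. apply Rmin_glb_lt; lra. apply Rmin_l. eapply Rle_lt_trans; [apply Rmin_r|lra]. }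
  assert (Q t).
  { split; [lra|]. intros s Hs. destruct (Rle_lt_dec s m); [apply Qm; lra|]. apply K; lra. }
  apply Hm1 in H. lra.
Qed.

(** Replaces the subdivision of [[0, 1]] in continuation arguments: it suffices to carry [P] between
    any two parameters near each [t], in either direction. [P] may hide existential choices that
    vary with the parameter. *)
Lemma chain_induction (P : R -> Prop) :
  P 0%R ->
  (forall t, (0 <= t <= 1)%R -> exists d, (0 < d)%R /\
     forall s s', (0 <= s <= 1)%R -> (0 <= s' <= 1)%R ->
       (Rabs (s - t) < d)%R -> (Rabs (s' - t) < d)%R -> P s -> P s') ->
  P 1%R.
Proof.
intros H0 H. apply (real_induction P); auto; [| |lra].
- intros t Ht Pt. destruct (H t ltac:(lra)) as (d & Hd & K). exists d. split; auto.
  intros s Hs Hs1. apply (K t s); auto; try lra.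
  + rewrite Rminus_diag_eq by auto. rewrite Rabs_R0. auto.
  + rewrite Rabs_pos_eq; lra.
- intros t Ht Pt. destruct (H t ltac:(lra)) as (d & Hd & K).
  set (s := Rmax 0 (t - d / 2)).
  assert (S : (0 <= s < t /\ t - d < s)%R).
  { unfold s. split; [split|]. apply Rmax_l. apply Rmax_lub_lt; lra. eapply Rlt_le_trans; [|apply Rmax_r]; lra. }
  apply (K s t); try lra.
  + rewrite Rabs_left; lra.
  + rewrite Rminus_diag_eq by auto. rewrite Rabs_R0. auto.
  + apply Pt. lra.
Qed.

(** * The mean value property on circles and the maximum principle *)

Definition eit (t : R) : C := (cos t, sin t).

Lemma Cmod_eit t : Cmod (eit t) = 1%R.
Proof.
unfold Cmod, eit; simpl. replace (cos t * (cos t * 1) + sin t * (sin t * 1))%R with 1%R.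
apply sqrt_1. assert (H := sin2_cos2 t). unfold Rsqr in H. lra.
Qed.

Lemma DR_eit t : DR eit t (Ci * eit t).
Proof.
apply DR_intro; unfold eit; simpl; auto_derive; auto; ring.
Qed.

Lemma eit_lip t s : (Cmod (eit t - eit s) <= 2 * Rabs (t - s))%R.
Proof.
eapply Rle_trans; [apply Cmod_le_ReIm|]. simpl.
assert (A : (Rabs (cos t - cos s) <= Rabs (t - s))%R).
{ destruct (MVT_gen cos s t (fun x => (- sin x)%R)) as (c & _ & E).
  - intros x _. auto_derive; auto; ring.
  - intros x _. apply continuity_cos.
  - rewrite E, Rabs_mult, Rabs_Ropp. assert (B := SIN_bound c).
    assert (Rabs (sin c) <= 1)%R by (apply Rabs_le; lra). assert (C := Rabs_pos (t - s)). nra. }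
assert (B : (Rabs (sin t - sin s) <= Rabs (t - s))%R).
{ destruct (MVT_gen sin s t (fun x => (cos x)%R)) as (c & _ & E).
  - intros x _. auto_derive; auto; ring.
  - intros x _. apply continuity_sin.
  - rewrite E, Rabs_mult. assert (B := COS_bound c).
    assert (Rabs (cos c) <= 1)%R by (apply Rabs_le; lra). assert (C := Rabs_pos (t - s)). nra. }
change (Rabs (cos t - cos s) + Rabs (sin t - sin s) <= 2 * Rabs (t - s))%R. lra.
Qed.

Lemma DR_continuous p t v : DR p t v -> continuous (fun s => Re (p s)) t.
Proof.
intro H. apply (ex_derive_continuous (K := R_AbsRing) (V := R_NormedModule)).
eexists. apply (DR_Re H).
Qed.

Lemma DR_scal c p t v : DR p t v -> DR (fun s => c * p s) t (c * v).
Proof.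
intro H. apply (@DR_comp (fun z => c * z) p t v c H).
eapply D_eq; [|apply D_scal, D_id]. ring.
Qed.

Lemma DR_ray p h t s : DR (fun s => p + RtoC s * (h * eit t)) s (h * eit t).
Proof. apply DR_line. Qed.

Lemma DR_circle p h s t : DR (fun t => p + RtoC s * (h * eit t)) t (RtoC s * (h * (Ci * eit t))).
Proof.
replace (RtoC s * (h * (Ci * eit t))) with ((0 + 1) * (RtoC s * (h * (Ci * eit t)))) by ring.
apply (@DR_comp (fun z => p + z) (fun t => RtoC s * (h * eit t))).
- apply DR_scal, DR_scal, DR_eit.
- apply D_plus; [apply D_const|apply D_id].
Qed.

Definition circle_int f p h (s : R) : R :=
  RInt (fun t => Re (f (p + RtoC s * (h * eit t)))) 0 (2 * PI).

Section Mean.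
Variables (f f' : C -> C) (p : C) (r : R).
Hypothesis (Hf : forall z, (0 < Cmod (z - p) < r)%R -> D f z (f' z) /\ contC f' z).
Variable h : C.
Hypothesis Hh : h <> 0.

Let ring_pt s t : (0 < s)%R -> (s * Cmod h < r)%R ->
  (0 < Cmod (p + RtoC s * (h * eit t) - p) < r)%R.
Proof.
intros Hs Hr. replace (p + RtoC s * (h * eit t) - p) with (RtoC s * (h * eit t)) by ring.
rewrite !Cmod_mult, Cmod_eit, Cmod_R, Rabs_pos_eq, Rmult_1_r by lra.
split; auto. apply Rmult_lt_0_compat; auto. apply Cmod_gt_0; auto.
Qed.

Let near_s s : (0 < s)%R -> (s * Cmod h < r)%R ->
  locally s (fun u => (0 < u)%R /\ (u * Cmod h < r)%R).
Proof.
intros Hs Hr. assert (Hm : (0 < Cmod h)%R) by (apply Cmod_gt_0; auto).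
assert (Hd : (0 < Rmin s (r / Cmod h - s))%R).
{ apply Rmin_pos; auto. apply Rlt_0_minus. apply Rlt_div_r; auto. }
exists (mkposreal _ Hd). intros u Hu. change (Rabs (u - s) < Rmin s (r / Cmod h - s))%R in Hu.
assert (A := Rlt_le_trans _ _ _ Hu (Rmin_l _ _)). assert (B := Rlt_le_trans _ _ _ Hu (Rmin_r _ _)).
apply Rabs_def2 in A. apply Rabs_def2 in B. split; [lra|]. apply Rlt_div_r; auto. lra.
Qed.

Lemma circle_int_ex s : (0 < s)%R -> (s * Cmod h < r)%R ->
  ex_RInt (fun t => Re (f (p + RtoC s * (h * eit t)))) 0 (2 * PI).
Proof.
intros Hs Hr. apply (ex_RInt_continuous (V := R_CompleteNormedModule)). intros t _.
apply (@DR_continuous (fun t => f (p + RtoC s * (h * eit t))) t (f' (p + RtoC s * (h * eit t)) * (RtoC s * (h * (Ci * eit t))))).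
apply (@DR_comp f (fun t => p + RtoC s * (h * eit t))); [apply DR_circle|].
apply Hf. apply ring_pt; auto.
Qed.

Let d_ray s t : (0 < s)%R -> (s * Cmod h < r)%R ->
  is_derive (fun s => Re (f (p + RtoC s * (h * eit t)))) s
   (Re (f' (p + RtoC s * (h * eit t)) * (h * eit t))).
Proof.
intros Hs Hr. apply (@DR_Re (fun s => f (p + RtoC s * (h * eit t)))).
apply (@DR_comp f (fun s => p + RtoC s * (h * eit t))); [apply DR_ray|].
apply Hf, ring_pt; auto.
Qed.

Let cont_2d s t : (0 < s)%R -> (s * Cmod h < r)%R ->
  continuity_2d_pt (fun u v => Re (f' (p + RtoC u * (h * eit v)) * (h * eit v))) s t.
Proof.
intros Hs Hr eps.
set (z0 := p + RtoC s * (h * eit t)). set (a := f' z0).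
assert (Hm : (0 < Cmod h)%R) by (apply Cmod_gt_0; auto).
assert (Ha := Cmod_ge_0 a). assert (He := cond_pos eps).
destruct (Hf _ (@ring_pt s t Hs Hr)) as [_ Hc]. fold z0 in Hc.
destruct (Hc (eps / (2 * Cmod h))%R ltac:(apply Rdiv_lt_0_compat; lra)) as (d & Hd & K).
set (d1 := (d / (2 * Cmod h))%R). set (d2 := (d / (4 * s * Cmod h))%R).
set (d3 := (eps / (4 * Cmod h * (Cmod a + 1)))%R).
assert (Hd1 : (0 < d1)%R) by (apply Rdiv_lt_0_compat; lra).
assert (Hd2 : (0 < d2)%R) by (apply Rdiv_lt_0_compat; nra).
assert (Hd3 : (0 < d3)%R) by (apply Rdiv_lt_0_compat; nra).
assert (Hd4 : (0 < Rmin d1 (Rmin d2 d3))%R) by (repeat apply Rmin_pos; auto).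
exists (mkposreal _ Hd4). intros u v Hu Hv. simpl in Hu, Hv.
assert (U := Rlt_le_trans _ _ _ Hu (Rmin_l _ _)).
assert (V := Rlt_le_trans _ _ _ Hv (Rmin_r _ _)).
assert (V1 := Rlt_le_trans _ _ _ V (Rmin_l _ _)). assert (V2 := Rlt_le_trans _ _ _ V (Rmin_r _ _)).
assert (Hev := eit_lip v t).
set (w := p + RtoC u * (h * eit v)).
assert (B : (Cmod (w - z0) < d)%R).
{ replace (w - z0) with (RtoC (u - s) * (h * eit v) + RtoC s * (h * (eit v - eit t)))
    by (unfold w, z0; rewrite RtoC_minus; ring).
  eapply Rle_lt_trans; [apply Cmod_triangle|].
  rewrite !Cmod_mult, Cmod_eit, !Cmod_R, (Rabs_pos_eq s), Rmult_1_r by lra.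
  assert (Rabs (u - s) * Cmod h < d / 2)%R.
  { apply Rmult_lt_compat_r with (r := Cmod h) in U; auto.
    replace (d1 * Cmod h)%R with (d / 2)%R in U by (unfold d1; field; lra). exact U. }
  assert (s * (Cmod h * Cmod (eit v - eit t)) <= d / 2)%R.
  { replace (d / 2)%R with (s * Cmod h * (2 * d2))%R by (unfold d2; field; lra).
    rewrite <- Rmult_assoc. apply Rmult_le_compat_l; nra. }
  lra. }
specialize (K w B).
replace (Re (f' w * (h * eit v)) - Re (a * (h * eit t)))%R with
  (Re ((f' w - a) * (h * eit v) + a * (h * (eit v - eit t)))).
2:{ generalize (f' w) a h (eit v) (eit t). intros [? ?] [? ?] [? ?] [? ?] [? ?]. simpl. ring. }
eapply Rle_lt_trans; [apply re_le_Cmod|]. eapply Rle_lt_trans; [apply Cmod_triangle|].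
rewrite !Cmod_mult, Cmod_eit, Rmult_1_r.
assert (Cmod (f' w - a) * Cmod h < eps / 2)%R.
{ apply Rmult_lt_compat_r with (r := Cmod h) in K; auto. fold a in K.
  replace (eps / (2 * Cmod h) * Cmod h)%R with (eps / 2)%R in K by (field; lra). exact K. }
assert (Cmod a * (Cmod h * Cmod (eit v - eit t)) <= eps / 2)%R.
{ replace (eps / 2)%R with ((Cmod a + 1) * (Cmod h * (2 * d3)))%R by (unfold d3; field; lra).
  apply Rmult_le_compat; try lra.
  - apply Rmult_le_pos; [lra|apply Cmod_ge_0].
  - apply Rmult_le_compat_l; lra. }
lra.
Qed.

(** Differentiating in the radius gives the integrand [Re (f' * (h * eit t))], which by holomorphy
    is also the derivative in the angle of [Im f / s]; its integral over a full turn is zero. All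
    the circles stay in the punctured disc. *)
Lemma circle_int_derive s : (0 < s)%R -> (s * Cmod h < r)%R ->
  is_derive (circle_int f p h) s 0%R.
Proof.
intros Hs Hr.
assert (E : RInt (fun t => Derive (fun u => Re (f (p + RtoC u * (h * eit t)))) s) 0 (2 * PI) = 0%R).
{ rewrite (RInt_ext _ (fun t => Re (f' (p + RtoC s * (h * eit t)) * (h * eit t)))).
  2:{ intros t _. apply is_derive_unique. apply d_ray; auto. }
  apply is_RInt_unique.
  replace 0%R with (@minus R_NormedModule ((fun t => / s * Im (f (p + RtoC s * (h * eit t))))%R (2 * PI)%R)
     ((fun t => / s * Im (f (p + RtoC s * (h * eit t))))%R 0%R)) at 2.
  2:{ unfold eit. rewrite cos_2PI, sin_2PI, cos_0, sin_0. apply (minus_eq_zero (G := R_AbelianGroup)). }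
  apply (is_RInt_derive (V := R_CompleteNormedModule) (fun t => / s * Im (f (p + RtoC s * (h * eit t))))%R).
  - intros t _.
    replace (Re (f' (p + RtoC s * (h * eit t)) * (h * eit t))) with
      (/ s * Im (f' (p + RtoC s * (h * eit t)) * (RtoC s * (h * (Ci * eit t)))))%R.
    2:{ replace (f' (p + RtoC s * (h * eit t)) * (RtoC s * (h * (Ci * eit t)))) with
         (RtoC s * (Ci * (f' (p + RtoC s * (h * eit t)) * (h * eit t)))) by ring.
        generalize (f' (p + RtoC s * (h * eit t)) * (h * eit t)). intros [x y]. simpl. field. lra. }
    apply is_derive_scal. apply (@DR_Im (fun t => f (p + RtoC s * (h * eit t)))).
    apply (@DR_comp f (fun t => p + RtoC s * (h * eit t))); [apply DR_circle|].
    apply Hf, ring_pt; auto.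
  - intros t _. apply continuity_pt_filterlim.
    assert (K := cont_2d t Hs Hr). intros eps He. destruct (K (mkposreal _ He)) as (d & Hd).
    exists d. split; [apply cond_pos|]. intros v [_ Hv]. apply (Hd s v).
    + rewrite Rminus_diag_eq by auto. rewrite Rabs_R0. apply cond_pos.
    + exact Hv. }
rewrite <- E. apply (is_derive_RInt_param (fun u t => Re (f (p + RtoC u * (h * eit t)))) 0 (2 * PI) s).
- eapply filter_imp; [|apply (@near_s s Hs Hr)]. intros u [Hu Hu2] t _. eexists. apply d_ray; auto.
- intros t _.
  apply continuity_2d_pt_ext_loc with (fun u v => Re (f' (p + RtoC u * (h * eit v)) * (h * eit v))); auto.
  destruct (@near_s s Hs Hr) as (d & Hd). exists d. intros u v Hu _. symmetry. apply is_derive_unique.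
  destruct (Hd u Hu). apply d_ray; auto.
- eapply filter_imp; [|apply (@near_s s Hs Hr)]. intros u [Hu Hu2]. apply circle_int_ex; auto.
Qed.

(** The mean is the same on all circles, and on small ones it is close to [Re c]. Only the limit at
    the centre enters, so the argument passes through removable singularities. *)
Lemma circle_int_mean c :
  (forall eps, (0 < eps)%R -> exists d, (0 < d)%R /\
     forall z, (0 < Cmod (z - p) < d)%R -> (Cmod (f z - c) < eps)%R) ->
  (Cmod h < r)%R -> circle_int f p h 1 = (2 * PI * Re c)%R.
Proof.
intros Hc Hr. assert (Hm : (0 < Cmod h)%R) by (apply Cmod_gt_0; auto).
assert (Hpi := PI_RGT_0).
assert (Cst : forall s, (0 < s < 1)%R -> circle_int f p h 1 = circle_int f p h s).
{ intros s Hs. destruct (MVT_gen (circle_int f p h) s 1 (fun _ => 0%R)) as (x & _ & E).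
  - intros x Hx. rewrite Rmin_left, Rmax_right in Hx by lra. apply circle_int_derive; nra.
  - intros x Hx. rewrite Rmin_left, Rmax_right in Hx by lra.
    apply continuity_pt_filterlim. apply (ex_derive_continuous (K := R_AbsRing) (V := R_NormedModule)).
    eexists. apply circle_int_derive; nra.
  - lra. }
apply Rminus_diag_uniq.
assert (A : forall eps, (0 < eps)%R -> (Rabs (circle_int f p h 1 - 2 * PI * Re c) <= 0 + 2 * PI * eps)%R).
{ intros eps He. destruct (Hc eps He) as (d & Hd & K).
  set (s := Rmin (/ 2) (d / (2 * Cmod h))).
  assert (Hs : (0 < s)%R) by (apply Rmin_pos; [lra|apply Rdiv_lt_0_compat; lra]).
  assert (Hs1 : (s <= / 2)%R) by apply Rmin_l.
  assert (Hs2 : (s * Cmod h < d)%R).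
  { apply Rle_lt_trans with (d / (2 * Cmod h) * Cmod h)%R.
    - apply Rmult_le_compat_r; [lra|apply Rmin_r].
    - replace (d / (2 * Cmod h) * Cmod h)%R with (d / 2)%R by (field; lra). lra. }
  rewrite (Cst s) by lra.
  assert (I1 : is_RInt (fun _ => Re c) 0 (2 * PI) (2 * PI * Re c)%R).
  { replace (2 * PI * Re c)%R with (scal (2 * PI - 0)%R (Re c)).
    - apply (is_RInt_const (V := R_NormedModule)).
    - change ((2 * PI - 0) * Re c = 2 * PI * Re c)%R. ring. }
  assert (I2 := RInt_correct (V := R_CompleteNormedModule) _ _ _ (@circle_int_ex s Hs ltac:(nra))).
  assert (I3 := is_RInt_minus _ _ _ _ _ _ I2 I1).
  change (minus (RInt (fun t : R => Re (f (p + s * (h * eit t)))) 0 (2 * PI)) (2 * PI * Re c)%R) with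
    (circle_int f p h s - 2 * PI * Re c)%R in I3.
  rewrite Rplus_0_l.
  replace (2 * PI * eps)%R with ((2 * PI - 0) * eps)%R by ring.
  refine (@norm_RInt_le_const R_NormedModule _ 0 (2 * PI) _ eps _ _ I3); [lra|].
  intros t _. change (Rabs (Re (f (p + s * (h * eit t))) - Re c) <= eps)%R.
  replace (Re (f (p + s * (h * eit t))) - Re c)%R with (Re (f (p + s * (h * eit t)) - c))
    by (destruct (f (p + s * (h * eit t))), c; reflexivity).
  eapply Rle_trans; [apply re_le_Cmod|]. apply Rlt_le. apply K.
  split; [apply (@ring_pt s t Hs); nra|].
  replace (p + s * (h * eit t) - p) with (RtoC s * (h * eit t)) by ring.
  rewrite !Cmod_mult, Cmod_eit, Cmod_R, Rabs_pos_eq, Rmult_1_r by lra. exact Hs2. }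
apply NNPP. intro N. apply Rabs_pos_lt in N.
specialize (A (Rabs (circle_int f p h 1 - 2 * PI * Re c) / (4 * PI))%R
  ltac:(apply Rdiv_lt_0_compat; lra)).
replace (0 + 2 * PI * (Rabs (circle_int f p h 1 - 2 * PI * Re c) / (4 * PI)))%R with
  (Rabs (circle_int f p h 1 - 2 * PI * Re c) / 2)%R in A by (field; lra). lra.
Qed.

Lemma mean_max c :
  (forall eps, (0 < eps)%R -> exists d, (0 < d)%R /\
     forall z, (0 < Cmod (z - p) < d)%R -> (Cmod (f z - c) < eps)%R) ->
  (forall z, (0 < Cmod (z - p) < r)%R -> (Re (f z) <= Re c)%R) ->
  (Cmod h < r)%R -> Re (f (p + h)) = Re c.
Proof.
intros Hc Hmax Hr. assert (Hm : (0 < Cmod h)%R) by (apply Cmod_gt_0; auto).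
assert (Hpi := PI_RGT_0).
(* [g] is continuous and nonnegative with integral zero, hence zero; the angle 0 corresponds to the
   point [p + h]. *)
set (g := fun t => (Re c - Re (f (p + RtoC 1 * (h * eit t))))%R).
assert (G0 : forall t, (0 <= g t)%R).
{ intro t. unfold g. assert (Re (f (p + RtoC 1 * (h * eit t))) <= Re c)%R; [apply Hmax; apply ring_pt; lra|lra]. }
assert (Gc : forall t, continuous g t).
{ intro t. apply (continuous_minus (V := R_NormedModule) (fun _ => Re c)); [apply continuous_const|].
  apply (@DR_continuous (fun t => f (p + RtoC 1 * (h * eit t))) t (f' (p + RtoC 1 * (h * eit t)) * (RtoC 1 * (h * (Ci * eit t))))).
  apply (@DR_comp f (fun t => p + RtoC 1 * (h * eit t))); [apply DR_circle|].
  apply Hf. apply ring_pt; lra. }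
assert (Gi : forall x y, ex_RInt g x y).
{ intros x y. apply (ex_RInt_continuous (V := R_CompleteNormedModule)). intros; apply Gc. }
assert (GI : RInt g 0 (2 * PI) = 0%R).
{ assert (I2 := RInt_correct (V := R_CompleteNormedModule) _ _ _ (@circle_int_ex 1 Rlt_0_1 ltac:(lra))).
  change (RInt (fun t : R => Re (f (p + 1%R * (h * eit t)))) 0 (2 * PI)) with (circle_int f p h 1) in I2.
  rewrite (@circle_int_mean c Hc Hr) in I2.
  assert (I1 := is_RInt_const (V := R_NormedModule) 0 (2 * PI) (Re c)).
  assert (I3 := is_RInt_minus _ _ _ _ _ _ I1 I2). apply (is_RInt_unique (V := R_CompleteNormedModule)) in I3.
  etransitivity; [exact I3|].
  change ((2 * PI - 0) * Re c - 2 * PI * Re c = 0)%R. ring. }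
assert (Eh : Re (f (p + h)) = (Re c - g 0)%R).
{ unfold g. replace (p + RtoC 1 * (h * eit 0)) with (p + h). ring.
  unfold eit. rewrite cos_0, sin_0. change (p + h = p + 1 * (h * RtoC 1)). ring. }
rewrite Eh. destruct (Req_dec (g 0%R) 0) as [->|N]; [ring|]. exfalso.
assert (Gp : (0 < g 0%R)%R) by (specialize (G0 0%R); lra).
assert (L : locally 0%R (fun t => (0 < g t)%R)).
{ apply (Gc 0%R (fun y => (0 < y)%R)). exists (mkposreal _ Gp). intros y Hy.
  change (Rabs (y - g 0%R) < g 0%R)%R in Hy. apply Rabs_def2 in Hy. lra. }
destruct L as (d & Hd). assert (Hd0 := cond_pos d).
set (b := Rmin (d / 2) PI).
assert (Hb : (0 < b <= PI /\ b < d)%R).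
{ unfold b. repeat split. apply Rmin_pos; lra. apply Rmin_r. eapply Rle_lt_trans; [apply Rmin_l|lra]. }
assert (P1 : (0 < RInt g 0 b)%R).
{ apply RInt_gt_0; [lra| |auto]. intros x Hx. apply Hd. change (Rabs (x - 0) < d)%R.
  rewrite Rminus_0_r, Rabs_pos_eq; lra. }
assert (P2 : (0 <= RInt g b (2 * PI))%R) by (apply RInt_ge_0; [lra|auto|auto]).
assert (Q := RInt_Chasles g 0 b (2 * PI) (Gi _ _) (Gi _ _)).
rewrite GI in Q. change (RInt g 0 b + RInt g b (2 * PI) = 0)%R in Q. lra.
Qed.

End Mean.

(** The maximum is taken in [x] first and then in [y]; the partial maximum is continuous in [y]
    because [G] is uniformly continuous. *)
Lemma max_square (G : R -> R -> R) :
  (forall x y, continuity_2d_pt G x y) ->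
  exists x0 y0, forall x y, (0 <= x <= 1 -> 0 <= y <= 1 -> G x y <= G x0 y0)%R.
Proof.
intro HG.
assert (Hx : forall y x, continuity_pt (fun x => G x y) x).
{ intros y x. apply continuity_pt_filterlim. apply filterlim_locally. intros eps.
  destruct (HG x y eps) as (d & Hd). exists d. intros u Hu. apply (Hd u y Hu).
  rewrite Rminus_diag_eq by auto. rewrite Rabs_R0. apply cond_pos. }
assert (M : forall y, exists m, (0 <= m <= 1)%R /\ forall x, (0 <= x <= 1 -> G x y <= G m y)%R).
{ intro y. destruct (@continuity_ab_maj (fun x => G x y) 0 1 Rle_0_1 (fun x _ => Hx y x)) as (m & H1 & H2).
  exists m. auto. }
destruct (choice _ M) as (m & Hm).
assert (Hc : forall y, (0 <= y <= 1)%R -> continuity_pt (fun y => G (m y) y) y).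
{ intros y Hy. apply continuity_pt_filterlim. apply filterlim_locally. intros eps.
  (* The range [[-1, 2]] makes room on both sides of [y], since [continuity_pt] at an end of
     [[0, 1]] also looks outside. *)
  destruct (@uniform_continuity_2d G 0 1 (-1) 2 (fun x y _ _ => HG x y) eps) as (d & Hd).
  assert (Hd1 : (0 < Rmin d 1)%R) by (apply Rmin_pos; [apply cond_pos|lra]).
  exists (mkposreal _ Hd1). intros u Hu. change (Rabs (u - y) < Rmin d 1)%R in Hu.
  assert (U1 := Rlt_le_trans _ _ _ Hu (Rmin_l _ _)). assert (U2 := Rlt_le_trans _ _ _ Hu (Rmin_r _ _)).
  apply Rabs_def2 in U2.
  destruct (Hm u) as [Mu1 Mu2], (Hm y) as [My1 My2].
  assert (A := Hd (m u) y (m u) u Mu1 ltac:(lra) Mu1 ltac:(lra)).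
  assert (B := Hd (m y) y (m y) u My1 ltac:(lra) My1 ltac:(lra)).
  rewrite Rminus_diag_eq, Rabs_R0 in A by auto. rewrite Rminus_diag_eq, Rabs_R0 in B by auto.
  specialize (A (cond_pos d) U1). specialize (B (cond_pos d) U1).
  apply Rabs_def2 in A. apply Rabs_def2 in B.
  specialize (Mu2 (m y) My1). specialize (My2 (m u) Mu1).
  change (Rabs (G (m u) u - G (m y) y) < eps)%R. apply Rabs_def1; lra. }
destruct (@continuity_ab_maj (fun y => G (m y) y) 0 1 Rle_0_1 Hc) as (y0 & H1 & H2).
exists (m y0), y0. intros x y Hx' Hy. eapply Rle_trans; [apply (Hm y); auto|]. apply H1. auto.
Qed.

(** * Period lattices and elliptic functions without poles *)

Lemma om1_neq0 (L : lattice) : om1 L <> 0.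
Proof.
intro E. apply (om_indep L). rewrite E. unfold Cdiv.
replace (/ 0) with (RtoC 0). rewrite Cmult_0_r. reflexivity.
unfold Cinv; simpl. unfold RtoC. f_equal; unfold Rdiv; [rewrite Rmult_0_l|rewrite Ropp_0, Rmult_0_l]; reflexivity.
Qed.

Lemma lattice_coords (L : lattice) z : exists s t : R, z = RtoC s * om1 L + RtoC t * om2 L.
Proof.
assert (H := om1_neq0 L). assert (I := om_indep L).
set (tau := om2 L / om1 L) in *.
exists (Re (z / om1 L) - Im (z / om1 L) / Im tau * Re tau)%R, (Im (z / om1 L) / Im tau)%R.
replace (om2 L) with (tau * om1 L) by (unfold tau; field; auto).
transitivity ((z / om1 L) * om1 L); [field; auto|].
rewrite Cmult_assoc, <- Cmult_plus_distr_r. f_equal.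
generalize dependent (z / om1 L). generalize dependent tau. clear.
intros [x y] I [u v]. simpl in *. unfold Cplus, Cmult, RtoC; simpl. f_equal; field; auto.
Qed.

Lemma fundamental_domain (L : lattice) z :
  exists l (s t : R), in_lattice L l /\ (0 <= s <= 1)%R /\ (0 <= t <= 1)%R /\
    z = RtoC s * om1 L + RtoC t * om2 L + l.
Proof.
destruct (lattice_coords L z) as (s & t & E).
assert (B : forall x : R, (0 <= x - IZR (Int_part x) <= 1)%R).
{ intro x. destruct (base_Int_part x). lra. }
exists (lattice_pt L (Int_part s) (Int_part t)), (s - IZR (Int_part s))%R, (t - IZR (Int_part t))%R.
split; [eexists; eexists; reflexivity|]. split; [apply B|]. split; [apply B|].
rewrite E. unfold lattice_pt. rewrite !RtoC_minus. ring.
Qed.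

Lemma in_lattice_add L a b : in_lattice L a -> in_lattice L b -> in_lattice L (a + b).
Proof.
intros (m & n & ->) (m' & n' & ->). exists (m + m')%Z, (n + n')%Z.
unfold lattice_pt. rewrite !plus_IZR, !RtoC_plus. ring.
Qed.

Lemma in_lattice_opp L a : in_lattice L a -> in_lattice L (- a).
Proof.
intros (m & n & ->). exists (- m)%Z, (- n)%Z.
unfold lattice_pt. rewrite !opp_IZR, !RtoC_opp. ring.
Qed.

Lemma in_lattice_0 L : in_lattice L 0.
Proof. exists 0%Z, 0%Z. unfold lattice_pt. ring. Qed.

Lemma in_lattice_sub L a b : in_lattice L a -> in_lattice L b -> in_lattice L (a - b).
Proof. intros. apply in_lattice_add; auto. apply in_lattice_opp; auto. Qed.

Lemma periodic_Z (F : C -> C) w : (forall z, F (z + w) = F z) -> forall (n : Z) z, F (z + RtoC (IZR n) * w) = F z.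
Proof.
intros H. assert (P : forall (n : nat) z, F (z + RtoC (INR n) * w) = F z).
{ induction n as [|n IH]; intro z.
  - f_equal. simpl. ring.
  - rewrite S_INR, RtoC_plus. replace (z + (INR n + 1) * w) with (z + INR n * w + w) by ring.
    rewrite H. apply IH. }
intros n z. destruct (Z_le_gt_dec 0 n) as [Hn|Hn].
- rewrite <- (Z2Nat.id n) by auto. rewrite <- INR_IZR_INZ. apply P.
- rewrite <- (P (Z.to_nat (- n)) (z + IZR n * w)). f_equal.
  rewrite INR_IZR_INZ, Z2Nat.id by lia. rewrite opp_IZR, RtoC_opp. ring.
Qed.

Lemma periodic_lattice (L : lattice) (F : C -> C) :
  (forall z, F (z + om1 L) = F z) -> (forall z, F (z + om2 L) = F z) ->
  forall l z, in_lattice L l -> F (z + l) = F z.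
Proof.
intros H1 H2 l z (m & n & ->). unfold lattice_pt. rewrite Cplus_assoc.
rewrite (periodic_Z F _ H2). apply (periodic_Z F _ H1).
Qed.

(* Maximum principle for the real part, through the mean value property, which
   only needs continuity at the centre of the circles. *)
Lemma elliptic_re_constant (L : lattice) (F F' : C -> C) :
  (forall l z, in_lattice L l -> F (z + l) = F z) ->
  (forall p, contC F p /\ exists r, (0 < r)%R /\
     forall z, (0 < Cmod (z - p) < r)%R -> D F z (F' z) /\ contC F' z) ->
  forall z w, Re (F z) = Re (F w).
Proof.
intros Hper HF.
assert (K : exists z0, forall z, (Re (F z) <= Re (F z0))%R).
{ destruct (@max_square (fun s t => Re (F (RtoC s * om1 L + RtoC t * om2 L)))) as (s0 & t0 & H).
  - intros s t eps. destruct (HF (RtoC s * om1 L + RtoC t * om2 L)) as [Hc _].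
    destruct (Hc eps (cond_pos eps)) as (r & Hr & K).
    set (M := (Cmod (om1 L) + Cmod (om2 L) + 1)%R).
    assert (A1 := Cmod_ge_0 (om1 L)). assert (A2 := Cmod_ge_0 (om2 L)).
    assert (Hd : (0 < r / M)%R) by (apply Rdiv_lt_0_compat; unfold M; lra).
    exists (mkposreal _ Hd). intros u v Hu Hv. simpl in Hu, Hv.
    set (w := RtoC u * om1 L + RtoC v * om2 L).
    replace (Re (F w) - Re (F (RtoC s * om1 L + RtoC t * om2 L)%C))%R with
      (Re (F w - F (RtoC s * om1 L + RtoC t * om2 L)))
      by (generalize (F w) (F (RtoC s * om1 L + RtoC t * om2 L)); intros [? ?] [? ?]; reflexivity).
    eapply Rle_lt_trans; [apply re_le_Cmod|]. apply K.
    replace (w - (RtoC s * om1 L + RtoC t * om2 L)) with (RtoC (u - s) * om1 L + RtoC (v - t) * om2 L)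
      by (unfold w; rewrite !RtoC_minus; ring).
    eapply Rle_lt_trans; [apply Cmod_triangle|]. rewrite !Cmod_mult, !Cmod_R.
    apply Rle_lt_trans with (Rmax (Rabs (u - s)) (Rabs (v - t)) * (Cmod (om1 L) + Cmod (om2 L)))%R.
    + rewrite Rmult_plus_distr_l. apply Rplus_le_compat; apply Rmult_le_compat_r; auto; [apply Rmax_l|apply Rmax_r].
    + assert (X := Rmax_lub_lt _ _ _ Hu Hv). apply Rlt_div_r in X; [|unfold M; lra].
      eapply Rle_lt_trans; [|exact X]. apply Rmult_le_compat_l; [|unfold M; lra].
      eapply Rle_trans; [apply Rabs_pos|apply Rmax_l].
  - exists (RtoC s0 * om1 L + RtoC t0 * om2 L). intro z.
    destruct (fundamental_domain L z) as (l & s & t & Hl & Hs & Ht & ->).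
    rewrite Hper by auto. apply H; auto. }
destruct K as (z0 & Hz0).
assert (All : forall z, Re (F z) = Re (F z0)).
{ intro z. replace z with (z0 + RtoC 1 * (z - z0)) by ring.
  (* The maximal value spreads along the segment from [z0] to [z]: forward by [mean_max], and to
     limit points by continuity. *)
  apply (@real_induction (fun t => Re (F (z0 + RtoC t * (z - z0))) = Re (F z0))); [| | |lra].
  - f_equal. f_equal. ring.
  - intros t Ht Et. set (p := z0 + RtoC t * (z - z0)) in *.
    destruct (HF p) as [Hc (r & Hr & Kr)].
    set (d := (r / (Cmod (z - z0) + 1))%R). assert (Hm := Cmod_ge_0 (z - z0)).
    assert (Hd : (0 < d)%R) by (apply Rdiv_lt_0_compat; lra).
    exists d. split; auto. intros s Hs Hs1.
    destruct (Ceq_dec z z0) as [->|Hne]. { f_equal. f_equal. ring. }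
    set (h := RtoC (s - t) * (z - z0)).
    replace (z0 + RtoC s * (z - z0)) with (p + h) by (unfold p, h; rewrite RtoC_minus; ring).
    rewrite <- Et. apply (@mean_max F F' p r Kr h).
    + apply Cmult_neq_0. intro E; apply RtoC_inj in E; lra. intro E; apply Hne. apply Ceq_minus; auto.
    + intros eps He. destruct (Hc eps He) as (d' & Hd' & K'). exists d'. split; auto.
      intros w Hw. apply K'. lra.
    + intros w _. rewrite Et. apply Hz0.
    + unfold h. rewrite Cmod_mult, Cmod_R, Rabs_pos_eq by lra.
      apply Rle_lt_trans with ((s - t) * (Cmod (z - z0) + 1))%R; [apply Rmult_le_compat_l; lra|].
      apply Rlt_div_r; [lra|]. fold d. lra.
  - intros t Ht K. set (p := z0 + RtoC t * (z - z0)) in *.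
    destruct (HF p) as [Hc _]. apply Rminus_diag_uniq. apply NNPP. intro N. apply Rabs_pos_lt in N.
    destruct (Hc _ N) as (d & Hd & Kd).
    set (s := Rmax 0 (t - d / (2 * (Cmod (z - z0) + 1)))). assert (Hm := Cmod_ge_0 (z - z0)).
    assert (Hdd : (0 < d / (2 * (Cmod (z - z0) + 1)))%R) by (apply Rdiv_lt_0_compat; lra).
    assert (S : (0 <= s < t /\ t - s <= d / (2 * (Cmod (z - z0) + 1)))%R).
    { unfold s. split; [split|]. apply Rmax_l. apply Rmax_lub_lt; lra.
      assert (X := Rmax_r 0 (t - d / (2 * (Cmod (z - z0) + 1)))). lra. }
    assert (B : (Cmod (z0 + RtoC s * (z - z0) - p) < d)%R).
    { replace (z0 + RtoC s * (z - z0) - p) with (RtoC (s - t) * (z - z0)) by (unfold p; rewrite RtoC_minus; ring).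
      rewrite Cmod_mult, Cmod_R, Rabs_left by lra.
      apply Rle_lt_trans with (d / (2 * (Cmod (z - z0) + 1)) * (Cmod (z - z0) + 1))%R.
      - apply Rmult_le_compat; lra.
      - replace (d / (2 * (Cmod (z - z0) + 1)) * (Cmod (z - z0) + 1))%R with (d / 2)%R by (field; lra). lra. }
    specialize (Kd _ B). specialize (K s ltac:(lra)). cbv beta in K.
    assert (T := re_le_Cmod (F (z0 + RtoC s * (z - z0)) - F p)).
    replace (Re (F (z0 + RtoC s * (z - z0)) - F p)) with (- (Re (F p) - Re (F z0)))%R in T.
    2:{ rewrite <- K. generalize (F (z0 + RtoC s * (z - z0))) (F p). intros [? ?] [? ?]. simpl. ring. }
    rewrite Rabs_Ropp in T. lra. }
intros z w. rewrite (All z), (All w). reflexivity.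
Qed.

Lemma elliptic_constant (L : lattice) (F F' : C -> C) :
  (forall l z, in_lattice L l -> F (z + l) = F z) ->
  (forall p, contC F p /\ exists r, (0 < r)%R /\
     forall z, (0 < Cmod (z - p) < r)%R -> D F z (F' z) /\ contC F' z) ->
  forall z w, F z = F w.
Proof.
intros Hper HF z w.
assert (A := @elliptic_re_constant L F F' Hper HF z w).
assert (cs : forall f p, contC f p -> contC (fun z => Ci * f z) p).
{ intros f p H eps He. destruct (H eps He) as (r & Hr & K). exists r. split; auto. intros x Hx.
  replace (Ci * f x - Ci * f p) with (Ci * (f x - f p)) by ring. rewrite Cmod_mult, Cmod_Ci, Rmult_1_l. auto. }
assert (B : Re (Ci * F z) = Re (Ci * F w)).
{ apply (@elliptic_re_constant L (fun z => Ci * F z) (fun z => Ci * F' z)).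
  - intros l x Hl. rewrite Hper; auto.
  - intro p. destruct (HF p) as [H1 (r & Hr & H2)]. split; [apply cs; auto|].
    exists r. split; auto. intros x Hx. destruct (H2 x Hx). split; [apply D_scal; auto|apply cs; auto]. }
destruct (F z), (F w). simpl in *. f_equal; lra.
Qed.

(** Giving [F] the value [c] on [S] makes it continuous, and [elliptic_constant] applies. Asking for
    one common limit at all points of [S] also fixes the constant, which is what an identity between
    elliptic functions needs. *)
Lemma elliptic_liouville (L : lattice) (S : C -> Prop) (F F' : C -> C) (c : C) :
  (forall l z, in_lattice L l -> S z -> S (z + l)) ->
  (forall l z, in_lattice L l -> ~ S z -> F (z + l) = F z) ->
  (forall p, S p -> forall eps, (0 < eps)%R -> exists d, (0 < d)%R /\
     forall z, (0 < Cmod (z - p) < d)%R -> (Cmod (F z - c) < eps)%R) ->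
  (forall p, exists r, (0 < r)%R /\ forall z, (0 < Cmod (z - p) < r)%R -> ~ S z) ->
  (forall p, ~ S p -> D F p (F' p) /\ contC F' p) ->
  (exists p, S p) ->
  forall z, ~ S z -> F z = c.
Proof.
intros HS Hper Hlim Hiso HF (p0 & Hp0) z Hz.
set (E := fun z => if excluded_middle_informative (S z) then c else F z).
assert (ES : forall p, S p -> E p = c).
{ intros p Hp. unfold E. destruct (excluded_middle_informative (S p)); tauto. }
assert (EF : forall p, ~ S p -> E p = F p).
{ intros p Hp. unfold E. destruct (excluded_middle_informative (S p)); tauto. }
assert (Loc : forall p, ~ S p -> exists r, (0 < r)%R /\ forall z, (Cmod (z - p) < r)%R -> ~ S z).
{ intros p Hp. destruct (Hiso p) as (r & Hr & K). exists r. split; auto. intros w Hw.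
  destruct (Ceq_dec w p) as [->|Hne]; auto. apply K. split; auto.
  apply Cmod_gt_0. intro X. apply Hne. apply Ceq_minus; auto. }
assert (HE : forall p, ~ S p -> D E p (F' p)).
{ intros p Hp. apply D_ext_loc with F; [|apply HF; auto].
  destruct (Loc p Hp) as (r & Hr & K). apply locally_Cmod. exists r. split; auto.
  intros w Hw. symmetry. apply EF. auto. }
assert (Nsub : forall l w, in_lattice L l -> S (w + l) -> S w).
{ intros l w Hl H. replace w with (w + l + - l) by ring. apply HS; auto. apply in_lattice_opp; auto. }
rewrite <- (EF z Hz), <- (ES p0 Hp0).
apply (@elliptic_constant L E F').
- intros l w Hl. destruct (classic (S w)) as [Hw|Hw].
  + rewrite !ES; auto.
  + rewrite !EF; auto. intro X. apply Hw. eapply Nsub; eauto.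
- intro p. split.
  + destruct (classic (S p)) as [Hp|Hp]; [|eapply D_cont; apply HE; auto].
    intros eps He. destruct (Hlim p Hp eps He) as (d & Hd & K). exists d. split; auto.
    intros w Hw. rewrite (ES p Hp). destruct (classic (S w)) as [Hw'|Hw'].
    * rewrite ES by auto. replace (c - c) with (RtoC 0) by ring. rewrite Cmod_0. auto.
    * rewrite EF by auto. apply K. split; auto. apply Cmod_gt_0. intro X. apply Hw'.
      replace w with p; auto. symmetry. apply Ceq_minus; auto.
  + destruct (Hiso p) as (r & Hr & K). exists r. split; auto. intros w Hw. split.
    * apply HE; auto.
    * apply HF; auto.
Qed.

(** * Lattice series *)

(** Summation from the centre outwards: each step adds the two new ends, which suits the comparison
    of consecutive boxes, the reflection and the shift by one. *)
Fixpoint zs (f : Z -> C) (N : nat) : C :=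
  match N with
  | O => f 0%Z
  | S n => zs f n + f (- Z.of_nat (S n))%Z + f (Z.of_nat (S n))
  end.

Definition zbox (a : Z -> Z -> C) (N : nat) : C := zs (fun m => zs (a m) N) N.

Definition znorm (m n : Z) : Z := Z.max (Z.abs m) (Z.abs n).

Lemma zs_S (f : Z -> C) N : zs f (S N) = zs f N + f (- Z.of_nat (S N))%Z + f (Z.of_nat (S N)).
Proof. reflexivity. Qed.

Lemma zs_ext (f : Z -> C) (g : Z -> C) N : (forall k, (Z.abs k <= Z.of_nat N)%Z -> f k = g k) -> zs f N = zs g N.
Proof.
induction N as [|N IH]; intro H; simpl zs.
- apply H. lia.
- rewrite IH, !H; auto; try lia. intros k Hk. apply H. lia.
Qed.

Lemma zs_plus (f : Z -> C) (g : Z -> C) N : zs (fun k => f k + g k) N = zs f N + zs g N.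
Proof. induction N as [|N IH]; simpl zs; [ring|rewrite IH; ring]. Qed.

Lemma zs_scal c (f : Z -> C) N : zs (fun k => c * f k) N = c * zs f N.
Proof. induction N as [|N IH]; simpl zs; [ring|rewrite IH; ring]. Qed.

Lemma zs_opp (f : Z -> C) N : zs (fun k => f (- k)%Z) N = zs f N.
Proof.
induction N as [|N IH]; [reflexivity|].
rewrite !zs_S, IH, Z.opp_involutive. ring.
Qed.

Lemma zs_shift (f : Z -> C) N : zs (fun k => f (k - 1)%Z) N = zs f N + f (- Z.of_nat (S N))%Z - f (Z.of_nat N).
Proof.
induction N as [|N IH].
- simpl. ring.
- rewrite !zs_S, IH.
  replace (- Z.of_nat (S N) - 1)%Z with (- Z.of_nat (S (S N)))%Z by lia.
  replace (Z.of_nat (S N) - 1)%Z with (Z.of_nat N) by lia. ring.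
Qed.

Lemma zs_bound (f : Z -> C) N B : (forall k, (Z.abs k <= Z.of_nat N)%Z -> (Cmod (f k) <= B)%R) ->
  (Cmod (zs f N) <= (2 * INR N + 1) * B)%R.
Proof.
induction N as [|N IH]; intro H.
- simpl. specialize (H 0%Z ltac:(lia)). lra.
- rewrite zs_S, S_INR.
  assert (A := H (Z.of_nat (S N)) ltac:(lia)). assert (A' := H (- Z.of_nat (S N))%Z ltac:(lia)).
  specialize (IH ltac:(intros; apply H; lia)).
  eapply Rle_trans; [apply Cmod_triangle|].
  eapply Rle_trans; [apply Rplus_le_compat_r, Cmod_triangle|]. lra.
Qed.

Lemma zbox_ext (a : Z -> Z -> C) (b : Z -> Z -> C) N : (forall m n, a m n = b m n) -> zbox a N = zbox b N.
Proof. intro H. apply zs_ext. intros. apply zs_ext. auto. Qed.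

Lemma zbox_plus (a : Z -> Z -> C) (b : Z -> Z -> C) N : zbox (fun m n => a m n + b m n) N = zbox a N + zbox b N.
Proof. unfold zbox. rewrite <- zs_plus. apply zs_ext. intros. apply zs_plus. Qed.

Lemma zbox_scal c (a : Z -> Z -> C) N : zbox (fun m n => c * a m n) N = c * zbox a N.
Proof. unfold zbox. rewrite <- zs_scal. apply zs_ext. intros. apply zs_scal. Qed.

Lemma zbox_opp (a : Z -> Z -> C) N : zbox (fun m n => a (- m) (- n))%Z N = zbox a N.
Proof.
unfold zbox. rewrite <- (zs_opp (fun m => zs (a m) N)). apply zs_ext. intros. apply zs_opp.
Qed.

(** The shell has [8 (N + 1)] points: two sides with [2 N + 3] points and two with [2 N + 1]. *)
Lemma zbox_shell (a : Z -> Z -> C) N B : (forall m n, (znorm m n = Z.of_nat (S N))%Z -> (Cmod (a m n) <= B)%R) ->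
  (Cmod (zbox a (S N) - zbox a N) <= 8 * (INR N + 1) * B)%R.
Proof.
intro H. unfold zbox, znorm in *.
replace (zs (fun m => zs (a m) (S N)) (S N) - zs (fun m => zs (a m) N) N) with
  (zs (fun m => a m (- Z.of_nat (S N))%Z + a m (Z.of_nat (S N))) N
   + zs (a (- Z.of_nat (S N))%Z) (S N) + zs (a (Z.of_nat (S N))) (S N)).
- eapply Rle_trans; [apply Cmod_triangle|].
  eapply Rle_trans; [apply Rplus_le_compat_r, Cmod_triangle|].
  assert (A1 := @zs_bound (fun m => a m (- Z.of_nat (S N))%Z + a m (Z.of_nat (S N))) N (2 * B)).
  specialize (A1 ltac:(intros k Hk; eapply Rle_trans; [apply Cmod_triangle|];
     assert (X := H k (- Z.of_nat (S N))%Z ltac:(lia)); assert (Y := H k (Z.of_nat (S N)) ltac:(lia)); lra)).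
  assert (A2 := @zs_bound (a (- Z.of_nat (S N))%Z) (S N) B ltac:(intros; apply H; lia)).
  assert (A3 := @zs_bound (a (Z.of_nat (S N))) (S N) B ltac:(intros; apply H; lia)).
  rewrite S_INR in A2, A3. lra.
- assert (E : zs (fun m => zs (a m) (S N)) N = zs (fun m => zs (a m) N) N +
     zs (fun m => a m (- Z.of_nat (S N))%Z + a m (Z.of_nat (S N))) N).
  { rewrite <- zs_plus. apply zs_ext. intros k Hk. simpl. ring. }
  transitivity (zs (fun m => zs (a m) (S N)) N + zs (a (- Z.of_nat (S N))%Z) (S N) + zs (a (Z.of_nat (S N))) (S N)
   - zs (fun m => zs (a m) N) N); [rewrite E; ring|reflexivity].
Qed.

(** With cubic decay a shell at distance [x] contributes at most [8 M / x ^ 2], and for [x >= 1]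
    this is dominated by the telescoping [16 M (1 / x - 1 / (x + 1))]. *)
Lemma zbox_tail (a : Z -> Z -> C) M : (0 <= M)%R ->
  (forall m n, (1 <= znorm m n)%Z -> (Cmod (a m n) <= M / IZR (znorm m n) ^ 3)%R) ->
  forall n m, (n <= m)%nat ->
    (Cmod (zbox a m - zbox a n) <= 16 * M * (/ (INR n + 1) - / (INR m + 1)))%R.
Proof.
intros HM H n m Hnm. induction Hnm as [|m Hnm IH].
- replace (zbox a n - zbox a n) with (RtoC 0) by ring. rewrite Cmod_0. right; ring.
- replace (zbox a (S m) - zbox a n) with ((zbox a (S m) - zbox a m) + (zbox a m - zbox a n)) by ring.
  eapply Rle_trans; [apply Cmod_triangle|].
  assert (A := @zbox_shell a m (M / (INR m + 1) ^ 3)%R).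
  specialize (A ltac:(intros k l E; specialize (H k l ltac:(lia)); rewrite E in H;
    rewrite <- INR_IZR_INZ, S_INR in H; exact H)).
  rewrite S_INR. assert (P := pos_INR m). set (x := (INR m + 1)%R) in *.
  assert (Hx : (1 <= x)%R) by (unfold x; lra).
  assert (B : (8 * x * (M / x ^ 3) <= 16 * M * (/ x - / (x + 1)))%R).
  { apply Rminus_le_0.
    replace (16 * M * (/ x - / (x + 1)) - 8 * x * (M / x ^ 3))%R with
      (8 * M * (x - 1) / (x ^ 2 * (x + 1)))%R by (field; lra).
    apply Rmult_le_pos; [nra|]. apply Rlt_le, Rinv_0_lt_compat. nra. }
  lra.
Qed.

Lemma zbox_0 (a : Z -> Z -> C) : zbox a 0 = a 0%Z 0%Z.
Proof. reflexivity. Qed.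

Lemma zbox_conv (a : Z -> Z -> C) M : (0 <= M)%R ->
  (forall m n, (1 <= znorm m n)%Z -> (Cmod (a m n) <= M / IZR (znorm m n) ^ 3)%R) ->
  exists l, CL (zbox a) l.
Proof.
intros HM H. destruct (@CL_cauchy (zbox a) (fun n => (16 * M * / (INR n + 1))%R)) as (l & Hl & _).
- intros n m Hnm. eapply Rle_trans; [apply (@zbox_tail a M HM H n m Hnm)|].
  apply Rmult_le_compat_l; [lra|]. assert (0 < / (INR m + 1))%R; [|lra].
  apply Rinv_0_lt_compat. assert (P := pos_INR m). lra.
- replace (Finite 0) with (Rbar_mult (16 * M)%R 0) by (simpl; f_equal; ring).
  apply is_lim_seq_scal_l.
  apply is_lim_seq_ext with (fun n => / INR (S n))%R; [intro; rewrite S_INR; auto|].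
  replace (Finite 0) with (Rbar_inv p_infty) by reflexivity.
  apply is_lim_seq_inv; [|discriminate]. apply -> is_lim_seq_incr_1. apply is_lim_seq_INR.
- exists l. auto.
Qed.

Lemma zbox_lim_bound (a : Z -> Z -> C) M l : (0 <= M)%R -> a 0%Z 0%Z = 0 ->
  (forall m n, (1 <= znorm m n)%Z -> (Cmod (a m n) <= M / IZR (znorm m n) ^ 3)%R) ->
  CL (zbox a) l -> (Cmod l <= 16 * M)%R.
Proof.
intros HM H0 H Hl. apply CL_Cmod_le with (u := zbox a) (N := O); auto. intros n _.
assert (A := @zbox_tail a M HM H O n ltac:(lia)). rewrite zbox_0, H0 in A.
replace (zbox a n - 0) with (zbox a n) in A by ring.
eapply Rle_trans; [exact A|]. simpl.
assert (0 < / (INR n + 1))%R by (apply Rinv_0_lt_compat; assert (P := pos_INR n); lra).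
replace (/ (0 + 1))%R with 1%R by (field; lra). nra.
Qed.

Lemma CL_0_bound u M (N : nat) : (forall n, (N <= n)%nat -> (Cmod (u n) <= M / INR (S n))%R) -> CL u 0.
Proof.
intros H eps He.
destruct (archimed_cor1 (eps / (Rabs M + 1))) as (n0 & H1 & H2).
{ apply Rdiv_lt_0_compat; auto. assert (X := Rabs_pos M). lra. }
exists (max N n0). intros n Hn. replace (u n - 0) with (u n) by ring.
eapply Rle_lt_trans; [apply H; lia|].
assert (Hpos : (0 < INR (S n))%R) by (apply lt_0_INR; lia).
assert (H3 : (/ INR (S n) <= / INR n0)%R).
{ apply Rinv_le_contravar; [apply lt_0_INR; lia|]. apply le_INR. lia. }
assert (X := Rabs_pos M). assert (Y := Rle_abs M).
apply Rle_lt_trans with ((Rabs M + 1) * / INR (S n))%R.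
- apply Rmult_le_compat_r; [apply Rlt_le, Rinv_0_lt_compat; auto|lra].
- apply Rlt_div_r in H1; [|lra].
  eapply Rle_lt_trans; [|exact H1]. rewrite Rmult_comm. apply Rmult_le_compat_r; lra.
Qed.

(** The shift exchanges one side of the box for another, [2 N + 1] points each, so that quadratic
    decay leaves a difference of order [1 / N]. Such decay is what a series of exponent two offers,
    or a difference of two series of exponent one, although neither converges absolutely without
    correction. *)
Lemma zbox_shift_fst (b : Z -> Z -> C) M (N0 : nat) : (0 <= M)%R ->
  (forall m n, (Z.of_nat N0 <= znorm m n)%Z -> (Cmod (b m n) <= M / IZR (znorm m n) ^ 2)%R) ->
  CL (fun N => zbox (fun m n => b (m - 1)%Z n) N - zbox b N) 0.
Proof.
intros HM H. apply CL_0_bound with (M := (12 * M)%R) (N := max 1 N0). intros N HN.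
assert (Hp : (0 < INR N)%R) by (apply lt_0_INR; lia).
assert (Hp1 : (1 <= INR N)%R) by (apply (le_INR 1); lia).
unfold zbox. rewrite (zs_shift (fun m => zs (b m) N)).
replace (zs (fun m => zs (b m) N) N + zs (b (- Z.of_nat (S N))%Z) N - zs (b (Z.of_nat N)) N - zs (fun m => zs (b m) N) N)
  with (zs (b (- Z.of_nat (S N))%Z) N - zs (b (Z.of_nat N)) N) by ring.
assert (A : forall m n, (Z.of_nat N <= znorm m n)%Z -> (Cmod (b m n) <= M / INR N ^ 2)%R).
{ intros m n Hmn. eapply Rle_trans; [apply H; lia|].
  apply Rmult_le_compat_l; auto. apply Rinv_le_contravar; [apply pow_lt; auto|].
  apply pow_incr. split; [lra|]. rewrite INR_IZR_INZ. apply IZR_le. auto. }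
assert (B1 := @zs_bound (b (- Z.of_nat (S N))%Z) N (M / INR N ^ 2) ltac:(intros; apply A; unfold znorm; lia)).
assert (B2 := @zs_bound (b (Z.of_nat N)) N (M / INR N ^ 2) ltac:(intros; apply A; unfold znorm; lia)).
unfold Cminus at 1. eapply Rle_trans; [apply Cmod_triangle|]. rewrite Cmod_opp.
eapply Rle_trans; [apply (Rplus_le_compat _ _ _ _ B1 B2)|].
rewrite S_INR. apply Rminus_le_0.
replace (12 * M / (INR N + 1) - ((2 * INR N + 1) * (M / INR N ^ 2) + (2 * INR N + 1) * (M / INR N ^ 2)))%R
  with (M * (8 * INR N ^ 2 - 6 * INR N - 2) / (INR N ^ 2 * (INR N + 1)))%R by (field; lra).
apply Rmult_le_pos; [apply Rmult_le_pos; nra|]. apply Rlt_le, Rinv_0_lt_compat. nra.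
Qed.

Lemma zs_swap (a : Z -> Z -> C) N N' : zs (fun m => zs (a m) N) N' = zs (fun n => zs (fun m => a m n) N') N.
Proof.
induction N' as [|N' IH]; simpl zs at 1.
- apply zs_ext. reflexivity.
- rewrite IH. rewrite <- !zs_plus. apply zs_ext. intros. reflexivity.
Qed.

Lemma zbox_swap (a : Z -> Z -> C) N : zbox a N = zbox (fun m n => a n m) N.
Proof. apply zs_swap. Qed.

Lemma zbox_shift_snd (b : Z -> Z -> C) M (N0 : nat) : (0 <= M)%R ->
  (forall m n, (Z.of_nat N0 <= znorm m n)%Z -> (Cmod (b m n) <= M / IZR (znorm m n) ^ 2)%R) ->
  CL (fun N => zbox (fun m n => b m (n - 1)%Z) N - zbox b N) 0.
Proof.
intros HM H.
apply CL_ext with (fun N => zbox (fun m n => b n (m - 1)%Z) N - zbox (fun m n => b n m) N).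
{ intro N. rewrite (zbox_swap (fun m n => b n m)). rewrite (zbox_swap (fun m n => b n (m - 1)%Z)). reflexivity. }
apply (@zbox_shift_fst (fun m n => b n m) M N0 HM). intros m n Hmn.
unfold znorm in *. rewrite Z.max_comm in *. apply H. auto.
Qed.

Lemma sum_n_head (g : nat -> C) n : sum_n g (S n) = g O + sum_n (fun i => g (S i)) n.
Proof.
induction n as [|n IH].
- rewrite sum_Sn, !sum_O. reflexivity.
- rewrite sum_Sn, IH, (sum_Sn (fun i => g (S i))). symmetry. apply Cplus_assoc.
Qed.

Lemma sum_n_zs (f : Z -> C) N : sum_n (fun i => f (Z.of_nat i - Z.of_nat N)%Z) (2 * N) = zs f N.
Proof.
induction N as [|N IH].
- rewrite sum_O. reflexivity.
- replace (2 * S N)%nat with (S (S (2 * N))) by lia.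
  rewrite sum_n_head, sum_Sn.
  rewrite (sum_n_ext _ (fun i => f (Z.of_nat i - Z.of_nat N)%Z)).
  2:{ intro i. f_equal. lia. }
  rewrite IH.
  replace (Z.of_nat 0 - Z.of_nat (S N))%Z with (- Z.of_nat (S N))%Z by lia.
  replace (Z.of_nat (S (S (2 * N))) - Z.of_nat (S N))%Z with (Z.of_nat (S N)) by lia.
  change (f (- Z.of_nat (S N))%Z + (zs f N + f (Z.of_nat (S N))) =
    zs f N + f (- Z.of_nat (S N))%Z + f (Z.of_nat (S N))). ring.
Qed.

Definition punctured (L : lattice) (F : C -> C) (m n : Z) : C :=
  if ((m =? 0) && (n =? 0))%Z%bool then RtoC 0 else F (lattice_pt L m n).

Lemma box_sum_zbox L F N : box_sum L F N = zbox (punctured L F) N.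
Proof.
unfold box_sum, zbox. rewrite <- sum_n_zs. apply sum_n_ext. intro i.
exact (sum_n_zs (punctured L F (Z.of_nat i - Z.of_nat N)) N).
Qed.

Lemma lattice_sum_eq L F l : CL (zbox (punctured L F)) l -> lattice_sum L F = l.
Proof.
intro H. unfold lattice_sum. apply CL_Lim. eapply CL_ext; [|exact H].
intro n. symmetry. apply box_sum_zbox.
Qed.

(** * Bounds for the terms and termwise differentiation *)

Lemma D_quadratic f z d (r M : R) : (0 < r)%R ->
  (forall w, (Cmod (w - z) < r)%R -> (Cmod (f w - f z - d * (w - z)) <= M * Cmod (w - z) ^ 2)%R) ->
  D f z d.
Proof.
intros Hr H. apply D_eps. intros eps He.
assert (Hm := Rabs_pos M).
assert (He' : (0 < eps / (Rabs M + 1))%R) by (apply Rdiv_lt_0_compat; lra).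
exists (Rmin r (eps / (Rabs M + 1))). split; [apply Rmin_pos; auto|].
intros w Hw. assert (H1 := Rlt_le_trans _ _ _ Hw (Rmin_l _ _)). assert (H2 := Rlt_le_trans _ _ _ Hw (Rmin_r _ _)).
eapply Rle_trans; [apply H; auto|]. assert (X := Cmod_ge_0 (w - z)). assert (Y := Rle_abs M).
apply Rlt_div_r in H2; [|lra]. simpl. rewrite Rmult_1_r, <- Rmult_assoc.
apply Rmult_le_compat_r; auto. nra.
Qed.

Lemma Cinv_sub_bound a b (p : R) : (0 < p)%R -> (p <= Cmod a)%R -> (p <= Cmod b)%R ->
  (Cmod (/ b - / a) <= Cmod (b - a) / p ^ 2)%R.
Proof.
intros Hp Ha Hb.
assert (a <> 0) by (apply Cmod_gt_0; lra). assert (b <> 0) by (apply Cmod_gt_0; lra).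
replace (/ b - / a) with (- (b - a) * / (a * b)) by (field; auto).
rewrite Cmod_mult, Cmod_opp, Cmod_inv, Cmod_mult by (apply Cmult_neq_0; auto).
apply Rmult_le_compat_l; [apply Cmod_ge_0|]. apply Rinv_le_contravar; [apply pow_lt; auto|].
simpl. rewrite Rmult_1_r. apply Rmult_le_compat; lra.
Qed.

Lemma Cmod_inv_pow_bound a (p : R) k : (0 < p)%R -> (p <= Cmod a)%R -> (Cmod (/ a ^ k) <= / p ^ k)%R.
Proof.
intros Hp Ha. assert (a <> 0) by (apply Cmod_gt_0; lra).
rewrite Cmod_inv by (apply Cpow_nz; auto). rewrite Cmod_pow.
apply Rinv_le_contravar; [apply pow_lt; auto|]. apply pow_incr. lra.
Qed.

(** The second order Taylor remainder of the power [- k]. The bound depends on [a] and [b] only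
    through their distance [p] from 0, hence it can be summed over the lattice. *)
Lemma inv_pow_remainder a b (p : R) k : (0 < p)%R -> (p <= Cmod a)%R -> (p <= Cmod b)%R ->
  (Cmod (/ b ^ k - / a ^ k + RtoC (INR k) * (b - a) * / a ^ (S k))
    <= INR k ^ 2 * Cmod (b - a) ^ 2 / p ^ (k + 2))%R.
Proof.
intros Hp Ha Hb.
assert (Ha0 : a <> 0) by (apply Cmod_gt_0; lra). assert (Hb0 : b <> 0) by (apply Cmod_gt_0; lra).
assert (Hh := Cmod_ge_0 (b - a)).
assert (Pk : forall j, (0 < p ^ j)%R) by (intro; apply pow_lt; auto).
induction k as [|k IH].
- simpl. replace (/ RtoC 1 - / RtoC 1 + 0 * (b - a) * / (a * 1)) with (RtoC 0) by (field; auto).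
  rewrite Cmod_0. right. field. lra.
- assert (Hka : a ^ k <> 0) by (apply Cpow_nz; auto). assert (Hkb : b ^ k <> 0) by (apply Cpow_nz; auto).
  replace (/ b ^ S k - / a ^ S k + RtoC (INR (S k)) * (b - a) * / a ^ S (S k)) with
    (/ b ^ 1 * (/ b ^ k - / a ^ k + RtoC (INR k) * (b - a) * / a ^ S k)
     + (/ a ^ S k * (- (b - a) * (/ b - / a))
     + - (RtoC (INR k) * ((b - a) * (/ a ^ S k * (/ b - / a)))))).
  2:{ rewrite S_INR, RtoC_plus. simpl. field. auto. }
  assert (A1 := @Cinv_sub_bound a b p Hp Ha Hb).
  assert (A2 := @Cmod_inv_pow_bound a p (S k) Hp Ha).
  assert (A3 := @Cmod_inv_pow_bound b p 1 Hp Hb).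
  set (h := Cmod (b - a)) in *.
  eapply Rle_trans; [apply Cmod_triangle|].
  eapply Rle_trans; [apply Rplus_le_compat_l, Cmod_triangle|].
  rewrite Cmod_opp, !Cmod_mult, Cmod_opp, Cmod_R, Rabs_pos_eq by apply pos_INR. fold h.
  apply Rle_trans with (/ p ^ 1 * (INR k ^ 2 * h ^ 2 / p ^ (k + 2)) + (/ p ^ S k * (h * (h / p ^ 2)) +
     INR k * (h * (/ p ^ S k * (h / p ^ 2)))))%R.
  + assert (Q := Cmod_ge_0).
    repeat apply Rplus_le_compat.
    * apply Rmult_le_compat; auto.
    * apply Rmult_le_compat; auto. { apply Rmult_le_pos; auto. } apply Rmult_le_compat_l; auto.
    * apply Rmult_le_compat_l; [apply pos_INR|]. apply Rmult_le_compat_l; auto. apply Rmult_le_compat; auto.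
  + rewrite S_INR. replace (k + 2)%nat with (S (S k)) by lia. replace (S k + 2)%nat with (S (S (S k))) by lia.
    apply Rminus_le_0. simpl pow.
    match goal with |- (0 <= ?x)%R => replace x with (INR k * h ^ 2 / (p * (p * (p * p ^ k))))%R end.
    * apply Rmult_le_pos; [apply Rmult_le_pos; [apply pos_INR|apply pow2_ge_0]|].
      apply Rlt_le, Rinv_0_lt_compat. repeat apply Rmult_lt_0_compat; auto.
    * specialize (Pk k). field. split; lra.
Qed.

(** The imaginary part of [m + n tau] controls [n], and then the modulus controls [m]; this is where
    the independence of the periods enters. *)
Lemma lattice_lower (L : lattice) : exists c : R, (0 < c)%R /\
  forall m n, (c * IZR (znorm m n) <= Cmod (lattice_pt L m n))%R.
Proof.
assert (H1 := om1_neq0 L). assert (I := om_indep L). set (tau := om2 L / om1 L) in *.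
assert (Hw : (0 < Cmod (om1 L))%R) by (apply Cmod_gt_0; auto).
assert (HI : (0 < Rabs (Im tau))%R) by (apply Rabs_pos_lt; auto).
assert (HT := Cmod_ge_0 tau).
set (B := (1 + (1 + Cmod tau) / Rabs (Im tau))%R).
assert (HB : (0 < B)%R).
{ unfold B. assert (0 < (1 + Cmod tau) / Rabs (Im tau))%R by (apply Rdiv_lt_0_compat; lra). lra. }
exists (Cmod (om1 L) / B)%R. split; [apply Rdiv_lt_0_compat; auto|]. intros m n.
replace (lattice_pt L m n) with (om1 L * (RtoC (IZR m) + RtoC (IZR n) * tau))
  by (unfold lattice_pt, tau; field; auto).
rewrite Cmod_mult. unfold Rdiv. rewrite Rmult_assoc. apply Rmult_le_compat_l; [lra|].
set (x := RtoC (IZR m) + RtoC (IZR n) * tau).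
assert (A : (Rabs (IZR n) * Rabs (Im tau) <= Cmod x)%R).
{ eapply Rle_trans; [|apply im_le_Cmod]. right. rewrite <- Rabs_mult. f_equal. unfold x.
  destruct tau. simpl. ring. }
assert (A' : (Rabs (IZR n) <= Cmod x / Rabs (Im tau))%R) by (apply Rle_div_r; auto).
assert (A2 : (Rabs (IZR m) <= Cmod x + Rabs (IZR n) * Cmod tau)%R).
{ rewrite <- !Cmod_R, <- Cmod_mult. replace (RtoC (IZR m)) with (x + - (RtoC (IZR n) * tau)) by (unfold x; ring).
  eapply Rle_trans; [apply Cmod_triangle|]. rewrite Cmod_opp. lra. }
assert (Hx := Cmod_ge_0 x).
assert (Hxi : (0 <= Cmod x / Rabs (Im tau))%R) by (apply Rmult_le_pos; [auto|apply Rlt_le, Rinv_0_lt_compat; auto]).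
assert (E : (B * Cmod x = Cmod x + Cmod x / Rabs (Im tau) + Cmod x / Rabs (Im tau) * Cmod tau)%R)
  by (unfold B; field; lra).
assert (A3 : (IZR (znorm m n) <= B * Cmod x)%R).
{ unfold znorm. destruct (Z.max_spec (Z.abs m) (Z.abs n)) as [[_ ->]|[_ ->]]; rewrite abs_IZR, E; nra. }
rewrite Rmult_comm. apply Rle_div_l; auto. lra.
Qed.

Lemma lattice_pt_0 L m n : lattice_pt L m n = 0 -> m = 0%Z /\ n = 0%Z.
Proof.
intro E. destruct (lattice_lower L) as (c & Hc & H). specialize (H m n). rewrite E, Cmod_0 in H.
assert (IZR (znorm m n) <= 0)%R by nra. apply le_IZR in H0. unfold znorm in H0. lia.
Qed.

Definition regular (L : lattice) (z : C) : Prop :=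
  forall m n, (1 <= znorm m n)%Z -> z <> lattice_pt L m n.

Lemma finite_min (P : Z -> R -> Prop) :
  (forall m r r', (0 < r' <= r)%R -> P m r -> P m r') ->
  (forall m, exists r, (0 < r)%R /\ P m r) ->
  forall N : nat, exists r, (0 < r)%R /\ forall m, (Z.abs m <= Z.of_nat N)%Z -> P m r.
Proof.
intros Hm He. induction N as [|N (r & Hr & IH)].
- destruct (He 0%Z) as (r & Hr & H). exists r. split; auto. intros m Hm0. replace m with 0%Z by lia. auto.
- destruct (He (Z.of_nat (S N))) as (r1 & Hr1 & H1). destruct (He (- Z.of_nat (S N))%Z) as (r2 & Hr2 & H2).
  exists (Rmin r (Rmin r1 r2)). assert (Hp : (0 < Rmin r (Rmin r1 r2))%R) by (repeat apply Rmin_pos; auto).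
  split; auto. intros m Hmm.
  destruct (Z_le_gt_dec (Z.abs m) (Z.of_nat N)) as [Hl|Hg].
  + apply Hm with r; auto. split; auto. apply Rmin_l.
  + assert (X := Rmin_r r (Rmin r1 r2)). assert (Y := Rmin_l r1 r2). assert (Z := Rmin_r r1 r2).
    assert (m = Z.of_nat (S N) \/ m = (- Z.of_nat (S N))%Z) as [->| ->] by lia.
    * apply Hm with r1; auto. lra.
    * apply Hm with r2; auto. lra.
Qed.

(** One constant bounds both [l] and [z - l] from below, uniformly for [z] near [z0]. Long lattice
    points are handled by the triangle inequality, the finitely many others by [finite_min]. *)
Lemma regular_lower L z0 : regular L z0 -> exists c r : R, (0 < c)%R /\ (0 < r)%R /\
  (forall m n, (c * IZR (znorm m n) <= Cmod (lattice_pt L m n))%R) /\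
  forall z, (Cmod (z - z0) < r)%R -> forall m n, (1 <= znorm m n)%Z ->
    (c * IZR (znorm m n) <= Cmod (z - lattice_pt L m n))%R.
Proof.
intro Hreg. destruct (lattice_lower L) as (c & Hc & H).
assert (Hz := Cmod_ge_0 z0).
(* From norm [N] on, [c] times the norm of [l] exceeds [2 |z|], so subtracting [z] costs at most
   half of the lower bound. *)
destruct (INR_archimed c (2 * (Cmod z0 + 1)) Hc) as (N & HN).
assert (F : exists d, (0 < d)%R /\ forall m, (Z.abs m <= Z.of_nat N)%Z -> forall n, (Z.abs n <= Z.of_nat N)%Z ->
   (1 <= znorm m n)%Z -> (d <= Cmod (z0 - lattice_pt L m n))%R).
{ apply (@finite_min (fun m d => forall n, (Z.abs n <= Z.of_nat N)%Z -> (1 <= znorm m n)%Z -> (d <= Cmod (z0 - lattice_pt L m n))%R)).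
  - intros m r r' Hr K n Hn Hmn. specialize (K n Hn Hmn). lra.
  - intro m. apply (@finite_min (fun n d => (1 <= znorm m n)%Z -> (d <= Cmod (z0 - lattice_pt L m n))%R)).
    + intros n r r' Hr K Hmn. specialize (K Hmn). lra.
    + intro n. destruct (Z_le_gt_dec 1 (znorm m n)) as [Hl|Hg].
      * exists (Cmod (z0 - lattice_pt L m n)). split; [|lra]. apply Cmod_gt_0. intro E.
        apply (Hreg m n Hl). apply Ceq_minus. auto.
      * exists 1%R. split; [lra|]. intro; lia. }
destruct F as (d & Hd & F).
set (c' := Rmin (c / 2) (d / (2 * (INR N + 1)))).
assert (HN0 := pos_INR N).
assert (Hdn : (0 < d / (2 * (INR N + 1)))%R) by (apply Rdiv_lt_0_compat; lra).
assert (Hc' : (0 < c')%R) by (apply Rmin_pos; lra).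
assert (C1 : (c' <= c / 2)%R) by apply Rmin_l. assert (C2 : (c' <= d / (2 * (INR N + 1)))%R) by apply Rmin_r.
exists c', (Rmin 1 (d / 2)). split; auto. split; [apply Rmin_pos; lra|]. split.
- intros m n. eapply Rle_trans; [|apply H]. apply Rmult_le_compat_r; [|lra].
  apply IZR_le. unfold znorm. lia.
- intros z Hzz m n Hmn.
  assert (Z1 := Rlt_le_trans _ _ _ Hzz (Rmin_l _ _)). assert (Z2 := Rlt_le_trans _ _ _ Hzz (Rmin_r _ _)).
  assert (K1 : (1 <= IZR (znorm m n))%R) by (apply IZR_le; auto).
  destruct (Z_le_gt_dec (znorm m n) (Z.of_nat N)) as [Hl|Hg].
  + specialize (F m ltac:(unfold znorm in Hl; lia) n ltac:(unfold znorm in Hl; lia) Hmn).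
    assert (Hl' : (IZR (znorm m n) <= INR N)%R) by (rewrite INR_IZR_INZ; apply IZR_le; auto).
    apply Rle_trans with (d / 2)%R.
    * apply Rle_trans with (d / (2 * (INR N + 1)) * (INR N + 1))%R.
      -- apply Rmult_le_compat; lra.
      -- right. field. lra.
    * replace (z0 - lattice_pt L m n) with (- (z - z0) + (z - lattice_pt L m n)) in F by ring.
      assert (X := Cmod_triangle (- (z - z0)) (z - lattice_pt L m n)). rewrite Cmod_opp in X. lra.
  + assert (Hg' : (INR N <= IZR (znorm m n))%R) by (rewrite INR_IZR_INZ; apply IZR_le; lia).
    specialize (H m n).
    assert (X := Cmod_sub_ge (lattice_pt L m n) z). rewrite Cmod_minus_sym in X.
    assert (Y : (Cmod z <= Cmod z0 + 1)%R).
    { replace z with ((z - z0) + z0) by ring. eapply Rle_trans; [apply Cmod_triangle|]. lra. }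
    assert (c * INR N <= c * IZR (znorm m n))%R by (apply Rmult_le_compat_l; lra).
    assert (c' * IZR (znorm m n) <= c / 2 * IZR (znorm m n))%R by (apply Rmult_le_compat_r; lra).
    lra.
Qed.

Lemma regular_near L z0 : regular L z0 -> exists r, (0 < r)%R /\ forall z, (Cmod (z - z0) < r)%R -> regular L z.
Proof.
intro H. destruct (regular_lower H) as (c & r & Hc & Hr & _ & K). exists r. split; auto.
intros z Hz m n Hmn E. specialize (K z Hz m n Hmn). rewrite E in K.
replace (lattice_pt L m n - lattice_pt L m n) with (RtoC 0) in K by ring. rewrite Cmod_0 in K.
assert (1 <= IZR (znorm m n))%R by (apply IZR_le; auto). nra.
Qed.

Lemma regular_0 L : regular L 0.
Proof.
intros m n H E. symmetry in E. apply lattice_pt_0 in E. destruct E as [-> ->]. unfold znorm in H. simpl in H. lia.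
Qed.

Lemma not_lattice_regular L z : ~ in_lattice L z -> regular L z.
Proof. intros H m n _ E. apply H. exists m, n. auto. Qed.

Lemma regular_opp L z : regular L z -> regular L (- z).
Proof.
intros H m n Hmn E. apply (H (- m)%Z (- n)%Z). unfold znorm in *. lia.
replace z with (- - z) by ring. rewrite E. unfold lattice_pt. rewrite !opp_IZR, !RtoC_opp. ring.
Qed.

(** The corrections make every term with [k >= 1] decay at least like the inverse cube of [l]. The
    derivative in [z] of the term of index [k] is [- k] times that of index [k + 1], corrections
    included. *)
Definition wterm (k : nat) (z l : C) : C :=
  match k with
  | 1%nat => / (z - l) + / l + z / l ^ 2
  | 2%nat => / (z - l) ^ 2 - / l ^ 2
  | _ => / (z - l) ^ k
  end.

Definition wsum (L : lattice) (k : nat) (z : C) : C := lattice_sum L (wterm k z).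

Lemma inv_pow_3 (c x : R) k : (0 < c)%R -> (1 <= x)%R -> (/ (c * x) ^ (k + 3) <= / c ^ (k + 3) / x ^ 3)%R.
Proof.
intros Hc Hx. unfold Rdiv. rewrite <- Rinv_mult. apply Rinv_le_contravar.
- apply Rmult_lt_0_compat; apply pow_lt; lra.
- rewrite Rpow_mult_distr. apply Rmult_le_compat_l; [apply Rlt_le, pow_lt; lra|].
  apply Rle_pow; auto. lia.
Qed.

Lemma znorm_0 m n : (1 <= znorm m n)%Z -> ((m =? 0) && (n =? 0))%Z%bool = false.
Proof.
unfold znorm. intro H. destruct (Z.eqb_spec m 0), (Z.eqb_spec n 0); auto. subst. simpl in H. lia.
Qed.

Lemma wterm_bound L k z : (1 <= k)%nat -> regular L z -> exists M, (0 <= M)%R /\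
  forall m n, (1 <= znorm m n)%Z -> (Cmod (punctured L (wterm k z) m n) <= M / IZR (znorm m n) ^ 3)%R.
Proof.
intros Hk Hreg. destruct (regular_lower Hreg) as (c & r & Hc & Hr & Hl & Hz).
specialize (Hz z ltac:(apply ball_center; auto)).
assert (B : exists (M : R) (j : nat), (0 <= M)%R /\ forall m n, (1 <= znorm m n)%Z ->
   (Cmod (wterm k z (lattice_pt L m n)) <= M * / (c * IZR (znorm m n)) ^ (j + 3))%R).
{ assert (Kp : forall m n, (1 <= znorm m n)%Z -> (0 < c * IZR (znorm m n))%R).
  { intros m n Hmn. apply Rmult_lt_0_compat; auto. apply IZR_lt. lia. }
  assert (N1 : forall m n, (1 <= znorm m n)%Z -> lattice_pt L m n <> 0).
  { intros m n Hmn. apply Cmod_gt_0. specialize (Hl m n). specialize (Kp m n Hmn). lra. }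
  assert (N2 : forall m n, (1 <= znorm m n)%Z -> z - lattice_pt L m n <> 0).
  { intros m n Hmn. apply Cmod_gt_0. specialize (Hz m n Hmn). specialize (Kp m n Hmn). lra. }
  destruct k as [|[|[|k]]]; [lia| | |].
  - exists (Cmod z ^ 2)%R, O. split; [apply pow2_ge_0|]. intros m n Hmn.
    specialize (Hl m n). specialize (Hz m n Hmn). specialize (Kp m n Hmn).
    specialize (N1 m n Hmn). specialize (N2 m n Hmn). set (l := lattice_pt L m n) in *.
    change (wterm 1 z l) with (/ (z - l) + / l + z / l ^ 2).
    replace (/ (z - l) + / l + z / (l ^ 2)) with (z ^ 2 * (/ l ^ 2 * / (z - l) ^ 1)) by (field; auto).
    rewrite !Cmod_mult, Cmod_pow. apply Rmult_le_compat_l; [apply pow2_ge_0|].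
    assert (A := @Cmod_inv_pow_bound l _ 2 Kp Hl). assert (A' := @Cmod_inv_pow_bound (z - l) _ 1 Kp Hz).
    replace (/ (c * IZR (znorm m n)) ^ (0 + 3))%R with (/ (c * IZR (znorm m n)) ^ 2 * / (c * IZR (znorm m n)) ^ 1)%R
      by (simpl; field; split; [assert (1 <= IZR (znorm m n))%R by (apply IZR_le; auto)|]; lra).
    apply Rmult_le_compat; auto; apply Cmod_ge_0.
  - exists (2 * Cmod z)%R, O. split; [assert (X := Cmod_ge_0 z); lra|]. intros m n Hmn.
    specialize (Hl m n). specialize (Hz m n Hmn). specialize (Kp m n Hmn).
    specialize (N1 m n Hmn). specialize (N2 m n Hmn). set (l := lattice_pt L m n) in *.
    change (wterm 2 z l) with (/ (z - l) ^ 2 - / l ^ 2).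
    replace (/ ((z - l) ^ 2) - / (l ^ 2)) with
      (z * (/ l ^ 1 * / (z - l) ^ 2 + - (/ l ^ 2 * / (z - l) ^ 1))) by (field; auto).
    rewrite Cmod_mult. rewrite (Rmult_comm 2), Rmult_assoc. apply Rmult_le_compat_l; [apply Cmod_ge_0|].
    eapply Rle_trans; [apply Cmod_triangle|]. rewrite Cmod_opp, !Cmod_mult.
    assert (A := @Cmod_inv_pow_bound l _ 2 Kp Hl). assert (A' := @Cmod_inv_pow_bound (z - l) _ 1 Kp Hz).
    assert (A2 := @Cmod_inv_pow_bound l _ 1 Kp Hl). assert (A2' := @Cmod_inv_pow_bound (z - l) _ 2 Kp Hz).
    replace (2 * / (c * IZR (znorm m n)) ^ (0 + 3))%R with
      (/ (c * IZR (znorm m n)) ^ 1 * / (c * IZR (znorm m n)) ^ 2 + / (c * IZR (znorm m n)) ^ 2 * / (c * IZR (znorm m n)) ^ 1)%R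
      by (simpl; field; split; [assert (1 <= IZR (znorm m n))%R by (apply IZR_le; auto)|]; lra).
    apply Rplus_le_compat; apply Rmult_le_compat; auto; apply Cmod_ge_0.
  - exists 1%R, k. split; [lra|]. intros m n Hmn. rewrite Rmult_1_l.
    change (wterm (S (S (S k))) z (lattice_pt L m n)) with (/ (z - lattice_pt L m n) ^ S (S (S k))).
    replace (k + 3)%nat with (S (S (S k))) by lia.
    apply Cmod_inv_pow_bound; auto. }
destruct B as (M & j & HM & B).
exists (M * / c ^ (j + 3))%R. split.
{ apply Rmult_le_pos; auto. apply Rlt_le, Rinv_0_lt_compat, pow_lt; auto. }
intros m n Hmn. unfold punctured. rewrite znorm_0 by auto.
eapply Rle_trans; [apply B; auto|]. unfold Rdiv. rewrite Rmult_assoc. apply Rmult_le_compat_l; auto.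
apply inv_pow_3; auto. apply IZR_le; auto.
Qed.

Lemma wsum_lim L k z : (1 <= k)%nat -> regular L z -> CL (zbox (punctured L (wterm k z))) (wsum L k z).
Proof.
intros Hk Hz. destruct (wterm_bound Hk Hz) as (M & HM & B).
destruct (zbox_conv _ HM B) as (l & Hl). unfold wsum. rewrite (lattice_sum_eq Hl). exact Hl.
Qed.

Lemma wterm_remainder k z w l : (1 <= k)%nat -> z - l <> 0 -> w - l <> 0 -> l <> 0 ->
  wterm k w l - wterm k z l + RtoC (INR k) * (w - z) * wterm (S k) z l =
  / (w - l) ^ k - / (z - l) ^ k + RtoC (INR k) * ((w - l) - (z - l)) * / (z - l) ^ S k.
Proof.
intros Hk H1 H2 H3. destruct k as [|[|[|k]]]; [lia| | |].
- simpl. field. auto.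
- change (INR 2) with (1 + 1)%R. rewrite RtoC_plus. simpl. field. auto.
- unfold wterm. f_equal. f_equal. f_equal. ring.
Qed.

(** The Taylor remainders of the terms have a sum bounded by a constant times [|w - z| ^ 2], so
    [D_quadratic] applies to the sum itself. *)
Lemma wsum_derive L k z : (1 <= k)%nat -> regular L z ->
  D (wsum L k) z (- RtoC (INR k) * wsum L (S k) z).
Proof.
intros Hk Hreg. destruct (regular_lower Hreg) as (c & r & Hc & Hr & Hl & Hz).
destruct (regular_near Hreg) as (r' & Hr' & Hnear).
assert (Hcp : (0 < c ^ (k + 2))%R) by (apply pow_lt; auto).
apply D_quadratic with (r := Rmin r r') (M := (16 * (INR k ^ 2 / c ^ (k + 2)))%R).
{ apply Rmin_pos; auto. }
intros w Hw. assert (W1 := Rlt_le_trans _ _ _ Hw (Rmin_l _ _)). assert (W2 := Rlt_le_trans _ _ _ Hw (Rmin_r _ _)).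
set (a := fun m n => (punctured L (wterm k w) m n + (-(1)) * punctured L (wterm k z) m n) +
   (RtoC (INR k) * (w - z)) * punctured L (wterm (S k) z) m n).
assert (Lim : CL (zbox a) (wsum L k w - wsum L k z - - RtoC (INR k) * wsum L (S k) z * (w - z))).
{ replace (wsum L k w - wsum L k z - - RtoC (INR k) * wsum L (S k) z * (w - z)) with
   ((wsum L k w + (-(1)) * wsum L k z) + (RtoC (INR k) * (w - z)) * wsum L (S k) z) by ring.
  apply CL_ext with (fun N => (zbox (punctured L (wterm k w)) N + (-(1)) * zbox (punctured L (wterm k z)) N)
     + (RtoC (INR k) * (w - z)) * zbox (punctured L (wterm (S k) z)) N).
  { intro N. unfold a. rewrite zbox_plus, zbox_plus, !zbox_scal. reflexivity. }
  apply CL_plus; [apply CL_plus|]; [|apply CL_scal|apply CL_scal]; apply wsum_lim; auto. }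
replace (16 * (INR k ^ 2 / c ^ (k + 2)) * Cmod (w - z) ^ 2)%R with
  (16 * (INR k ^ 2 * Cmod (w - z) ^ 2 / c ^ (k + 2)))%R by (field; lra).
apply (@zbox_lim_bound a (INR k ^ 2 * Cmod (w - z) ^ 2 / c ^ (k + 2))); auto.
- apply Rmult_le_pos; [apply Rmult_le_pos; apply pow2_ge_0|apply Rlt_le, Rinv_0_lt_compat; auto].
- unfold a, punctured. simpl. ring.
- intros m n Hmn. unfold a, punctured. rewrite znorm_0 by auto.
  assert (K1 : (1 <= IZR (znorm m n))%R) by (apply IZR_le; auto).
  assert (Kp : (0 < c * IZR (znorm m n))%R) by (apply Rmult_lt_0_compat; lra).
  specialize (Hl m n). assert (Hz1 := Hz z ltac:(apply ball_center; auto) m n Hmn).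
  assert (Hz2 := Hz w W1 m n Hmn). set (l := lattice_pt L m n) in *.
  replace (wterm k w l + (-(1)) * wterm k z l + RtoC (INR k) * (w - z) * wterm (S k) z l) with
    (wterm k w l - wterm k z l + RtoC (INR k) * (w - z) * wterm (S k) z l) by ring.
  rewrite wterm_remainder; auto; try (apply Cmod_gt_0; lra).
  eapply Rle_trans; [apply (@inv_pow_remainder (z - l) (w - l) _ k Kp Hz1 Hz2)|].
  replace (w - l - (z - l)) with (w - z) by ring.
  destruct k as [|k]; [lia|]. replace (S k + 2)%nat with (k + 3)%nat by lia.
  unfold Rdiv. rewrite !Rmult_assoc. apply Rmult_le_compat_l; [apply pow2_ge_0|].
  apply Rmult_le_compat_l; [apply pow2_ge_0|]. apply inv_pow_3; auto.
Qed.

Lemma sign_sq k : (-(1)) ^ k * (-(1)) ^ k = 1.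
Proof. rewrite <- Cpow_mult_l. replace (-(1) * -(1)) with (RtoC 1) by ring. apply Cpow_1_l. Qed.

Lemma inv_opp_pow a k : a <> 0 -> / (- a) ^ k = (-(1)) ^ k * / a ^ k.
Proof.
intro H. replace (- a) with (-(1) * a) by ring. rewrite Cpow_mult_l.
assert (E := sign_sq k). set (s := (-(1)) ^ k) in *.
assert (Hs : s <> 0) by (intro X; rewrite X in E; apply C1_nz; rewrite <- E; ring).
assert (a ^ k <> 0) by (apply Cpow_nz; auto).
transitivity ((s * s) * / (s * a ^ k)); [rewrite E; ring|field; auto].
Qed.

Lemma wterm_opp k z (l : C) : (1 <= k)%nat -> l <> 0 -> z - l <> 0 ->
  wterm k (- z) (- l) = (-(1)) ^ k * wterm k z l.
Proof.
intros Hk H1 H2.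
assert (P := inv_opp_pow k H2). replace (- (z - l)) with (- z - - l) in P by ring.
destruct k as [|[|[|k]]]; [lia| | |exact P].
- simpl in *. rewrite !Cmult_1_r in P. rewrite P.
  assert (Q := inv_opp_pow 1 H1). simpl in Q. rewrite !Cmult_1_r in Q. rewrite Q. field. auto.
- unfold wterm. rewrite P. replace ((- l) ^ 2) with (l ^ 2) by ring. ring.
Qed.

Lemma wsum_opp L k z : (1 <= k)%nat -> regular L z -> wsum L k (- z) = (-(1)) ^ k * wsum L k z.
Proof.
intros Hk Hz. apply CL_unique with (zbox (punctured L (wterm k (- z)))).
- apply wsum_lim; auto. apply regular_opp; auto.
- apply CL_ext with (fun N => (-(1)) ^ k * zbox (punctured L (wterm k z)) N).
  2:{ apply CL_scal. apply wsum_lim; auto. }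
  intro N. rewrite <- zbox_scal, <- (zbox_opp (punctured L (wterm k (- z)))).
  apply zbox_ext. intros m n. unfold punctured.
  destruct (Z_le_gt_dec 1 (znorm m n)) as [Hl|Hg].
  + rewrite !znorm_0 by (unfold znorm in *; lia).
    replace (lattice_pt L (- m) (- n)) with (- lattice_pt L m n)
      by (unfold lattice_pt; rewrite !opp_IZR, !RtoC_opp; ring).
    symmetry. apply wterm_opp; auto.
    * intro E. apply lattice_pt_0 in E. destruct E as [-> ->]. unfold znorm in Hl. simpl in Hl. lia.
    * intro E. apply (Hz m n Hl). apply Ceq_minus. auto.
  + assert (m = 0%Z /\ n = 0%Z) as [-> ->] by (unfold znorm in Hg; lia). simpl. ring.
Qed.

Lemma wsum_lattice_sum_pow L k : (3 <= k)%nat -> wsum L k 0 = (-(1)) ^ k * lattice_sum L (fun l => / l ^ k).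
Proof.
intro Hk. assert (H := @wsum_lim L k 0 ltac:(lia) (@regular_0 L)).
assert (E := sign_sq k).
assert (H2 : CL (zbox (punctured L (fun l => / l ^ k))) ((-(1)) ^ k * wsum L k 0)).
{ apply CL_ext with (fun N => (-(1)) ^ k * zbox (punctured L (wterm k 0)) N); [|apply CL_scal; auto].
  intro N. rewrite <- zbox_scal. apply zbox_ext. intros m n. unfold punctured.
  destruct (Z_le_gt_dec 1 (znorm m n)) as [Hl|Hg].
  - rewrite !znorm_0 by auto. set (l := lattice_pt L m n).
    assert (l <> 0).
    { intro X. apply lattice_pt_0 in X. destruct X as [-> ->]. unfold znorm in Hl. simpl in Hl. lia. }
    replace (wterm k 0 l) with (/ (- l) ^ k).
    + rewrite inv_opp_pow by auto. rewrite Cmult_assoc, E. ring.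
    + destruct k as [|[|[|k]]]; try lia. unfold wterm. f_equal. f_equal. ring.
  - assert (m = 0%Z /\ n = 0%Z) as [-> ->] by (unfold znorm in Hg; lia). simpl. ring. }
rewrite (lattice_sum_eq H2), Cmult_assoc, E. ring.
Qed.

Lemma wsum_0_low L k : (1 <= k <= 2)%nat -> wsum L k 0 = 0.
Proof.
intro Hk. apply CL_unique with (zbox (punctured L (wterm k 0))).
- apply wsum_lim; [lia|apply regular_0].
- apply CL_ext with (fun N => 0 * zbox (punctured L (wterm k 0)) N).
  2:{ assert (H := @CL_scal 0 _ _ (@wsum_lim L k 0 ltac:(lia) (@regular_0 L))). rewrite Cmult_0_l in H. exact H. }
  intro N. rewrite <- zbox_scal. apply zbox_ext. intros m n. unfold punctured.
  destruct (Z_le_gt_dec 1 (znorm m n)) as [Hl|Hg].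
  + rewrite !znorm_0 by auto. set (l := lattice_pt L m n).
    assert (l <> 0).
    { intro X. apply lattice_pt_0 in X. destruct X as [-> ->]. unfold znorm in Hl. simpl in Hl. lia. }
    assert (0 - l <> 0) by (intro X; apply H; replace l with (- (0 - l)) by ring; rewrite X; ring).
    destruct k as [|[|[|k]]]; try lia; simpl; field; auto.
  + assert (m = 0%Z /\ n = 0%Z) as [-> ->] by (unfold znorm in Hg; lia). simpl. ring.
Qed.

Lemma wsum_0_odd L k : (1 <= k)%nat -> (-(1)) ^ k = -(1) -> wsum L k 0 = 0.
Proof.
intros Hk E. assert (H := wsum_opp Hk (@regular_0 L)). rewrite E in H.
replace (- (0)) with (RtoC 0) in H by ring.
assert (T : RtoC 2 <> 0) by (intro T; apply RtoC_inj in T; lra).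
assert (Q : 2 * wsum L k 0 = 0).
{ replace (2 * wsum L k 0) with (wsum L k 0 - -(1) * wsum L k 0) by ring. rewrite <- H. ring. }
replace (wsum L k 0) with (2 * wsum L k 0 / 2) by field. rewrite Q. field.
Qed.

(** * The Weierstrass functions *)

(** The value at [p] is left out, since at a pole it is only the default that comes from dividing by
    zero. *)
Definition limp f p (l : C) : Prop :=
  forall eps : R, (0 < eps)%R -> exists d, (0 < d)%R /\
    forall z, (0 < Cmod (z - p) < d)%R -> (Cmod (f z - l) < eps)%R.

Lemma contC_limp f p : contC f p -> limp f p (f p).
Proof. intros H eps He. destruct (H eps He) as (d & Hd & K). exists d. split; auto. intros z Hz. apply K. lra. Qed.

Lemma limp_ext f g p (l : C) (r : R) : (0 < r)%R ->
  (forall z, (0 < Cmod (z - p) < r)%R -> f z = g z) -> limp f p l -> limp g p l.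
Proof.
intros Hr E H eps He. destruct (H eps He) as (d & Hd & K). exists (Rmin r d).
split; [apply Rmin_pos; auto|]. intros z [Hz1 Hz2].
assert (A := Rlt_le_trans _ _ _ Hz2 (Rmin_l _ _)). assert (B := Rlt_le_trans _ _ _ Hz2 (Rmin_r _ _)).
rewrite <- E by auto. auto.
Qed.

Lemma limp_plus f g p (l m : C) : limp f p l -> limp g p m -> limp (fun z => f z + g z) p (l + m).
Proof.
intros H K eps He. destruct (H (eps/2)%R ltac:(lra)) as (d1 & Hd1 & K1).
destruct (K (eps/2)%R ltac:(lra)) as (d2 & Hd2 & K2). exists (Rmin d1 d2). split; [apply Rmin_pos; auto|].
intros z [Hz1 Hz2].
assert (A := Rlt_le_trans _ _ _ Hz2 (Rmin_l _ _)). assert (B := Rlt_le_trans _ _ _ Hz2 (Rmin_r _ _)).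
specialize (K1 z ltac:(auto)). specialize (K2 z ltac:(auto)).
replace (f z + g z - (l + m)) with ((f z - l) + (g z - m)) by ring.
eapply Rle_lt_trans; [apply Cmod_triangle|]. lra.
Qed.

Lemma limp_mult f g p (l m : C) : limp f p l -> limp g p m -> limp (fun z => f z * g z) p (l * m).
Proof.
intros H K eps He.
assert (Hl := Cmod_ge_0 l). assert (Hm := Cmod_ge_0 m).
destruct (H (Rmin 1 (eps / (2 * (Cmod m + 1)))) ltac:(apply Rmin_pos; [lra|apply Rdiv_lt_0_compat; lra])) as (d1 & Hd1 & K1).
destruct (K (eps / (2 * (Cmod l + 1)))%R ltac:(apply Rdiv_lt_0_compat; lra)) as (d2 & Hd2 & K2).
exists (Rmin d1 d2). split; [apply Rmin_pos; auto|].
intros z [Hz1 Hz2].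
assert (A := Rlt_le_trans _ _ _ Hz2 (Rmin_l _ _)). assert (B := Rlt_le_trans _ _ _ Hz2 (Rmin_r _ _)).
specialize (K1 z ltac:(auto)). specialize (K2 z ltac:(auto)).
assert (K11 := Rlt_le_trans _ _ _ K1 (Rmin_l _ _)). assert (K12 := Rlt_le_trans _ _ _ K1 (Rmin_r _ _)).
replace (f z * g z - l * m) with (f z * (g z - m) + (f z - l) * m) by ring.
eapply Rle_lt_trans; [apply Cmod_triangle|]. rewrite !Cmod_mult.
assert (F : (Cmod (f z) <= Cmod l + 1)%R).
{ replace (f z) with ((f z - l) + l) by ring. eapply Rle_trans; [apply Cmod_triangle|]. lra. }
assert (T1 : (Cmod (f z) * Cmod (g z - m) < eps / 2)%R).
{ apply Rlt_div_r in K2; [|lra]. assert (X := Cmod_ge_0 (g z - m)).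
  apply Rle_lt_trans with ((Cmod l + 1) * Cmod (g z - m))%R; [apply Rmult_le_compat_r; auto|]. lra. }
assert (T2 : (Cmod (f z - l) * Cmod m <= eps / 2)%R).
{ apply Rlt_div_r in K12; [|lra]. assert (X := Cmod_ge_0 (f z - l)). nra. }
lra.
Qed.

Lemma limp_D_quotient f p a : D f p a -> limp (fun z => (f z - f p) / (z - p)) p a.
Proof.
intros H eps He. destruct (proj1 (D_eps _ _ _) H (eps / 2)%R ltac:(lra)) as (d & Hd & K).
exists d. split; auto. intros z [Hz1 Hz2]. specialize (K z Hz2).
assert (Hne : z - p <> 0) by (apply Cmod_gt_0; auto).
replace ((f z - f p) / (z - p) - a) with ((f z - f p - a * (z - p)) / (z - p)) by (field; auto).
rewrite Cmod_div by auto. apply Rlt_div_l; auto. nra.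
Qed.

(** The class O(1) at the origin. Remainders of expansions are kept as explicit functions of this
    class, so that expansions are multiplied by [field] and [ring]. *)
Definition bdp f (r : R) : Prop := exists B, forall z, (0 < Cmod z < r)%R -> (Cmod (f z) <= B)%R.

Lemma bdp_const c r : bdp (fun _ => c) r.
Proof. exists (Cmod c). intros; lra. Qed.
Lemma bdp_id r : bdp (fun z => z) r.
Proof. exists r. intros; lra. Qed.
Lemma bdp_plus f g r : bdp f r -> bdp g r -> bdp (fun z => f z + g z) r.
Proof.
intros (B & H) (B' & H'). exists (B + B')%R. intros z Hz. eapply Rle_trans; [apply Cmod_triangle|].
specialize (H z Hz). specialize (H' z Hz). lra.
Qed.
Lemma bdp_mult f g r : bdp f r -> bdp g r -> bdp (fun z => f z * g z) r.
Proof.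
intros (B & H) (B' & H'). exists (B * B')%R. intros z Hz. rewrite Cmod_mult.
apply Rmult_le_compat; auto; apply Cmod_ge_0.
Qed.
Lemma bdp_opp f r : bdp f r -> bdp (fun z => - f z) r.
Proof. intros (B & H). exists B. intros z Hz. rewrite Cmod_opp. auto. Qed.
Lemma bdp_minus f g r : bdp f r -> bdp g r -> bdp (fun z => f z - g z) r.
Proof. intros H K. exact (bdp_plus H (bdp_opp K)). Qed.
Lemma bdp_pow f r n : bdp f r -> bdp (fun z => f z ^ n) r.
Proof. intro H. induction n as [|n IH]; [exact (bdp_const 1 r)|exact (bdp_mult H IH)]. Qed.

Lemma limp_0_bdp f (c : C) r : (0 < r)%R -> bdp f r -> limp (fun z => c + z * f z) 0 c.
Proof.
intros Hr (B & H) eps He. assert (X := Rabs_pos B). assert (Y := Rle_abs B).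
exists (Rmin r (eps / (Rabs B + 1))). split; [apply Rmin_pos; auto; apply Rdiv_lt_0_compat; lra|].
intros z [Hz1 Hz2].
replace (z - 0) with z in * by ring.
assert (A1 := Rlt_le_trans _ _ _ Hz2 (Rmin_l _ _)). assert (A2 := Rlt_le_trans _ _ _ Hz2 (Rmin_r _ _)).
replace (c + z * f z - c) with (z * f z) by ring. rewrite Cmod_mult.
specialize (H z ltac:(auto)). apply Rlt_div_r in A2; [|lra]. nra.
Qed.

(** The mean value inequality on the segment from 0 raises the order of a bound by one. Repeated
    along the [W_k], it takes the place of Taylor's formula. *)
Lemma bound_integrate f (f' : C -> C) (r M : R) n :
  (forall z, (Cmod z < r)%R -> D f z (f' z)) ->
  (forall z, (Cmod z < r)%R -> (Cmod (f' z) <= M * Cmod z ^ n)%R) -> f 0 = 0 ->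
  forall z, (Cmod z < r)%R -> (Cmod (f z) <= M * Cmod z ^ S n)%R.
Proof.
intros HD HB H0 z Hz.
assert (K := @mvt_segment f (fun t => f' (0 + RtoC t * (z - 0))) z 0 (M * Cmod z ^ n)%R).
rewrite H0 in K. replace (f z - 0) with (f z) in K by ring. replace (z - 0) with z in K by ring.
replace (M * Cmod z ^ S n)%R with (M * Cmod z ^ n * Cmod z)%R by (simpl; ring).
apply K. intros t Ht.
assert (E : Cmod (0 + RtoC t * z) = (t * Cmod z)%R).
{ rewrite Cplus_0_l, Cmod_mult, Cmod_R, Rabs_pos_eq; lra. }
assert (Hz0 := Cmod_ge_0 z).
assert (Ht' : (Cmod (0 + RtoC t * z) <= Cmod z)%R) by (rewrite E; nra).
split; [apply HD; lra|]. eapply Rle_trans; [apply HB; lra|].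
(* A negative [M] is compatible with the bound only where the power of [|z|] vanishes. *)
assert (HM : (0 <= M)%R \/ (Cmod z ^ n <= 0)%R).
{ destruct (Rle_lt_dec 0 M); auto. right. specialize (HB z Hz). assert (X := Cmod_ge_0 (f' z)).
  assert (0 <= Cmod z ^ n)%R by (apply pow_le; auto). nra. }
destruct HM as [HM|HM].
- apply Rmult_le_compat_l; auto. apply pow_incr. split; auto. apply Cmod_ge_0.
- assert (A0 : (0 <= Cmod (0 + RtoC t * z) ^ n)%R) by (apply pow_le, Cmod_ge_0).
  assert (A1 : (Cmod (0 + RtoC t * z) ^ n <= Cmod z ^ n)%R) by (apply pow_incr; split; auto; apply Cmod_ge_0).
  assert (Cmod (0 + RtoC t * z) ^ n = 0)%R by lra. rewrite H. assert (X : (0 <= Cmod z ^ n)%R) by (apply pow_le; auto).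
  replace (Cmod z ^ n)%R with 0%R by lra. lra.
Qed.

Lemma bdp_quotient f (r M : R) n : (forall z, (Cmod z < r)%R -> (Cmod (f z) <= M * Cmod z ^ n)%R) ->
  bdp (fun z => f z / z ^ n) r.
Proof.
intro H. exists M. intros z [Hz1 Hz2].
assert (z <> 0) by (apply Cmod_gt_0; auto).
rewrite Cmod_div by (apply Cpow_nz; auto). rewrite Cmod_pow. apply Rle_div_l; [apply pow_lt; auto|]. auto.
Qed.

Definition Wf (L : lattice) (k : nat) (z : C) : C := / z ^ k + wsum L k z.

Lemma wp_Wf L z : wp L z = Wf L 2 z.
Proof. reflexivity. Qed.

Lemma wzeta_Wf L z : wzeta L z = Wf L 1 z.
Proof. unfold Wf. rewrite Cpow_1_r. reflexivity. Qed.

Lemma not_lattice_neq0 L z : ~ in_lattice L z -> z <> 0.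
Proof. intros H ->. apply H, in_lattice_0. Qed.

Lemma Wf_derive L k z : (1 <= k)%nat -> ~ in_lattice L z -> D (Wf L k) z (- RtoC (INR k) * Wf L (S k) z).
Proof.
intros Hk Hz. assert (H0 := not_lattice_neq0 Hz). unfold Wf.
eapply D_eq; [|apply D_plus; [apply D_inv; [apply Cpow_nz; auto|apply D_pow; apply D_id]
  |apply wsum_derive; auto; apply not_lattice_regular; auto]].
destruct k as [|k]; [lia|]. simpl pred.
assert (z ^ k <> 0) by (apply Cpow_nz; auto).
replace (z ^ S k) with (z * z ^ k) by reflexivity. replace (z ^ S (S k)) with (z * (z * z ^ k)) by reflexivity.
field. auto.
Qed.

Lemma Wf_opp L k z : (1 <= k)%nat -> ~ in_lattice L z -> Wf L k (- z) = (-(1)) ^ k * Wf L k z.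
Proof.
intros Hk Hz. unfold Wf. rewrite wsum_opp by (auto; apply not_lattice_regular; auto).
rewrite inv_opp_pow by (eapply not_lattice_neq0; eauto). ring.
Qed.

Lemma zs_split (f : Z -> C) N : zs f N = f 0%Z + zs (fun k => if (k =? 0)%Z then 0 else f k) N.
Proof.
induction N as [|N IH]; [simpl; ring|]. rewrite !zs_S, IH.
destruct (Z.eqb_spec (- Z.of_nat (S N)) 0); [lia|]. destruct (Z.eqb_spec (Z.of_nat (S N)) 0); [lia|]. ring.
Qed.

Lemma zbox_split (a : Z -> Z -> C) N : zbox a N = a 0%Z 0%Z + zbox (fun m n => if ((m =? 0) && (n =? 0))%Z%bool then 0 else a m n) N.
Proof.
unfold zbox. rewrite zs_split. rewrite (zs_split (fun m => zs _ N)).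
rewrite zs_split. simpl.
rewrite Cplus_assoc. f_equal.
apply zs_ext. intros k _. destruct (Z.eqb_spec k 0); auto.
Qed.

Lemma lattice_pt_00 L : lattice_pt L 0 0 = 0.
Proof. unfold lattice_pt. ring. Qed.

(** The regularising part of a box sum, affine in [z] for [k = 1] and constant for [k = 2]. Once it
    is split off, what remains is a plain sum over all the lattice points of the box, 0 included, on
    which a period acts as a shift of indices. *)
Definition wreg (L : lattice) (k : nat) (z : C) (N : nat) : C :=
  match k with
  | 1%nat => zbox (punctured L (fun l => / l)) N + z * zbox (punctured L (fun l => / l ^ 2)) N
  | 2%nat => - zbox (punctured L (fun l => / l ^ 2)) N
  | _ => 0
  end.

Lemma Wf_lim L k z : (1 <= k)%nat -> ~ in_lattice L z ->
  CL (fun N => zbox (fun m n => / (z - lattice_pt L m n) ^ k) N + wreg L k z N) (Wf L k z).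
Proof.
intros Hk Hz. apply CL_ext with (fun N => / z ^ k + zbox (punctured L (wterm k z)) N).
2:{ apply CL_plus; [apply CL_const|]. apply wsum_lim; auto. apply not_lattice_regular; auto. }
intro N. rewrite (zbox_split (fun m n => / (z - lattice_pt L m n) ^ k)).
rewrite lattice_pt_00. replace (z - 0) with z by ring. rewrite <- Cplus_assoc. f_equal.
change (fun m n => if ((m =? 0) && (n =? 0))%Z%bool then RtoC 0 else / (z - lattice_pt L m n) ^ k) with
  (punctured L (fun l => / (z - l) ^ k)).
destruct k as [|[|[|k]]]; [lia| | |].
- unfold wreg. rewrite <- zbox_scal, <- !zbox_plus. apply zbox_ext. intros m n. unfold punctured.
  destruct (_ && _)%bool; [ring|]. rewrite Cpow_1_r. unfold wterm, Cdiv. ring.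
- unfold wreg. replace (- zbox (punctured L (fun l => / l ^ 2)) N) with ((-(1)) * zbox (punctured L (fun l => / l ^ 2)) N) by ring.
  rewrite <- zbox_scal, <- !zbox_plus. apply zbox_ext. intros m n. unfold punctured.
  destruct (_ && _)%bool; [ring|]. unfold wterm. ring.
- unfold wreg. rewrite Cplus_0_r. reflexivity.
Qed.

Lemma shift_lim L (G : C -> C) z (M : R) : (0 <= M)%R ->
  (forall m n, (1 <= znorm m n)%Z -> (Cmod (G (z - lattice_pt L m n)%C) <= M / IZR (znorm m n) ^ 2)%R) ->
  CL (fun N => zbox (fun m n => G (z + om1 L - lattice_pt L m n)) N - zbox (fun m n => G (z - lattice_pt L m n)) N) 0 /\
  CL (fun N => zbox (fun m n => G (z + om2 L - lattice_pt L m n)) N - zbox (fun m n => G (z - lattice_pt L m n)) N) 0.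
Proof.
intros HM H. split.
- eapply CL_ext; [|apply (@zbox_shift_fst (fun m n => G (z - lattice_pt L m n)) M 1 HM); auto].
  intro N. cbv beta. f_equal. apply zbox_ext. intros m n. f_equal. unfold lattice_pt. rewrite minus_IZR, RtoC_minus. ring.
- eapply CL_ext; [|apply (@zbox_shift_snd (fun m n => G (z - lattice_pt L m n)) M 1 HM); auto].
  intro N. cbv beta. f_equal. apply zbox_ext. intros m n. f_equal. unfold lattice_pt. rewrite minus_IZR, RtoC_minus. ring.
Qed.

Lemma in_lattice_om1 L : in_lattice L (om1 L).
Proof. exists 1%Z, 0%Z. unfold lattice_pt. ring. Qed.
Lemma in_lattice_om2 L : in_lattice L (om2 L).
Proof. exists 0%Z, 1%Z. unfold lattice_pt. ring. Qed.

Lemma in_lattice_shift L l z : in_lattice L l -> (in_lattice L (z + l) <-> in_lattice L z).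
Proof.
intro H. split; intro K.
- replace z with (z + l - l) by ring. apply in_lattice_sub; auto.
- apply in_lattice_add; auto.
Qed.

(** The function is replaced by 0 outside the invariant set [P]; then it has the two periods
    everywhere, and [periodic_lattice] applies. *)
Lemma periodic_on_lattice (L : lattice) (P : C -> Prop) (T : C -> C) :
  (forall l z, in_lattice L l -> P z -> P (z + l)) ->
  (forall z, P z -> T (z + om1 L) = T z /\ T (z + om2 L) = T z) ->
  forall l z, in_lattice L l -> P z -> T (z + l) = T z.
Proof.
intros HP HT l z Hl Hz.
set (T' := fun z => if excluded_middle_informative (P z) then T z else 0).
assert (E : forall z, P z -> T' z = T z).
{ intros x Hx. unfold T'. destruct (excluded_middle_informative (P x)); tauto. }
assert (Back : forall l z, in_lattice L l -> P (z + l) -> P z).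
{ intros l0 x Hl0 Hx. replace x with (x + l0 + - l0) by ring. apply HP; auto. apply in_lattice_opp; auto. }
assert (G : forall w, in_lattice L w -> (forall z, P z -> T (z + w) = T z) -> forall z, T' (z + w) = T' z).
{ intros w Hw H x. destruct (classic (P x)) as [Hx|Hx].
  - rewrite !E; auto.
  - unfold T'. destruct (excluded_middle_informative (P x)); [tauto|].
    destruct (excluded_middle_informative (P (x + w))); auto. exfalso; apply Hx; eapply Back; eauto. }
rewrite <- (E z), <- (E (z + l)) by auto.
apply (@periodic_lattice L T'); auto; apply G; try apply in_lattice_om1; try apply in_lattice_om2; apply HT.
Qed.

(** The regularising parts at [z] and at [z + l] are equal for [k >= 2], and the plain box sums
    differ by a quantity that tends to 0. For [k = 1] both points fail, whence the quasi-periods of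
    zeta. *)
Lemma Wf_periodic L k l z : (2 <= k)%nat -> in_lattice L l -> ~ in_lattice L z -> Wf L k (z + l) = Wf L k z.
Proof.
intros Hk. apply (@periodic_on_lattice L (fun z => ~ in_lattice L z) (Wf L k)).
- intros l0 x Hl Hx K. exact (Hx (proj1 (in_lattice_shift _ Hl) K)).
- clear l z. intros z Hz.
  destruct (regular_lower (not_lattice_regular Hz)) as (c & r & Hc & Hr & _ & Hl).
  specialize (Hl z (ball_center _ Hr)).
  destruct (@shift_lim L (fun y => / y ^ k) z (/ c ^ k)) as [S1 S2].
  { apply Rlt_le, Rinv_0_lt_compat, pow_lt; auto. }
  { intros m n Hmn. specialize (Hl m n Hmn). assert (K1 : (1 <= IZR (znorm m n))%R) by (apply IZR_le; auto).
    eapply Rle_trans; [apply Cmod_inv_pow_bound with (p := (c * IZR (znorm m n))%R); auto|].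
    - apply Rmult_lt_0_compat; lra.
    - unfold Rdiv. rewrite <- Rinv_mult. apply Rinv_le_contravar.
      + apply Rmult_lt_0_compat; apply pow_lt; lra.
      + rewrite Rpow_mult_distr. apply Rmult_le_compat_l; [apply Rlt_le, pow_lt; lra|]. apply Rle_pow; auto. }
  assert (G : forall w, in_lattice L w ->
    CL (fun N => zbox (fun m n => / (z + w - lattice_pt L m n) ^ k) N - zbox (fun m n => / (z - lattice_pt L m n) ^ k) N) 0 ->
    Wf L k (z + w) = Wf L k z).
  { intros w Hw H.
    assert (A := @Wf_lim L k (z + w) ltac:(lia) (fun X => Hz (proj1 (in_lattice_shift _ Hw) X))).
    assert (B := @Wf_lim L k z ltac:(lia) Hz).
    apply Ceq_minus. eapply CL_unique; [apply (CL_minus A B)|].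
    eapply CL_ext; [|exact H]. intro N. cbv beta. destruct k as [|[|[|k]]]; try lia; unfold wreg; ring. }
  split; apply G; auto; [apply in_lattice_om1|apply in_lattice_om2].
Qed.

Lemma D_ex_cont f z : (exists d, D f z d) -> contC f z.
Proof. intros (d & H). exact (D_cont H). Qed.

(** Lattice points closer than [c] coincide, so at most one of them lies near [p] without being [p],
    and the radius can be chosen to exclude it. *)
Lemma lattice_discrete L p : exists r, (0 < r)%R /\
  forall z, (0 < Cmod (z - p) < r)%R -> ~ in_lattice L z.
Proof.
destruct (lattice_lower L) as (c & Hc & H).
assert (Far : forall z w, in_lattice L z -> in_lattice L w -> (Cmod (z - w) < c)%R -> z = w).
{ intros z w Hz Hw Hd. destruct (in_lattice_sub Hz Hw) as (m & n & E). specialize (H m n). rewrite <- E in H.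
  destruct (Z_le_gt_dec 1 (znorm m n)) as [Hl|Hg].
  - assert (1 <= IZR (znorm m n))%R by (apply IZR_le; auto). nra.
  - assert (m = 0%Z /\ n = 0%Z) as [-> ->] by (unfold znorm in Hg; lia).
    rewrite lattice_pt_00 in E. apply Ceq_minus. auto. }
destruct (classic (exists q, in_lattice L q /\ (0 < Cmod (q - p) < c / 2)%R)) as [(q & Hq & Hq1)|N].
- exists (Cmod (q - p)). split; [lra|]. intros z Hz Hzl.
  assert (z = q) as ->; [|lra]. apply Far; auto.
  replace (z - q) with ((z - p) - (q - p)) by ring. unfold Cminus at 1.
  eapply Rle_lt_trans; [apply Cmod_triangle|]. rewrite Cmod_opp. lra.
- exists (c / 2)%R. split; [lra|]. intros z Hz Hzl. apply N. exists z. auto.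
Qed.

Lemma limp_lattice L (F : C -> C) (c : C) :
  (forall l z, in_lattice L l -> ~ in_lattice L z -> F (z + l) = F z) ->
  limp F 0 c -> forall p, in_lattice L p -> limp F p c.
Proof.
intros HF H p Hp eps He. destruct (H eps He) as (d & Hd & K).
destruct (lattice_discrete L p) as (r & Hr & Hr2).
exists (Rmin r d). split; [apply Rmin_pos; auto|]. intros z [Hz1 Hz2].
assert (A := Rlt_le_trans _ _ _ Hz2 (Rmin_l _ _)). assert (B := Rlt_le_trans _ _ _ Hz2 (Rmin_r _ _)).
assert (Hzl := Hr2 z ltac:(auto)).
replace (F z) with (F (z - p)).
- apply K. replace (z - p - 0) with (z - p) by ring. auto.
- unfold Cminus. apply HF; auto. apply in_lattice_opp; auto.
Qed.

Ltac dstep :=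
  match goal with
  | |- D (fun z => Cplus _ _) _ _ => eapply D_plus
  | |- D (fun z => Cminus _ _) _ _ => eapply D_minus
  | |- D (fun z => Copp _) _ _ => eapply D_opp
  | |- D (fun z => Cmult _ _) _ _ => eapply D_mult
  | |- D (fun z => z) _ _ => eapply D_id
  | |- D (fun z => ?c) _ _ => eapply D_const
  end.

(** With [a = g2 / 20] and [b = g3 / 28] the two brackets are the expansions at 0 of [- wp' / 2] and
    of [wp], carried just far enough for all the negative powers and the constant term to cancel. *)
Lemma cubic_expansion (z a b u v : C) : z <> 0 ->
  4 * ((/ z ^ 3 + (- a * z - 2 * b * z ^ 3 + z ^ 4 * v)) * (/ z ^ 3 + (- a * z - 2 * b * z ^ 3 + z ^ 4 * v)))
  - 4 * ((/ z ^ 2 + (a * z ^ 2 + b * z ^ 4 + z ^ 5 * u)) * ((/ z ^ 2 + (a * z ^ 2 + b * z ^ 4 + z ^ 5 * u)) *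
      (/ z ^ 2 + (a * z ^ 2 + b * z ^ 4 + z ^ 5 * u))))
  + 20 * a * (/ z ^ 2 + (a * z ^ 2 + b * z ^ 4 + z ^ 5 * u)) + 28 * b =
  z * (8 * v - 12 * u + z * (4 * (- a - 2 * b * z ^ 2 + z ^ 3 * v) ^ 2 - 12 * (a + b * z ^ 2 + z ^ 3 * u) ^ 2
     + 20 * a * (a + b * z ^ 2 + z ^ 3 * u)) - 4 * z ^ 5 * (a + b * z ^ 2 + z ^ 3 * u) ^ 3).
Proof.
intro Hz. set (i := / z). assert (Hi : i * z = 1) by (unfold i; field; auto).
set (p := 1 + a * z ^ 4 + b * z ^ 6 + z ^ 7 * u). set (d := 1 - a * z ^ 4 - 2 * b * z ^ 6 + z ^ 7 * v).
replace (/ z ^ 2 + (a * z ^ 2 + b * z ^ 4 + z ^ 5 * u)) with (i ^ 2 * p) by (unfold p, i; field; auto).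
replace (/ z ^ 3 + (- a * z - 2 * b * z ^ 3 + z ^ 4 * v)) with (i ^ 3 * d) by (unfold d, i; field; auto).
(* Powers of [i * z = 1] balance the terms, so that [ring] can treat [i] and [z] as independent
   variables. *)
transitivity (4 * (i ^ 3 * d * (i ^ 3 * d)) - 4 * (i ^ 2 * p * (i ^ 2 * p * (i ^ 2 * p))) +
  20 * a * (i ^ 2 * p) * (i * z) ^ 4 + 28 * b * (i * z) ^ 6); [rewrite Hi; ring|].
match goal with |- _ = z * ?Q => transitivity ((i * z) ^ 6 * (z * Q)); [|rewrite Hi; ring] end.
unfold p, d. ring.
Qed.

(** The same cancellation for [wp'' = 6 wp ^ 2 - g2 / 2], where [wp''] is [6 W_4]. *)
Lemma second_expansion (z a b u t : C) : z <> 0 ->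
  6 * (/ z ^ 4 + (a / 3 + 2 * b * z ^ 2 + z ^ 3 * t))
  - 6 * ((/ z ^ 2 + (a * z ^ 2 + b * z ^ 4 + z ^ 5 * u)) * (/ z ^ 2 + (a * z ^ 2 + b * z ^ 4 + z ^ 5 * u))) + 10 * a
  = z * (6 * z ^ 2 * t - 12 * z ^ 2 * u - 6 * z ^ 3 * (a + b * z ^ 2 + z ^ 3 * u) ^ 2).
Proof.
intro Hz. set (i := / z). assert (Hi : i * z = 1) by (unfold i; field; auto).
replace (/ z ^ 4) with (i ^ 4) by (unfold i; field; auto). replace (/ z ^ 2) with (i ^ 2) by (unfold i; field; auto).
replace (6 * (i ^ 4 + (a / 3 + 2 * b * z ^ 2 + z ^ 3 * t))) with (6 * i ^ 4 + (2 * a + 12 * b * z ^ 2 + 6 * z ^ 3 * t)) by field.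
set (w := a + b * z ^ 2 + z ^ 3 * u).
replace (a * z ^ 2 + b * z ^ 4 + z ^ 5 * u) with (z ^ 2 * w) by (unfold w; ring).
transitivity (2 * a + 12 * b * z ^ 2 + 6 * z ^ 3 * t - 12 * (i * z) ^ 2 * w - 6 * (z ^ 2 * w) ^ 2 + 10 * a); [ring|].
rewrite Hi. unfold w. ring.
Qed.

Section Weierstrass.
Variable L : lattice.
Variables g2 g3 : C.
Hypothesis Hg2 : lattice_g2 L = g2.
Hypothesis Hg3 : lattice_g3 L = g3.

Lemma wsum4_0 : wsum L 4 0 = g2 / 60.
Proof.
rewrite wsum_lattice_sum_pow by lia. rewrite <- Hg2. unfold lattice_g2. simpl. field.
Qed.

Lemma wsum6_0 : wsum L 6 0 = g3 / 140.
Proof.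
rewrite wsum_lattice_sum_pow by lia. rewrite <- Hg3. unfold lattice_g3. simpl. field.
Qed.

(** The descent starts from the value of the regular sum of index 6 and a Lipschitz bound there, and
    integrates down to index 2. The constants of integration vanish for odd index by parity and for
    index 2 by the regularisation, and for index 4 the constant is [g2 / 60]. *)
Lemma wsum_expansion : exists (r : R) (u v t : C -> C), (0 < r)%R /\ bdp u r /\ bdp v r /\ bdp t r /\
  forall z, (0 < Cmod z < r)%R ->
    wsum L 2 z = g2 / 20 * z ^ 2 + g3 / 28 * z ^ 4 + z ^ 5 * u z /\
    wsum L 3 z = - (g2 / 20) * z - g3 / 14 * z ^ 3 + z ^ 4 * v z /\
    wsum L 4 z = g2 / 60 + g3 / 14 * z ^ 2 + z ^ 3 * t z.
Proof.
destruct (regular_near (@regular_0 L)) as (r0 & Hr0 & Hreg).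
assert (Hreg' : forall z, (Cmod z < r0)%R -> regular L z).
{ intros z Hz. apply Hreg. replace (z - 0) with z by ring. auto. }
assert (Dw : forall k z, (1 <= k)%nat -> (Cmod z < r0)%R -> D (wsum L k) z (- RtoC (INR k) * wsum L (S k) z)).
{ intros. apply wsum_derive; auto. }
assert (S6 : exists M r, (0 < r <= r0)%R /\ forall z, (Cmod z < r)%R -> (Cmod (wsum L 6 z - g3 / 140) <= M * Cmod z ^ 1)%R).
{ destruct (D_bound (@Dw 6%nat 0 ltac:(lia) ltac:(rewrite Cmod_0; auto))) as (r & Hr & K).
  eexists; exists (Rmin r r0). split; [split; [apply Rmin_pos; auto|apply Rmin_r]|].
  intros z Hz. rewrite <- wsum6_0. assert (A := Rlt_le_trans _ _ _ Hz (Rmin_l _ _)).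
  specialize (K z). replace (z - 0) with z in K by ring. rewrite pow_1. apply K. auto. }
destruct S6 as (M & r & Hr & S6).
assert (S5 : forall z, (Cmod z < r)%R -> (Cmod (wsum L 5 z + g3 / 28 * z) <= 5 * M * Cmod z ^ 2)%R).
{ apply (@bound_integrate (fun z => wsum L 5 z + g3 / 28 * z) (fun z => (- 5) * (wsum L 6 z - g3 / 140))).
  - intros z Hz. eapply D_eq; [|apply D_plus; [apply Dw; [lia|lra]|apply D_scal, D_id]].
    change (INR 5) with (1+1+1+1+1)%R. rewrite !RtoC_plus. field.
  - intros z Hz. rewrite Cmod_mult. replace (Cmod (- 5)) with 5%R by (rewrite Cmod_R, Rabs_left; lra).
    rewrite Rmult_assoc. apply Rmult_le_compat_l; [lra|]. auto.
  - rewrite wsum_0_odd; [ring|lia|ring]. }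
assert (S4 : forall z, (Cmod z < r)%R -> (Cmod (wsum L 4 z - (g2 / 60 + g3 / 14 * z ^ 2)) <= 4 * (5 * M) * Cmod z ^ 3)%R).
{ apply (@bound_integrate (fun z => wsum L 4 z - (g2 / 60 + g3 / 14 * z ^ 2)) (fun z => (- 4) * (wsum L 5 z + g3 / 28 * z))).
  - intros z Hz. eapply D_eq; [|apply D_minus; [apply Dw; [lia|lra]|apply D_plus; [apply D_const|apply D_scal, D_pow, D_id]]].
    change (INR 4) with (1+1+1+1)%R. change (INR 2) with (1+1)%R. rewrite !RtoC_plus. simpl. field.
  - intros z Hz. rewrite Cmod_mult. replace (Cmod (- 4)) with 4%R by (rewrite Cmod_R, Rabs_left; lra).
    rewrite (Rmult_assoc 4 (5 * M)). apply Rmult_le_compat_l; [lra|]. auto.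
  - rewrite wsum4_0. simpl. field. }
assert (S3 : forall z, (Cmod z < r)%R -> (Cmod (wsum L 3 z - (- (g2 / 20) * z - g3 / 14 * z ^ 3)) <= 3 * (4 * (5 * M)) * Cmod z ^ 4)%R).
{ apply (@bound_integrate (fun z => wsum L 3 z - (- (g2 / 20) * z - g3 / 14 * z ^ 3)) (fun z => (- 3) * (wsum L 4 z - (g2 / 60 + g3 / 14 * z ^ 2)))).
  - intros z Hz. eapply D_eq; [|apply D_minus; [apply Dw; [lia|lra]|apply D_minus; [apply D_scal, D_id|apply D_scal, D_pow, D_id]]].
    change (INR 3) with (1+1+1)%R. rewrite !RtoC_plus. simpl. field.
  - intros z Hz. rewrite Cmod_mult. replace (Cmod (- 3)) with 3%R by (rewrite Cmod_R, Rabs_left; lra).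
    rewrite (Rmult_assoc 3). apply Rmult_le_compat_l; [lra|]. auto.
  - rewrite wsum_0_odd; [simpl; ring|lia|ring]. }
assert (S2 : forall z, (Cmod z < r)%R -> (Cmod (wsum L 2 z - (g2 / 20 * z ^ 2 + g3 / 28 * z ^ 4)) <= 2 * (3 * (4 * (5 * M))) * Cmod z ^ 5)%R).
{ apply (@bound_integrate (fun z => wsum L 2 z - (g2 / 20 * z ^ 2 + g3 / 28 * z ^ 4)) (fun z => (- 2) * (wsum L 3 z - (- (g2 / 20) * z - g3 / 14 * z ^ 3)))).
  - intros z Hz. eapply D_eq; [|apply D_minus; [apply Dw; [lia|lra]|apply D_plus; apply D_scal, D_pow, D_id]].
    change (INR 4) with (1+1+1+1)%R. change (INR 2) with (1+1)%R. rewrite !RtoC_plus. simpl. field.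
  - intros z Hz. rewrite Cmod_mult. replace (Cmod (- 2)) with 2%R by (rewrite Cmod_R, Rabs_left; lra).
    rewrite (Rmult_assoc 2). apply Rmult_le_compat_l; [lra|]. auto.
  - rewrite wsum_0_low; [simpl; ring|lia]. }
exists r, (fun z => (wsum L 2 z - (g2 / 20 * z ^ 2 + g3 / 28 * z ^ 4)) / z ^ 5),
  (fun z => (wsum L 3 z - (- (g2 / 20) * z - g3 / 14 * z ^ 3)) / z ^ 4),
  (fun z => (wsum L 4 z - (g2 / 60 + g3 / 14 * z ^ 2)) / z ^ 3).
split; [lra|]. split; [eapply (bdp_quotient _ _ S2)|]. split; [eapply (bdp_quotient _ _ S3)|]. split; [eapply (bdp_quotient _ _ S4)|].
intros z [Hz _]. assert (z <> 0) by (apply Cmod_gt_0; auto).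
repeat split; field; auto.
Qed.

Ltac bd := repeat first [assumption | apply bdp_plus | apply bdp_minus | apply bdp_mult | apply bdp_opp | apply bdp_pow
   | apply bdp_const | apply bdp_id].

Lemma Wf_cont k z : (1 <= k)%nat -> ~ in_lattice L z -> contC (Wf L k) z.
Proof. intros Hk Hz. eapply D_cont. apply Wf_derive; auto. Qed.

Ltac dW := repeat match goal with
  | |- D (fun z => Wf ?L ?k z) _ _ => apply (@Wf_derive L k); [lia|assumption]
  | |- D (Wf ?L ?k) _ _ => apply (@Wf_derive L k); [lia|assumption]
  | _ => dstep
  end.

Lemma weierstrass_cubic z : ~ in_lattice L z ->
  4 * (Wf L 3 z * Wf L 3 z) - 4 * (Wf L 2 z * (Wf L 2 z * Wf L 2 z)) + g2 * Wf L 2 z + g3 = 0.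
Proof.
apply (@elliptic_liouville L (in_lattice L)
  (fun z => 4 * (Wf L 3 z * Wf L 3 z) - 4 * (Wf L 2 z * (Wf L 2 z * Wf L 2 z)) + g2 * Wf L 2 z + g3)
  (fun z => - 24 * (Wf L 3 z * Wf L 4 z) + 24 * (Wf L 2 z * (Wf L 2 z * Wf L 3 z)) - 2 * g2 * Wf L 3 z)).
- intros l w Hl Hw. apply in_lattice_add; auto.
- intros l w Hl Hw. rewrite !Wf_periodic by (auto; lia). reflexivity.
- apply limp_lattice.
  { intros l w Hl Hw. rewrite !Wf_periodic by (auto; lia). reflexivity. }
  destruct wsum_expansion as (r & u & v & t & Hr & Bu & Bv & Bt & E).
  set (a := g2 / 20) in *. set (b := g3 / 28) in *.
  set (Q := fun z => 8 * v z - 12 * u z + z * (4 * (- a - 2 * b * z ^ 2 + z ^ 3 * v z) ^ 2 - 12 * (a + b * z ^ 2 + z ^ 3 * u z) ^ 2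
     + 20 * a * (a + b * z ^ 2 + z ^ 3 * u z)) - 4 * z ^ 5 * (a + b * z ^ 2 + z ^ 3 * u z) ^ 3).
  apply (@limp_ext (fun z => 0 + z * Q z) _ 0 0 r Hr).
  + intros z0 Hz0. replace (z0 - 0) with z0 in Hz0 by ring. destruct (E z0 Hz0) as (E2 & E3 & E4).
    assert (Hz : z0 <> 0) by (apply Cmod_gt_0; lra).
    unfold Wf. rewrite E2, E3. unfold Q. rewrite <- cubic_expansion by auto.
    replace g2 with (20 * a) by (unfold a; field). replace g3 with (28 * b) by (unfold b; field).
    replace (28 * b / 14) with (2 * b) by field. ring.
  + apply limp_0_bdp with r; auto. unfold Q. bd.
- apply lattice_discrete.
- intros p Hp. split.
  + eapply D_eq; [|dW].
    change (INR 3) with (1+1+1)%R. change (INR 2) with (1+1)%R. rewrite !RtoC_plus. ring.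
  + apply D_ex_cont. eexists. dW.
- exists 0. apply in_lattice_0.
Qed.

Lemma weierstrass_second z : ~ in_lattice L z ->
  6 * Wf L 4 z = 6 * (Wf L 2 z * Wf L 2 z) - g2 / 2.
Proof.
intro Hz. cut (6 * Wf L 4 z - 6 * (Wf L 2 z * Wf L 2 z) + g2 / 2 = 0).
{ intro H. replace (6 * Wf L 4 z) with ((6 * Wf L 4 z - 6 * (Wf L 2 z * Wf L 2 z) + g2 / 2) + (6 * (Wf L 2 z * Wf L 2 z) - g2 / 2)) by ring.
  rewrite H. ring. }
revert z Hz.
apply (@elliptic_liouville L (in_lattice L)
  (fun z => 6 * Wf L 4 z - 6 * (Wf L 2 z * Wf L 2 z) + g2 / 2)
  (fun z => - 24 * Wf L 5 z + 24 * (Wf L 2 z * Wf L 3 z))).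
- intros l w Hl Hw. apply in_lattice_add; auto.
- intros l w Hl Hw. rewrite !Wf_periodic by (auto; lia). reflexivity.
- apply limp_lattice.
  { intros l w Hl Hw. rewrite !Wf_periodic by (auto; lia). reflexivity. }
  destruct wsum_expansion as (r & u & v & t & Hr & Bu & Bv & Bt & E).
  set (a := g2 / 20) in *. set (b := g3 / 28) in *.
  set (Q := fun z => 6 * z ^ 2 * t z - 12 * z ^ 2 * u z - 6 * z ^ 3 * (a + b * z ^ 2 + z ^ 3 * u z) ^ 2).
  apply (@limp_ext (fun z => 0 + z * Q z) _ 0 0 r Hr).
  + intros z0 Hz0. replace (z0 - 0) with z0 in Hz0 by ring. destruct (E z0 Hz0) as (E2 & E3 & E4).
    assert (Hz : z0 <> 0) by (apply Cmod_gt_0; lra).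
    unfold Wf. rewrite E2, E4. unfold Q. rewrite <- second_expansion by auto.
    replace (g2 / 2) with (10 * a) by (unfold a; field). replace (g2 / 60) with (a / 3) by (unfold a; field).
    replace (g3 / 14) with (2 * b) by (unfold b; field). ring.
  + apply limp_0_bdp with r; auto. unfold Q. bd.
- apply lattice_discrete.
- intros p Hp. split.
  + eapply D_eq; [|dW].
    change (INR 4) with (1+1+1+1)%R. change (INR 2) with (1+1)%R. rewrite !RtoC_plus. ring.
  + apply D_ex_cont. eexists. dW.
- exists 0. apply in_lattice_0.
Qed.

End Weierstrass.

(** * The addition theorems *)

Ltac inr := rewrite ?INR_IZR_INZ; simpl Z.of_nat.

(** The combination of zeta functions that occurs in the torus coefficient, with [w = varkappa]. It
    is elliptic in [z], and its classical value is [wp'(w) / (wp(z) - wp(w))]. *)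
Definition zeta_diff (L : lattice) (w z : C) : C := Wf L 1 (z - w) - Wf L 1 (z + w) + 2 * Wf L 1 w.

Lemma D_shift f z c a : D f (z + c) a -> D (fun z => f (z + c)) z a.
Proof.
intro H. eapply D_eq; [|apply (@D_comp f (fun z => z + c) z a (1 + 0)); auto].
- ring.
- apply D_plus; [apply D_id|apply D_const].
Qed.

Lemma D_shift_sub f z c a : D f (z - c) a -> D (fun z => f (z - c)) z a.
Proof. apply (@D_shift f z (- c) a). Qed.

(** The terms of the difference of the two series decay quadratically, so [shift_lim] applies to it
    directly. The regularising parts leave a multiple of [w] that does not depend on [z] and
    cancels; no quasi-period has to be named. *)
Lemma zeta_diff_periodic L w l z : in_lattice L l -> ~ in_lattice L (z - w) -> ~ in_lattice L (z + w) ->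
  zeta_diff L w (z + l) = zeta_diff L w z.
Proof.
intros Hl H1 H2.
apply (@periodic_on_lattice L (fun z => ~ in_lattice L (z - w) /\ ~ in_lattice L (z + w)) (zeta_diff L w)); auto.
- clear. intros l z Hl [H1 H2]. split; intro K.
  + apply H1. apply (in_lattice_shift (z - w) Hl). replace (z - w + l) with (z + l - w) by ring. auto.
  + apply H2. apply (in_lattice_shift (z + w) Hl). replace (z + w + l) with (z + l + w) by ring. auto.
- clear. intros z [H1 H2].
  destruct (regular_lower (not_lattice_regular H1)) as (c1 & r1 & Hc1 & Hr1 & _ & B1).
  destruct (regular_lower (not_lattice_regular H2)) as (c2 & r2 & Hc2 & Hr2 & _ & B2).
  specialize (B1 _ (ball_center _ Hr1)). specialize (B2 _ (ball_center _ Hr2)).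
  destruct (@shift_lim L (fun y => / (y - w) ^ 1 - / (y + w) ^ 1) z (Cmod (2 * w) / (c1 * c2))) as [S1 S2].
  { apply Rmult_le_pos; [apply Cmod_ge_0|]. apply Rlt_le, Rinv_0_lt_compat, Rmult_lt_0_compat; auto. }
  { intros m n Hmn. specialize (B1 m n Hmn). specialize (B2 m n Hmn).
    assert (K1 : (1 <= IZR (znorm m n))%R) by (apply IZR_le; auto).
    set (l := lattice_pt L m n) in *. set (x := IZR (znorm m n)) in *.
    assert (N1 : z - w - l <> 0) by (apply Cmod_gt_0; nra).
    assert (N2 : z + w - l <> 0) by (apply Cmod_gt_0; nra).
    assert (N1' : z - l - w <> 0) by (replace (z - l - w) with (z - w - l) by ring; auto).
    assert (N2' : z - l + w <> 0) by (replace (z - l + w) with (z + w - l) by ring; auto).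
    replace (/ (z - l - w) ^ 1 - / (z - l + w) ^ 1) with (2 * w * / ((z - w - l) * (z + w - l))) by (field; auto).
    rewrite Cmod_mult. unfold Rdiv. rewrite Rmult_assoc. apply Rmult_le_compat_l; [apply Cmod_ge_0|].
    rewrite Cmod_inv by (apply Cmult_neq_0; auto). rewrite <- Rinv_mult. apply Rinv_le_contravar.
    - repeat apply Rmult_lt_0_compat; auto; try (apply pow_lt); lra.
    - rewrite Cmod_mult. replace (c1 * c2 * x ^ 2)%R with ((c1 * x) * (c2 * x))%R by ring.
      apply Rmult_le_compat; auto; apply Rmult_le_pos; lra. }
  assert (G : forall o, in_lattice L o ->
    CL (fun N => zbox (fun m n => / (z + o - lattice_pt L m n - w) ^ 1 - / (z + o - lattice_pt L m n + w) ^ 1) N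
       - zbox (fun m n => / (z - lattice_pt L m n - w) ^ 1 - / (z - lattice_pt L m n + w) ^ 1) N) 0 ->
    zeta_diff L w (z + o) = zeta_diff L w z).
  { intros o Ho H.
    assert (H1' : ~ in_lattice L (z + o - w)).
    { replace (z + o - w) with (z - w + o) by ring. intro K. apply H1, (in_lattice_shift (z - w) Ho), K. }
    assert (H2' : ~ in_lattice L (z + o + w)).
    { replace (z + o + w) with (z + w + o) by ring. intro K. apply H2, (in_lattice_shift (z + w) Ho), K. }
    assert (A1 := @Wf_lim L 1 _ (Nat.le_refl 1) H1). assert (A2 := @Wf_lim L 1 _ (Nat.le_refl 1) H2).
    assert (A3 := @Wf_lim L 1 _ (Nat.le_refl 1) H1'). assert (A4 := @Wf_lim L 1 _ (Nat.le_refl 1) H2').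
    apply Ceq_minus. unfold zeta_diff.
    replace (Wf L 1 (z + o - w) - Wf L 1 (z + o + w) + 2 * Wf L 1 w - (Wf L 1 (z - w) - Wf L 1 (z + w) + 2 * Wf L 1 w))
      with ((Wf L 1 (z + o - w) - Wf L 1 (z + o + w)) - (Wf L 1 (z - w) - Wf L 1 (z + w))) by ring.
    eapply CL_unique; [apply (CL_minus (CL_minus A3 A4) (CL_minus A1 A2))|].
    eapply CL_ext; [|exact H]. intro N. cbv beta. unfold wreg.
    assert (T : forall y, zbox (fun m n => / (y - lattice_pt L m n - w) ^ 1 - / (y - lattice_pt L m n + w) ^ 1) N =
      zbox (fun m n => / (y - w - lattice_pt L m n) ^ 1) N + (-(1)) * zbox (fun m n => / (y + w - lattice_pt L m n) ^ 1) N).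
    { intro y. rewrite <- zbox_scal, <- zbox_plus. apply zbox_ext. intros m n.
      replace (y - lattice_pt L m n - w) with (y - w - lattice_pt L m n) by ring.
      replace (y - lattice_pt L m n + w) with (y + w - lattice_pt L m n) by ring. ring. }
    rewrite (T z), (T (z + o)). ring. }
  split; apply G; auto; [apply in_lattice_om1|apply in_lattice_om2].
Qed.

Lemma min3_pos (x y z : R) : (0 < x)%R -> (0 < y)%R -> (0 < z)%R ->
  exists r, (0 < r)%R /\ (r <= x)%R /\ (r <= y)%R /\ (r <= z)%R.
Proof.
intros. exists (Rmin x (Rmin y z)). split; [repeat apply Rmin_pos; auto|].
assert (A := Rmin_r x (Rmin y z)). split; [apply Rmin_l|]. split; (eapply Rle_trans; [exact A|]); [apply Rmin_l|apply Rmin_r].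
Qed.

Section Addition.
Variable L : lattice.

Lemma Wf_opp_lattice z : ~ in_lattice L z -> ~ in_lattice L (- z).
Proof. intros H K. apply H. replace z with (- - z) by ring. apply in_lattice_opp; auto. Qed.

Lemma zeta_diff_derive w z : ~ in_lattice L (z - w) -> ~ in_lattice L (z + w) ->
  D (zeta_diff L w) z (- Wf L 2 (z - w) + Wf L 2 (z + w)).
Proof.
intros H1 H2. unfold zeta_diff. eapply D_eq; [|apply D_plus; [apply D_minus|apply D_const]].
2:{ apply (@D_shift_sub (Wf L 1)). apply Wf_derive; auto. }
2:{ apply (@D_shift (Wf L 1)). apply Wf_derive; auto. }
simpl. ring.
Qed.

Lemma not_lattice_locally z : ~ in_lattice L z -> exists r, (0 < r)%R /\ forall y, (Cmod (y - z) < r)%R -> ~ in_lattice L y.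
Proof.
intro Hz. destruct (lattice_discrete L z) as (r & Hr & H). exists r. split; auto. intros y Hy.
destruct (Ceq_dec y z) as [->|N]; auto. apply H. split; auto. apply Cmod_gt_0. intro E. apply N, Ceq_minus; auto.
Qed.

Variable w : C.
Hypothesis Hw : ~ in_lattice L w.

Let near0 : exists r, (0 < r)%R /\ forall z, (Cmod z < r)%R -> ~ in_lattice L (z - w) /\ ~ in_lattice L (z + w).
Proof.
destruct (not_lattice_locally Hw) as (r1 & Hr1 & K1). destruct (not_lattice_locally (Wf_opp_lattice Hw)) as (r2 & Hr2 & K2).
exists (Rmin r1 r2). split; [apply Rmin_pos; auto|]. intros z Hz.
assert (A := Rlt_le_trans _ _ _ Hz (Rmin_l _ _)). assert (B := Rlt_le_trans _ _ _ Hz (Rmin_r _ _)).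
split; [apply K2|apply K1].
- replace (z - w - - w) with z by ring. auto.
- replace (z + w - w) with z by ring. auto.
Qed.

(** The double zero at 0 will meet the double pole of [wp]. It is obtained by integrating twice from
    the second derivative [E2], whose value at 0 is [- 4 W_3(w)]; the parity of the [W_k] makes the
    lower terms vanish. *)
Lemma zeta_diff_expansion : exists (r : R) (u : C -> C), (0 < r)%R /\ bdp u r /\
  forall z, (0 < Cmod z < r)%R -> zeta_diff L w z = - 2 * Wf L 3 w * z ^ 2 + z ^ 3 * u z.
Proof.
destruct near0 as (r0 & Hr0 & Hn).
set (E2 := fun z => 2 * Wf L 3 (z - w) - 2 * Wf L 3 (z + w)).
assert (DE2 : forall z, (Cmod z < r0)%R -> exists d, D E2 z d).
{ intros z Hz. destruct (Hn z Hz) as [H1 H2]. eexists. unfold E2. apply D_minus; apply D_scal.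
  - apply (@D_shift_sub (Wf L 3)), Wf_derive; auto.
  - apply (@D_shift (Wf L 3)), Wf_derive; auto. }
destruct (DE2 0) as (d & Hd); [rewrite Cmod_0; auto|].
destruct (D_bound Hd) as (r1 & Hr1 & B). set (M := (Cmod d + 1)%R) in *.
assert (E20 : E2 0 = - 4 * Wf L 3 w).
{ unfold E2. replace (0 - w) with (- w) by ring. rewrite Wf_opp by (auto; lia).
  replace (0 + w) with w by ring. simpl. ring. }
set (r := Rmin r0 r1). assert (Hr : (0 < r)%R) by (apply Rmin_pos; auto).
assert (R0 : (r <= r0)%R) by apply Rmin_l. assert (R1 : (r <= r1)%R) by apply Rmin_r.
assert (B2 : forall z, (Cmod z < r)%R -> (Cmod (E2 z + 4 * Wf L 3 w) <= M * Cmod z ^ 1)%R).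
{ intros z Hz. specialize (B z). replace (z - 0) with z in B by ring. rewrite E20 in B.
  replace (E2 z + 4 * Wf L 3 w) with (E2 z - - 4 * Wf L 3 w) by ring. rewrite pow_1. apply B. lra. }
assert (B1 : forall z, (Cmod z < r)%R -> (Cmod (- Wf L 2 (z - w) + Wf L 2 (z + w) + 4 * Wf L 3 w * z) <= M * Cmod z ^ 2)%R).
{ apply (@bound_integrate (fun z => - Wf L 2 (z - w) + Wf L 2 (z + w) + 4 * Wf L 3 w * z) (fun z => E2 z + 4 * Wf L 3 w)); auto.
  - intros z Hz. destruct (Hn z ltac:(lra)) as [H1 H2].
    eapply D_eq; [|apply D_plus; [apply D_plus; [apply D_opp, (@D_shift_sub (Wf L 2)), Wf_derive; auto|apply (@D_shift (Wf L 2)), Wf_derive; auto]|apply D_scal, D_id]].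
    unfold E2. change (INR 2) with (1+1)%R. rewrite !RtoC_plus. ring.
  - replace (0 - w) with (- w) by ring. rewrite Wf_opp by (auto; lia). replace (0 + w) with w by ring. simpl. ring. }
assert (B0 : forall z, (Cmod z < r)%R -> (Cmod (zeta_diff L w z - - 2 * Wf L 3 w * z ^ 2) <= M * Cmod z ^ 3)%R).
{ apply (@bound_integrate (fun z => zeta_diff L w z - - 2 * Wf L 3 w * z ^ 2) (fun z => - Wf L 2 (z - w) + Wf L 2 (z + w) + 4 * Wf L 3 w * z)); auto.
  - intros z Hz. destruct (Hn z ltac:(lra)) as [H1 H2].
    eapply D_eq; [|apply D_minus; [apply zeta_diff_derive; auto|apply D_scal, D_pow, D_id]].
    change (INR 2) with (1+1)%R. rewrite !RtoC_plus. simpl. ring.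
  - unfold zeta_diff. replace (0 - w) with (- w) by ring. rewrite Wf_opp by (auto; lia). replace (0 + w) with w by ring. simpl. ring. }
exists r, (fun z => (zeta_diff L w z - - 2 * Wf L 3 w * z ^ 2) / z ^ 3). split; auto.
split; [eapply (bdp_quotient _ _ B0)|]. intros z [Hz _]. assert (z <> 0) by (apply Cmod_gt_0; auto). field. auto.
Qed.

Hypothesis H2w : ~ in_lattice L (2 * w).

Let Sing z := in_lattice L z \/ in_lattice L (z - w) \/ in_lattice L (z + w).

Let F z := (Wf L 2 z - Wf L 2 w) * zeta_diff L w z.

Let Sing_shift l z : in_lattice L l -> (Sing (z + l) <-> Sing z).
Proof.
intro Hl. unfold Sing.
replace (z + l - w) with (z - w + l) by ring. replace (z + l + w) with (z + w + l) by ring.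
rewrite !(fun z => in_lattice_shift z Hl). tauto.
Qed.

Let F_periodic l z : in_lattice L l -> ~ Sing z -> F (z + l) = F z.
Proof.
intros Hl Hz. unfold Sing in Hz. unfold F. rewrite Wf_periodic, zeta_diff_periodic; auto; tauto.
Qed.

Let F_even z : ~ Sing z -> F (- z) = F z.
Proof.
intro Hz. unfold Sing in Hz. unfold F. rewrite Wf_opp by (lia || tauto). unfold zeta_diff.
replace (- z - w) with (- (z + w)) by ring. replace (- z + w) with (- (z - w)) by ring.
rewrite !Wf_opp by (lia || tauto). simpl. ring.
Qed.

Let Sing_discrete p : exists r, (0 < r)%R /\ forall z, (0 < Cmod (z - p) < r)%R -> ~ Sing z.
Proof.
destruct (lattice_discrete L p) as (r1 & Hr1 & K1). destruct (lattice_discrete L (p - w)) as (r2 & Hr2 & K2).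
destruct (lattice_discrete L (p + w)) as (r3 & Hr3 & K3).
destruct (min3_pos Hr1 Hr2 Hr3) as (r & Hr & A1 & A2 & A3).
exists r. split; auto. intros z Hz [H|[H|H]].
- apply (K1 z); auto; lra.
- apply (K2 (z - w)); auto. replace (z - w - (p - w)) with (z - p) by ring. lra.
- apply (K3 (z + w)); auto. replace (z + w - (p + w)) with (z - p) by ring. lra.
Qed.

Let F_lim_0 : limp F 0 (- 2 * Wf L 3 w).
Proof.
destruct zeta_diff_expansion as (r1 & u & Hr1 & Bu & Eu).
destruct (regular_near (@regular_0 L)) as (r2 & Hr2 & Hreg).
destruct (D_bound (wsum_derive (k := 2) ltac:(lia) (@regular_0 L))) as (r3 & Hr3 & B3).
destruct (min3_pos Hr1 Hr2 Hr3) as (r & Hr & A1 & A2 & A3).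
set (s := wsum L 2) in *.
assert (Bs : bdp s r).
{ eexists. intros z Hz. specialize (B3 z). replace (z - 0) with z in B3 by ring.
  specialize (B3 ltac:(lra)). replace (s z) with ((s z - s 0) + s 0) by ring.
  eapply Rle_trans; [apply Cmod_triangle|]. eapply Rle_trans; [apply Rplus_le_compat_r, B3|].
  apply Rplus_le_compat_r. apply Rmult_le_compat_l; [|apply Rlt_le, (proj2 Hz)].
  match goal with |- (0 <= Cmod ?x + 1)%R => assert (X := Cmod_ge_0 x); lra end. }
assert (Bu' : bdp u r).
{ destruct Bu as (B & HB). exists B. intros z Hz. apply HB. lra. }
set (Q := fun z => u z + (s z - Wf L 2 w) * (- 2 * Wf L 3 w * z + z ^ 2 * u z)).
apply (@limp_ext (fun z => - 2 * Wf L 3 w + z * Q z) _ 0 _ r Hr).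
- intros z Hz. replace (z - 0) with z in Hz by ring. unfold F, Q. rewrite Eu by lra.
  assert (z <> 0) by (apply Cmod_gt_0; lra).
  change (Wf L 2 z) with (/ z ^ 2 + s z). field. auto.
- apply limp_0_bdp with r; auto. unfold Q.
  repeat first [assumption | apply bdp_plus | apply bdp_minus | apply bdp_mult | apply bdp_pow | apply bdp_const | apply bdp_id].
Qed.

(** The simple pole of zeta meets the simple zero of [wp(z) - wp(w)], and the limit is the
    derivative [wp'(w) = - 2 W_3(w)]. The remaining factor [R] is continuous at [w] because [2 w] is
    not a period. *)
Let F_lim_w : limp F w (- 2 * Wf L 3 w).
Proof.
set (R := fun z => wsum L 1 (z - w) - Wf L 1 (z + w) + 2 * Wf L 1 w).
destruct (Sing_discrete w) as (r & Hr & Hd).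
apply (@limp_ext (fun z => (Wf L 2 z - Wf L 2 w) / (z - w) + (Wf L 2 z - Wf L 2 w) * R z) _ w _ r Hr).
- intros z Hz. unfold F, zeta_diff, R. unfold Wf at 9.
  assert (z - w <> 0) by (apply Cmod_gt_0; lra).
  change (Wf L 1 (z - w)) with (/ (z - w) ^ 1 + wsum L 1 (z - w)). field. auto.
- replace (- 2 * Wf L 3 w) with (- 2 * Wf L 3 w + 0 * R w) by ring.
  apply limp_plus.
  + eapply limp_D_quotient. eapply D_eq; [|apply Wf_derive; auto]. inr. ring.
  + apply limp_mult.
    * replace (RtoC 0) with (Wf L 2 w - Wf L 2 w) by ring. apply contC_limp with (f := fun z => Wf L 2 z - Wf L 2 w).
      eapply D_cont. apply D_minus; [apply Wf_derive; auto|apply D_const].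
    * apply contC_limp. eapply D_cont. unfold R. apply D_plus; [apply D_minus|apply D_const].
      -- apply (@D_shift_sub (wsum L 1)). apply wsum_derive; auto. replace (w - w) with (RtoC 0) by ring. apply regular_0.
      -- apply (@D_shift (Wf L 1)). apply Wf_derive; auto. replace (w + w) with (2 * w) by ring. auto.
Qed.

Let F_lim_mw : limp F (- w) (- 2 * Wf L 3 w).
Proof.
intros eps He. destruct (F_lim_w He) as (d & Hd & K). destruct (Sing_discrete (- w)) as (r & Hr & Hs).
exists (Rmin r d). split; [apply Rmin_pos; auto|]. intros z [Hz1 Hz2].
assert (A := Rlt_le_trans _ _ _ Hz2 (Rmin_l _ _)). assert (B := Rlt_le_trans _ _ _ Hz2 (Rmin_r _ _)).
rewrite <- F_even by (apply Hs; auto). apply K.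
replace (- z - w) with (- (z - - w)) by ring. rewrite Cmod_opp. auto.
Qed.

Let F_lim p : Sing p -> limp F p (- 2 * Wf L 3 w).
Proof.
intro Hp.
assert (T : forall p0 l, in_lattice L l -> limp F p0 (- 2 * Wf L 3 w) -> limp F (p0 + l) (- 2 * Wf L 3 w)).
{ intros p0 l Hl H eps He. destruct (H eps He) as (d & Hd & K). destruct (Sing_discrete p0) as (r & Hr & Hs).
  exists (Rmin r d). split; [apply Rmin_pos; auto|]. intros z [Hz1 Hz2].
  assert (A := Rlt_le_trans _ _ _ Hz2 (Rmin_l _ _)). assert (B := Rlt_le_trans _ _ _ Hz2 (Rmin_r _ _)).
  replace (z - (p0 + l)) with (z - l - p0) in * by ring.
  replace z with (z - l + l) by ring. rewrite F_periodic; auto. }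
destruct Hp as [H|[H|H]].
- replace p with (0 + p) by ring. auto.
- replace p with (w + (p - w)) by ring. auto.
- replace p with (- w + (p + w)) by ring. auto.
Qed.

Lemma zeta_addition z : ~ in_lattice L z -> ~ in_lattice L (z - w) -> ~ in_lattice L (z + w) ->
  (Wf L 2 z - Wf L 2 w) * zeta_diff L w z = - 2 * Wf L 3 w.
Proof.
intros H1 H2 H3.
apply (@elliptic_liouville L Sing F
  (fun z => - 2 * Wf L 3 z * zeta_diff L w z + (Wf L 2 z - Wf L 2 w) * (- Wf L 2 (z - w) + Wf L 2 (z + w)))).
- intros l x Hl Hx. apply Sing_shift; auto.
- intros l x Hl Hx. apply F_periodic; auto.
- intros p Hp. apply F_lim. auto.
- apply Sing_discrete.
- intros p Hp. unfold Sing in Hp. split.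
  + unfold F. eapply D_eq; [|apply D_mult; [apply D_minus; [apply Wf_derive; [lia|tauto]|apply D_const]|apply zeta_diff_derive; tauto]].
    inr. ring.
  + apply D_ex_cont. eexists. apply D_plus; apply D_mult.
    * apply D_scal. apply Wf_derive; [lia|tauto].
    * apply zeta_diff_derive; tauto.
    * apply D_minus; [apply Wf_derive; [lia|tauto]|apply D_const].
    * apply D_plus; [apply D_opp; apply (@D_shift_sub (Wf L 2)), Wf_derive; [lia|tauto]
        |apply (@D_shift (Wf L 2)), Wf_derive; [lia|tauto]].
- exists 0. left. apply in_lattice_0.
- unfold Sing. tauto.
Qed.

End Addition.

(* The derivative of [zeta_addition] with respect to [w]. *)
Lemma wp_addition L w z : ~ in_lattice L w -> ~ in_lattice L (2 * w) ->
  ~ in_lattice L z -> ~ in_lattice L (z - w) -> ~ in_lattice L (z + w) ->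
  2 * Wf L 3 w * zeta_diff L w z + (Wf L 2 z - Wf L 2 w) * (Wf L 2 (z - w) + Wf L 2 (z + w) - 2 * Wf L 2 w)
  = 6 * Wf L 4 w.
Proof.
intros H1 H2 H3 H4 H5.
assert (Near : forall y, ~ in_lattice L y -> forall c : C, c = 1 \/ c = 2 \/ c = -(1) -> exists r, (0 < r)%R /\
   forall v, (Cmod (v - w) < r)%R -> ~ in_lattice L (y + c * (v - w))).
{ intros y Hy c Hc. destruct (not_lattice_locally Hy) as (r & Hr & K). exists (r / 2)%R. split; [lra|].
  intros v Hv. apply K. replace (y + c * (v - w) - y) with (c * (v - w)) by ring.
  rewrite Cmod_mult. assert (Cmod c <= 2)%R.
  { destruct Hc as [->|[->| ->]]; rewrite ?Cmod_opp, Cmod_R, Rabs_pos_eq; lra. }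
  assert (X := Cmod_ge_0 (v - w)). nra. }
destruct (Near w H1 1 ltac:(auto)) as (r1 & Hr1 & K1).
destruct (Near (2 * w) H2 2 ltac:(auto)) as (r2 & Hr2 & K2).
destruct (Near (z - w) H4 (-(1)) ltac:(auto)) as (r3 & Hr3 & K3).
destruct (Near (z + w) H5 1 ltac:(auto)) as (r4 & Hr4 & K4).
destruct (min3_pos Hr1 Hr2 Hr3) as (r & Hr & A1 & A2 & A3).
apply (@D_unique (fun v => (Wf L 2 z - Wf L 2 v) * zeta_diff L v z) w).
- eapply D_eq; [|apply D_mult; [apply D_minus; [apply D_const|apply Wf_derive; auto]|]].
  2:{ unfold zeta_diff. apply D_plus; [apply D_minus|apply D_scal, Wf_derive; auto].
      - apply (@D_comp (Wf L 1) (fun v => z - v) w); [apply Wf_derive; auto|apply D_minus; [apply D_const|apply D_id]].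
      - apply (@D_comp (Wf L 1) (fun v => z + v) w); [apply Wf_derive; auto|apply D_plus; [apply D_const|apply D_id]]. }
  cbv beta. fold (zeta_diff L w z). change (INR 2) with (1+1)%R. rewrite RtoC_plus. change (INR 1) with 1%R. ring.
- apply D_ext_loc with (fun v => - 2 * Wf L 3 v).
  + apply locally_Cmod. exists (Rmin r r4). split; [apply Rmin_pos; auto|]. intros v Hv.
    assert (V1 := Rlt_le_trans _ _ _ Hv (Rmin_l _ _)). assert (V2 := Rlt_le_trans _ _ _ Hv (Rmin_r _ _)).
    symmetry. apply zeta_addition; auto.
    * replace v with (w + 1 * (v - w)) by ring. apply K1; lra.
    * replace (2 * v) with (2 * w + 2 * (v - w)) by ring. apply K2; lra.
    * replace (z - v) with (z - w + -(1) * (v - w)) by ring. apply K3; lra.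
    * replace (z + v) with (z + w + 1 * (v - w)) by ring. apply K4; lra.
  + eapply D_eq; [|apply D_scal, Wf_derive; auto]. change (INR 3) with (1+1+1)%R. rewrite !RtoC_plus. ring.
Qed.

(** * The cover of the torus *)

(* The constants of the cover lie in the field of the 8th roots of unity, so
   everything is expressed by [xk], with [xk ^ 4 = -1] and [sqrt 2 = xk ^ 3 - xk]. *)
Definition xk : C := RtoC (sqrt 2 / 2) * (Ci - 1).

Lemma sqrt2_sq : (sqrt 2 * sqrt 2 = 2)%R.
Proof. apply sqrt_sqrt. lra. Qed.

Lemma xk_2 : xk ^ 2 = - Ci.
Proof.
unfold xk. assert (H := sqrt2_sq). set (r := sqrt 2) in *. clearbody r.
unfold Ci, Cpow, RtoC, Cminus, Cplus, Copp, Cmult; simpl. f_equal; field [H].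
Qed.

Lemma Ci_sq : Ci * Ci = -(1).
Proof. unfold Ci, RtoC, Copp, Cmult; simpl. f_equal; ring. Qed.

Lemma Ci_xk : Ci = - xk ^ 2.
Proof. rewrite xk_2. ring. Qed.

Lemma xk_4 : xk ^ 4 = -(1).
Proof. replace (xk ^ 4) with (xk ^ 2 * xk ^ 2) by ring. rewrite xk_2. rewrite <- Ci_sq. ring. Qed.

Lemma sqrt2_xk : RtoC (sqrt 2) = xk ^ 3 - xk.
Proof.
replace (xk ^ 3) with (xk ^ 2 * xk) by ring. rewrite xk_2. unfold xk.
assert (H := sqrt2_sq). set (r := sqrt 2) in *. clearbody r.
unfold Ci, RtoC, Cminus, Cplus, Copp, Cmult; simpl. f_equal; field [H].
Qed.

Lemma xk_neq0 : xk <> 0.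
Proof. intro E. assert (H := xk_4). rewrite E in H. apply C1_nz. replace (RtoC 1) with (- -(1)) by ring. rewrite <- H. simpl. ring. Qed.

Definition root1 : C := (xk ^ 3 - xk) / 3.
Definition root2 : C := - (3 + (xk ^ 3 - xk)) / 6.
Definition root3 : C := (3 - (xk ^ 3 - xk)) / 6.
Definition wpk : C := - (7 / 2) - 13 / 6 * (xk ^ 3 - xk).
Definition dlt : C := 1 + (xk ^ 3 - xk).

(** Its zeros [i] and [- 1] are the two points that the cover sends to infinity. *)
Definition den (x : C) : C := (x - Ci) * (x + 1).

Lemma cover_map_eq (x : C) : cover_map x = root2 + dlt / (x - Ci) - Ci * (dlt / (x + 1)).
Proof.
unfold cover_map, root2, dlt. rewrite <- sqrt2_xk.
replace (RtoC ((3 + sqrt 2) / 6)) with ((3 + RtoC (sqrt 2)) / 6).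
2:{ rewrite RtoC_div by lra. rewrite RtoC_plus. reflexivity. }
rewrite RtoC_plus. unfold Cdiv. ring.
Qed.

Lemma dlt_inv : dlt * (xk ^ 3 - xk - 1) = 1.
Proof. unfold dlt. ring [xk_4]. Qed.

Lemma dlt_neq0 : dlt <> 0.
Proof. intro E. assert (H := dlt_inv). rewrite E in H. apply C1_nz. rewrite <- H. ring. Qed.

Lemma den_factors (x : C) : den x <> 0 <-> x - Ci <> 0 /\ x + 1 <> 0.
Proof.
unfold den. split.
- intro H. split; intro E; apply H; rewrite E; ring.
- intros [H1 H2]. apply Cmult_neq_0; auto.
Qed.

(** This and the next three factorisations record the fibres: 0 and infinity over [root2], 1 and
    [- i] over [root1], and the double points [- xk] over [root3] and [xk] over [wpk]. *)
Lemma cover_root2 (x : C) : den x <> 0 -> cover_map x - root2 = dlt * (1 + xk ^ 2) * x / den x.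
Proof.
intro H. apply den_factors in H. destruct H as [H1 H2]. rewrite cover_map_eq. unfold den.
rewrite Ci_xk in *. field [xk_4]. auto.
Qed.

Lemma cover_root1 (x : C) : den x <> 0 -> cover_map x - root1 = - (dlt / 2) * (x - 1) * (x + Ci) / den x.
Proof.
intro H. apply den_factors in H. destruct H as [H1 H2]. rewrite cover_map_eq. unfold den, root1, root2, dlt.
rewrite Ci_xk in *. field [xk_4]. auto.
Qed.

Lemma cover_root3 (x : C) : den x <> 0 -> cover_map x - root3 = - (x + xk) ^ 2 / den x.
Proof.
intro H. apply den_factors in H. destruct H as [H1 H2]. rewrite cover_map_eq. unfold den, root3, root2, dlt.
rewrite Ci_xk in *. field [xk_4]. auto.
Qed.

Lemma cover_wpk (x : C) : den x <> 0 -> cover_map x - wpk = dlt ^ 2 * (x - xk) ^ 2 / den x.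
Proof.
intro H. apply den_factors in H. destruct H as [H1 H2]. rewrite cover_map_eq. unfold den, wpk, root2, dlt.
rewrite Ci_xk in *. field [xk_4]. auto.
Qed.

Definition cover_deriv (x : C) : C := - dlt * (1 + xk ^ 2) * (x - xk) * (x + xk) / den x ^ 2.

Lemma cover_map_derive (x : C) : den x <> 0 -> D cover_map x (cover_deriv x).
Proof.
intro H. apply den_factors in H. destruct H as [H1 H2].
apply D_ext with (fun x => root2 + dlt / (x - Ci) - Ci * (dlt / (x + 1))); [intro; symmetry; apply cover_map_eq|].
eapply D_eq; [|apply D_minus; [apply D_plus; [apply D_const|]|apply D_scal]].
2:{ apply D_div; [auto|apply D_const|apply D_minus; [apply D_id|apply D_const]]. }
2:{ apply D_div; [auto|apply D_const|apply D_plus; [apply D_id|apply D_const]]. }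
unfold cover_deriv, den. rewrite Ci_xk in *. field [xk_4]. auto.
Qed.

Lemma branch_poly (x : C) : x ^ 5 - x <> 0 -> x <> 0 /\ x - 1 <> 0 /\ x + 1 <> 0 /\ x - Ci <> 0 /\ x + Ci <> 0.
Proof.
assert (E : x ^ 5 - x = x * (x - 1) * (x + 1) * (x - Ci) * (x + Ci)).
{ replace (x * (x - 1) * (x + 1) * (x - Ci) * (x + Ci)) with (x * (x ^ 2 - 1) * (x ^ 2 - Ci * Ci)) by ring.
  rewrite Ci_sq. ring. }
rewrite E. intro H. repeat split; intro X; apply H; rewrite X; ring.
Qed.

Lemma branch_poly_intro (x : C) : x <> 0 -> x - 1 <> 0 -> x + 1 <> 0 -> x - Ci <> 0 -> x + Ci <> 0 -> x ^ 5 - x <> 0.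
Proof.
assert (E : x ^ 5 - x = x * (x - 1) * (x + 1) * (x - Ci) * (x + Ci)).
{ replace (x * (x - 1) * (x + 1) * (x - Ci) * (x + Ci)) with (x * (x ^ 2 - 1) * (x ^ 2 - Ci * Ci)) by ring.
  rewrite Ci_sq. ring. }
rewrite E. intros. repeat apply Cmult_neq_0; auto.
Qed.

Lemma branch_den (x : C) : x ^ 5 - x <> 0 -> den x <> 0.
Proof. intro H. apply branch_poly in H. apply den_factors. tauto. Qed.

(* [alpha_x ^ 2], the logarithmic derivative of [alpha_x] divided by 2, and its derivative. *)
Definition deriv_sq (x : C) : C := (1 - Ci) / 2 * (x - xk) ^ 2 / (x ^ 5 - x).
Definition half_log_deriv (x : C) : C := (2 / (x - xk) - (5 * x ^ 4 - 1) / (x ^ 5 - x)) / 4.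
Definition half_log_deriv_prime (x : C) : C :=
  (- 2 / (x - xk) ^ 2 - (20 * x ^ 3 * (x ^ 5 - x) - (5 * x ^ 4 - 1) ^ 2) / (x ^ 5 - x) ^ 2) / 4.

Lemma D_poly (x : C) : D (fun x => x ^ 5 - x) x (5 * x ^ 4 - 1).
Proof.
eapply D_eq; [|apply D_minus; [apply D_pow, D_id|apply D_id]]. inr. simpl. ring.
Qed.

Lemma half_log_deriv_derive (x : C) : x ^ 5 - x <> 0 -> x <> xk -> D half_log_deriv x (half_log_deriv_prime x).
Proof.
intros H1 H2. assert (H3 : x - xk <> 0) by (intro E; apply H2, Ceq_minus; auto).
unfold half_log_deriv. apply D_ext with (fun x => / 4 * (2 / (x - xk) - (5 * x ^ 4 - 1) / (x ^ 5 - x))); [intro; unfold Cdiv; ring|].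
eapply D_eq; [|apply D_scal, D_minus].
2:{ apply D_div; [auto|apply D_const|apply D_minus; [apply D_id|apply D_const]]. }
2:{ apply D_div; [auto|apply D_minus; [apply D_scal, D_pow, D_id|apply D_const]|apply D_poly]. }
unfold half_log_deriv_prime. inr. simpl pred. field. auto.
Qed.

Lemma deriv_sq_derive (x : C) : x ^ 5 - x <> 0 -> x <> xk -> D deriv_sq x (4 * half_log_deriv x * deriv_sq x).
Proof.
intros H1 H2. assert (H3 : x - xk <> 0) by (intro E; apply H2, Ceq_minus; auto).
unfold deriv_sq. eapply D_eq; [|apply D_div; [auto|apply D_scal, D_pow, D_minus; [apply D_id|apply D_const]|apply D_poly]].
unfold half_log_deriv. inr. simpl pred. field. auto.
Qed.

Lemma one_minus_Ci : 1 - Ci <> 0.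
Proof. intro E. apply (f_equal Re) in E. simpl in E. lra. Qed.

Lemma deriv_sq_neq0 (x : C) : x ^ 5 - x <> 0 -> x <> xk -> deriv_sq x <> 0.
Proof.
intros H1 H2 E. assert (H3 : x - xk <> 0) by (intro E'; apply H2, Ceq_minus; auto).
assert (H4 := one_minus_Ci).
assert (F : deriv_sq x * (2 * (x ^ 5 - x)) = (1 - Ci) * (x - xk) ^ 2) by (unfold deriv_sq; field; auto).
rewrite E in F. apply (Cmult_neq_0 (1 - Ci) ((x - xk) ^ 2)); auto. apply Cpow_nz; auto. rewrite <- F. ring.
Qed.

(* The coefficient of the torus equation as a function of [u = wp alpha]: the sum of
   the two shifted [wp] comes from the addition theorem. *)
Definition torus_rational (u : C) : C :=
  - (3 / 16) * (2 * wpk + (6 * wpk ^ 2 - 5 / 6) / (u - wpk)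
     - 4 * (xk ^ 3 - xk) * (7 + 5 * (xk ^ 3 - xk)) ^ 2 / (u - wpk) ^ 2
     + (7 + 5 * (xk ^ 3 - xk)) / (u - wpk) - (xk ^ 3 - xk) - 1).

(** Along the cover [1 / (wp - wpk)] is a constant times [t = den x / (x - xk) ^ 2], so the
    coefficient becomes a quadratic polynomial in [t]. The inverse of [dlt] is replaced by
    [sqrt 2 - 1] to keep all the constants polynomial in [xk]. *)
Lemma torus_rational_cover (x : C) : x ^ 5 - x <> 0 -> x <> xk ->
  torus_rational (cover_map x) = - (3 / 16) * (- 8 - 16 / 3 * (xk ^ 3 - xk) + (24 + 16 * (xk ^ 3 - xk)) * (den x / (x - xk) ^ 2)
     - (16 + 12 * (xk ^ 3 - xk)) * (den x / (x - xk) ^ 2) ^ 2).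
Proof.
intros H1 H2. assert (H3 : x - xk <> 0) by (intro E; apply H2, Ceq_minus; auto).
assert (H4 := branch_den H1). assert (H5 := dlt_neq0).
set (t := den x / (x - xk) ^ 2). set (e := xk ^ 3 - xk - 1).
assert (He : / dlt = e) by (replace e with (dlt * e / dlt) by (field; auto); unfold e; rewrite dlt_inv; field; auto).
assert (I1 : / (cover_map x - wpk) = e ^ 2 * t).
{ rewrite cover_wpk by auto. rewrite <- He. unfold t. field. auto. }
assert (N : cover_map x - wpk <> 0).
{ rewrite cover_wpk by auto. intro E.
  assert (X : dlt ^ 2 * (x - xk) ^ 2 = 0).
  { replace (dlt ^ 2 * (x - xk) ^ 2) with (dlt ^ 2 * (x - xk) ^ 2 / den x * den x) by (field; auto). rewrite E. ring. }
  revert X. apply Cmult_neq_0; apply Cpow_nz; auto. }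
transitivity (- (3 / 16) * (2 * wpk + (6 * wpk ^ 2 - 5 / 6) * / (cover_map x - wpk)
     - 4 * (xk ^ 3 - xk) * (7 + 5 * (xk ^ 3 - xk)) ^ 2 * (/ (cover_map x - wpk)) ^ 2
     + (7 + 5 * (xk ^ 3 - xk)) * / (cover_map x - wpk) - (xk ^ 3 - xk) - 1)).
{ unfold torus_rational. field. auto. }
rewrite I1. unfold e, wpk. field [xk_4].
Qed.

Lemma whittaker_eq (x : C) : whittaker_coeff x = - (3 / 16) * (x ^ 8 + 14 * x ^ 4 + 1) / (x ^ 5 - x) ^ 2.
Proof. unfold whittaker_coeff. rewrite RtoC_div by lra. unfold Cdiv. ring. Qed.

(** [half_log_deriv_prime x - half_log_deriv x ^ 2] is half the Schwarzian derivative of [alpha].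
    The equality is the transformation law of an equation in normal form, multiplied by
    [alpha_x ^ 2], with the torus coefficient written as in [torus_rational_cover]. *)
Lemma whittaker_torus (x : C) : x ^ 5 - x <> 0 -> x <> xk ->
  whittaker_coeff x + half_log_deriv_prime x - half_log_deriv x ^ 2 =
   (- (3 / 16) * (- 8 - 16 / 3 * (xk ^ 3 - xk) + (24 + 16 * (xk ^ 3 - xk)) * (den x / (x - xk) ^ 2)
     - (16 + 12 * (xk ^ 3 - xk)) * (den x / (x - xk) ^ 2) ^ 2)) * deriv_sq x.
Proof.
intros H1 H2. assert (H3 : x - xk <> 0) by (intro E; apply H2, Ceq_minus; auto).
rewrite whittaker_eq. unfold half_log_deriv_prime, half_log_deriv, den, deriv_sq. rewrite Ci_xk.
Time field [xk_4]. auto.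
Qed.

Lemma C_derive_wp L z : ~ in_lattice L z -> C_derive (wp L) z = - 2 * Wf L 3 z.
Proof.
intro H. apply D_C_derive. apply D_ext with (Wf L 2); [reflexivity|].
eapply D_eq; [|apply Wf_derive; auto]. inr. ring.
Qed.

Lemma roots_distinct : root1 - root2 = dlt / 2 /\ root3 - root2 = 1 /\
  2 * (root3 - root1) * (root3 - root2) = 1 - (xk ^ 3 - xk).
Proof. unfold root1, root2, root3, dlt. repeat split; field [xk_4]. Qed.

(** * The coefficient of the torus equation *)

Section Burnside.
Variables (L : lattice) (kappa : C).
Hypothesis Hg2 : lattice_g2 L = RtoC (5 / 3).
Hypothesis Hg3 : lattice_g3 L = RtoC (- (7 / 27) * sqrt 2).

Lemma wp_cubic z : ~ in_lattice L z ->
  Wf L 3 z ^ 2 = (Wf L 2 z - root1) * (Wf L 2 z - root2) * (Wf L 2 z - root3).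
Proof.
intro Hz. assert (H := weierstrass_cubic Hg2 Hg3 Hz).
replace (RtoC (5 / 3)) with (5 / 3) in H by (rewrite RtoC_div by lra; reflexivity).
replace (RtoC (- (7 / 27) * sqrt 2)) with (- (7 / 27) * (xk ^ 3 - xk)) in H.
2:{ rewrite RtoC_mult, RtoC_opp, RtoC_div, sqrt2_xk by lra. reflexivity. }
set (p := Wf L 2 z) in *. set (d := Wf L 3 z) in *.
replace (d ^ 2) with ((4 * (d * d) - 4 * (p * (p * p)) + 5 / 3 * p + - (7 / 27) * (xk ^ 3 - xk)) / 4
   + (p ^ 3 - 5 / 12 * p + 7 / 108 * (xk ^ 3 - xk))) by field.
rewrite H. unfold root1, root2, root3. field [xk_4].
Qed.

Lemma wp_second z : ~ in_lattice L z -> 6 * Wf L 4 z = 6 * Wf L 2 z ^ 2 - 5 / 6.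
Proof.
intro Hz. rewrite (weierstrass_second Hg2 Hg3 Hz).
rewrite RtoC_div by lra. field.
Qed.

Hypothesis Hkappa : ~ in_lattice L kappa.
Hypothesis Hwp : wp L kappa = RtoC (- (7 / 2) - 13 / 6 * sqrt 2).
Hypothesis Hwp' : C_derive (wp L) kappa = RtoC (sqrt (sqrt 32) * (7 + 5 * sqrt 2)) * Ci.

Lemma wpk_eq : RtoC (- (7 / 2) - 13 / 6 * sqrt 2) = wpk.
Proof.
unfold wpk. rewrite <- sqrt2_xk. rewrite RtoC_minus, RtoC_mult, RtoC_opp, !RtoC_div by lra. reflexivity.
Qed.

Lemma wp_kappa : Wf L 2 kappa = wpk.
Proof. rewrite <- wp_Wf, Hwp. apply wpk_eq. Qed.

(** The last equality identifies the constant [2^(-1/4) zeta(varkappa)] of the equation with twice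
    [32^(-1/4) zeta(varkappa)], the part that completes [zeta_diff]. *)
Lemma sqrt_sqrt_32 : (sqrt (sqrt 32) * sqrt (sqrt 32) = 4 * sqrt 2 /\ 0 < sqrt (sqrt 32) /\ 2 * / sqrt (sqrt 32) = / sqrt (sqrt 2))%R.
Proof.
assert (E : (sqrt 32 = 4 * sqrt 2)%R).
{ replace 32%R with ((4 * 4) * 2)%R by ring. rewrite sqrt_mult by lra. rewrite sqrt_square by lra. reflexivity. }
assert (P : (0 < sqrt 2)%R) by (apply sqrt_lt_R0; lra).
rewrite E. split; [apply sqrt_sqrt; lra|]. split; [apply sqrt_lt_R0; lra|].
replace (4 * sqrt 2)%R with ((2 * 2) * sqrt 2)%R by ring. rewrite sqrt_mult by lra. rewrite sqrt_square by lra.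
field. apply Rgt_not_eq, sqrt_lt_R0. lra.
Qed.

Definition rt32 : C := RtoC (sqrt (sqrt 32)).

Lemma rt32_sq : rt32 ^ 2 = 4 * (xk ^ 3 - xk).
Proof.
unfold rt32. rewrite <- sqrt2_xk. destruct sqrt_sqrt_32 as [H _].
replace (RtoC (sqrt (sqrt 32)) ^ 2) with (RtoC (sqrt (sqrt 32)) * RtoC (sqrt (sqrt 32))) by ring.
rewrite <- RtoC_mult, H, RtoC_mult. reflexivity.
Qed.

Lemma rt32_neq0 : rt32 <> 0.
Proof. destruct sqrt_sqrt_32 as (_ & H & _). intro E. apply RtoC_inj in E. lra. Qed.

Lemma wp'_kappa : - 2 * Wf L 3 kappa = rt32 * (7 + 5 * (xk ^ 3 - xk)) * Ci.
Proof.
rewrite <- C_derive_wp by auto. rewrite Hwp'. unfold rt32. rewrite <- sqrt2_xk.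
rewrite RtoC_mult, RtoC_plus, RtoC_mult. reflexivity.
Qed.

Lemma wp'_kappa_neq0 : Wf L 3 kappa <> 0.
Proof.
intro E. assert (H := wp'_kappa). rewrite E in H.
assert (F : 7 + 5 * (xk ^ 3 - xk) <> 0).
{ rewrite <- sqrt2_xk. rewrite <- RtoC_mult, <- RtoC_plus. intro X. apply RtoC_inj in X.
  assert (0 <= sqrt 2)%R by apply sqrt_pos. lra. }
revert H. replace (- 2 * 0) with (RtoC 0) by ring. intro H. symmetry in H. revert H.
repeat apply Cmult_neq_0; auto. apply rt32_neq0. apply Ci_nz.
Qed.

(** An odd function with period [2 kappa] vanishes at [kappa], whereas [wp'] does not. Hence the two
    singularities are distinct on the torus. *)
Lemma two_kappa : ~ in_lattice L (2 * kappa).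
Proof.
intro H. assert (E := @Wf_periodic L 3 (2 * kappa) (- kappa) ltac:(lia) H (Wf_opp_lattice Hkappa)).
replace (- kappa + 2 * kappa) with kappa in E by ring.
rewrite Wf_opp in E by (auto; lia). apply wp'_kappa_neq0.
assert (T : 2 * Wf L 3 kappa = 0).
{ replace (2 * Wf L 3 kappa) with (Wf L 3 kappa - (-(1)) ^ 3 * Wf L 3 kappa) by ring. rewrite <- E. ring. }
replace (Wf L 3 kappa) with (2 * Wf L 3 kappa / 2) by field. rewrite T. field.
Qed.

Lemma pm_mod_wp z : pm_mod L kappa z -> ~ in_lattice L z /\ Wf L 2 z = wpk /\ Wf L 3 z <> 0.
Proof.
assert (N3 := wp'_kappa_neq0).
intros [H|H].
- replace z with (kappa + (z - kappa)) by ring. split.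
  + intro K. apply Hkappa. apply (in_lattice_shift _ H). auto.
  + rewrite !Wf_periodic by (auto; lia). split; auto. apply wp_kappa.
- replace z with (- kappa + (z + kappa)) by ring. assert (N := Wf_opp_lattice Hkappa). split.
  + intro K. apply N. apply (in_lattice_shift _ H). auto.
  + rewrite !Wf_periodic by (auto; lia). rewrite !Wf_opp by (auto; lia). split.
    * rewrite <- wp_kappa. ring.
    * intro E. apply N3. replace (Wf L 3 kappa) with (- ((-(1)) ^ 3 * Wf L 3 kappa)) by ring. rewrite E. ring.
Qed.

Definition burnside_coeff : C -> C :=
  torus_coeff L kappa
     (- (RtoC (/ sqrt (sqrt 32)) * Ci))
     (RtoC (/ sqrt (sqrt 32)) * Ci)
     (- (RtoC (/ sqrt (sqrt 2)) * Ci * wzeta L kappa + RtoC (sqrt 2) + 1)).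

Lemma burnside_coeff_zeta z : burnside_coeff z =
  - (3 / 16) * (Wf L 2 (z - kappa) + Wf L 2 (z + kappa) - / rt32 * Ci * zeta_diff L kappa z - (xk ^ 3 - xk) - 1).
Proof.
unfold burnside_coeff, torus_coeff, zeta_diff. rewrite !wp_Wf, !wzeta_Wf, sqrt2_xk.
destruct sqrt_sqrt_32 as (_ & Hp & H2). rewrite <- H2.
rewrite RtoC_mult, !RtoC_inv by lra. fold rt32. rewrite RtoC_div by lra. ring.
Qed.

(** [zeta_addition] turns the zeta part into [wp'(varkappa) / (wp - wpk)] times [- 32^(-1/4) i];
    since [wp'(varkappa)] is [32^(1/4) (7 + 5 sqrt 2) i], the product has the real coefficient
    [7 + 5 sqrt 2]. [wp_addition] then gives the two shifted [wp]. *)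
Lemma burnside_coeff_rational z : ~ in_lattice L z -> ~ pm_mod L kappa z ->
  Wf L 2 z - wpk <> 0 /\
  - / rt32 * Ci * zeta_diff L kappa z = (7 + 5 * (xk ^ 3 - xk)) / (Wf L 2 z - wpk) /\
  burnside_coeff z = torus_rational (Wf L 2 z).
Proof.
intros Hz Hs. assert (Hs1 : ~ in_lattice L (z - kappa)) by (intro; apply Hs; left; auto).
assert (Hs2 : ~ in_lattice L (z + kappa)) by (intro; apply Hs; right; auto).
assert (A := zeta_addition Hkappa two_kappa Hz Hs1 Hs2).
assert (B := wp_addition Hkappa two_kappa Hz Hs1 Hs2).
rewrite wp_kappa in A, B. assert (Hd := wp'_kappa). rewrite (wp_second Hkappa), wp_kappa in B.
assert (N : Wf L 2 z - wpk <> 0).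
{ intro E. rewrite E in A. assert (T : - 2 * Wf L 3 kappa = 0) by (rewrite <- A; ring).
  apply wp'_kappa_neq0. replace (Wf L 3 kappa) with (- 2 * Wf L 3 kappa / - 2) by field. rewrite T. field. }
assert (R := rt32_neq0). rewrite Hd in A.
set (j := Wf L 2 z - wpk) in *. set (E := zeta_diff L kappa z) in *.
assert (EE : E = rt32 * (7 + 5 * (xk ^ 3 - xk)) * Ci / j) by (rewrite <- A; field; auto).
assert (Z : - / rt32 * Ci * E = (7 + 5 * (xk ^ 3 - xk)) / j).
{ rewrite EE. transitivity (- (Ci * Ci) * (7 + 5 * (xk ^ 3 - xk)) / j); [field; auto|]. rewrite Ci_sq. field. auto. }
split; [exact N|]. split; [exact Z|].
rewrite burnside_coeff_zeta. fold E.
replace (Wf L 2 (z - kappa) + Wf L 2 (z + kappa) - / rt32 * Ci * E - (xk ^ 3 - xk) - 1) with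
  (Wf L 2 (z - kappa) + Wf L 2 (z + kappa) + (- / rt32 * Ci * E) - (xk ^ 3 - xk) - 1) by ring.
rewrite Z. unfold torus_rational. fold j.
set (P := Wf L 2 (z - kappa) + Wf L 2 (z + kappa)) in *.
assert (EP : P = 2 * wpk + (6 * wpk ^ 2 - 5 / 6 + (- 2 * Wf L 3 kappa) * E) / j).
{ rewrite <- B. field. auto. }
rewrite EP, Hd, EE.
(* The coefficient of the double pole is [wp'(varkappa) ^ 2 = - 4 sqrt 2 (7 + 5 sqrt 2) ^ 2]. *)
replace (rt32 * (7 + 5 * (xk ^ 3 - xk)) * Ci * (rt32 * (7 + 5 * (xk ^ 3 - xk)) * Ci / j)) with
  (rt32 ^ 2 * (7 + 5 * (xk ^ 3 - xk)) ^ 2 * (Ci * Ci) / j) by (field; auto).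
rewrite rt32_sq, Ci_sq. field. auto.
Qed.

Lemma burnside_coeff_equiv z : ~ in_lattice L z -> ~ pm_mod L kappa z ->
  burnside_coeff z = torus_coeff_wp L kappa (RtoC (7 + 5 * sqrt 2)) (- RtoC (sqrt 2) - 1) z.
Proof.
intros Hz Hs. destruct (burnside_coeff_rational Hz Hs) as (N & Z & _).
rewrite burnside_coeff_zeta. unfold torus_coeff_wp. rewrite !wp_Wf, wp_kappa.
rewrite RtoC_plus, RtoC_mult, sqrt2_xk, RtoC_div by lra.
transitivity (- (3 / 16) * (Wf L 2 (z - kappa) + Wf L 2 (z + kappa) + (- / rt32 * Ci * zeta_diff L kappa z) - (xk ^ 3 - xk) - 1)); [ring|].
rewrite Z. ring.
Qed.

Lemma pm_mod_shift l z : in_lattice L l -> (pm_mod L kappa (z + l) <-> pm_mod L kappa z).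
Proof.
intro Hl. unfold pm_mod. replace (z + l - kappa) with (z - kappa + l) by ring.
replace (z + l + kappa) with (z + kappa + l) by ring. rewrite !(fun z => in_lattice_shift z Hl). tauto.
Qed.

Lemma burnside_coeff_periodic l z : in_lattice L l -> ~ pm_mod L kappa z -> burnside_coeff (z + l) = burnside_coeff z.
Proof.
intros Hl Hz. assert (Hs1 : ~ in_lattice L (z - kappa)) by (intro; apply Hz; left; auto).
assert (Hs2 : ~ in_lattice L (z + kappa)) by (intro; apply Hz; right; auto).
rewrite !burnside_coeff_zeta. rewrite zeta_diff_periodic by auto.
replace (z + l - kappa) with (z - kappa + l) by ring.
replace (z + l + kappa) with (z + kappa + l) by ring. rewrite !Wf_periodic by (auto; lia). reflexivity.
Qed.

Lemma burnside_coeff_D z : ~ pm_mod L kappa z -> exists d, D burnside_coeff z d.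
Proof.
intros Hz. assert (Hs1 : ~ in_lattice L (z - kappa)) by (intro; apply Hz; left; auto).
assert (Hs2 : ~ in_lattice L (z + kappa)) by (intro; apply Hz; right; auto).
eexists. apply D_ext with (fun z => - (3 / 16) * (Wf L 2 (z - kappa) + Wf L 2 (z + kappa) - / rt32 * Ci * zeta_diff L kappa z - (xk ^ 3 - xk) - 1)).
{ intro. symmetry. apply burnside_coeff_zeta. }
apply D_scal. apply D_minus; [apply D_minus; [apply D_minus; [apply D_plus|]|]|].
- apply (@D_shift_sub (Wf L 2)), Wf_derive; auto.
- apply (@D_shift (Wf L 2)), Wf_derive; auto.
- apply D_scal, zeta_diff_derive; auto.
- apply D_const.
- apply D_const.
Qed.

Lemma pm_mod_discrete p : exists r, (0 < r)%R /\ forall z, (0 < Cmod (z - p) < r)%R -> ~ pm_mod L kappa z.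
Proof.
destruct (lattice_discrete L (p - kappa)) as (r2 & Hr2 & K2).
destruct (lattice_discrete L (p + kappa)) as (r3 & Hr3 & K3).
exists (Rmin r2 r3). split; [apply Rmin_pos; auto|]. intros z [Hz1 Hz2].
assert (A := Rlt_le_trans _ _ _ Hz2 (Rmin_l _ _)). assert (B := Rlt_le_trans _ _ _ Hz2 (Rmin_r _ _)).
intros [H|H].
- apply (K2 (z - kappa)); auto. replace (z - kappa - (p - kappa)) with (z - p) by ring. auto.
- apply (K3 (z + kappa)); auto. replace (z + kappa - (p + kappa)) with (z - p) by ring. auto.
Qed.

Lemma isolated_open (S : C -> Prop) : (forall p, exists r, (0 < r)%R /\ forall z, (0 < Cmod (z - p) < r)%R -> ~ S z) ->
  forall p, ~ S p -> exists r, (0 < r)%R /\ forall z, (Cmod (z - p) < r)%R -> ~ S z.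
Proof.
intros H p Hp. destruct (H p) as (r & Hr & K). exists r. split; auto. intros z Hz.
destruct (Ceq_dec z p) as [->|N]; auto. apply K. split; auto. apply Cmod_gt_0. intro E. apply N, Ceq_minus; auto.
Qed.

End Burnside.

(** * Local tools: limits, square roots, nonvanishing *)

Ltac nz := repeat match goal with |- Cmult _ _ <> _ => apply Cmult_neq_0 end;
  try first [assumption | apply Cpow_nz; assumption | let E := fresh in intro E; apply RtoC_inj in E; lra].

Lemma contC_punctured f a (r : R) : (0 < r)%R -> contC f a ->
  (forall z, (0 < Cmod (z - a) < r)%R -> f z = 0) -> f a = 0.
Proof.
intros Hr Hc H. apply Cmod_eq_0. apply Rle_antisym; [|apply Cmod_ge_0]. apply le_epsilon. intros eps He.
destruct (Hc eps He) as (d & Hd & K). assert (Hm : (0 < Rmin r d / 2)%R) by (assert (0 < Rmin r d)%R by (apply Rmin_pos; auto); lra).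
set (z := a + RtoC (Rmin r d / 2)).
assert (Ez : Cmod (z - a) = (Rmin r d / 2)%R).
{ unfold z. replace (a + RtoC (Rmin r d / 2) - a) with (RtoC (Rmin r d / 2)) by ring. rewrite Cmod_R, Rabs_pos_eq; lra. }
assert (A := Rmin_l r d). assert (B := Rmin_r r d).
specialize (K z ltac:(lra)). rewrite H in K by lra. replace (0 - f a) with (- f a) in K by ring.
rewrite Cmod_opp in K. lra.
Qed.

Lemma sqrt_D f g z d : locally z (fun w => f w ^ 2 = g w) -> D g z d -> contC f z -> f z <> 0 ->
  D f z (d / (2 * f z)).
Proof.
intros HE HD Hc H0. apply locally_Cmod in HE. destruct HE as (r & Hr & E).
assert (Hm : (0 < Cmod (f z))%R) by (apply Cmod_gt_0; auto).
destruct (Hc (Cmod (f z)) Hm) as (r1 & Hr1 & K1).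
assert (Nz : forall w, (Cmod (w - z) < r1)%R -> f w + f z <> 0).
{ intros w Hw X. specialize (K1 w Hw). replace (f w - f z) with (- (2 * f z)) in K1.
  - rewrite Cmod_opp, Cmod_mult, Cmod_R, Rabs_pos_eq in K1; lra.
  - replace (f w) with ((f w + f z) - f z) by ring. rewrite X. ring. }
(* [f w - f z = (g w - g z) / (f w + f z)], and the quotient is differentiable at [z]. *)
apply D_eps. intros eps He.
assert (HL : limp (fun w => ((g w - g z) / (w - z)) * / (f w + f z)) z (d * / (f z + f z))).
{ apply limp_mult; [apply limp_D_quotient; auto|].
  intros e2 He2. set (m := Cmod (f z)) in *.
  destruct (Hc (Rmin (m / 2) (e2 * (m * m)))) as (r2 & Hr2 & K2).
  { apply Rmin_pos; [lra|]. repeat apply Rmult_lt_0_compat; auto. }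
  exists (Rmin r1 r2). split; [apply Rmin_pos; auto|]. intros w [_ Hw].
  assert (W1 := Rlt_le_trans _ _ _ Hw (Rmin_l _ _)). assert (W2 := Rlt_le_trans _ _ _ Hw (Rmin_r _ _)).
  specialize (K2 w W2). assert (K3 := Rlt_le_trans _ _ _ K2 (Rmin_l _ _)). assert (K4 := Rlt_le_trans _ _ _ K2 (Rmin_r _ _)).
  assert (Hfz : f z + f z <> 0) by (apply Nz; apply ball_center; auto).
  assert (B1 : Cmod (f z + f z) = (2 * m)%R).
  { replace (f z + f z) with (2 * f z) by ring. rewrite Cmod_mult, Cmod_R, Rabs_pos_eq by lra. reflexivity. }
  assert (B2 : (m <= Cmod (f w + f z))%R).
  { assert (X := Cmod_add_ge (f z + f z) (f w - f z)). replace (f z + f z + (f w - f z)) with (f w + f z) in X by ring. lra. }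
  assert (Q := @Cinv_sub_bound (f z + f z) (f w + f z) m Hm ltac:(lra) B2).
  replace (f w + f z - (f z + f z)) with (f w - f z) in Q by ring.
  eapply Rle_lt_trans; [exact Q|]. apply Rlt_div_l; [apply pow_lt; auto|]. simpl. rewrite Rmult_1_r. exact K4. }
destruct (HL eps He) as (d0 & Hd0 & K).
exists (Rmin d0 (Rmin r r1)). split; [repeat apply Rmin_pos; auto|]. intros w Hw.
assert (W1 := Rlt_le_trans _ _ _ Hw (Rmin_l _ _)). assert (W2 := Rlt_le_trans _ _ _ Hw (Rmin_r _ _)).
assert (W3 := Rlt_le_trans _ _ _ W2 (Rmin_l _ _)). assert (W4 := Rlt_le_trans _ _ _ W2 (Rmin_r _ _)).
destruct (Ceq_dec w z) as [->|Nw].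
{ replace (f z - f z - d / (2 * f z) * (z - z)) with (RtoC 0) by ring. rewrite Cmod_0.
  apply Rmult_le_pos; [lra|apply Cmod_ge_0]. }
assert (Nwz : w - z <> 0) by (intro X; apply Nw, Ceq_minus; auto).
specialize (K w ltac:(split; [apply Cmod_gt_0; auto|auto])).
assert (Sg : (f w - f z) * (f w + f z) = g w - g z) by (rewrite <- (E w W3), <- (E z (ball_center _ Hr)); ring).
specialize (Nz w W4).
replace (f w - f z - d / (2 * f z) * (w - z)) with
  ((((g w - g z) / (w - z)) * / (f w + f z) - d * / (f z + f z)) * (w - z)).
- rewrite Cmod_mult. apply Rmult_le_compat_r; [apply Cmod_ge_0|lra].
- rewrite <- Sg. field. repeat split; auto. intro X. apply H0. replace (f z) with ((f z + f z) / 2) by field. rewrite X. field.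
Qed.

Lemma ball_shrink3 z (r1 r2 r3 : R) (P1 P2 P3 : C -> Prop) : (0 < r1)%R -> (0 < r2)%R -> (0 < r3)%R ->
  (forall x, (Cmod (x - z) < r1)%R -> P1 x) -> (forall x, (Cmod (x - z) < r2)%R -> P2 x) ->
  (forall x, (Cmod (x - z) < r3)%R -> P3 x) ->
  exists r, (0 < r)%R /\ forall x, (Cmod (x - z) < r)%R -> P1 x /\ P2 x /\ P3 x.
Proof.
intros Hr1 Hr2 Hr3 H1 H2 H3. destruct (min3_pos Hr1 Hr2 Hr3) as (r & Hr & A & B & C).
exists r. split; auto. intros x Hx. repeat split; [apply H1|apply H2|apply H3]; lra.
Qed.

Lemma neq_near z y : z <> y -> exists r, (0 < r)%R /\ forall x, (Cmod (x - z) < r)%R -> x <> y.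
Proof.
intro H. exists (Cmod (y - z)). split.
- apply Cmod_gt_0. intro E. apply H. symmetry. apply Ceq_minus; auto.
- intros x Hx ->. lra.
Qed.

Lemma nonzero_near f z : contC f z -> f z <> 0 -> exists r, (0 < r)%R /\ forall x, (Cmod (x - z) < r)%R -> f x <> 0.
Proof.
intros Hc H. destruct (Hc (Cmod (f z))) as (r & Hr & K); [apply Cmod_gt_0; auto|].
exists r. split; auto. intros x Hx E. specialize (K x Hx). rewrite E in K.
replace (0 - f z) with (- f z) in K by ring. rewrite Cmod_opp in K. lra.
Qed.

Lemma poly_near x0 : x0 ^ 5 - x0 <> 0 -> exists r, (0 < r)%R /\ forall x, (Cmod (x - x0) < r)%R -> x ^ 5 - x <> 0.
Proof. intro H. apply (@nonzero_near (fun x => x ^ 5 - x)); auto. eapply D_cont. apply D_poly. Qed.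

Lemma limp_comp (phi f : C -> C) p (l : C) : contC phi l -> limp f p l -> limp (fun z => phi (f z)) p (phi l).
Proof.
intros H K eps He. destruct (H eps He) as (d & Hd & A). destruct (K d Hd) as (d' & Hd' & B).
exists d'. split; auto.
Qed.

Lemma limp_contC f p : limp f p (f p) -> contC f p.
Proof.
intros H eps He. destruct (H eps He) as (d & Hd & K). exists d. split; auto. intros z Hz.
destruct (Ceq_dec z p) as [->|N].
- replace (f p - f p) with (RtoC 0) by ring. rewrite Cmod_0. auto.
- apply K. split; auto. apply Cmod_gt_0. intro E. apply N, Ceq_minus; auto.
Qed.

Lemma xk_units : xk - 1 <> 0 /\ xk + 1 <> 0 /\ 1 - (xk ^ 3 - xk) <> 0 /\ xk ^ 2 + 1 <> 0.
Proof.
assert (T : RtoC 2 <> 0) by (intro X; apply RtoC_inj in X; lra).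
assert (H : xk ^ 4 - 1 = - (2)) by (rewrite xk_4; ring).
assert (F : xk ^ 4 - 1 <> 0).
{ rewrite H. intro X. apply T. replace (RtoC 2) with (- - (2)) by ring. rewrite X. ring. }
repeat split; intro E.
- apply F. replace (xk ^ 4 - 1) with ((xk - 1) * (xk ^ 3 + xk ^ 2 + xk + 1)) by ring. rewrite E. ring.
- apply F. replace (xk ^ 4 - 1) with ((xk + 1) * (xk ^ 3 - xk ^ 2 + xk - 1)) by ring. rewrite E. ring.
- apply C1_nz. rewrite <- dlt_inv. replace (xk ^ 3 - xk - 1) with (- (1 - (xk ^ 3 - xk))) by ring. rewrite E. ring.
- apply F. replace (xk ^ 4 - 1) with ((xk ^ 2 + 1) * (xk ^ 2 - 1)) by ring. rewrite E. ring.
Qed.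

Lemma node_den : den (- xk) = - xk * (xk - 1) ^ 2.
Proof. unfold den. rewrite Ci_xk. ring. Qed.

Lemma node_deriv_sq : deriv_sq (- xk) = (1 + xk ^ 2) * xk.
Proof.
assert (N := xk_neq0). unfold deriv_sq. replace ((- xk) ^ 5 - - xk) with (2 * xk) by (ring [xk_4]).
rewrite Ci_xk. field. auto.
Qed.

(* At [- xk], where [cover_deriv] and [wp'] both vanish, [alpha_x] is the quotient of two
   zeros; these are the limits that replace [branch_sq] there. *)
Lemma node_value : 2 * dlt ^ 2 * (1 + xk ^ 2) * (- xk) * (- xk - 1) * (- xk + Ci) / den (- xk) ^ 3 / (1 - (xk ^ 3 - xk)) ^ 2 = deriv_sq (- xk).
Proof.
rewrite node_deriv_sq, node_den, Ci_xk. unfold dlt. assert (N := xk_neq0). destruct xk_units as (N1 & N2 & N3 & N4).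
field [xk_4]. auto.
Qed.

Lemma node_value2 : - dlt * (1 + xk ^ 2) * (- xk - xk) / den (- xk) ^ 2 = (1 - (xk ^ 3 - xk)) * deriv_sq (- xk).
Proof.
rewrite node_deriv_sq, node_den. unfold dlt. assert (N := xk_neq0). destruct xk_units as (N1 & N2 & N3 & N4).
field [xk_4]. auto.
Qed.

(** * The derivative of a branch of alpha *)

Section Branch.
Variable L : lattice.
Hypothesis Hg2 : lattice_g2 L = RtoC (5 / 3).
Hypothesis Hg3 : lattice_g3 L = RtoC (- (7 / 27) * sqrt 2).

(* The derivative of a branch of [x |-> alpha] satisfies [al' ^ 2 = deriv_sq], away from
   the zero [- xk] of [cover_deriv] where [wp' (al x)] vanishes too. *)
Section Generic.
Variables (al a1 : C -> C) (x : C).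
Hypothesis Hx : x ^ 5 - x <> 0.
Hypothesis Hal : locally x (fun y => D al y (a1 y) /\ ~ in_lattice L (al y) /\ Wf L 2 (al y) = cover_map y).

Lemma branch_chain : - 2 * Wf L 3 (al x) * a1 x = cover_deriv x.
Proof.
destruct (locally_singleton _ _ Hal) as (H1 & H2 & H3).
apply (@D_unique cover_map x); [|apply cover_map_derive, branch_den; auto].
apply D_ext_loc with (fun y => Wf L 2 (al y)).
- eapply filter_imp; [|exact Hal]. intros y (_ & _ & E). exact E.
- eapply D_eq; [|apply (@D_comp (Wf L 2) al x _ _ (Wf_derive (k := 2) ltac:(lia) H2) H1)]. inr. ring.
Qed.

Lemma branch_cubic : 4 * Wf L 3 (al x) ^ 2 = 2 * dlt ^ 2 * (1 + xk ^ 2) * x * (x - 1) * (x + Ci) * (x + xk) ^ 2 / den x ^ 3.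
Proof.
destruct (locally_singleton _ _ Hal) as (H1 & H2 & H3).
assert (Hd := branch_den Hx).
rewrite (wp_cubic Hg2 Hg3 H2), H3, cover_root1, cover_root2, cover_root3 by auto. field. auto.
Qed.

(** The square of the chain rule is divided by the cubic. The factor [(x + xk) ^ 2] occurs on both
    sides and cancels, which is possible only away from [- xk]. *)
Lemma branch_sq : x <> - xk -> a1 x ^ 2 = deriv_sq x /\ Wf L 3 (al x) <> 0.
Proof.
intro Nx. assert (Nx' : x + xk <> 0).
{ intro E. apply Nx. replace x with ((x + xk) - xk) by ring. rewrite E. ring. }
assert (H := branch_chain). assert (K := branch_cubic).
assert (Hd := branch_den Hx). destruct (branch_poly Hx) as (P1 & P2 & P3 & P4 & P5). assert (Hdl := dlt_neq0).
assert (N1 : 1 + xk ^ 2 <> 0) by (rewrite xk_2; exact one_minus_Ci).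
set (w := Wf L 3 (al x)) in *.
set (c := 2 * dlt ^ 2 * (1 + xk ^ 2) * x * (x - 1) * (x + Ci) * (x + xk) ^ 2 / den x ^ 3) in *.
assert (Nc : c * den x ^ 3 <> 0).
{ unfold c. replace (2 * dlt ^ 2 * (1 + xk ^ 2) * x * (x - 1) * (x + Ci) * (x + xk) ^ 2 / den x ^ 3 * den x ^ 3) with
    (2 * dlt ^ 2 * (1 + xk ^ 2) * x * (x - 1) * (x + Ci) * (x + xk) ^ 2) by (field; auto).
  nz. }
assert (Nw : w <> 0).
{ intro E. apply Nc. rewrite <- K, E. ring. }
split; auto.
assert (S : 4 * w ^ 2 * a1 x ^ 2 = cover_deriv x ^ 2) by (rewrite <- H; ring).
replace (a1 x ^ 2) with (cover_deriv x ^ 2 / (4 * w ^ 2)) by (rewrite <- S; field; auto).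
rewrite K. unfold c, cover_deriv, deriv_sq.
assert (E5 : x ^ 5 - x = den x * x * (x - 1) * (x + Ci)).
{ unfold den. rewrite Ci_xk. ring [xk_4]. }
rewrite E5. replace (1 - Ci) with (1 + xk ^ 2) by (rewrite Ci_xk; ring). field. repeat split; auto.
Qed.
End Generic.

(** Away from [- xk] the derivative is the quotient of [cover_deriv] by [- 2 W_3(al)], which is
    continuous. At [- xk] both are divided by their zero first, and the limit of the quotient
    provides the continuity as well as the square. *)
Lemma branch_cont (al a1 : C -> C) x : x ^ 5 - x <> 0 -> x <> xk -> a1 x <> 0 ->
  locally x (fun y => D al y (a1 y) /\ ~ in_lattice L (al y) /\ Wf L 2 (al y) = cover_map y) ->
  contC a1 x /\ a1 x ^ 2 = deriv_sq x.
Proof.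
intros Hx Nk N0 Hal.
destruct (locally_singleton _ _ Hal) as (H1 & H2 & H3).
assert (Hl := Hal). apply locally_locally in Hl. apply locally_Cmod in Hl. destruct Hl as (r & Hr & K).
destruct (poly_near Hx) as (r1 & Hr1 & K1).
assert (DW : D (fun y => - 2 * Wf L 3 (al y)) x (6 * Wf L 4 (al x) * a1 x)).
{ eapply D_eq; [|apply D_scal, (@D_comp (Wf L 3) al x _ _ (Wf_derive (k := 3) ltac:(lia) H2) H1)]. inr. ring. }
assert (DG : exists d, D cover_deriv x d).
{ eexists. unfold cover_deriv. apply D_div; [apply Cpow_nz, branch_den; auto| |apply D_pow].
  - apply D_mult; [apply D_scal, D_minus; [apply D_id|apply D_const]|apply D_plus; [apply D_id|apply D_const]].
  - unfold den. apply D_mult; [apply D_minus; [apply D_id|apply D_const]|apply D_plus; [apply D_id|apply D_const]]. }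
destruct (Ceq_dec x (- xk)) as [E|N].
- (* Divide [- 2 Wf 3 (al y) * a1 y = cover_deriv y] by [y - x]. *)
  assert (F0 : - 2 * Wf L 3 (al x) = 0).
  { assert (B := @branch_chain al a1 x Hx Hal). unfold cover_deriv in B. rewrite E in B at 4.
    replace (- xk + xk) with (RtoC 0) in B by ring.
    replace (- 2 * Wf L 3 (al x)) with (- 2 * Wf L 3 (al x) * a1 x / a1 x) by (field; auto). rewrite B. unfold Cdiv. ring. }
  assert (Hd := branch_den Hx).
  set (h := fun y => (- 2 * Wf L 3 (al y) - - 2 * Wf L 3 (al x)) / (y - x)).
  assert (Hh : limp h x (6 * Wf L 4 (al x) * a1 x)) by apply (limp_D_quotient DW).
  (* [Kf], and [rf] below, are the right-hand sides of [branch_cubic] and [branch_chain] with the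
     factors [(y + xk) ^ 2] and [y + xk] removed. *)
  set (Kf := fun y => 2 * dlt ^ 2 * (1 + xk ^ 2) * y * (y - 1) * (y + Ci) / den y ^ 3).
  assert (DK : exists d, D Kf x d).
  { eexists. unfold Kf. apply D_div; [apply Cpow_nz; auto| |apply D_pow].
    - apply D_mult; [apply D_mult; [apply D_scal, D_id|]|]; [apply D_minus; [apply D_id|apply D_const]|apply D_plus; [apply D_id|apply D_const]].
    - unfold den. apply D_mult; [apply D_minus; [apply D_id|apply D_const]|apply D_plus; [apply D_id|apply D_const]]. }
  set (rf := fun y => - dlt * (1 + xk ^ 2) * (y - xk) / den y ^ 2).
  assert (Drf : exists d, D rf x d).
  { eexists. unfold rf. apply D_div; [apply Cpow_nz; auto| |apply D_pow].
    - apply D_scal; [apply D_minus; [apply D_id|apply D_const]].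
    - unfold den. apply D_mult; [apply D_minus; [apply D_id|apply D_const]|apply D_plus; [apply D_id|apply D_const]]. }
  destruct (min3_pos Hr Hr1 Hr) as (r2 & Hr2 & L1 & L2 & _).
  assert (Pt : forall y, (0 < Cmod (y - x) < r2)%R -> h y ^ 2 = Kf y /\ h y * a1 y = rf y).
  { intros y Hy. assert (Hy5 := K1 y ltac:(lra)). assert (Hyl := K y ltac:(lra)).
    assert (Nyx : y - x <> 0) by (apply Cmod_gt_0; lra).
    assert (Eyx : y + xk = y - x) by (rewrite E; ring).
    assert (Hdy := branch_den Hy5).
    assert (Q1 := @branch_cubic al a1 y Hy5 Hyl). assert (Q2 := @branch_chain al a1 y Hy5 Hyl).
    unfold h. rewrite F0. split.
    - replace (((- 2 * Wf L 3 (al y) - 0) / (y - x)) ^ 2) with (4 * Wf L 3 (al y) ^ 2 / (y - x) ^ 2) by (field; auto).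
      rewrite Q1, Eyx. unfold Kf. field. auto.
    - replace ((- 2 * Wf L 3 (al y) - 0) / (y - x) * a1 y) with (- 2 * Wf L 3 (al y) * a1 y / (y - x)) by (field; auto).
      rewrite Q2. unfold cover_deriv, rf. rewrite Eyx. field. auto. }
  assert (LU : forall f (l m : C), limp f x l -> limp f x m -> l = m).
  { intros f l m A B. apply Ceq_minus. apply Cmod_eq_0, Rle_antisym; [|apply Cmod_ge_0]. apply le_epsilon. intros eps He.
    destruct (A (eps/2)%R ltac:(lra)) as (d1 & Hd1 & A1). destruct (B (eps/2)%R ltac:(lra)) as (d2 & Hd2 & B1).
    assert (Hm : (0 < Rmin d1 d2)%R) by (apply Rmin_pos; auto). assert (M1 := Rmin_l d1 d2). assert (M2 := Rmin_r d1 d2).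
    set (y := x + RtoC (Rmin d1 d2 / 2)).
    assert (Ey : Cmod (y - x) = (Rmin d1 d2 / 2)%R).
    { unfold y. replace (x + RtoC (Rmin d1 d2 / 2) - x) with (RtoC (Rmin d1 d2 / 2)) by ring. rewrite Cmod_R, Rabs_pos_eq; lra. }
    specialize (A1 y ltac:(lra)). specialize (B1 y ltac:(lra)).
    replace (l - m) with (- (f y - l) + (f y - m)) by ring. eapply Rle_trans; [apply Cmod_triangle|]. rewrite Cmod_opp. lra. }
  set (k := 6 * Wf L 4 (al x)) in *.
  assert (EK : (k * a1 x) ^ 2 = Kf x).
  { apply LU with (fun y => h y * h y).
    - replace ((k * a1 x) ^ 2) with (k * a1 x * (k * a1 x)) by ring. apply limp_mult; auto.
    - apply limp_ext with (f := Kf) (r := r2); auto. { intros y Hy. destruct (Pt y Hy) as [Q _]. rewrite <- Q. ring. }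
      apply contC_limp. apply D_ex_cont. auto. }
  (* [k] is [wp''] at a point where [wp = root3], that is [2 (root3 - root1) (root3 - root2)]. *)
  assert (Ek : k = 1 - (xk ^ 3 - xk)).
  { destruct roots_distinct as (R1 & R2 & R3). rewrite <- R3. unfold k. rewrite (wp_second Hg2 Hg3 H2), H3.
    assert (T := cover_root3 Hd). rewrite E in T at 2. replace (- xk + xk) with (RtoC 0) in T by ring.
    replace (cover_map x) with ((cover_map x - root3) + root3) by ring. rewrite T.
    replace (- 0 ^ 2 / den x + root3) with root3 by (unfold Cdiv; ring).
    unfold root1, root2, root3. field [xk_4]. }
  assert (Nk' : k <> 0).
  { rewrite Ek. intro X. apply C1_nz. rewrite <- dlt_inv.
    replace (xk ^ 3 - xk - 1) with (- (1 - (xk ^ 3 - xk))) by ring. rewrite X. ring. }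
  assert (Nk4 := xk_neq0).
  assert (EG : a1 x ^ 2 = deriv_sq x).
  { replace (a1 x ^ 2) with ((k * a1 x) ^ 2 / k ^ 2) by (field; auto). rewrite EK, Ek. unfold Kf. rewrite E.
    apply node_value. }
  split; auto.
  assert (NKx : k * a1 x <> 0) by (apply Cmult_neq_0; auto).
  assert (NK : Kf x <> 0) by (rewrite <- EK; apply Cpow_nz; auto).
  destruct (nonzero_near (D_ex_cont DK) NK) as (r3 & Hr3 & K3).
  apply limp_contC.
  replace (a1 x) with (rf x * / (k * a1 x)).
  2:{ replace (rf x) with (k * a1 x ^ 2); [field; auto|]. rewrite EG, Ek. unfold rf. rewrite E. symmetry. apply node_value2. }
  apply (@limp_ext (fun y => rf y * / h y) a1 x (rf x * / (k * a1 x)) (Rmin r2 r3)).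
  { apply Rmin_pos; auto. }
  { intros y [Hy1 Hy2]. assert (Y1 := Rlt_le_trans _ _ _ Hy2 (Rmin_l _ _)). assert (Y2 := Rlt_le_trans _ _ _ Hy2 (Rmin_r _ _)).
    destruct (Pt y ltac:(auto)) as [Q1 Q2]. rewrite <- Q2.
    assert (h y <> 0). { intro X. apply (K3 y Y2). rewrite <- Q1, X. simpl. ring. }
    field. auto. }
  apply limp_mult.
  + apply contC_limp. apply D_ex_cont. auto.
  + apply (@limp_comp (fun z => / z)); auto. eapply D_cont. apply D_inv_id. auto.
- destruct (@branch_sq al a1 x Hx Hal N) as [E Nw]. split; auto.
  assert (N2 : - 2 * Wf L 3 (al x) <> 0).
  { apply Cmult_neq_0; auto. intro X; apply RtoC_inj in X; lra. }
  destruct DG as (d & Hd).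
  assert (Q : contC (fun y => cover_deriv y / (- 2 * Wf L 3 (al y))) x).
  { eapply D_cont. apply (@D_div cover_deriv (fun y => - 2 * Wf L 3 (al y)) x d _ N2 Hd DW). }
  destruct (nonzero_near (D_cont DW) N2) as (r2 & Hr2 & K2).
  assert (B : forall y, (Cmod (y - x) < Rmin r (Rmin r1 r2))%R -> cover_deriv y / (- 2 * Wf L 3 (al y)) = a1 y).
  { intros y Hy. assert (Y1 := Rlt_le_trans _ _ _ Hy (Rmin_l _ _)). assert (Y2 := Rlt_le_trans _ _ _ Hy (Rmin_r _ _)).
    assert (Y3 := Rlt_le_trans _ _ _ Y2 (Rmin_l _ _)). assert (Y4 := Rlt_le_trans _ _ _ Y2 (Rmin_r _ _)).
    specialize (K2 y Y4). rewrite <- (@branch_chain al a1 y (K1 y Y3) (K y Y1)). field.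
    intro X. apply K2. rewrite X. ring. }
  assert (Hm : (0 < Rmin r (Rmin r1 r2))%R) by (repeat apply Rmin_pos; auto).
  intros eps He. destruct (Q eps He) as (d' & Hd' & KQ). exists (Rmin d' (Rmin r (Rmin r1 r2))).
  split; [apply Rmin_pos; auto|]. intros y Hy.
  assert (Y1 := Rlt_le_trans _ _ _ Hy (Rmin_l _ _)). assert (Y2 := Rlt_le_trans _ _ _ Hy (Rmin_r _ _)).
  rewrite <- (B y Y2), <- (B x (ball_center _ Hm)). auto.
Qed.
End Branch.

Lemma xk_neq_opp : xk <> - xk.
Proof.
intro E. apply xk_neq0. replace xk with ((xk - - xk) / 2) by field. rewrite <- E at 1. field_simplify.
replace (xk - xk) with (RtoC 0) by ring. field.
Qed.

(** The facts about a branch that hold on a whole neighbourhood once [cover_branch_at] holds at its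
    centre. The second derivative of [al] is the one that the transformation of the equation
    consumes. *)
Definition branch_point (L : lattice) (kappa : C) (al : C -> C) (x : C) : Prop :=
  x ^ 5 - x <> 0 /\ x <> xk /\ D al x (C_derive al x) /\ C_derive al x ^ 2 = deriv_sq x /\
  D (C_derive al) x (2 * half_log_deriv x * C_derive al x) /\
  ~ in_lattice L (al x) /\ Wf L 2 (al x) = cover_map x /\ ~ pm_mod L kappa (al x).

(** * The change of variables and the singular points *)

Section Transfer.
Variables (L : lattice) (kappa : C).
Hypothesis Hg2 : lattice_g2 L = RtoC (5 / 3).
Hypothesis Hg3 : lattice_g3 L = RtoC (- (7 / 27) * sqrt 2).
Hypothesis Hkappa : ~ in_lattice L kappa.
Hypothesis Hwp : wp L kappa = RtoC (- (7 / 2) - 13 / 6 * sqrt 2).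
Hypothesis Hwp' : C_derive (wp L) kappa = RtoC (sqrt (sqrt 32) * (7 + 5 * sqrt 2)) * Ci.

Let q := burnside_coeff L kappa.

Lemma cover_neq_wpk x : x ^ 5 - x <> 0 -> x <> xk -> cover_map x <> wpk.
Proof.
intros H1 H2 E. assert (Hd := branch_den H1). assert (C := cover_wpk Hd).
replace (cover_map x - wpk) with (RtoC 0) in C by (rewrite E; ring).
assert (X : dlt ^ 2 * (x - xk) ^ 2 = 0).
{ replace (dlt ^ 2 * (x - xk) ^ 2) with (dlt ^ 2 * (x - xk) ^ 2 / den x * den x) by (field; auto). rewrite <- C. ring. }
revert X. apply Cmult_neq_0; apply Cpow_nz; [apply dlt_neq0|]. intro Y. apply H2, Ceq_minus; auto.
Qed.

Lemma branch_structure al x0 : cover_branch_at L al x0 ->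
  exists r, (0 < r)%R /\ forall x, (Cmod (x - x0) < r)%R -> branch_point L kappa al x.
Proof.
intros (H5 & Hl & Hd).
assert (Hl' : locally x0 (fun y => D al y (C_derive al y) /\ ~ in_lattice L (al y) /\ Wf L 2 (al y) = cover_map y)).
{ eapply filter_imp; [|exact Hl]. intros y (A & B & C). split; [apply holo_D; auto|]. split; auto. }
(* [deriv_sq] vanishes at [xk], where [alpha] would not be a local coordinate. *)
assert (Nk : x0 <> xk).
{ intros ->. destruct (@branch_sq L Hg2 Hg3 al (C_derive al) xk H5 Hl' xk_neq_opp) as [E _].
  apply (Cpow_nz _ 2 Hd). rewrite E. unfold deriv_sq. replace (xk - xk) with (RtoC 0) by ring. unfold Cdiv. simpl. ring. }
destruct (poly_near H5) as (r1 & Hr1 & K1). destruct (neq_near Nk) as (r2 & Hr2 & K2).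
(* The ball may contain [- xk] only as its centre. There the derivative is nonzero by
   [cover_branch_at], elsewhere by [branch_sq]. *)
assert (N3 : exists r3, (0 < r3)%R /\ forall x, (Cmod (x - x0) < r3)%R -> x = x0 \/ x <> - xk).
{ destruct (Ceq_dec x0 (- xk)) as [->|N].
  - exists 1%R. split; [lra|]. intros x _. destruct (Ceq_dec x (- xk)); auto.
  - destruct (neq_near N) as (r3 & Hr3 & K3). exists r3. split; auto. }
destruct N3 as (r3 & Hr3 & K3).
assert (Hll := Hl'). apply locally_locally in Hll. apply locally_Cmod in Hll. destruct Hll as (r4 & Hr4 & K4).
destruct (ball_shrink3 x0 _ _ _ Hr1 Hr2 Hr3 K1 K2 K3) as (r5 & Hr5 & K5).
set (r := Rmin r5 r4). assert (Hr : (0 < r)%R) by (apply Rmin_pos; auto).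
assert (B : forall x, (Cmod (x - x0) < r)%R -> x ^ 5 - x <> 0 /\ x <> xk /\ contC (C_derive al) x /\
   C_derive al x ^ 2 = deriv_sq x /\ D al x (C_derive al x) /\ ~ in_lattice L (al x) /\ Wf L 2 (al x) = cover_map x).
{ intros x Hx. assert (X1 := Rlt_le_trans _ _ _ Hx (Rmin_l _ _)). assert (X2 := Rlt_le_trans _ _ _ Hx (Rmin_r _ _)).
  destruct (K5 x X1) as (P1 & P2 & P3). assert (P4 := K4 x X2).
  assert (P5 : C_derive al x <> 0).
  { destruct P3 as [->|P3]; auto. destruct (@branch_sq L Hg2 Hg3 al (C_derive al) x P1 P4 P3) as [E _].
    intro X. apply (deriv_sq_neq0 P1 P2). rewrite <- E, X. simpl. ring. }
  destruct (@branch_cont L Hg2 Hg3 al (C_derive al) x P1 P2 P5 P4). destruct (locally_singleton _ _ P4) as (Q1 & Q2 & Q3).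
  tauto. }
exists r. split; auto. intros x Hx. destruct (B x Hx) as (P1 & P2 & P3 & P4 & P5 & P6 & P7).
refine (conj P1 (conj P2 (conj P5 (conj P4 (conj _ (conj P6 (conj P7 _))))))).
- assert (N : C_derive al x <> 0).
  { intro X. apply (deriv_sq_neq0 P1 P2). rewrite <- P4, X. simpl. ring. }
  eapply D_eq; [|eapply (@sqrt_D (C_derive al) deriv_sq x _); [|apply deriv_sq_derive; auto|auto|auto]].
  + rewrite <- P4. field. auto.
  + apply (@locally_ball _ x0 r); auto. intros y Hy. apply (B y Hy).
- intro H. destruct (pm_mod_wp Hkappa Hwp Hwp' H) as (_ & E & _). apply (cover_neq_wpk P1 P2). rewrite <- P7. exact E.
Qed.

Lemma branch_point_cover al x : locally x (branch_point L kappa al) -> cover_branch_at L al x.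
Proof.
intro H. destruct (locally_singleton _ _ H) as (P1 & P2 & P3 & P4 & P5 & P6 & P7 & P8).
split; auto. split.
- eapply filter_imp; [|exact H]. intros y (Q1 & Q2 & Q3 & Q4 & Q5 & Q6 & Q7 & Q8).
  split; [apply holo_D; auto|]. split; auto.
- intro X. apply (deriv_sq_neq0 P1 P2). rewrite <- P4, X. simpl. ring.
Qed.

Lemma branch_point_neq0 al x : branch_point L kappa al x -> C_derive al x <> 0.
Proof. intros (P1 & P2 & _ & P4 & _) X. apply (deriv_sq_neq0 P1 P2). rewrite <- P4, X. simpl. ring. Qed.

Lemma branch_q al x : branch_point L kappa al x -> whittaker_coeff x + half_log_deriv_prime x - half_log_deriv x ^ 2 = q (al x) * deriv_sq x.
Proof.
intros (P1 & P2 & P3 & P4 & P5 & P6 & P7 & P8).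
unfold q. destruct (burnside_coeff_rational Hg2 Hg3 Hkappa Hwp Hwp' P6 P8) as (_ & _ & E).
rewrite E, P7, torus_rational_cover by auto. apply whittaker_torus; auto.
Qed.

Lemma branch_inverse al x0 : cover_branch_at L al x0 ->
  exists (r s : R) (g : C -> C), (0 < r)%R /\ (0 < s)%R /\
    (forall x, (Cmod (x - x0) < r)%R -> branch_point L kappa al x) /\
    (forall z w, (Cmod (z - x0) < r)%R -> (Cmod (w - x0) < r)%R -> al z = al w -> z = w) /\
    (forall v, (Cmod (v - al x0) < s)%R ->
       (Cmod (g v - x0) < r)%R /\ al (g v) = v /\ D g v (/ C_derive al (g v))).
Proof.
intro H. destruct (branch_structure H) as (r0 & Hr0 & K).
destruct (@local_inverse al (C_derive al) x0 r0 Hr0) as (r & s & g & Hr & Hs & _ & Inj & G).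
- intros z Hz. apply (K z Hz).
- eapply D_cont. apply (K x0 (ball_center _ Hr0)).
- apply branch_point_neq0, K, ball_center; auto.
- exists r, s, g. refine (conj (proj1 Hr) (conj Hs (conj _ (conj Inj G)))). intros x Hx. apply K. lra.
Qed.

(** With [h = half_log_deriv], so that [S' = h S], the first derivatives are [(h psi + psi') / S]
    for [xi] and [S xi' - h psi] for [psi]. Differentiating once more leaves exactly [branch_q]. The
    forward direction works in the variable [alpha], through the local inverse [g]. *)
Lemma transfer al S psi xi x0 : cover_branch_at L al x0 -> changed_by al S psi xi x0 ->
  (solution_at whittaker_coeff psi x0 <-> solution_at q xi (al x0)).
Proof.
intros Hb Hc. destruct (branch_inverse Hb) as (r & s & g & Hr & Hs & Bp & Inj & G).
apply locally_Cmod in Hc. destruct Hc as (rc & Hrc & Hc).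
set (r' := Rmin r rc). assert (Hr' : (0 < r')%R) by (apply Rmin_pos; auto).
assert (R1 : (r' <= r)%R) by apply Rmin_l. assert (R2 : (r' <= rc)%R) by apply Rmin_r.
assert (HS : forall x, (Cmod (x - x0) < r')%R -> S x <> 0 /\ S x ^ 2 = C_derive al x /\ D S x (half_log_deriv x * S x) /\ xi (al x) = S x * psi x).
{ intros x Hx. destruct (Hc x ltac:(lra)) as (H1 & H2 & H3).
  assert (B := Bp x ltac:(lra)). assert (N := branch_point_neq0 B).
  assert (NS : S x <> 0). { intro X. apply N. rewrite <- H2, X. simpl. ring. }
  split; auto. split; auto. split; auto. destruct B as (P1 & P2 & P3 & P4 & P5 & _).
  eapply D_eq; [|eapply (@sqrt_D S (C_derive al) x _); [|exact P5| |auto]].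
  - rewrite <- H2. field. auto.
  - apply (@locally_ball _ x0 r'); auto. intros y Hy. apply (Hc y). lra.
  - eapply D_cont. apply holo_D; eauto. }
rewrite !solution_at_iff. split.
- intros (rp & f1 & Hrp & Hsol).
  destruct (D_cont (proj2 (proj2 (G (al x0) (ball_center _ Hs)))) (eps := Rmin r' rp)) as (d & Hd & Kd).
  { apply Rmin_pos; auto. }
  assert (G0 : g (al x0) = x0).
  { apply Inj; [apply (G (al x0)); apply ball_center; auto|apply ball_center; auto|apply (G (al x0)); apply ball_center; auto]. }
  rewrite G0 in Kd.
  exists (Rmin s d), (fun v => (half_log_deriv (g v) * psi (g v) + f1 (g v)) / S (g v)).
  split; [apply Rmin_pos; auto|].
  assert (Key : forall v, (Cmod (v - al x0) < Rmin s d)%R ->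
     (Cmod (g v - x0) < r')%R /\ (Cmod (g v - x0) < rp)%R /\ al (g v) = v /\ D g v (/ S (g v) ^ 2)).
  { intros v Hv. assert (V1 := Rlt_le_trans _ _ _ Hv (Rmin_l _ _)). assert (V2 := Rlt_le_trans _ _ _ Hv (Rmin_r _ _)).
    specialize (Kd v V2). assert (E1 := Rlt_le_trans _ _ _ Kd (Rmin_l _ _)). assert (E2 := Rlt_le_trans _ _ _ Kd (Rmin_r _ _)).
    destruct (G v V1) as (_ & G2 & G3). split; auto. split; auto. split; auto. destruct (HS _ E1) as (_ & -> & _). exact G3. }
  intros v Hv. destruct (Key v Hv) as (E1 & E2 & E3 & E4).
  destruct (HS _ E1) as (S0 & S2 & S3 & S4). assert (B := Bp (g v) ltac:(lra)).
  assert (Q := branch_q B). destruct B as (P1 & P2 & P3 & P4 & P5 & P6 & P7 & P8).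
  destruct (Hsol _ E2) as [D1 D2].
  split.
  + apply D_ext_loc with (fun v => S (g v) * psi (g v)).
    * apply (@locally_ball _ (al x0) (Rmin s d)); auto. intros w Hw.
      destruct (Key w Hw) as (W1 & W2 & W3 & W4). destruct (HS _ W1) as (_ & _ & _ & T). rewrite <- T, W3. reflexivity.
    * eapply D_eq; [|apply D_mult; eapply D_comp; [exact S3|exact E4|exact D1|exact E4]]. cbv beta. field. auto.
  + eapply D_eq; [|apply (@D_comp (fun x => (half_log_deriv x * psi x + f1 x) / S x) g v); [|exact E4]].
    2:{ apply D_div; [auto| |exact S3]. apply D_plus; [apply D_mult; [apply half_log_deriv_derive; auto|exact D1]|exact D2]. }
    cbv beta. replace (xi v) with (S (g v) * psi (g v)) by (rewrite <- S4, E3; reflexivity).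
    rewrite <- P4, <- S2 in Q.
    replace (q v) with (q (al (g v)) * (S (g v) ^ 2) ^ 2 / S (g v) ^ 4) by (rewrite E3; field; auto).
    rewrite <- Q. field. auto.
- intros (rp & f1 & Hrp & Hsol).
  destruct (Bp x0 (ball_center _ Hr)) as (_ & _ & Dal & _).
  destruct (D_cont Dal Hrp) as (d & Hd & Kd).
  exists (Rmin r' d), (fun x => S x * f1 (al x) - half_log_deriv x * psi x).
  split; [apply Rmin_pos; auto|].
  assert (D1 : forall x, (Cmod (x - x0) < Rmin r' d)%R -> D psi x (S x * f1 (al x) - half_log_deriv x * psi x)).
  { intros x Hx. assert (X1 := Rlt_le_trans _ _ _ Hx (Rmin_l _ _)). assert (X2 := Rlt_le_trans _ _ _ Hx (Rmin_r _ _)).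
    destruct (HS x X1) as (S0 & S2 & S3 & S4). destruct (Bp x ltac:(lra)) as (P1 & P2 & P3 & P4 & P5 & P6 & P7 & P8).
    destruct (Hsol _ (Kd x X2)) as [E1 E2].
    apply D_ext_loc with (fun x => xi (al x) / S x).
    - apply (@locally_ball _ x0 r'); auto. intros y Hy. destruct (HS y Hy) as (T0 & _ & _ & T). rewrite T. field. auto.
    - eapply D_eq; [|apply D_div; [auto|eapply D_comp; [exact E1|exact P3]|exact S3]].
      cbv beta. rewrite S4, <- S2. field. auto. }
  intros x Hx. split; [apply D1; auto|].
  assert (X1 := Rlt_le_trans _ _ _ Hx (Rmin_l _ _)). assert (X2 := Rlt_le_trans _ _ _ Hx (Rmin_r _ _)).
  destruct (HS x X1) as (S0 & S2 & S3 & S4). assert (B := Bp x ltac:(lra)). assert (Q := branch_q B).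
  destruct B as (P1 & P2 & P3 & P4 & P5 & P6 & P7 & P8).
  destruct (Hsol _ (Kd x X2)) as [E1 E2].
  eapply D_eq; [|apply D_minus; apply D_mult; [exact S3|eapply D_comp; [exact E2|exact P3]|apply half_log_deriv_derive; auto|apply D1; auto]].
  cbv beta. rewrite S4, <- S2. rewrite <- P4, <- S2 in Q.
  replace (whittaker_coeff x) with (q (al x) * (S x ^ 2) ^ 2 - half_log_deriv_prime x + half_log_deriv x ^ 2) by (rewrite <- Q; ring). ring.
Qed.

(** [h] is [(z - kappa) ^ 2 q] with the polar parts of [W_1] and [W_2] multiplied out; the terms at
    [z + kappa] are regular by [two_kappa]. The value [- 3 / 16] at [kappa] is the coefficient of
    the double pole. *)
Lemma q_at_kappa : exists (r : R) (h : C -> C), (0 < r)%R /\ h kappa = - (3 / 16) /\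
  forall z, (Cmod (z - kappa) < r)%R -> (exists d, D h z d) /\ (z <> kappa -> q z = h z / (z - kappa) ^ 2).
Proof.
assert (H2k := two_kappa Hkappa Hwp').
destruct (not_lattice_locally H2k) as (r1 & Hr1 & K1).
destruct (regular_near (@regular_0 L)) as (r2 & Hr2 & K2).
set (h := fun z => - (3 / 16) * (1 + (z - kappa) ^ 2 * (wsum L 2 (z - kappa) + Wf L 2 (z + kappa)
  - / rt32 * Ci * (wsum L 1 (z - kappa) - Wf L 1 (z + kappa) + 2 * Wf L 1 kappa) - (xk ^ 3 - xk) - 1) - / rt32 * Ci * (z - kappa))).
exists (Rmin r1 r2), h. split; [apply Rmin_pos; auto|]. split.
{ unfold h. replace (kappa - kappa) with (RtoC 0) by ring. simpl. ring. }
intros z Hz. assert (Z1 := Rlt_le_trans _ _ _ Hz (Rmin_l _ _)). assert (Z2 := Rlt_le_trans _ _ _ Hz (Rmin_r _ _)).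
assert (N1 : ~ in_lattice L (z + kappa)).
{ apply K1. replace (z + kappa - 2 * kappa) with (z - kappa) by ring. auto. }
assert (N2 : regular L (z - kappa)).
{ apply K2. replace (z - kappa - 0) with (z - kappa) by ring. auto. }
split.
- eexists. unfold h. apply D_scal, D_minus; [apply D_plus; [apply D_const|apply D_mult]|apply D_scal, D_minus; [apply D_id|apply D_const]].
  + apply D_pow, D_minus; [apply D_id|apply D_const].
  + apply D_minus; [apply D_minus; [apply D_minus; [apply D_plus|apply D_scal, D_plus; [apply D_minus|apply D_const]]|apply D_const]|apply D_const].
    * apply (@D_shift_sub (wsum L 2)), wsum_derive; auto.
    * apply (@D_shift (Wf L 2)), Wf_derive; auto.
    * apply (@D_shift_sub (wsum L 1)), wsum_derive; auto.
    * apply (@D_shift (Wf L 1)), Wf_derive; auto.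
- intro Hne. assert (N : z - kappa <> 0) by (intro X; apply Hne, Ceq_minus; auto).
  unfold q. rewrite burnside_coeff_zeta. unfold zeta_diff, h.
  change (Wf L 2 (z - kappa)) with (/ (z - kappa) ^ 2 + wsum L 2 (z - kappa)).
  change (Wf L 1 (z - kappa)) with (/ (z - kappa) ^ 1 + wsum L 1 (z - kappa)).
  assert (R := rt32_neq0). field. auto.
Qed.

Lemma q_opp z : ~ pm_mod L kappa z -> q (- z) = q z.
Proof.
intros Hz. assert (Hs1 : ~ in_lattice L (z - kappa)) by (intro; apply Hz; left; auto).
assert (Hs2 : ~ in_lattice L (z + kappa)) by (intro; apply Hz; right; auto).
unfold q. rewrite !burnside_coeff_zeta. unfold zeta_diff.
replace (- z - kappa) with (- (z + kappa)) by ring. replace (- z + kappa) with (- (z - kappa)) by ring.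
rewrite !Wf_opp by (auto; lia). replace ((-(1)) ^ 2) with (RtoC 1) by ring. replace ((-(1)) ^ 1) with (-(1)) by ring. ring.
Qed.

(** [q] is even and periodic, so the isometry [phi] carries the statement at [kappa] to every
    singular point [e * kappa + l]; the sign disappears in the square of [e * (z - a)]. *)
Lemma q_regular_singular (e l : C) : (e = 1 \/ e = -(1)) -> in_lattice L l -> regular_singular_at q (e * kappa + l).
Proof.
intros He Hl. assert (E2 : e * e = 1) by (destruct He as [-> | ->]; ring).
assert (Ce : Cmod e = 1%R) by (destruct He as [-> | ->]; rewrite ?Cmod_opp; apply Cmod_1).
set (a := e * kappa + l). destruct q_at_kappa as (r & h & Hr & Hh & K).
destruct (pm_mod_discrete L kappa a) as (r1 & Hr1 & K1).
set (phi := fun z => e * (z - l)).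
assert (Phi : forall z, phi z - kappa = e * (z - a)).
{ intro z. unfold phi, a. replace (e * (z - (e * kappa + l))) with (e * (z - l) - e * e * kappa) by ring. rewrite E2. ring. }
assert (Phi2 : forall z, Cmod (phi z - kappa) = Cmod (z - a)).
{ intro z. rewrite Phi, Cmod_mult, Ce. ring. }
assert (Dphi : forall z, D phi z e).
{ intro z. unfold phi. eapply D_eq; [|apply D_scal, D_minus; [apply D_id|apply D_const]]. ring. }
assert (Q : forall z, (0 < Cmod (z - a) < Rmin r r1)%R -> q z = h (phi z) / (z - a) ^ 2).
{ intros z [Hz1 Hz2]. assert (Z1 := Rlt_le_trans _ _ _ Hz2 (Rmin_l _ _)). assert (Z2 := Rlt_le_trans _ _ _ Hz2 (Rmin_r _ _)).
  assert (Ns := K1 z ltac:(auto)). assert (Nza : z - a <> 0) by (apply Cmod_gt_0; auto).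
  assert (Eq : q z = q (phi z)).
  { assert (Ns' : ~ pm_mod L kappa (z - l)).
    { intro X. apply Ns. replace z with (z - l + l) by ring. apply pm_mod_shift; auto. }
    transitivity (q (z - l)).
    - replace z with (z - l + l) at 1 by ring. apply burnside_coeff_periodic; auto.
    - unfold phi. destruct He as [-> | ->]; [f_equal; ring|]. replace (-(1) * (z - l)) with (- (z - l)) by ring.
      symmetry. apply q_opp; auto. }
  rewrite Eq. destruct (K (phi z)) as [_ K2]; [rewrite Phi2; auto|]. rewrite K2.
  - rewrite Phi. replace ((e * (z - a)) ^ 2) with ((e * e) * (z - a) ^ 2) by ring. rewrite E2. f_equal. ring.
  - intro X. apply Nza. replace (z - a) with (e * e * (z - a)) by (rewrite E2; ring).
    rewrite <- Cmult_assoc, <- Phi, X. replace (kappa - kappa) with (RtoC 0) by ring. ring. }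
assert (Hm : (0 < Rmin r r1)%R) by (apply Rmin_pos; auto).
assert (Dh : forall z, (Cmod (z - a) < Rmin r r1)%R -> exists d, D (fun z => h (phi z)) z d).
{ intros z Hz. destruct (K (phi z)) as [(d & Hd) _].
  - rewrite Phi2. eapply Rlt_le_trans; [exact Hz|apply Rmin_l].
  - eexists. eapply D_comp; [exact Hd|apply Dphi]. }
split.
- exists (fun z => h (phi z)). apply locally_Cmod. exists (Rmin r r1). split; auto. intros z Hz. split.
  + destruct (Dh z Hz) as (d & Hd). exact (D_holo Hd).
  + intro Hne. apply Q. split; auto. apply Cmod_gt_0. intro X. apply Hne, Ceq_minus; auto.
- intros (h2 & H2). apply locally_Cmod in H2. destruct H2 as (r2 & Hr2 & H2).
  (* A holomorphic extension [h2] of [q] would make this difference vanish off [a], hence at [a] by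
     continuity, against [h kappa = - 3 / 16]. *)
  assert (Z : h2 a * (a - a) ^ 2 - h (phi a) = 0).
  { apply (@contC_punctured (fun z => h2 z * (z - a) ^ 2 - h (phi z)) a (Rmin r2 (Rmin r r1))).
    - apply Rmin_pos; auto.
    - destruct (H2 a (ball_center _ Hr2)) as [Hh2 _]. apply holo_D in Hh2. destruct (Dh a (ball_center _ Hm)) as (d & Hd).
      eapply D_cont. apply D_minus; [|exact Hd]. apply D_mult; [exact Hh2|]. apply D_pow, D_minus; [apply D_id|apply D_const].
    - intros z [Hz1 Hz2]. assert (Z1 := Rlt_le_trans _ _ _ Hz2 (Rmin_l _ _)). assert (Z2 := Rlt_le_trans _ _ _ Hz2 (Rmin_r _ _)).
      assert (Nza : z - a <> 0) by (apply Cmod_gt_0; auto).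
      destruct (H2 z Z1) as [_ E]. rewrite <- E, (Q z ltac:(auto)); [field; auto|].
      intros ->. apply Nza. ring. }
  assert (Ea : phi a = kappa).
  { apply Ceq_minus. rewrite Phi. ring. }
  rewrite Ea, Hh in Z. replace (a - a) with (RtoC 0) in Z by ring.
  assert (X : RtoC 3 = 0).
  { replace (RtoC 3) with (16 * (h2 a * 0 ^ 2 - - (3 / 16)) - 16 * h2 a * 0 ^ 2) by field. rewrite Z. simpl. ring. }
  apply RtoC_inj in X. lra.
Qed.

Lemma q_fuchsian : fuchsian_on_torus L q (pm_mod L kappa).
Proof.
split; [|split; [|split]].
- intros l z Hl. apply pm_mod_shift; auto.
- intros l z Hl Hz. apply burnside_coeff_periodic; auto.
- intros z Hz. destruct (@isolated_open _ (pm_mod_discrete L kappa) z Hz) as (r & Hr & K).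
  apply locally_Cmod. exists r. split; auto. intros w Hw. destruct (burnside_coeff_D (K w Hw)) as (d & Hd). exact (D_holo Hd).
- intros z [H|H].
  + replace z with (1 * kappa + (z - kappa)) by ring. apply q_regular_singular; auto.
  + replace z with (-(1) * kappa + (z + kappa)) by ring. apply q_regular_singular; auto.
Qed.

End Transfer.

(** * Paths and continuation *)

Lemma locally_R (t : R) (P : R -> Prop) :
  locally t P <-> exists d, (0 < d)%R /\ forall s, (Rabs (s - t) < d)%R -> P s.
Proof.
split.
- intros (d & H). exists d. split; [apply cond_pos|]. exact H.
- intros (d & Hd & H). exists (mkposreal d Hd). exact H.
Qed.

Lemma is_path_eps (p : R -> C) : is_path p <->
  forall t, in01 t -> forall eps : R, (0 < eps)%R -> exists d : R, (0 < d)%R /\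
    forall s, in01 s -> (Rabs (s - t) < d)%R -> (Cmod (p s - p t) < eps)%R.
Proof.
split; intros H t Ht.
- intros eps He. specialize (H t Ht (fun z => (Cmod (z - p t) < eps)%R)).
  assert (K : within in01 (locally t) (fun s => (Cmod (p s - p t) < eps)%R)).
  { apply H. apply locally_Cmod. exists eps. auto. }
  apply locally_R in K. destruct K as (d & Hd & K). exists d. split; auto.
- intros P HP. apply locally_Cmod in HP. destruct HP as (r & Hr & HP).
  destruct (H t Ht r Hr) as (d & Hd & K). apply locally_R. exists d. split; auto.
Qed.

Lemma is_path_comp (A : C -> C) (p : R -> C) : is_path p -> (forall t, in01 t -> contC A (p t)) ->
  is_path (fun t => A (p t)).
Proof.
rewrite !is_path_eps. intros H HA t Ht eps He.
destruct (HA t Ht eps He) as (r & Hr & K). destruct (H t Ht r Hr) as (d & Hd & K2).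
exists d. split; auto.
Qed.

Definition seg (z w : C) (t : R) : C := z + RtoC t * (w - z).

Lemma seg_0 z w : seg z w 0 = z. Proof. unfold seg. ring. Qed.
Lemma seg_1 z w : seg z w 1 = w. Proof. unfold seg. ring. Qed.

Lemma seg_path z w : is_path (seg z w).
Proof.
apply is_path_eps. intros t _ eps He. assert (H := Cmod_ge_0 (w - z)).
exists (eps / (Cmod (w - z) + 1))%R. split; [apply Rdiv_lt_0_compat; lra|]. intros s _ Hs.
replace (seg z w s - seg z w t) with (RtoC (s - t) * (w - z)) by (unfold seg; rewrite RtoC_minus; ring).
rewrite Cmod_mult, Cmod_R. apply Rlt_div_r in Hs; [|lra]. assert (X := Rabs_pos (s - t)). nra.
Qed.

Lemma seg_ball z0 r z w t : (Cmod (z - z0) < r)%R -> (Cmod (w - z0) < r)%R -> in01 t ->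
  (Cmod (seg z w t - z0) < r)%R.
Proof. intros Hz Hw Ht. unfold seg. apply segment_ball; auto. Qed.

(** All members of the family are continued along one and the same path. The final germs are
    prescribed up to equality near [z1] only, which is what concatenation can preserve. *)
Definition conn (P : nat -> (C -> C) -> C -> Prop) z0 (f0 : nat -> C -> C) z1 (f1 : nat -> C -> C) : Prop :=
  exists (p : R -> C) (F : R -> nat -> C -> C), is_path p /\ p 0%R = z0 /\ p 1%R = z1 /\
    forall i, continuation (P i) p (fun t => F t i) (f0 i) /\ locally z1 (fun z => F 1%R i z = f1 i z).

Lemma in01_0 : in01 0. Proof. unfold in01; lra. Qed.
Lemma in01_1 : in01 1. Proof. unfold in01; lra. Qed.

(** For a path inside one patch, where fixed functions represent the germs at all of its points. *)
Lemma conn_move (P : nat -> (C -> C) -> C -> Prop) z0 (f0 : nat -> C -> C) z1 (f1 : nat -> C -> C) (p : R -> C) (f : nat -> C -> C) :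
  is_path p -> p 0%R = z0 -> p 1%R = z1 -> (forall t i, in01 t -> P i (f i) (p t)) ->
  (forall i, locally z0 (fun z => f i z = f0 i z)) -> (forall i, locally z1 (fun z => f i z = f1 i z)) ->
  conn P z0 f0 z1 f1.
Proof.
intros Hp H0 H1 HP E0 E1. exists p, (fun _ => f). split; auto. split; auto. split; auto. intro i. split; auto.
split; [rewrite H0; auto|]. intros t Ht. split; auto.
apply locally_R. exists 1%R. split; [lra|]. intros s _ _. apply locally_Cmod. exists 1%R. split; [lra|]. auto.
Qed.

Lemma conn_trans (P : nat -> (C -> C) -> C -> Prop) z0 (f0 : nat -> C -> C) z1 (f1 : nat -> C -> C) z2 (f2 : nat -> C -> C) :
  conn P z0 f0 z1 f1 -> conn P z1 f1 z2 f2 -> conn P z0 f0 z2 f2.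
Proof.
intros (p & F & Hp & p0 & p1 & HF) (p' & F' & Hp' & p0' & p1' & HF').
set (h := fun t => if Rle_dec t (1/2) then p (2 * t)%R else p' (2 * t - 1)%R).
set (H := fun t => if Rle_dec t (1/2) then F (2 * t)%R else F' (2 * t - 1)%R).
assert (h1 : forall t, (t <= 1/2)%R -> h t = p (2 * t)%R).
{ intros t Ht. unfold h. destruct (Rle_dec t (1/2)); auto. lra. }
assert (h2 : forall t, (1/2 <= t)%R -> h t = p' (2 * t - 1)%R).
{ intros t Ht. unfold h. destruct (Rle_dec t (1/2)); auto. replace t with (1/2)%R by lra.
  replace (2 * (1 / 2))%R with 1%R by field. replace (1 - 1)%R with 0%R by ring. congruence. }
assert (H1 : forall t, (t <= 1/2)%R -> H t = F (2 * t)%R).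
{ intros t Ht. unfold H. destruct (Rle_dec t (1/2)); auto. lra. }
assert (H2 : forall t, (1/2 < t)%R -> H t = F' (2 * t - 1)%R).
{ intros t Ht. unfold H. destruct (Rle_dec t (1/2)); auto. lra. }
rewrite is_path_eps in Hp, Hp'.
assert (I1 : forall t, in01 t -> (t <= 1/2)%R -> in01 (2 * t)) by (unfold in01; intros; lra).
assert (I2 : forall t, in01 t -> (1/2 <= t)%R -> in01 (2 * t - 1)) by (unfold in01; intros; lra).
assert (A1 : forall s t d, (Rabs (s - t) < d / 2 -> Rabs (2 * s - 2 * t) < d)%R).
{ intros s t d Hs. replace (2 * s - 2 * t)%R with (2 * (s - t))%R by ring. rewrite Rabs_mult, (Rabs_pos_eq 2); lra. }
assert (A2 : forall s t d, (Rabs (s - t) < d / 2 -> Rabs (2 * s - 1 - (2 * t - 1)) < d)%R).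
{ intros s t d Hs. replace (2 * s - 1 - (2 * t - 1))%R with (2 * (s - t))%R by ring. rewrite Rabs_mult, (Rabs_pos_eq 2); lra. }
exists h, H. split; [|split; [|split]].
- apply is_path_eps. intros t Ht eps He.
  assert (B1 : exists d, (0 < d)%R /\ ((t <= 1/2)%R -> forall s, in01 s -> (s <= 1/2)%R -> (Rabs (s - t) < d)%R -> (Cmod (h s - h t) < eps)%R)).
  { destruct (Rle_dec t (1/2)) as [Hl|Hl]; [|exists 1%R; split; [lra|]; intro; lra].
    destruct (Hp (2 * t)%R ltac:(auto) eps He) as (d & Hd & K). exists (d / 2)%R. split; [lra|]. intros _ s Hs Hs2 Hst.
    rewrite !h1 by auto. apply K; auto. }
  assert (B2 : exists d, (0 < d)%R /\ ((1/2 <= t)%R -> forall s, in01 s -> (1/2 <= s)%R -> (Rabs (s - t) < d)%R -> (Cmod (h s - h t) < eps)%R)).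
  { destruct (Rle_dec (1/2) t) as [Hl|Hl]; [|exists 1%R; split; [lra|]; intro; lra].
    destruct (Hp' (2 * t - 1)%R ltac:(auto) eps He) as (d & Hd & K). exists (d / 2)%R. split; [lra|]. intros _ s Hs Hs2 Hst.
    rewrite !h2 by auto. apply K; auto. }
  destruct B1 as (d1 & Hd1 & B1), B2 as (d2 & Hd2 & B2).
  destruct (Req_dec t (1/2)) as [E|E].
  + exists (Rmin d1 d2). split; [apply Rmin_pos; auto|]. intros s Hs Hst.
    assert (S1 := Rlt_le_trans _ _ _ Hst (Rmin_l _ _)). assert (S2 := Rlt_le_trans _ _ _ Hst (Rmin_r _ _)).
    destruct (Rle_dec s (1/2)); [apply B1|apply B2]; auto; lra.
  + assert (M : (0 < Rabs (t - 1/2))%R) by (apply Rabs_pos_lt; lra).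
    destruct (min3_pos Hd1 Hd2 M) as (d & Hd & L1 & L2 & L3). exists d. split; auto. intros s Hs Hst.
    destruct (Rle_dec t (1/2)) as [Hl|Hl].
    * rewrite Rabs_left in L3 by lra. apply Rabs_def2 in Hst as Q. apply B1; auto; try lra.
    * rewrite Rabs_pos_eq in L3 by lra. apply Rabs_def2 in Hst as Q. apply B2; auto; try lra.
- rewrite h1 by lra. replace (2 * 0)%R with 0%R by ring. auto.
- rewrite h2 by lra. replace (2 * 1 - 1)%R with 1%R by ring. auto.
- intro i. destruct (HF i) as [[Ea Eb] Ec], (HF' i) as [[Ea' Eb'] Ec'].
  split; [split|].
  + rewrite h1, H1 by lra. replace (2 * 0)%R with 0%R by ring. auto.
  + intros t Ht. split.
    * destruct (Rle_dec t (1/2)) as [Hl|Hl].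
      -- rewrite h1, H1 by auto. apply Eb; auto.
      -- rewrite h2, H2 by lra. apply Eb'. apply I2; auto; lra.
    * destruct (Rlt_dec t (1/2)) as [Hl|Hl]; [|destruct (Req_dec t (1/2)) as [E|E]].
      -- destruct (Eb (2 * t)%R ltac:(apply I1; auto; lra)) as [_ K]. apply locally_R in K. destruct K as (d & Hd & K).
         apply locally_R. exists (Rmin (d / 2) (1/2 - t)). split; [apply Rmin_pos; lra|]. intros s Hs Hsi.
         assert (S1 := Rlt_le_trans _ _ _ Hs (Rmin_l _ _)). assert (S2 := Rlt_le_trans _ _ _ Hs (Rmin_r _ _)).
         apply Rabs_def2 in S2. rewrite h1, !H1 by lra. apply K; auto. apply I1; auto; lra.
      -- destruct (Eb (2 * t)%R ltac:(apply I1; auto; lra)) as [_ K]. apply locally_R in K. destruct K as (d & Hd & K).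
         destruct (Eb' (2 * t - 1)%R ltac:(apply I2; auto; lra)) as [_ K']. apply locally_R in K'. destruct K' as (d' & Hd' & K').
         rewrite E in K, K'. replace (2 * (1/2))%R with 1%R in K by field.
         replace (2 * (1 / 2) - 1)%R with 0%R in K' by field.
         (* At the junction the two families agree as germs at [z1]. The agreement holds on a ball,
            hence also as germs at the nearby points of the second path. *)
         assert (G : locally z1 (fun z => F' 0%R i z = F 1%R i z)).
         { rewrite p0' in Ea'. generalize (filter_and _ _ Ea' Ec). apply filter_imp. intros z [X Y]. congruence. }
         apply locally_locally in G. apply locally_Cmod in G. destruct G as (rho & Hrho & G).
         destruct (Hp' 0%R in01_0 rho Hrho) as (d3 & Hd3 & K3). rewrite p0' in K3.
         destruct (min3_pos Hd Hd' Hd3) as (m & Hm & L1 & L2 & L3).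
         apply locally_R. exists (m / 2)%R. split; [lra|]. intros s Hs Hsi.
         rewrite (H1 t) by lra. rewrite E. replace (2 * (1/2))%R with 1%R by field.
         destruct (Rle_dec s (1/2)) as [Hs2|Hs2].
         ++ rewrite h1, H1 by auto. apply K; [|apply I1; auto].
            assert (X := A1 s (1/2)%R m ltac:(rewrite <- E; auto)). replace (2 * (1/2))%R with 1%R in X by field. lra.
         ++ rewrite h2, H2 by lra.
            assert (X := A2 s (1/2)%R m ltac:(rewrite <- E; auto)). replace (2 * (1/2) - 1)%R with 0%R in X by field.
            assert (Y := I2 s Hsi ltac:(lra)).
            specialize (K' (2 * s - 1)%R ltac:(lra) Y). specialize (G _ (K3 (2 * s - 1)%R Y ltac:(lra))).
            generalize (filter_and _ _ K' G). apply filter_imp. intros z [U V]. congruence.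
      -- destruct (Eb' (2 * t - 1)%R ltac:(apply I2; auto; lra)) as [_ K]. apply locally_R in K. destruct K as (d & Hd & K).
         apply locally_R. exists (Rmin (d / 2) (t - 1/2)). split; [apply Rmin_pos; lra|]. intros s Hs Hsi.
         assert (S1 := Rlt_le_trans _ _ _ Hs (Rmin_l _ _)). assert (S2 := Rlt_le_trans _ _ _ Hs (Rmin_r _ _)).
         apply Rabs_def2 in S2. rewrite h2, !H2 by lra. apply K; auto. apply I2; auto; lra.
  + rewrite H2 by lra. replace (2 * 1 - 1)%R with 1%R by ring. auto.
Qed.

(** * Square roots along paths *)

Lemma C_sqrt_exists z : exists c, c ^ 2 = z.
Proof.
destruct z as [a b]. set (m := Cmod (a, b)).
assert (Ha := re_le_Cmod (a, b)). fold m in Ha. simpl in Ha.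
assert (Hm : (m * m = a * a + b * b)%R).
{ assert (X := Cmod2_alt (a, b)). fold m in X. simpl in X. lra. }
apply Rabs_le_between in Ha.
assert (H1 := sqrt_sqrt ((m + a) / 2) ltac:(lra)). assert (H2 := sqrt_sqrt ((m - a) / 2) ltac:(lra)).
set (u := sqrt ((m + a) / 2)) in *. set (v := sqrt ((m - a) / 2)) in *.
assert (Hu : (0 <= u)%R) by apply sqrt_pos. assert (Hv : (0 <= v)%R) by apply sqrt_pos.
assert (E : ((2 * (u * v)) * (2 * (u * v)) = b * b)%R).
{ replace ((2 * (u * v)) * (2 * (u * v)))%R with (4 * (u * u) * (v * v))%R by ring. rewrite H1, H2. nra. }
assert (Huv : (0 <= u * v)%R) by (apply Rmult_le_pos; auto).
destruct (Rle_dec 0 b) as [Hb|Hb].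
- exists (u, v). unfold Cpow, Cmult, RtoC; simpl. f_equal; [lra|].
  assert ((2 * (u * v) - b) * (2 * (u * v) + b) = 0)%R by lra.
  apply Rmult_integral in H. destruct H; lra.
- exists (u, - v)%R. unfold Cpow, Cmult, RtoC; simpl. f_equal; [lra|].
  assert ((2 * (u * v) - b) * (2 * (u * v) + b) = 0)%R by lra.
  apply Rmult_integral in H. destruct H; lra.
Qed.

Lemma local_sqrt z0 : z0 <> 0 -> exists (s : R) (g : C -> C), (0 < s)%R /\
  forall v, (Cmod (v - z0) < s)%R -> g v ^ 2 = v /\ g v <> 0 /\ exists d, D g v d.
Proof.
intro H0. destruct (C_sqrt_exists z0) as (c & Hc).
assert (Nc : c <> 0) by (intro E; apply H0; rewrite <- Hc, E; simpl; ring).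
destruct (@local_inverse (fun z => z * z) (fun z => 2 * z) c 1 Rlt_0_1) as (r & s & g & Hr & Hs & Nz & _ & G).
- intros z _. eapply D_eq; [|apply (@D_mult (fun z => z) (fun z => z) z 1 1); apply D_id]. ring.
- eapply D_cont. apply D_scal, D_id.
- nz.
- exists s, g. split; auto. intros v Hv. assert (Ec : c * c = z0) by (rewrite <- Hc; ring). cbv beta in G. rewrite Ec in G.
  destruct (G v Hv) as (G1 & G2 & G3). cbv beta in G2. split; [replace (g v ^ 2) with (g v * g v) by ring; exact G2|]. split; [|eauto].
  intro E. apply (Nz _ G1). rewrite E. ring.
Qed.

Lemma sq_eq_sign a b : a ^ 2 = b ^ 2 -> a = b \/ a = - b.
Proof.
intro H. destruct (Ceq_dec (a - b) 0) as [E|E]; [left; apply Ceq_minus; auto|right].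
assert (F : (a - b) * (a + b) = 0) by (replace ((a - b) * (a + b)) with (a ^ 2 - b ^ 2) by ring; rewrite H; ring).
apply Ceq_minus. replace (a - - b) with ((a - b) * (a + b) / (a - b)) by (field; auto). rewrite F. field; auto.
Qed.

(** A root on [[0, s]] is prolonged by a local holomorphic root. The predicate [Q] asks for
    continuity relative to [[0, T]] only, since the function is arbitrary beyond [T] until it is
    prolonged. *)
Lemma path_sqrt (v : R -> C) (r0 : C) : is_path v -> (forall t, in01 t -> v t <> 0) -> r0 ^ 2 = v 0%R ->
  exists r : R -> C, is_path r /\ r 0%R = r0 /\ forall t, in01 t -> r t ^ 2 = v t.
Proof.
intros Hv Nv H0. rewrite is_path_eps in Hv.
set (Q := fun T (r : R -> C) => r 0%R = r0 /\ forall t, (0 <= t <= T)%R -> r t ^ 2 = v t /\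
   forall eps, (0 < eps)%R -> exists d, (0 < d)%R /\ forall s, (0 <= s <= T)%R -> (Rabs (s - t) < d)%R -> (Cmod (r s - r t) < eps)%R).
assert (K : exists r, Q 1%R r).
{ apply (chain_induction (fun T => exists r, Q T r)).
  - exists (fun _ => r0). split; auto. intros t Ht. replace t with 0%R by lra. split; auto.
    intros eps He. exists 1%R. split; [lra|]. intros s _ _. replace (r0 - r0) with (RtoC 0) by ring. rewrite Cmod_0; auto.
  - intros t Ht. destruct (local_sqrt (Nv t Ht)) as (s0 & g & Hs0 & G).
    destruct (Hv t Ht s0 Hs0) as (d & Hd & Kd). exists d. split; auto.
    intros s s' Hs Hs' Hst Hst' (r & R0 & R1).
    destruct (Rle_dec s' s) as [Hl|Hl].
    { exists r. split; auto. intros t' Ht'. destruct (R1 t' ltac:(lra)) as [X Y]. split; auto.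
      intros eps He. destruct (Y eps He) as (d' & Hd' & Y'). exists d'. split; auto. intros. apply Y'; auto. lra. }
    assert (In : forall u, (s <= u <= s')%R -> in01 u /\ (Rabs (u - t) < d)%R).
    { intros u Hu. split; [unfold in01 in *; lra|]. apply Rabs_def2 in Hst. apply Rabs_def2 in Hst'. apply Rabs_def1; lra. }
    assert (Gs : forall u, (s <= u <= s')%R -> g (v u) ^ 2 = v u /\ contC g (v u)).
    { intros u Hu. destruct (In u Hu) as [U1 U2]. destruct (G (v u) (Kd u U1 U2)) as (G1 & _ & (dd & G2)). split; auto. exact (D_cont G2). }
    destruct (R1 s ltac:(lra)) as [Rs _]. destruct (Gs s ltac:(lra)) as [Gss _].
    (* The local root may be opposite to the one carried so far; [e] corrects its sign. *)
    assert (Sg : exists e, e ^ 2 = 1 /\ Cmod e = 1%R /\ r s = e * g (v s)).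
    { destruct (@sq_eq_sign (r s) (g (v s))) as [E|E]; [congruence| |].
      - exists 1. rewrite Cmod_1. repeat split; [ring|rewrite E; ring].
      - exists (-(1)). rewrite Cmod_m1. repeat split; [ring|rewrite E; ring]. }
    destruct Sg as (e & E2 & Ce & Es).
    set (r' := fun u => if Rle_dec u s then r u else e * g (v u)).
    assert (r1 : forall u, (u <= s)%R -> r' u = r u). { intros u Hu. unfold r'. destruct (Rle_dec u s); auto. lra. }
    assert (r2 : forall u, (s <= u)%R -> r' u = e * g (v u)).
    { intros u Hu. unfold r'. destruct (Rle_dec u s); auto. replace u with s by lra. auto. }
    exists r'. split; [rewrite r1 by lra; auto|]. intros u Hu. split.
    { destruct (Rle_dec u s); [rewrite r1 by auto; apply R1; lra|].
      rewrite r2 by lra. destruct (Gs u ltac:(lra)) as [X _]. rewrite Cpow_mult_l, E2, X. ring. }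
    intros eps He.
    assert (B1 : exists d1, (0 < d1)%R /\ ((u <= s)%R -> forall x, (0 <= x <= s)%R -> (Rabs (x - u) < d1)%R -> (Cmod (r' x - r' u) < eps)%R)).
    { destruct (Rle_dec u s) as [L|L]; [|exists 1%R; split; [lra|]; intro; lra].
      destruct (R1 u ltac:(lra)) as [_ Y]. destruct (Y eps He) as (d1 & Hd1 & Y1). exists d1. split; auto. intros _ x Hx Hxu.
      rewrite !r1 by lra. auto. }
    assert (B2 : exists d1, (0 < d1)%R /\ ((s <= u)%R -> forall x, (s <= x <= s')%R -> (Rabs (x - u) < d1)%R -> (Cmod (r' x - r' u) < eps)%R)).
    { destruct (Rle_dec s u) as [L|L]; [|exists 1%R; split; [lra|]; intro; lra].
      destruct (Gs u ltac:(lra)) as [_ Y]. destruct (Y eps He) as (d1 & Hd1 & Y1).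
      destruct (In u ltac:(lra)) as [U1 _]. destruct (Hv u U1 d1 Hd1) as (d2 & Hd2 & Y2).
      exists d2. split; auto. intros _ x Hx Hxu. rewrite !r2 by lra.
      replace (e * g (v x) - e * g (v u)) with (e * (g (v x) - g (v u))) by ring. rewrite Cmod_mult, Ce, Rmult_1_l.
      apply Y1. apply Y2; auto. apply In; auto. }
    destruct B1 as (d1 & Hd1 & B1), B2 as (d2 & Hd2 & B2).
    destruct (Req_dec u s) as [E|E].
    + exists (Rmin d1 d2). split; [apply Rmin_pos; auto|]. intros x Hx Hxu.
      assert (S1 := Rlt_le_trans _ _ _ Hxu (Rmin_l _ _)). assert (S2 := Rlt_le_trans _ _ _ Hxu (Rmin_r _ _)).
      destruct (Rle_dec x s); [apply B1|apply B2]; auto; lra.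
    + assert (M : (0 < Rabs (u - s))%R) by (apply Rabs_pos_lt; lra).
      destruct (min3_pos Hd1 Hd2 M) as (m & Hm & L1 & L2 & L3). exists m. split; auto. intros x Hx Hxu.
      apply Rabs_def2 in Hxu as X.
      destruct (Rle_dec u s) as [L|L].
      * rewrite Rabs_left in L3 by lra. apply B1; auto; lra.
      * rewrite Rabs_pos_eq in L3 by lra. apply B2; auto; lra. }
destruct K as (r & R0 & R1). exists r. split; [|split; auto].
- apply is_path_eps. intros t Ht eps He. apply R1; auto.
- intros t Ht. apply R1. auto.
Qed.

Unset Strict Implicit.

(** * Germs of branches and of solutions *)

Lemma locally_and (P Q : C -> Prop) z : locally z P -> locally z Q -> locally z (fun y => P y /\ Q y).
Proof. intros; apply filter_and; auto. Qed.

Lemma locally_imp (P Q : C -> Prop) z : (forall y, P y -> Q y) -> locally z P -> locally z Q.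
Proof. intros H K. eapply filter_imp; eauto. Qed.

Lemma locally_self (P : C -> Prop) z : locally z P -> P z.
Proof. intro H. apply (locally_singleton _ _ H). Qed.

Lemma locally_twice (P : C -> Prop) z : locally z P -> locally z (fun y => locally y P).
Proof. intro H. apply locally_locally in H. exact H. Qed.

Lemma locally_comp (A : C -> C) (P : C -> Prop) z : contC A z -> locally (A z) P -> locally z (fun y => P (A y)).
Proof.
intros H K. apply locally_Cmod in K. destruct K as (r & Hr & K). destruct (H r Hr) as (d & Hd & K2).
apply locally_Cmod. exists d. split; auto.
Qed.

Lemma D_near_ext (A B : C -> C) z : locally z (holo_at A) -> locally z (fun y => A y = B y) ->
  locally z (fun y => holo_at B y /\ C_derive B y = C_derive A y).
Proof.
intros H E. apply locally_twice in E. generalize (@locally_and _ _ _ H E). apply locally_imp. intros y [Hy Ey].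
apply holo_D in Hy. assert (K := @D_ext_loc A B y _ Ey Hy). split; [exact (D_holo K)|]. apply D_C_derive; auto.
Qed.

Lemma cover_branch_ext L (A B : C -> C) z : locally z (fun y => A y = B y) -> cover_branch_at L A z -> cover_branch_at L B z.
Proof.
intros E (H1 & H2 & H3). assert (H4 : locally z (holo_at A)) by (revert H2; apply locally_imp; tauto).
assert (K := @D_near_ext _ _ _ H4 E). split; auto. split.
- generalize (@locally_and _ _ _ (@locally_and _ _ _ K E) H2). apply locally_imp. intros y (((X1 & X2) & X3) & X4). rewrite <- X3. tauto.
- destruct (locally_self K) as [_ ->]. auto.
Qed.

Lemma changed_by_ext (A B S T f g X Y : C -> C) z : locally z (holo_at A) ->
  locally z (fun y => A y = B y) -> locally z (fun y => S y = T y) -> locally z (fun y => f y = g y) ->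
  locally (A z) (fun v => X v = Y v) -> changed_by A S f X z -> changed_by B T g Y z.
Proof.
intros HA EA ES Ef EX H. assert (K := @D_near_ext _ _ _ HA EA).
assert (HS : locally z (holo_at S)) by (revert H; apply locally_imp; tauto).
assert (KS := @D_near_ext _ _ _ HS ES).
assert (cA : contC A z) by (eapply D_cont; apply holo_D; exact (locally_self HA)).
assert (EXA := @locally_comp _ _ _ cA EX).
generalize (@locally_and _ _ _ (@locally_and _ _ _ (@locally_and _ _ _ K EA) (@locally_and _ _ _ KS ES)) (@locally_and _ _ _ (@locally_and _ _ _ Ef EXA) H)).
apply locally_imp. intros y ((((Q1 & Q2) & Q3) & ((Q4 & Q5) & Q6)) & ((Q7 & Q8) & (Q9 & Q10 & Q11))).
split; auto. split.
- rewrite Q2, <- Q6. auto.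
- rewrite <- Q3, <- Q8, Q11, Q6, Q7. reflexivity.
Qed.

(** A change of sign of the square root can be charged either to the solution on the torus or to the
    one in the [x]-plane. The path to the torus uses the first form, the lift the second. *)
Lemma changed_by_scale (A S f X : C -> C) z (e : C) : e ^ 2 = 1 -> changed_by A S f X z ->
  changed_by A (fun y => e * S y) f (fun v => e * X v) z /\ changed_by A (fun y => e * S y) (fun y => e * f y) X z.
Proof.
intros E H.
assert (Hd : forall y, holo_at S y -> holo_at (fun y => e * S y) y).
{ intros y Hy. apply holo_D in Hy. eapply D_holo. apply D_scal. exact Hy. }
split; revert H; apply locally_imp; intros y (H1 & H2 & H3); (split; [apply Hd; auto|]); split.
- rewrite Cpow_mult_l, E, H2. ring.
- rewrite H3. ring.
- rewrite Cpow_mult_l, E, H2. ring.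
- rewrite H3. replace (e * S y * (e * f y)) with (e ^ 2 * (S y * f y)) by ring. rewrite E. ring.
Qed.

Lemma solution_scale (q : C -> C) f z (e : C) : solution_at q f z -> solution_at q (fun y => e * f y) z.
Proof.
rewrite !solution_at_iff. intros (r & f1 & Hr & H). exists r, (fun y => e * f1 y). split; auto.
intros y Hy. destruct (H y Hy) as [H1 H2]. split; [apply D_scal; auto|].
eapply D_eq; [|apply D_scal; exact H2]. ring.
Qed.

Lemma cover_branch_holo L (A : C -> C) x : cover_branch_at L A x -> locally x (holo_at A).
Proof. intros (_ & H & _). revert H. apply locally_imp. tauto. Qed.

Lemma cover_branch_cont L (A : C -> C) x : cover_branch_at L A x -> contC A x.
Proof. intro H. eapply D_cont. apply holo_D. exact (locally_self (cover_branch_holo H)). Qed.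

(** * Patches: a branch with a square root of its derivative *)

Section Patches.
Variables (L : lattice) (kappa : C).
Hypothesis Hg2 : lattice_g2 L = RtoC (5 / 3).
Hypothesis Hg3 : lattice_g3 L = RtoC (- (7 / 27) * sqrt 2).
Hypothesis Hkappa : ~ in_lattice L kappa.
Hypothesis Hwp : wp L kappa = RtoC (- (7 / 2) - 13 / 6 * sqrt 2).
Hypothesis Hwp' : C_derive (wp L) kappa = RtoC (sqrt (sqrt 32) * (7 + 5 * sqrt 2)) * Ci.

Let q := burnside_coeff L kappa.
Let bp := branch_point L kappa.

Lemma cover_branch_near A x : cover_branch_at L A x -> locally x (fun y => cover_branch_at L A y /\ bp A y).
Proof.
intro H. destruct (branch_structure Hg2 Hg3 Hkappa Hwp Hwp' H) as (r & Hr & K).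
apply locally_Cmod. exists r. split; auto. intros y Hy. split; [|apply K; auto].
eapply branch_point_cover. apply (@locally_ball _ x r y Hy). exact K.
Qed.

(** A branch is an open map, by its continuous local inverse; thus relations proved in the variable
    [x] become relations between germs in [alpha]. *)
Lemma cover_branch_open A x (Q : C -> Prop) : cover_branch_at L A x -> locally x (fun y => Q (A y)) -> locally (A x) Q.
Proof.
intros H HQ. destruct (branch_inverse Hg2 Hg3 Hkappa Hwp Hwp' H) as (r & s & g & Hr & Hs & _ & Inj & G).
apply locally_Cmod in HQ. destruct HQ as (r1 & Hr1 & HQ).
assert (G0 : g (A x) = x).
{ apply Inj; [apply (G (A x)); apply ball_center; auto|apply ball_center; auto|apply (G (A x)); apply ball_center; auto]. }
destruct (D_cont (proj2 (proj2 (G (A x) (ball_center _ Hs)))) Hr1) as (d & Hd & Kd). rewrite G0 in Kd.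
apply locally_Cmod. exists (Rmin s d). split; [apply Rmin_pos; auto|]. intros v Hv.
assert (V1 := Rlt_le_trans _ _ _ Hv (Rmin_l _ _)). assert (V2 := Rlt_le_trans _ _ _ Hv (Rmin_r _ _)).
destruct (G v V1) as (_ & E & _). rewrite <- E. apply HQ. apply Kd. auto.
Qed.

Definition root_branch (A S : C -> C) (x : C) : Prop :=
  cover_branch_at L A x /\ bp A x /\ holo_at S x /\ S x ^ 2 = C_derive A x /\ S x <> 0.

Lemma root_branch_exists A x : cover_branch_at L A x -> exists S, locally x (root_branch A S).
Proof.
intro H. destruct (locally_self (cover_branch_near H)) as [_ B].
destruct (local_sqrt (branch_point_neq0 B)) as (s & g & Hs & G).
assert (DA : contC (C_derive A) x) by (eapply D_cont; apply B).
exists (fun y => g (C_derive A y)).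
assert (Near : locally x (fun y => (Cmod (C_derive A y - C_derive A x) < s)%R)).
{ destruct (DA s Hs) as (d & Hd & K). apply locally_Cmod. exists d; auto. }
generalize (@locally_and _ _ _ Near (cover_branch_near H)). apply locally_imp. intros y [Hy [H1 H2]].
destruct (G _ Hy) as (G1 & G2 & (d & G3)). split; auto. split; auto. split.
- eapply D_holo. eapply D_comp; [exact G3|apply H2].
- split; auto.
Qed.

Lemma patch_to_torus A S f x : locally x (root_branch A S) -> exists X, locally x (changed_by A S f X).
Proof.
intro H. destruct (locally_self H) as (Hb & _).
destruct (branch_inverse Hg2 Hg3 Hkappa Hwp Hwp' Hb) as (r & s & g & Hr & Hs & _ & Inj & G).
exists (fun v => S (g v) * f (g v)).
assert (N1 : locally x (fun y => (Cmod (y - x) < r)%R)) by (apply locally_Cmod; exists r; auto).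
assert (N2 : locally x (fun y => (Cmod (A y - A x) < s)%R)).
{ destruct (cover_branch_cont Hb Hs) as (d & Hd & K). apply locally_Cmod. exists d; auto. }
apply locally_locally. generalize (@locally_and _ _ _ (@locally_and _ _ _ N1 N2) H). apply locally_imp. intros y ((H1 & H2) & H3).
destruct H3 as (_ & _ & H4 & H5 & _). split; auto. split; auto.
destruct (G _ H2) as (G1 & G2 & _). assert (E : g (A y) = y) by (apply Inj; auto). rewrite E. reflexivity.
Qed.

Lemma patch_to_cover A S X x : locally x (root_branch A S) -> locally x (changed_by A S (fun y => X (A y) / S y) X).
Proof.
intro H. apply locally_locally. revert H. apply locally_imp. intros y (_ & _ & H4 & H5 & H6). split; auto. split; auto.
field. auto.
Qed.

(** The product [(S - e T) (S + e T)] vanishes, and the second factor is nonzero at [x], hence near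
    it. So the sign is constant, not just chosen pointwise. *)
Lemma changed_sign A S T x : cover_branch_at L A x -> locally x (fun y => holo_at S y /\ S y ^ 2 = C_derive A y) ->
  locally x (root_branch A T) -> exists e, e ^ 2 = 1 /\ locally x (fun y => S y = e * T y).
Proof.
intros Hb HS HT. destruct (locally_self HS) as [S1 S2]. destruct (locally_self HT) as (_ & _ & T1 & T2 & T3).
assert (E : exists e, e ^ 2 = 1 /\ S x = e * T x).
{ destruct (@sq_eq_sign (S x) (T x)) as [E|E]; [congruence| |].
  - exists 1. split; [ring|rewrite E; ring].
  - exists (-(1)). split; [ring|rewrite E; ring]. }
destruct E as (e & E2 & Ex). exists e. split; auto.
assert (N : exists r, (0 < r)%R /\ forall y, (Cmod (y - x) < r)%R -> S y + e * T y <> 0).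
{ apply (@nonzero_near (fun y => S y + e * T y)).
  - apply holo_D in S1. apply holo_D in T1. eapply D_cont. apply D_plus; [exact S1|apply D_scal; exact T1].
  - rewrite Ex. intro X. apply T3.
    assert (Y : e * (e * T x + e * T x) = 0) by (rewrite X; ring).
    replace (T x) with (e * (e * T x + e * T x) / (2 * e ^ 2)); [rewrite Y, E2; field|].
    replace (e * (e * T x + e * T x)) with (2 * e ^ 2 * T x) by ring. rewrite E2. field. }
destruct N as (r & Hr & N). assert (N1 : locally x (fun y => S y + e * T y <> 0)) by (apply locally_Cmod; exists r; auto).
generalize (@locally_and _ _ _ N1 (@locally_and _ _ _ HS HT)). apply locally_imp. intros y (Y1 & (_ & Y2) & (_ & _ & _ & Y3 & _)).
apply Ceq_minus.
assert (F : (S y - e * T y) * (S y + e * T y) = 0).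
{ replace ((S y - e * T y) * (S y + e * T y)) with (S y ^ 2 - e ^ 2 * T y ^ 2) by ring. rewrite E2, Y2, Y3. ring. }
replace (S y - e * T y) with ((S y - e * T y) * (S y + e * T y) / (S y + e * T y)) by (field; auto). rewrite F. field; auto.
Qed.

Definition PX (i : nat) : (C -> C) -> C -> Prop :=
  match i with O => cover_branch_at L | 1%nat | 2%nat => solution_at whittaker_coeff | _ => fun _ _ => True end.

(** At index 0 the germ is immaterial: the entry records that the path avoids the singular
    points. *)
Definition PT (i : nat) : (C -> C) -> C -> Prop :=
  match i with O => fun _ z => ~ pm_mod L kappa z | 1%nat | 2%nat => solution_at q | _ => fun _ _ => True end.

(* Indexing by [nat] (with trivial entries from 3 on) lets the three germs be continued
   at once. *)
Definition tri (A f g : C -> C) (i : nat) : C -> C :=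
  match i with O => A | 1%nat => f | 2%nat => g | _ => fun _ => 0 end.

Lemma PX_ext i (A B : C -> C) z : locally z (fun y => A y = B y) -> PX i A z -> PX i B z.
Proof.
destruct i as [|[|[|i]]]; simpl; intro E; auto; [apply cover_branch_ext; auto|apply solution_at_ext; auto|apply solution_at_ext; auto].
Qed.

Lemma conn_end z0 (f0 : nat -> C -> C) z1 (f1 : nat -> C -> C) : conn PX z0 f0 z1 f1 -> forall i, PX i (f1 i) z1.
Proof.
intros (p & F & Hp & p0 & p1 & H) i. destruct (H i) as [[_ H1] H2]. destruct (H1 1%R in01_1) as [H3 _].
rewrite p1 in H3. eapply PX_ext; [exact H2|exact H3].
Qed.

Lemma PX_tri A f g z : cover_branch_at L A z -> solution_at whittaker_coeff f z -> solution_at whittaker_coeff g z ->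
  forall i, PX i (tri A f g i) z.
Proof. intros H1 H2 H3 [|[|[|i]]]; simpl; auto. Qed.

Lemma PT_tri A f g z : ~ pm_mod L kappa z -> solution_at q f z -> solution_at q g z -> forall i, PT i (tri A f g i) z.
Proof. intros H1 H2 H3 [|[|[|i]]]; simpl; auto. Qed.

Lemma tri_near (A f g A' f' g' : C -> C) z : locally z (fun y => A y = A' y) -> locally z (fun y => f y = f' y) ->
  locally z (fun y => g y = g' y) -> forall i, locally z (fun y => tri A f g i y = tri A' f' g' i y).
Proof.
intros H1 H2 H3 [|[|[|i]]]; simpl; auto. apply locally_Cmod. exists 1%R. split; [lra|]. auto.
Qed.

Lemma locally_refl (f : C -> C) z : locally z (fun y => f y = f y).
Proof. apply locally_Cmod. exists 1%R. split; [lra|]. auto. Qed.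

Lemma conn_refl_tri P A f g z : (forall i, P i (tri A f g i) z) -> conn P z (tri A f g) z (tri A f g).
Proof.
intro H. apply conn_move with (p := seg z z) (f := tri A f g).
- apply seg_path.
- apply seg_0.
- apply seg_1.
- intros t i _. replace (seg z z t) with z by (unfold seg; ring). apply H.
- intro i. apply locally_refl.
- intro i. apply locally_refl.
Qed.

End Patches.

(** * The orbifold groups *)

Section Orbifold.
Variables (L : lattice) (kappa : C).
Hypothesis Hg2 : lattice_g2 L = RtoC (5 / 3).
Hypothesis Hg3 : lattice_g3 L = RtoC (- (7 / 27) * sqrt 2).
Hypothesis Hkappa : ~ in_lattice L kappa.
Hypothesis Hwp : wp L kappa = RtoC (- (7 / 2) - 13 / 6 * sqrt 2).
Hypothesis Hwp' : C_derive (wp L) kappa = RtoC (sqrt (sqrt 32) * (7 + 5 * sqrt 2)) * Ci.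

Let q := burnside_coeff L kappa.
Let PXL := PX L.
Let PTL := PT L kappa.
Let transferL := transfer Hg2 Hg3 Hkappa Hwp Hwp'.

Lemma locally_at (P : C -> Prop) z : locally z P -> exists r, (0 < r)%R /\ forall y, (Cmod (y - z) < r)%R -> P y.
Proof. apply locally_Cmod. Qed.

Lemma forward_patch A f1 f2 x : cover_branch_at L A x ->
  solution_at whittaker_coeff f1 x -> solution_at whittaker_coeff f2 x ->
  exists S X1 X2, locally x (fun y => root_branch L kappa A S y /\ changed_by A S f1 X1 y /\ changed_by A S f2 X2 y /\
    solution_at q X1 (A y) /\ solution_at q X2 (A y)).
Proof.
intros Hb H1 H2. destruct (root_branch_exists Hg2 Hg3 Hkappa Hwp Hwp' Hb) as (S & HS).
destruct (patch_to_torus Hg2 Hg3 Hkappa Hwp Hwp' f1 HS) as (X1 & E1).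
destruct (patch_to_torus Hg2 Hg3 Hkappa Hwp Hwp' f2 HS) as (X2 & E2).
exists S, X1, X2. apply solution_at_near in H1. apply solution_at_near in H2.
generalize (@locally_and _ _ _ (@locally_and _ _ _ HS (@locally_and _ _ _ E1 E2)) (@locally_and _ _ _ H1 H2)).
apply locally_imp. intros y ((Y1 & Y2 & Y3) & Y4 & Y5). split; auto. split; auto. split; auto.
destruct Y1 as (Y1 & _). split; [apply (transferL Y1 Y2); auto|apply (transferL Y1 Y3); auto].
Qed.

Lemma changed_by_root A S f X x : changed_by A S f X x -> locally x (fun y => holo_at S y /\ S y ^ 2 = C_derive A y).
Proof. apply locally_imp. tauto. Qed.

Let zero : C -> C := fun _ => 0.

(** Each patch determines the torus solutions up to one sign common to both. The invariant of the
    chain therefore only asserts that some [X1], [X2] with a common root [S] correspond to the germs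
    at [x t] and are reached from [xi1], [xi2]. *)
Lemma cover_path_to_torus (x : R -> C) (A F1 F2 : R -> C -> C) x0 al psi1 psi2 xi1 xi2 s :
  is_path x -> x 0%R = x0 -> continuation (cover_branch_at L) x A al ->
  continuation (solution_at whittaker_coeff) x F1 psi1 -> continuation (solution_at whittaker_coeff) x F2 psi2 ->
  changed_by al s psi1 xi1 x0 -> changed_by al s psi2 xi2 x0 ->
  exists X1 X2 S, conn PTL (al x0) (tri zero xi1 xi2) (A 1%R (x 1%R)) (tri zero X1 X2) /\
    changed_by (A 1%R) S (F1 1%R) X1 (x 1%R) /\ changed_by (A 1%R) S (F2 1%R) X2 (x 1%R).
Proof.
intros Hp Hx0 [A0 HA] [F10 HF1] [F20 HF2] C1 C2. rewrite is_path_eps in Hp. rewrite Hx0 in A0, F10, F20.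
apply (chain_induction (fun t => exists X1 X2 S, conn PTL (al x0) (tri zero xi1 xi2) (A t (x t)) (tri zero X1 X2) /\
    changed_by (A t) S (F1 t) X1 (x t) /\ changed_by (A t) S (F2 t) X2 (x t))).
- assert (B0 : cover_branch_at L al x0).
  { eapply cover_branch_ext; [exact A0|]. rewrite <- Hx0. apply HA, in01_0. }
  assert (sym : forall f g z, locally z (fun y : C => f y = g y :> C) -> locally z (fun y : C => g y = f y)).
  { intros f g z. apply locally_imp. auto. }
  exists xi1, xi2, s. rewrite Hx0. rewrite (locally_self A0). split; [|split].
  + apply conn_refl_tri. apply PT_tri.
    * apply (locally_self (cover_branch_near Hg2 Hg3 Hkappa Hwp Hwp' B0)).
    * apply (transferL B0 C1). eapply solution_at_ext; [exact F10|]. rewrite <- Hx0. apply HF1, in01_0.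
    * apply (transferL B0 C2). eapply solution_at_ext; [exact F20|]. rewrite <- Hx0. apply HF2, in01_0.
  + refine (changed_by_ext _ _ _ _ _ C1); auto; [exact (cover_branch_holo B0)|apply locally_refl|apply locally_refl].
  + refine (changed_by_ext _ _ _ _ _ C2); auto; [exact (cover_branch_holo B0)|apply locally_refl|apply locally_refl].
- intros t Ht. destruct (HA t Ht) as [HAt HAl]. destruct (HF1 t Ht) as [HF1t HF1l]. destruct (HF2 t Ht) as [HF2t HF2l].
  destruct (forward_patch HAt HF1t HF2t) as (S & X1 & X2 & HP). apply locally_at in HP. destruct HP as (r & Hr & HP).
  apply locally_R in HAl. apply locally_R in HF1l. apply locally_R in HF2l.
  destruct HAl as (d1 & Hd1 & HAl), HF1l as (d2 & Hd2 & HF1l), HF2l as (d3 & Hd3 & HF2l).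
  destruct (Hp t Ht r Hr) as (d4 & Hd4 & Hp4). destruct (min3_pos Hd1 Hd2 Hd3) as (d5 & Hd5 & L1 & L2 & L3).
  exists (Rmin d4 d5). split; [apply Rmin_pos; auto|].
  assert (Loc : forall u, in01 u -> (Rabs (u - t) < Rmin d4 d5)%R -> (Cmod (x u - x t) < r)%R /\
     locally (x u) (fun z => A u z = A t z) /\ locally (x u) (fun z => F1 u z = F1 t z) /\ locally (x u) (fun z => F2 u z = F2 t z)).
  { intros u Hu Hut. assert (S1 := Rlt_le_trans _ _ _ Hut (Rmin_l _ _)). assert (S2 := Rlt_le_trans _ _ _ Hut (Rmin_r _ _)).
    split; [apply Hp4; auto|]. split; [apply HAl; auto; lra|]. split; [apply HF1l; auto; lra|apply HF2l; auto; lra]. }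
  intros u u' Hu Hu' Hut Hut' (Y1 & Y2 & T & Cn & D1 & D2).
  destruct (Loc u Hu Hut) as (B1 & EA & E1 & E2). destruct (Loc u' Hu' Hut') as (B1' & EA' & E1' & E2').
  destruct (HP _ B1) as (Ru & G1 & G2 & _). destruct (HP _ B1') as (Ru' & G1' & G2' & _).
  assert (Hb := proj1 Ru).
  assert (HolA : locally (x u) (holo_at (A u))).
  { destruct (HA u Hu) as [X _]. exact (cover_branch_holo X). }
  assert (D1' : changed_by (A t) T (F1 t) Y1 (x u)) by (refine (changed_by_ext HolA EA (locally_refl _ _) E1 (locally_refl _ _) D1)).
  assert (D2' : changed_by (A t) T (F2 t) Y2 (x u)) by (refine (changed_by_ext HolA EA (locally_refl _ _) E2 (locally_refl _ _) D2)).
  assert (HR : locally (x u) (root_branch L kappa (A t) S)).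
  { apply (@locally_ball _ (x t) r); auto. intros w Hw. apply (HP w Hw). }
  (* The root carried so far and that of the patch differ by [e]; multiplying the solutions of the
     patch by [e] makes them continue the previous germs. *)
  destruct (changed_sign Hb (changed_by_root D1') HR) as (e & Ee & Es).
  assert (Q : forall f X Y, changed_by (A t) S f X (x u) -> changed_by (A t) T f Y (x u) ->
     locally (A t (x u)) (fun v => e * X v = Y v)).
  { intros f X Y HX HY. apply (cover_branch_open Hg2 Hg3 Hkappa Hwp Hwp' Hb).
    generalize (@locally_and _ _ _ Es (@locally_and _ _ _ HX HY)). apply locally_imp.
    intros w (W1 & (_ & _ & W2) & (_ & _ & W3)). rewrite W2, W3, W1. ring. }
  exists (fun v => e * X1 v), (fun v => e * X2 v), (fun w => e * S w). split; [|split].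
  + eapply conn_trans; [exact Cn|].
    (* Inside the patch the torus path follows the image of a straight segment rather than that of
       [x], since the germs of the patch are valid on the whole disc. *)
    apply conn_move with (p := fun tau => A t (seg (x u) (x u') tau)) (f := tri zero (fun v => e * X1 v) (fun v => e * X2 v)).
    * apply is_path_comp; [apply seg_path|]. intros tau Htau. apply (@cover_branch_cont L).
      apply (HP (seg (x u) (x u') tau)). apply seg_ball; auto.
    * rewrite seg_0. symmetry. apply (locally_self EA).
    * rewrite seg_1. symmetry. apply (locally_self EA').
    * intros tau i Htau. destruct (HP (seg (x u) (x u') tau)) as ((_ & Bp & _) & _ & _ & Z1 & Z2); [apply seg_ball; auto|].
      apply PT_tri; [apply Bp|apply solution_scale; auto|apply solution_scale; auto].
    * rewrite (locally_self EA). apply tri_near; [apply locally_refl|eapply Q; eauto|eapply Q; eauto].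
    * intro i. apply locally_refl.
  + assert (EA'' : locally (x u') (fun z => A t z = A u' z)) by (revert EA'; apply locally_imp; auto).
    assert (E1'' : locally (x u') (fun z => F1 t z = F1 u' z)) by (revert E1'; apply locally_imp; auto).
    refine (changed_by_ext _ EA'' (locally_refl _ _) E1'' (locally_refl _ _) (proj1 (changed_by_scale Ee G1'))).
    apply (cover_branch_holo (proj1 Ru')).
  + assert (EA'' : locally (x u') (fun z => A t z = A u' z)) by (revert EA'; apply locally_imp; auto).
    assert (E2'' : locally (x u') (fun z => F2 t z = F2 u' z)) by (revert E2'; apply locally_imp; auto).
    refine (changed_by_ext _ EA'' (locally_refl _ _) E2'' (locally_refl _ _) (proj1 (changed_by_scale Ee G2'))).
    apply (cover_branch_holo (proj1 Ru')).
Qed.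

(** Near each parameter both germs come from solutions on a common disc, where the Wronskian is
    constant. This is what makes the monodromy matrix invertible. *)
Lemma wronsk_continuation (g : R -> C) (F1 F2 : R -> C -> C) (f1 f2 : C -> C) :
  continuation (solution_at q) g F1 f1 -> continuation (solution_at q) g F2 f2 -> is_path g ->
  wronsk (F1 0%R) (C_derive (F1 0%R)) (F2 0%R) (C_derive (F2 0%R)) (g 0%R) <> 0 ->
  wronsk (F1 1%R) (C_derive (F1 1%R)) (F2 1%R) (C_derive (F2 1%R)) (g 1%R) <> 0.
Proof.
intros [_ H1] [_ H2] Hg H0. rewrite is_path_eps in Hg.
apply (chain_induction (fun t => wronsk (F1 t) (C_derive (F1 t)) (F2 t) (C_derive (F2 t)) (g t) <> 0)); auto.
intros t Ht. destruct (H1 t Ht) as [S1 L1]. destruct (H2 t Ht) as [S2 L2].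
apply solution_at_iff in S1. apply solution_at_iff in S2.
destruct S1 as (r1 & f1' & Hr1 & S1), S2 as (r2 & f2' & Hr2 & S2).
set (r := Rmin r1 r2). assert (Hr : (0 < r)%R) by (apply Rmin_pos; auto).
apply (sol_on_shrink (r1 := r)) in S1; [|apply Rmin_l]. apply (sol_on_shrink (r1 := r)) in S2; [|apply Rmin_r].
apply locally_R in L1. apply locally_R in L2. destruct L1 as (d1 & Hd1 & L1), L2 as (d2 & Hd2 & L2).
destruct (Hg t Ht r Hr) as (d3 & Hd3 & G). destruct (min3_pos Hd1 Hd2 Hd3) as (d & Hd & A1 & A2 & A3).
exists d. split; auto.
assert (E : forall s, in01 s -> (Rabs (s - t) < d)%R ->
   wronsk (F1 s) (C_derive (F1 s)) (F2 s) (C_derive (F2 s)) (g s) = wronsk (F1 t) f1' (F2 t) f2' (g t)).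
{ intros s Hs Hst. assert (B := G s Hs ltac:(lra)). rewrite <- (wronsk_const S1 S2 (g s) B).
  specialize (L1 s ltac:(lra) Hs). specialize (L2 s ltac:(lra) Hs).
  destruct (S1 (g s) B) as [D1 _], (S2 (g s) B) as [D2 _].
  assert (E1 : C_derive (F1 s) (g s) = f1' (g s)).
  { apply D_C_derive. apply D_ext_loc with (F1 t); auto. revert L1. apply locally_imp. auto. }
  assert (E2 : C_derive (F2 s) (g s) = f2' (g s)).
  { apply D_C_derive. apply D_ext_loc with (F2 t); auto. revert L2. apply locally_imp. auto. }
  unfold wronsk. rewrite E1, E2, (locally_self L1), (locally_self L2). reflexivity. }
intros s s' Hs Hs' Hst Hst'. rewrite !E by auto. auto.
Qed.

(** [wp] is locally invertible at [p], and the branch is its local inverse after [cover_map]. The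
    ball on which [wp] is injective is returned too, because the uniqueness of branches is decided
    there. *)
Lemma wp_lift p x : ~ in_lattice L p -> Wf L 3 p <> 0 -> x ^ 5 - x <> 0 -> cover_map x = Wf L 2 p -> cover_deriv x <> 0 ->
  exists A r, (0 < r)%R /\ cover_branch_at L A x /\ A x = p /\
    forall z w, (Cmod (z - p) < r)%R -> (Cmod (w - p) < r)%R -> Wf L 2 z = Wf L 2 w -> z = w.
Proof.
intros Hp H3 H5 Hv Hd. destruct (not_lattice_locally Hp) as (r0 & Hr0 & K0).
destruct (@local_inverse (Wf L 2) (fun z => - RtoC (INR 2) * Wf L 3 z) p r0 Hr0) as (r & s & g & Hr & Hs & Nz & Inj & G).
- intros z Hz. apply Wf_derive; auto.
- eapply D_cont. apply D_scal, Wf_derive; auto.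
- apply Cmult_neq_0; auto. inr. intro E. assert (X : RtoC 2 = 0) by (replace (RtoC 2) with (- - (2)) by ring; rewrite E; ring).
  apply RtoC_inj in X. lra.
- set (A := fun y => g (cover_map y)).
  assert (Gp : g (Wf L 2 p) = p).
  { apply Inj; [apply G, ball_center; auto|apply ball_center; lra|apply G, ball_center; auto]. }
  assert (Hden := branch_den H5).
  destruct (D_cont (cover_map_derive Hden) Hs) as (d & Hd0 & Kd).
  destruct (poly_near H5) as (d2 & Hd2 & Kd2).
  assert (HA : forall y, (Cmod (y - x) < Rmin d d2)%R -> (Cmod (A y - p) < r)%R /\ Wf L 2 (A y) = cover_map y /\
     D A y (cover_deriv y * / (- RtoC (INR 2) * Wf L 3 (A y)))).
  { intros y Hy. assert (S1 := Rlt_le_trans _ _ _ Hy (Rmin_l _ _)). assert (S2 := Rlt_le_trans _ _ _ Hy (Rmin_r _ _)).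
    specialize (Kd y S1). rewrite Hv in Kd. destruct (G _ Kd) as (G1 & G2 & G3). split; auto. split; auto.
    unfold A. apply (@D_comp g cover_map y); [exact G3|apply cover_map_derive, branch_den; auto]. }
  assert (Hm : (0 < Rmin d d2)%R) by (apply Rmin_pos; auto).
  exists A, r. split; [apply Hr|]. split; [|split; auto].
  + split; auto. split.
    * apply locally_Cmod. exists (Rmin d d2). split; auto. intros y Hy. destruct (HA y Hy) as (Y1 & Y2 & Y3).
      split; [exact (D_holo Y3)|]. split; auto. apply K0. lra.
    * destruct (HA x (ball_center _ Hm)) as (Y1 & _ & Y3). rewrite (D_C_derive Y3). apply Cmult_neq_0; auto.
      assert (N := Nz _ Y1). cbv beta in N. intro X. apply C1_nz.
      rewrite <- (Cinv_r _ N), X. ring.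
  + unfold A. rewrite Hv. exact Gp.
Qed.

(** Near [x] both branches stay in the ball where [wp] is injective, and [wp] takes the same value
    on them. *)
Lemma cover_branch_unique A B x p (r : R) : cover_branch_at L A x -> cover_branch_at L B x -> A x = B x ->
  (Cmod (A x - p) < r)%R ->
  (forall z w, (Cmod (z - p) < r)%R -> (Cmod (w - p) < r)%R -> Wf L 2 z = Wf L 2 w -> z = w) ->
  locally x (fun y => A y = B y).
Proof.
intros HA HB E Hr Inj.
assert (N : forall C, cover_branch_at L C x -> C x = A x -> locally x (fun y => (Cmod (C y - p) < r)%R)).
{ intros C HC EC. assert (P : (0 < r - Cmod (A x - p))%R) by lra. destruct (cover_branch_cont HC P) as (d & Hd & K).
  apply locally_Cmod. exists d. split; auto. intros y Hy. specialize (K y Hy). rewrite EC in K.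
  replace (C y - p) with ((C y - A x) + (A x - p)) by ring. eapply Rle_lt_trans; [apply Cmod_triangle|]. lra. }
destruct HA as (HA1 & HA2 & HA3), HB as (HB1 & HB2 & HB3).
generalize (@locally_and _ _ _ (@locally_and _ _ _ (N A (conj HA1 (conj HA2 HA3)) eq_refl) (N B (conj HB1 (conj HB2 HB3)) (eq_sym E)))
  (@locally_and _ _ _ HA2 HB2)).
apply locally_imp. intros y ((Y1 & Y2) & (_ & _ & Y3) & (_ & _ & Y4)). apply Inj; auto.
change (wp L (A y) = wp L (B y)). congruence.
Qed.

(** * Lifting torus paths to the x-plane *)

Section Lifting.
Variables (x0 : C) (al psi1 psi2 : C -> C).

(* The germs [X1], [X2] at [p] correspond to germs that are continued from [x0]. *)
Definition over (p : C) (X1 X2 : C -> C) : Prop :=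
  exists x A f1 f2 S, conn PXL x0 (tri al psi1 psi2) x (tri A f1 f2) /\ A x = p /\
    changed_by A S f1 X1 x /\ changed_by A S f2 X2 x.

(** On the patch the torus solutions are pulled back as [e * (X (A0 z) / S0 z)], with the sign [e]
    that fits the germs given at [y]. These are solutions on the whole disc, so they are continued
    from [y] to [y'] along a segment. *)
Lemma over_patch A0 S0 (X1 X2 : C -> C) x1 r y y' A f1 f2 S :
  (forall z, (Cmod (z - x1) < r)%R -> root_branch L kappa A0 S0 z /\ solution_at q X1 (A0 z) /\ solution_at q X2 (A0 z)) ->
  (Cmod (y - x1) < r)%R -> (Cmod (y' - x1) < r)%R ->
  conn PXL x0 (tri al psi1 psi2) y (tri A f1 f2) -> locally y (fun z => A z = A0 z) ->
  changed_by A S f1 X1 y -> changed_by A S f2 X2 y ->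
  exists g1 g2 T, conn PXL x0 (tri al psi1 psi2) y' (tri A0 g1 g2) /\ changed_by A0 T g1 X1 y' /\ changed_by A0 T g2 X2 y'.
Proof.
intros H Hy Hy' Cn EA C1 C2.
assert (HbA := conn_end Cn 0). simpl in HbA.
assert (HR : forall z, (Cmod (z - x1) < r)%R -> locally z (root_branch L kappa A0 S0)).
{ intros z Hz. apply (@locally_ball _ x1 r); auto. intros w Hw. apply (H w Hw). }
assert (C1' := changed_by_ext (cover_branch_holo HbA) EA (locally_refl S _) (locally_refl f1 _) (locally_refl X1 _) C1).
assert (C2' := changed_by_ext (cover_branch_holo HbA) EA (locally_refl S _) (locally_refl f2 _) (locally_refl X2 _) C2).
destruct (changed_sign (proj1 (proj1 (H y Hy))) (changed_by_root C1') (HR y Hy)) as (e & Ee & Es).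
set (g := fun (X : C -> C) z => e * (X (A0 z) / S0 z)).
assert (Hg : forall X z, (Cmod (z - x1) < r)%R -> changed_by A0 (fun w => e * S0 w) (g X) X z).
{ intros X z Hz. exact (proj2 (changed_by_scale Ee (locally_self (patch_to_cover X (HR z Hz))))). }
assert (Hsol : forall X z, (Cmod (z - x1) < r)%R -> solution_at q X (A0 z) -> solution_at whittaker_coeff (g X) z).
{ intros X z Hz HX. apply (transferL (proj1 (proj1 (H z Hz))) (Hg X z Hz)). auto. }
assert (Hf : forall f X, changed_by A0 S f X y -> locally y (fun z => g X z = f z)).
{ intros f X HX. generalize (@locally_and _ _ _ Es (@locally_and _ _ _ HX (HR y Hy))). apply locally_imp.
  intros z (Z1 & (_ & _ & Z2) & (_ & _ & _ & _ & Z3)). unfold g. rewrite Z2, Z1.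
  replace (e * (e * S0 z * f z / S0 z)) with (e ^ 2 * f z) by (field; auto). rewrite Ee. ring. }
exists (g X1), (g X2), (fun w => e * S0 w). split; [|split; apply Hg; auto].
eapply conn_trans; [exact Cn|].
apply conn_move with (p := seg y y') (f := tri A0 (g X1) (g X2)).
- apply seg_path.
- apply seg_0.
- apply seg_1.
- intros t i Ht. assert (B := seg_ball _ _ _ Hy Hy' Ht). destruct (H _ B) as (B1 & B2 & B3).
  apply PX_tri; [apply B1|apply Hsol; auto|apply Hsol; auto].
- apply tri_near; [revert EA; apply locally_imp; auto|apply Hf; auto|apply Hf; auto].
- intro i. apply locally_refl.
Qed.

(* The points over the branch points of the cover and over the critical points of
   [cover_map]. *)
Definition bad (z : C) : Prop := in_lattice L z \/ Wf L 3 z = 0 \/ pm_mod L kappa z.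

Lemma not_bad_values z : ~ bad z -> ~ in_lattice L z /\ Wf L 3 z <> 0 /\ Wf L 2 z - root1 <> 0 /\
  Wf L 2 z - root2 <> 0 /\ Wf L 2 z - root3 <> 0 /\ Wf L 2 z - wpk <> 0.
Proof.
intro H. assert (H1 : ~ in_lattice L z) by (intro X; apply H; left; auto).
assert (H2 : Wf L 3 z <> 0) by (intro X; apply H; right; left; auto).
assert (H3 : ~ pm_mod L kappa z) by (intro X; apply H; right; right; auto).
assert (K := wp_cubic Hg2 Hg3 H1).
split; auto. split; auto.
assert (N : Wf L 3 z ^ 2 <> 0) by (apply Cpow_nz; auto).
split; [|split; [|split]]; try (intro E; apply N; rewrite K, E; ring).
apply (burnside_coeff_rational Hg2 Hg3 Hkappa Hwp Hwp' H1 H3).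
Qed.

(** The two points of a fibre are the roots of this quadratic, whose product is [- i]. Its
    discriminant serves to lift paths, the product to recognise the involution. *)
Lemma cover_map_quadratic x v : den x <> 0 ->
  (cover_map x = v <-> (v - root2) * x ^ 2 + (v - root2 - dlt) * (1 - Ci) * x - (v - root2) * Ci = 0).
Proof.
intro Hd. assert (K := cover_root2 Hd).
assert (Ed : den x = x ^ 2 + (1 - Ci) * x - Ci) by (unfold den; ring).
replace (1 + xk ^ 2) with (1 - Ci) in K by (rewrite Ci_xk; ring).
split; intro H.
- rewrite H in K. replace ((v - root2) * x ^ 2 + (v - root2 - dlt) * (1 - Ci) * x - (v - root2) * Ci) with
    ((v - root2) * den x - dlt * (1 - Ci) * x) by (rewrite Ed; ring). rewrite K. field. auto.
- assert (E : (v - root2) * den x = dlt * (1 - Ci) * x).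
  { replace ((v - root2) * den x) with (((v - root2) * x ^ 2 + (v - root2 - dlt) * (1 - Ci) * x - (v - root2) * Ci) + dlt * (1 - Ci) * x)
      by (rewrite Ed; ring). rewrite H. ring. }
  replace (cover_map x) with (cover_map x - root2 + root2) by ring. rewrite K, <- E. field. auto.
Qed.

Lemma cover_point_regular x v : den x <> 0 -> cover_map x = v -> v - root1 <> 0 -> v - root2 <> 0 -> v - root3 <> 0 -> v - wpk <> 0 ->
  x ^ 5 - x <> 0 /\ cover_deriv x <> 0.
Proof.
intros Hd Hv N1 N2 N3 N4. assert (Hd' := proj1 (den_factors x) Hd). destruct Hd' as [D1 D2].
assert (K1 := cover_root1 Hd). assert (K2 := cover_root2 Hd). assert (K3 := cover_root3 Hd). assert (K4 := cover_wpk Hd).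
rewrite Hv in K1, K2, K3, K4. split.
- apply branch_poly_intro; auto; intro E.
  + apply N2. rewrite K2, E. unfold Cdiv. ring.
  + apply N1. rewrite K1, E. unfold Cdiv. ring.
  + apply N1. rewrite K1, E. unfold Cdiv. ring.
- intro E. assert (X : - dlt * (1 + xk ^ 2) * (x - xk) * (x + xk) = 0).
  { replace (- dlt * (1 + xk ^ 2) * (x - xk) * (x + xk)) with (cover_deriv x * den x ^ 2) by (unfold cover_deriv; field; auto).
    rewrite E. ring. }
  assert (Hdl := dlt_neq0).
  assert (- dlt <> 0) by (intro Y; apply Hdl; replace dlt with (- - dlt) by ring; rewrite Y; ring).
  assert (1 + xk ^ 2 <> 0) by (rewrite xk_2; exact one_minus_Ci).
  assert (x - xk <> 0) by (intro Y; apply N4; rewrite K4, Y; unfold Cdiv; simpl; ring).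
  assert (x + xk <> 0) by (intro Y; apply N3; rewrite K3, Y; unfold Cdiv; simpl; ring).
  cut (- dlt * (1 + xk ^ 2) * (x - xk) * (x + xk) <> 0); [auto|].
  repeat apply Cmult_neq_0; auto.
Qed.

(** The quadratic formula along the path. The discriminant is [2 i (wp - root3) (wp - wpk)]; it
    vanishes over the critical values of the cover, which a path free of bad points avoids, so its
    square root can be followed by [path_sqrt]. *)
Lemma cover_lift_path (p : R -> C) x : is_path p -> (forall t, in01 t -> ~ bad (p t)) -> den x <> 0 -> cover_map x = Wf L 2 (p 0%R) ->
  exists y : R -> C, is_path y /\ y 0%R = x /\ forall t, in01 t -> den (y t) <> 0 /\ cover_map (y t) = Wf L 2 (p t).
Proof.
intros Hp Hb Hdx Hx.
assert (Pv : forall h, (forall v, exists d, D h v d) -> is_path (fun t => h (Wf L 2 (p t)))).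
{ intros h Hh. apply (@is_path_comp (fun z => h (Wf L 2 z)) p Hp). intros t Ht.
  destruct (not_bad_values (Hb t Ht)) as (N & _). destruct (Hh (Wf L 2 (p t))) as (d & Hd).
  eapply D_cont. eapply D_comp; [exact Hd|apply Wf_derive; auto]. }
set (a := fun t => Wf L 2 (p t) - root2). set (b := fun t => (a t - dlt) * (1 - Ci)).
set (dc := fun t => 2 * Ci * (Wf L 2 (p t) - root3) * (Wf L 2 (p t) - wpk)).
assert (Edc : forall t, dc t = b t ^ 2 + 4 * a t ^ 2 * Ci).
{ intro t. unfold dc, b. assert (R3 : root3 = root2 + 1) by (unfold root2, root3; field).
  assert (R4 : wpk = root2 - dlt ^ 2) by (unfold root2, wpk, dlt; field [xk_4]).
  rewrite R3, R4. replace (Wf L 2 (p t)) with (a t + root2) by (unfold a; ring).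
  unfold dlt. rewrite Ci_xk. ring [xk_4]. }
assert (Na : forall t, in01 t -> a t <> 0) by (intros t Ht; apply (not_bad_values (Hb t Ht))).
assert (N2 : RtoC 2 <> 0) by (intro E; apply RtoC_inj in E; lra).
destruct (@path_sqrt dc (2 * a 0%R * x + b 0%R)) as (r & Hr & Hr0 & Hr2).
- apply (Pv (fun v => 2 * Ci * (v - root3) * (v - wpk))). intro v. eexists.
  apply D_mult; [apply D_scal|]; (apply D_minus; [apply D_id|apply D_const]).
- intros t Ht. destruct (not_bad_values (Hb t Ht)) as (_ & _ & _ & _ & M3 & M4). unfold dc. assert (M := Ci_nz). nz.
- rewrite Edc. apply (cover_map_quadratic _ Hdx) in Hx. change (a 0%R * x ^ 2 + b 0%R * x - a 0%R * Ci = 0) in Hx.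
  replace ((2 * a 0%R * x + b 0%R) ^ 2) with (4 * a 0%R * (a 0%R * x ^ 2 + b 0%R * x - a 0%R * Ci) + (b 0%R ^ 2 + 4 * a 0%R ^ 2 * Ci)) by ring.
  rewrite Hx. ring.
- exists (fun t => (r t - b t) / (2 * a t)). split; [|split].
  + assert (Q1 : is_path (fun t => b t)).
    { apply (Pv (fun v => (v - root2 - dlt) * (1 - Ci))). intro v. eexists.
      apply D_mult; [|apply D_const]. apply D_minus; [|apply D_const]. apply D_minus; [apply D_id|apply D_const]. }
    assert (Q2 : is_path (fun t => / (2 * a t))).
    { apply (@is_path_comp (fun z => / (2 * (Wf L 2 z - root2))) p Hp). intros t Ht.
      destruct (not_bad_values (Hb t Ht)) as (N & _ & _ & N' & _). eapply D_cont. apply D_inv; [nz|].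
      apply D_scal, D_minus; [apply Wf_derive; auto|apply D_const]. }
    assert (Pm : forall u w : R -> C, is_path u -> is_path w -> is_path (fun t => u t - w t)).
    { intros u w. rewrite !is_path_eps. intros Hu Hw t Ht eps He.
      destruct (Hu t Ht (eps/2)%R ltac:(lra)) as (d1 & Hd1 & K1). destruct (Hw t Ht (eps/2)%R ltac:(lra)) as (d2 & Hd2 & K2).
      exists (Rmin d1 d2). split; [apply Rmin_pos; auto|]. intros s Hs Hst.
      specialize (K1 s Hs (Rlt_le_trans _ _ _ Hst (Rmin_l _ _))). specialize (K2 s Hs (Rlt_le_trans _ _ _ Hst (Rmin_r _ _))).
      replace (u s - w s - (u t - w t)) with ((u s - u t) + - (w s - w t)) by ring.
      eapply Rle_lt_trans; [apply Cmod_triangle|]. rewrite Cmod_opp. lra. }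
    assert (Pt : forall u w : R -> C, is_path u -> is_path w -> is_path (fun t => u t * w t)).
    { intros u w. rewrite !is_path_eps. intros Hu Hw t Ht eps He.
      assert (A1 := Cmod_ge_0 (u t)). assert (A2 := Cmod_ge_0 (w t)).
      destruct (Hu t Ht (Rmin 1 (eps / (2 * (Cmod (w t) + 1))))) as (d1 & Hd1 & K1).
      { apply Rmin_pos; [lra|apply Rdiv_lt_0_compat; lra]. }
      destruct (Hw t Ht (eps / (2 * (Cmod (u t) + 1)))%R ltac:(apply Rdiv_lt_0_compat; lra)) as (d2 & Hd2 & K2).
      exists (Rmin d1 d2). split; [apply Rmin_pos; auto|]. intros s Hs Hst.
      specialize (K1 s Hs (Rlt_le_trans _ _ _ Hst (Rmin_l _ _))). specialize (K2 s Hs (Rlt_le_trans _ _ _ Hst (Rmin_r _ _))).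
      assert (K11 := Rlt_le_trans _ _ _ K1 (Rmin_l _ _)). assert (K12 := Rlt_le_trans _ _ _ K1 (Rmin_r _ _)).
      replace (u s * w s - u t * w t) with (u s * (w s - w t) + (u s - u t) * w t) by ring.
      eapply Rle_lt_trans; [apply Cmod_triangle|]. rewrite !Cmod_mult.
      assert (F : (Cmod (u s) <= Cmod (u t) + 1)%R).
      { replace (u s) with ((u s - u t) + u t) by ring. eapply Rle_trans; [apply Cmod_triangle|]. lra. }
      apply Rlt_div_r in K2; [|lra]. apply Rlt_div_r in K12; [|lra].
      assert (X := Cmod_ge_0 (w s - w t)). assert (Y := Cmod_ge_0 (u s - u t)). nra. }
    apply Pt; auto.
  + rewrite Hr0. field. apply Na, in01_0.
  + intros t Ht. set (y := (r t - b t) / (2 * a t)). assert (At := Na t Ht). assert (Rt := Hr2 t Ht). rewrite Edc in Rt.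
    assert (E : a t * y ^ 2 + b t * y - a t * Ci = 0).
    { replace (a t * y ^ 2 + b t * y - a t * Ci) with ((r t ^ 2 - (b t ^ 2 + 4 * a t ^ 2 * Ci)) / (4 * a t))
        by (unfold y; field; auto). rewrite Rt. field. auto. }
    (* The quadratic and [a t * den y] differ by [dlt * (1 - Ci) * y]. A zero of [den] would thus
       force [y = 0], but [den 0 = - Ci]. *)
    assert (Dy : den y <> 0).
    { intro X. assert (Ed : den y = y ^ 2 + (1 - Ci) * y - Ci) by (unfold den; ring).
      assert (Y0 : dlt * ((1 - Ci) * y) = 0).
      { replace (dlt * ((1 - Ci) * y)) with (a t * den y - (a t * y ^ 2 + b t * y - a t * Ci)) by (rewrite Ed; unfold b; ring).
        rewrite X, E. ring. }
      assert (Y1 : y = 0).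
      { destruct (Ceq_dec y 0) as [|N]; auto. exfalso. revert Y0. assert (M1 := dlt_neq0). assert (M2 := one_minus_Ci).
        change (dlt * ((1 - Ci) * y) <> 0). nz. }
      rewrite Y1 in Ed. rewrite Y1, Ed in X. apply Ci_nz. replace Ci with (- (0 ^ 2 + (1 - Ci) * 0 - Ci)) by ring. rewrite X. ring. }
    split; auto. apply (cover_map_quadratic _ Dy). exact E.
Qed.

Lemma over_path (p : R -> C) (X1 X2 : C -> C) : is_path p ->
  (forall t, in01 t -> ~ bad (p t) /\ solution_at q X1 (p t) /\ solution_at q X2 (p t)) ->
  over (p 0%R) X1 X2 -> over (p 1%R) X1 X2.
Proof.
intros Hp Hb (x & A & f1 & f2 & S & Cn & EA & C1 & C2).
assert (HbA := conn_end Cn 0). simpl in HbA.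
assert (Hdx : den x <> 0) by (apply branch_den, HbA).
destruct (@cover_lift_path p x Hp (fun t Ht => proj1 (Hb t Ht)) Hdx) as (y & Hy & Hy0 & Hyt).
{ rewrite <- EA. destruct HbA as (_ & H2 & _). symmetry. apply (locally_self H2). }
(* Stronger than [over]: the point above [p t] is fixed to be the lift [y t], which makes the
   branches of successive patches comparable. *)
assert (K : exists A f1 f2 S, conn PXL x0 (tri al psi1 psi2) (y 1%R) (tri A f1 f2) /\ A (y 1%R) = p 1%R /\
    changed_by A S f1 X1 (y 1%R) /\ changed_by A S f2 X2 (y 1%R)).
{ apply (chain_induction (fun t => exists A f1 f2 S, conn PXL x0 (tri al psi1 psi2) (y t) (tri A f1 f2) /\ A (y t) = p t /\
    changed_by A S f1 X1 (y t) /\ changed_by A S f2 X2 (y t))).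
  - rewrite Hy0. exists A, f1, f2, S. auto.
  - intros t Ht. destruct (Hb t Ht) as (Bt & Q1 & Q2). destruct (Hyt t Ht) as (Dt & Et).
    destruct (not_bad_values Bt) as (V1 & V2 & V3 & V4 & V5 & V6).
    destruct (cover_point_regular Dt Et V3 V4 V5 V6) as (P5 & Pd).
    destruct (wp_lift V1 V2 P5 Et Pd) as (A0 & r & Hr & HA0 & EA0 & Inj).
    destruct (root_branch_exists Hg2 Hg3 Hkappa Hwp Hwp' HA0) as (S0 & HS0).
    assert (HX : locally (y t) (fun z => (Cmod (A0 z - p t) < r)%R /\ solution_at q X1 (A0 z) /\ solution_at q X2 (A0 z))).
    { assert (cA := cover_branch_cont HA0).
      apply (@locally_comp A0 (fun v => (Cmod (v - p t) < r)%R /\ solution_at q X1 v /\ solution_at q X2 v)); auto.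
      rewrite EA0. apply locally_and; [apply locally_Cmod; exists r; auto|].
      apply locally_and; apply solution_at_near; auto. }
    destruct (locally_at (@locally_and _ _ _ HS0 HX)) as (r1 & Hr1 & K1).
    rewrite is_path_eps in Hp, Hy.
    destruct (Hy t Ht r1 Hr1) as (d1 & Hd1 & Y1). destruct (Hp t Ht r Hr) as (d2 & Hd2 & P2).
    exists (Rmin d1 d2). split; [apply Rmin_pos; auto|].
    (* [A0 (y s)] and [p s] have the same image under [wp] and both lie in the ball where [wp] is
       injective. *)
    assert (Loc : forall s, in01 s -> (Rabs (s - t) < Rmin d1 d2)%R -> (Cmod (y s - y t) < r1)%R /\ A0 (y s) = p s).
    { intros s Hs Hst. specialize (Y1 s Hs (Rlt_le_trans _ _ _ Hst (Rmin_l _ _))).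
      specialize (P2 s Hs (Rlt_le_trans _ _ _ Hst (Rmin_r _ _))). split; auto.
      destruct (K1 _ Y1) as ((Z1 & _) & Z2 & _). apply Inj; auto.
      destruct Z1 as (_ & Z1 & _). destruct (locally_self Z1) as (_ & _ & Z3). change (wp L (A0 (y s)) = Wf L 2 (p s)).
      rewrite Z3. apply (Hyt s Hs). }
    intros s s' Hs Hs' Hst Hst' (A' & g1 & g2 & T & Cn' & EA' & C1' & C2').
    destruct (Loc s Hs Hst) as (L1 & L2). destruct (Loc s' Hs' Hst') as (L1' & L2').
    assert (HbA' := conn_end Cn' 0). simpl in HbA'.
    assert (U : locally (y s) (fun z => A' z = A0 z)).
    { destruct (K1 _ L1) as ((Z1 & _) & Z2 & _).
      apply (@cover_branch_unique A' A0 (y s) (p t) r); auto; [congruence|]. rewrite EA', <- L2. auto. }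
    destruct (@over_patch A0 S0 X1 X2 (y t) r1 (y s) (y s') A' g1 g2 T) as (h1 & h2 & T' & R1 & R2 & R3); auto.
    { intros z Hz. destruct (K1 z Hz) as (Z1 & Z2 & Z3 & Z4). auto. }
    exists A0, h1, h2, T'. auto. }
destruct K as (A' & g1 & g2 & T & R1 & R2 & R3 & R4). exists (y 1%R), A', g1, g2, T. auto.
Qed.

Lemma over_ext p (X1 X2 Y1 Y2 : C -> C) : locally p (fun v => X1 v = Y1 v) -> locally p (fun v => X2 v = Y2 v) ->
  over p X1 X2 -> over p Y1 Y2.
Proof.
intros E1 E2 (x & A & f1 & f2 & S & Cn & EA & C1 & C2). assert (HbA := conn_end Cn 0). simpl in HbA.
exists x, A, f1, f2, S. split; auto. split; auto. rewrite <- EA in E1, E2.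
split; [refine (changed_by_ext (cover_branch_holo HbA) _ _ _ E1 C1)|refine (changed_by_ext (cover_branch_holo HbA) _ _ _ E2 C2)];
  apply locally_refl.
Qed.

(* Go around the only possible bad point [c] of the ball. *)
Lemma over_ball c r (X1 X2 : C -> C) p p' :
  (forall z, (Cmod (z - c) < r)%R -> solution_at q X1 z /\ solution_at q X2 z /\ (z <> c -> ~ bad z)) ->
  (Cmod (p - c) < r)%R -> (Cmod (p' - c) < r)%R -> ~ bad p -> ~ bad p' -> over p X1 X2 -> over p' X1 X2.
Proof.
intros H Hp Hp' Bp Bp'.
assert (Sg : forall a b, (Cmod (a - c) < r)%R -> (Cmod (b - c) < r)%R ->
   (forall t, in01 t -> seg a b t <> c \/ ~ bad c) -> over a X1 X2 -> over b X1 X2).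
{ intros a b Ha Hb N Ov. rewrite <- (seg_1 a b). apply over_path; [apply seg_path| |rewrite seg_0; auto].
  intros t Ht. destruct (H (seg a b t)) as (H1 & H2 & H3); [apply seg_ball; auto|]. split; auto.
  destruct (N t Ht) as [X|X]; auto. destruct (Ceq_dec (seg a b t) c) as [->|]; auto. }
destruct (classic (bad c)) as [Bc|Bc].
2:{ apply Sg; auto. }
destruct (classic (exists t, in01 t /\ seg p p' t = c)) as [(t & Ht & Et)|N].
2:{ apply Sg; auto. intros t Ht. left. intro X. apply N. exists t; auto. }
assert (Npc : p - c <> 0) by (intro X; apply Bp; apply Ceq_minus in X; rewrite X; auto).
assert (Npc' : p' - c <> 0) by (intro X; apply Bp'; apply Ceq_minus in X; rewrite X; auto).
assert (Et1 : t <> 1%R).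
{ intros ->. rewrite seg_1 in Et. apply Npc'. rewrite Et. ring. }
assert (Et0 : t <> 0%R).
{ intros ->. rewrite seg_0 in Et. apply Npc. rewrite Et. ring. }
unfold in01 in Ht.
set (k := (t / (1 - t))%R). assert (Hk : (0 < k)%R) by (apply Rdiv_lt_0_compat; lra).
assert (Epc : p - c = - RtoC k * (p' - c)).
{ assert (T1 : RtoC (1 - t) <> 0) by (intro X; apply RtoC_inj in X; lra).
  assert (E : RtoC (1 - t) * (p - c) + RtoC t * (p' - c) = 0).
  { rewrite RtoC_minus. rewrite <- Et. unfold seg. ring. }
  unfold k. rewrite RtoC_div by lra.
  replace (p - c) with ((RtoC (1 - t) * (p - c) + RtoC t * (p' - c)) / RtoC (1 - t) - RtoC t / RtoC (1 - t) * (p' - c)) by (field; auto).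
  rewrite E. field. auto. }
(* The detour passes through the point a quarter turn from [p'] about [c]. As [p - c] is a negative
   multiple of [p' - c], neither of the two legs meets [c]. *)
set (m := c + Ci * (p' - c)).
assert (Hm : (Cmod (m - c) < r)%R).
{ unfold m. replace (c + Ci * (p' - c) - c) with (Ci * (p' - c)) by ring. rewrite Cmod_mult, Cmod_Ci, Rmult_1_l. auto. }
assert (Nri : forall a b : R, (a <> 0 \/ b <> 0)%R -> (RtoC a + RtoC b * Ci) * (p' - c) <> 0).
{ intros a b Hab. apply Cmult_neq_0; auto. intro X.
  assert (Xr := f_equal Re X). assert (Xi := f_equal Im X). simpl in Xr, Xi.
  destruct Hab as [Y|Y]; apply Y; lra. }
intro Ov. apply (Sg m p'); auto.
- intros s Hs. left. intro X. unfold in01 in Hs.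
  apply (Nri s (1 - s)%R). { destruct (Req_dec s 0); [right|left]; lra. }
  replace ((RtoC s + RtoC (1 - s) * Ci) * (p' - c)) with (seg m p' s - c); [rewrite X; ring|].
  unfold seg, m. rewrite RtoC_minus. ring.
- apply (Sg p m); auto. intros s Hs. left. intro X. unfold in01 in Hs.
  apply (Nri (- k * (1 - s))%R s). { destruct (Req_dec s 0); [left|right]; nra. }
  replace ((RtoC (- k * (1 - s)) + RtoC s * Ci) * (p' - c)) with (seg p m s - c); [rewrite X; ring|].
  unfold seg, m. rewrite RtoC_mult, RtoC_opp, RtoC_minus.
  replace (p + RtoC s * (c + Ci * (p' - c) - p) - c) with ((1 - RtoC s) * (p - c) + RtoC s * Ci * (p' - c)) by ring.
  rewrite Epc. ring.
Qed.

(** For the zeros of [wp']: near a lattice point the pole of order three dominates, and at a zero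
    outside the lattice the derivative [- 3 W_4] is nonzero, because the cubic has no double
    root. *)
Lemma bad_isolated p : exists r, (0 < r)%R /\ forall z, (0 < Cmod (z - p) < r)%R -> ~ bad z.
Proof.
destruct (lattice_discrete L p) as (r1 & Hr1 & K1). destruct (pm_mod_discrete L kappa p) as (r2 & Hr2 & K2).
assert (K3 : exists r3, (0 < r3)%R /\ forall z, (0 < Cmod (z - p) < r3)%R -> ~ in_lattice L z -> Wf L 3 z <> 0).
{ destruct (classic (in_lattice L p)) as [Hp|Hp].
  - destruct (regular_near (@regular_0 L)) as (r & Hr & Kr).
    assert (Cf : contC (fun z => 1 + z ^ 3 * wsum L 3 z) 0).
    { eapply D_cont. apply D_plus; [apply D_const|apply D_mult; [apply D_pow, D_id|apply wsum_derive; [lia|apply regular_0]]]. }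
    destruct (nonzero_near Cf) as (r3 & Hr3 & K3).
    { replace (1 + 0 ^ 3 * wsum L 3 0) with (RtoC 1) by ring. apply C1_nz. }
    exists r3. split; auto. intros z Hz Nz E. apply (K3 (z - p)).
    { replace (z - p - 0) with (z - p) by ring. lra. }
    assert (Nzp : z - p <> 0) by (apply Cmod_gt_0; lra).
    assert (E' : Wf L 3 (z - p) = 0).
    { rewrite <- E. unfold Cminus. apply Wf_periodic; auto. apply in_lattice_opp; auto. }
    unfold Wf in E'. replace (1 + (z - p) ^ 3 * wsum L 3 (z - p)) with ((z - p) ^ 3 * (/ (z - p) ^ 3 + wsum L 3 (z - p))) by (field; auto).
    rewrite E'. ring.
  - destruct (Ceq_dec (Wf L 3 p) 0) as [E|N].
    + assert (N4 : - RtoC (INR 3) * Wf L 4 p <> 0).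
      { intro X. assert (W4 : 6 * Wf L 4 p = 0) by (replace (6 * Wf L 4 p) with (- 2 * (- RtoC (INR 3) * Wf L 4 p)) by (inr; ring); rewrite X; ring).
        rewrite (wp_second Hg2 Hg3 Hp) in W4. assert (K := wp_cubic Hg2 Hg3 Hp). rewrite E in K.
        set (u := Wf L 2 p) in *.
        assert (U2 : u ^ 2 = 5 / 36).
        { replace (u ^ 2) with ((6 * u ^ 2 - 5 / 6) / 6 + 5 / 36) by field. rewrite W4. field. }
        assert (U1 : u = 7 / 30 * (xk ^ 3 - xk)).
        { assert (Hu : u * u ^ 2 - 5 / 12 * u + 7 / 108 * (xk ^ 3 - xk) = 0).
          { transitivity ((u - root1) * (u - root2) * (u - root3)); [unfold root1, root2, root3; field [xk_4]|].
            rewrite <- K. simpl. ring. }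
          rewrite U2 in Hu.
          replace u with (- (18 / 5) * (u * (5 / 36) - 5 / 12 * u + 7 / 108 * (xk ^ 3 - xk)) + 7 / 30 * (xk ^ 3 - xk)) by field.
          rewrite Hu. ring. }
        (* If [wp'] and [wp''] vanished together, [u ^ 2 = 5 / 36] would give [900 u ^ 2 = 125],
           while the cubic reduced by it gives [u = 7 sqrt 2 / 30] and [900 u ^ 2 = 98]. *)
        assert (X9 : RtoC 27 = 0).
        { transitivity (900 * (5 / 36) - 98); [field|]. rewrite <- U2, U1, <- sqrt2_xk.
          replace (900 * (7 / 30 * RtoC (sqrt 2)) ^ 2 - 98) with (49 * (RtoC (sqrt 2) * RtoC (sqrt 2) - 2)) by field.
          rewrite <- RtoC_mult, sqrt2_sq. ring. }
        apply RtoC_inj in X9. lra. }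
      assert (Q := limp_D_quotient (Wf_derive (k := 3) ltac:(lia) Hp)).
      destruct (Q (Cmod (- RtoC (INR 3) * Wf L 4 p))) as (d & Hd & Kd); [apply Cmod_gt_0; auto|].
      exists d. split; auto. intros z Hz _ X. specialize (Kd z Hz). rewrite X, E in Kd.
      replace ((0 - 0) / (z - p) - - RtoC (INR 3) * Wf L 4 p) with (- (- RtoC (INR 3) * Wf L 4 p)) in Kd by (unfold Cdiv; ring).
      rewrite Cmod_opp in Kd. lra.
    + destruct (nonzero_near (Wf_cont (k := 3) ltac:(lia) Hp) N) as (r3 & Hr3 & K3). exists r3. split; auto.
      intros z Hz _. apply K3. lra. }
destruct K3 as (r3 & Hr3 & K3). destruct (min3_pos Hr1 Hr2 Hr3) as (r & Hr & A1 & A2 & A3).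
exists r. split; auto. intros z Hz [H|[H|H]].
- apply (K1 z); auto; lra.
- apply (K3 z); auto; [lra|]. apply K1; lra.
- apply (K2 z); auto; lra.
Qed.

End Lifting.
End Orbifold.

Lemma locally_radius (Q : C -> Prop) z : locally z Q -> exists r, (0 < r)%R /\ forall y, (Cmod (y - z) < r)%R -> locally y Q.
Proof. intro H. apply locally_at, locally_twice, H. Qed.

(** * From continuation on the torus to continuation on the curve *)

Section Group.
Variables (L : lattice) (kappa : C).
Hypothesis Hg2 : lattice_g2 L = RtoC (5 / 3).
Hypothesis Hg3 : lattice_g3 L = RtoC (- (7 / 27) * sqrt 2).
Hypothesis Hkappa : ~ in_lattice L kappa.
Hypothesis Hwp : wp L kappa = RtoC (- (7 / 2) - 13 / 6 * sqrt 2).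
Hypothesis Hwp' : C_derive (wp L) kappa = RtoC (sqrt (sqrt 32) * (7 + 5 * sqrt 2)) * Ci.

Let q := burnside_coeff L kappa.
Let PXL := PX L.
Let PTL := PT L kappa.
Let transferL := transfer Hg2 Hg3 Hkappa Hwp Hwp'.
Let badL := bad L kappa.

Lemma not_bad_near p (e : R) : (0 < e)%R -> exists p', (Cmod (p' - p) < e)%R /\ ~ badL p'.
Proof.
intro He. destruct (bad_isolated kappa Hg2 Hg3 p) as (r & Hr & K).
assert (Hm : (0 < Rmin e r)%R) by (apply Rmin_pos; auto). assert (M1 := Rmin_l e r). assert (M2 := Rmin_r e r).
exists (p + RtoC (Rmin e r / 2)).
assert (E : Cmod (p + RtoC (Rmin e r / 2) - p) = (Rmin e r / 2)%R).
{ replace (p + RtoC (Rmin e r / 2) - p) with (RtoC (Rmin e r / 2)) by ring. rewrite Cmod_R. apply Rabs_pos_eq. lra. }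
split; [rewrite E; lra|apply K; rewrite E; lra].
Qed.

Section Continue.
Variables (x0 : C) (al psi1 psi2 s xi1 xi2 : C -> C).
Hypothesis Hal : cover_branch_at L al x0.
Hypothesis Hpsi1 : solution_at whittaker_coeff psi1 x0.
Hypothesis Hpsi2 : solution_at whittaker_coeff psi2 x0.
Hypothesis Hc1 : changed_by al s psi1 xi1 x0.
Hypothesis Hc2 : changed_by al s psi2 xi2 x0.

Let overL := over L x0 al psi1 psi2.

(** [al x0] can itself be a half period, namely for [x0 = - xk], so the start is moved by an
    arbitrarily small amount. *)
Lemma over_start (e : R) : (0 < e)%R -> exists p, (Cmod (p - al x0) < e)%R /\ ~ badL p /\ overL p xi1 xi2.
Proof.
intro He. destruct (bad_isolated kappa Hg2 Hg3 (al x0)) as (rb & Hrb & Kb).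
destruct (branch_inverse Hg2 Hg3 Hkappa Hwp Hwp' Hal) as (ri & _ & _ & Hri & _ & _ & Inj & _).
destruct (locally_at (@locally_and _ _ _ (@locally_and _ _ _ (cover_branch_near Hg2 Hg3 Hkappa Hwp Hwp' Hal)
   (@locally_and _ _ _ (solution_at_near Hpsi1) (solution_at_near Hpsi2)))
   (@locally_and _ _ _ (locally_twice Hc1) (locally_twice Hc2)))) as (r & Hr & K).
assert (Hm0 : (0 < Rmin e rb)%R) by (apply Rmin_pos; auto).
destruct (cover_branch_cont Hal Hm0) as (d & Hd & Kd).
destruct (min3_pos Hri Hr Hd) as (m & Hm & M1 & M2 & M3).
set (x := x0 + RtoC (m / 2)).
assert (Ex : Cmod (x - x0) = (m / 2)%R).
{ unfold x. replace (x0 + RtoC (m / 2) - x0) with (RtoC (m / 2)) by ring. rewrite Cmod_R. apply Rabs_pos_eq. lra. }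
assert (Bx : (Cmod (al x - al x0) < Rmin e rb)%R) by (apply Kd; rewrite Ex; lra).
assert (N := Rmin_l e rb). assert (N' := Rmin_r e rb).
exists (al x). split; [lra|]. split.
- apply Kb. split; [|lra]. apply Cmod_gt_0. intro X. apply Ceq_minus in X.
  assert (Y : x = x0). { apply Inj; auto; [lra|apply ball_center; auto]. }
  rewrite Y in Ex. replace (x0 - x0) with (RtoC 0) in Ex by ring. rewrite Cmod_0 in Ex. lra.
- destruct (K x ltac:(lra)) as (_ & C1 & C2). exists x, al, psi1, psi2, s. split; [|auto].
  apply conn_move with (p := seg x0 x) (f := tri al psi1 psi2);
    [apply seg_path|apply seg_0|apply seg_1| |intro; apply locally_refl|intro; apply locally_refl].
  intros t i Ht. assert (B : (Cmod (seg x0 x t - x0) < r)%R) by (apply seg_ball; auto; [apply ball_center; auto|lra]).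
  destruct (K _ B) as (((B1 & _) & B2 & B3) & _). apply PX_tri; auto.
Qed.

(** The path may run through half periods and lattice points, over which no lift is at hand. The
    invariant therefore speaks of good points arbitrarily close to [g t], at which the germs of
    [F1 t] and [F2 t] are already reached; [over_ball] moves between them. *)
Lemma over_continue (g : R -> C) (F1 F2 : R -> C -> C) : is_path g -> g 0%R = al x0 ->
  continuation (solution_at q) g F1 xi1 -> continuation (solution_at q) g F2 xi2 ->
  forall e : R, (0 < e)%R -> exists p, (Cmod (p - g 1%R) < e)%R /\ ~ badL p /\ overL p (F1 1%R) (F2 1%R).
Proof.
intros Hg Hg0 [H10 H1] [H20 H2]. rewrite Hg0 in H10, H20. rewrite is_path_eps in Hg.
apply (chain_induction (fun t => forall e : R, (0 < e)%R ->
  exists p, (Cmod (p - g t) < e)%R /\ ~ badL p /\ overL p (F1 t) (F2 t))).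
- intros e He. rewrite Hg0.
  destruct (locally_radius (@locally_and _ _ _ H10 H20)) as (r & Hr & K).
  destruct (@over_start (Rmin e r)) as (p & P1 & P2 & P3); [apply Rmin_pos; auto|].
  assert (N := Rmin_l e r). assert (N' := Rmin_r e r). exists p. split; [lra|]. split; auto.
  specialize (K p ltac:(lra)). revert P3. apply over_ext; revert K; apply locally_imp; intros y [Y1 Y2]; auto.
- intros t Ht. destruct (H1 t Ht) as [S1 L1]. destruct (H2 t Ht) as [S2 L2].
  destruct (locally_at (@locally_and _ _ _ (solution_at_near S1) (solution_at_near S2))) as (r1 & Hr1 & K1).
  destruct (bad_isolated kappa Hg2 Hg3 (g t)) as (rb & Hrb & Kb).
  set (r := Rmin r1 rb). assert (Hr : (0 < r)%R) by (apply Rmin_pos; auto).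
  assert (HB : forall z, (Cmod (z - g t) < r)%R -> solution_at q (F1 t) z /\ solution_at q (F2 t) z /\ (z <> g t -> ~ badL z)).
  { intros z Hz. assert (Z1 := Rlt_le_trans _ _ _ Hz (Rmin_l _ _)). assert (Z2 := Rlt_le_trans _ _ _ Hz (Rmin_r _ _)).
    destruct (K1 z Z1) as [Y1 Y2]. split; auto. split; auto. intro N. apply Kb. split; auto. apply Cmod_gt_0.
    intro X. apply N, Ceq_minus, X. }
  apply locally_R in L1. apply locally_R in L2. destruct L1 as (d1 & Hd1 & L1), L2 as (d2 & Hd2 & L2).
  destruct (Hg t Ht r Hr) as (d3 & Hd3 & G). destruct (min3_pos Hd1 Hd2 Hd3) as (d & Hd & A1 & A2 & A3).
  exists d. split; auto.
  assert (Loc : forall u, in01 u -> (Rabs (u - t) < d)%R -> exists rho, (0 < rho)%R /\ forall z, (Cmod (z - g u) < rho)%R ->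
    (Cmod (z - g t) < r)%R /\ locally z (fun v => F1 u v = F1 t v) /\ locally z (fun v => F2 u v = F2 t v)).
  { intros u Hu Hut. assert (B := G u Hu ltac:(lra)).
    destruct (locally_radius (@locally_and _ _ _ (L1 u ltac:(lra) Hu) (L2 u ltac:(lra) Hu))) as (r2 & Hr2 & K2).
    exists (Rmin r2 (r - Cmod (g u - g t))). split; [apply Rmin_pos; lra|]. intros z Hz.
    assert (Z1 := Rlt_le_trans _ _ _ Hz (Rmin_l _ _)). assert (Z2 := Rlt_le_trans _ _ _ Hz (Rmin_r _ _)).
    split.
    - replace (z - g t) with ((z - g u) + (g u - g t)) by ring. eapply Rle_lt_trans; [apply Cmod_triangle|]. lra.
    - specialize (K2 z Z1). split; revert K2; apply locally_imp; tauto. }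
  intros u u' Hu Hu' Hut Hut' Pu e He.
  destruct (Loc u Hu Hut) as (rho & Hrho & Q). destruct (Loc u' Hu' Hut') as (rho' & Hrho' & Q').
  destruct (Pu rho Hrho) as (p & P1 & P2 & P3). destruct (Q p P1) as (Q1 & Q2 & Q3).
  destruct (@not_bad_near (g u') (Rmin e rho')) as (p' & P1' & P2'); [apply Rmin_pos; auto|].
  assert (N := Rmin_l e rho'). assert (N' := Rmin_r e rho'). destruct (Q' p' ltac:(lra)) as (Q1' & Q2' & Q3').
  exists p'. split; [lra|]. split; auto.
  apply (@over_ext L x0 al psi1 psi2 p' (F1 t) (F2 t)).
  + revert Q2'. apply locally_imp; auto.
  + revert Q3'. apply locally_imp; auto.
  + apply (over_ball Hg2 Hg3 Hkappa Hwp Hwp' (x0 := x0) (al := al) (psi1 := psi1) (psi2 := psi2) HB Q1 Q1' P2 P2').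
    exact (@over_ext L x0 al psi1 psi2 p _ _ _ _ Q2 Q3 P3).
Qed.

(** Undoes the small move at the end: from a good point near [B xb] the continuation returns to the
    centre [xb] within one patch of the known branch [B]. At the good point [wp] is injective, so
    the branch that arrives is the germ of [B]. *)
Lemma over_end (B X1 X2 : C -> C) xb : cover_branch_at L B xb -> solution_at q X1 (B xb) -> solution_at q X2 (B xb) ->
  exists r, (0 < r)%R /\ forall y A f1 f2 S, (Cmod (y - xb) < r)%R -> ~ badL (B y) -> A y = B y ->
    conn PXL x0 (tri al psi1 psi2) y (tri A f1 f2) -> changed_by A S f1 X1 y -> changed_by A S f2 X2 y ->
    exists g1 g2 T, conn PXL x0 (tri al psi1 psi2) xb (tri B g1 g2) /\ changed_by B T g1 X1 xb /\ changed_by B T g2 X2 xb.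
Proof.
intros HB S1 S2. destruct (root_branch_exists Hg2 Hg3 Hkappa Hwp Hwp' HB) as (S0 & HS0).
assert (HX : locally xb (fun z => solution_at q X1 (B z) /\ solution_at q X2 (B z))).
{ apply (@locally_comp B (fun v => solution_at q X1 v /\ solution_at q X2 v)); [exact (cover_branch_cont HB)|].
  apply locally_and; apply solution_at_near; auto. }
destruct (locally_at (@locally_and _ _ _ HS0 HX)) as (r & Hr & K).
exists r. split; auto. intros y A f1 f2 S Hy Nb EA Cn C1 C2.
assert (HA := conn_end Cn 0). simpl in HA.
destruct (K y Hy) as ((HBy & _) & _).
destruct (not_bad_values Hg2 Hg3 Hkappa Hwp Hwp' Nb) as (V1 & V2 & V3 & V4 & V5 & V6).
assert (Ev : cover_map y = Wf L 2 (B y)).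
{ destruct HBy as (_ & X & _). symmetry. apply (locally_self X). }
assert (Dy : den y <> 0) by (apply branch_den, HBy).
destruct (cover_point_regular Dy Ev V3 V4 V5 V6) as (P5 & Pd).
destruct (wp_lift V1 V2 P5 Ev Pd) as (A0 & r' & Hr' & _ & _ & Inj).
assert (U : locally y (fun z => A z = B z)).
{ apply (@cover_branch_unique L A B y (B y) r'); auto. rewrite EA. apply ball_center; auto. }
apply (@over_patch L kappa Hg2 Hg3 Hkappa Hwp Hwp' x0 al psi1 psi2 B S0 X1 X2 xb r y xb A f1 f2 S); auto.
apply ball_center; auto.
Qed.

Lemma cover_branch_shift (A : C -> C) (x l : C) : in_lattice L l -> cover_branch_at L A x -> cover_branch_at L (fun y => A y + l) x.
Proof.
intros Hl H. assert (Hd : forall y, holo_at A y -> D (fun y => A y + l) y (C_derive A y)).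
{ intros y Hy. apply holo_D in Hy. eapply D_eq; [|apply D_plus; [exact Hy|apply D_const]]. ring. }
assert (H0 := locally_self (cover_branch_holo H)). destruct H as (H1 & H2 & H3). split; auto. split.
- revert H2. apply locally_imp. intros y (Y1 & Y2 & Y3). split; [exact (D_holo (Hd y Y1))|]. split.
  + intro X. apply Y2. apply (in_lattice_shift _ Hl). exact X.
  + change (Wf L 2 (A y + l) = cover_map y). rewrite Wf_periodic; auto.
- rewrite (D_C_derive (Hd x H0)). auto.
Qed.

Lemma cover_map_involution (x : C) : x <> 0 -> den x <> 0 -> den (- Ci / x) <> 0 /\ cover_map (- Ci / x) = cover_map x.
Proof.
intros Hx Hd. apply den_factors in Hd as [D1 D2].
assert (E1 : - Ci / x - Ci = - Ci * (x + 1) / x) by (field; auto).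
assert (E2 : - Ci / x + 1 = (x - Ci) / x) by (field; auto).
assert (N1 : - Ci / x - Ci <> 0).
{ rewrite E1. assert (- Ci <> 0) by (intro Y; apply Ci_nz; replace Ci with (- - Ci) by ring; rewrite Y; ring).
  apply Cmult_neq_0; [nz|]. intro Y. apply C1_nz. rewrite <- (Cinv_r x), Y by auto. ring. }
assert (N2 : - Ci / x + 1 <> 0).
{ rewrite E2. apply Cmult_neq_0; auto. intro Y. apply C1_nz. rewrite <- (Cinv_r x), Y by auto. ring. }
split; [apply den_factors; auto|].
unfold cover_map. set (c := RtoC (1 + sqrt 2)). rewrite E1, E2.
assert (NC : - Ci <> 0) by (intro Y; apply Ci_nz; replace Ci with (- - Ci) by ring; rewrite Y; ring).
assert (Q : c / (- Ci * (x + 1) / x) - Ci * (c / ((x - Ci) / x)) = c / (x - Ci) - Ci * (c / (x + 1))).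
{ assert (I : / (- Ci * (x + 1) / x) = Ci * x / (x + 1)).
  { assert (J : (Ci * x / (x + 1)) * (- Ci * (x + 1) / x) = 1).
    { transitivity (- (Ci * Ci)); [field; auto|rewrite Ci_sq; ring]. }
    transitivity ((Ci * x / (x + 1)) * (- Ci * (x + 1) / x) * / (- Ci * (x + 1) / x)); [rewrite J; ring|].
    rewrite <- Cmult_assoc, Cinv_r; [ring|]. rewrite <- E1. exact N1. }
  unfold Cdiv at 1. rewrite I.
  assert (J : Ci * x = Ci * (x - Ci) - 1) by (transitivity (Ci * x - (Ci * Ci + 1)); [rewrite Ci_sq; ring|ring]).
  transitivity (c * (Ci - Ci / (x + 1)) - c * (Ci * x) / (x - Ci)); [field; auto|].
  rewrite J. field. auto. }
replace (- RtoC ((3 + sqrt 2) / 6) + c / (- Ci * (x + 1) / x) - Ci * (c / ((x - Ci) / x)))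
  with (- RtoC ((3 + sqrt 2) / 6) + (c / (- Ci * (x + 1) / x) - Ci * (c / ((x - Ci) / x)))) by ring.
rewrite Q. unfold Cminus. ring.
Qed.

Lemma cover_branch_involution (A : C -> C) (x : C) : x <> 0 -> cover_branch_at L A x -> cover_branch_at L (fun y => A (- Ci / y)) (- Ci / x).
Proof.
intros Hx H.
assert (NC : - Ci <> 0) by (intro Y; apply Ci_nz; replace Ci with (- - Ci) by ring; rewrite Y; ring).
assert (Nx : - Ci / x <> 0) by (intro Y; apply NC; replace (- Ci) with ((- Ci / x) * x) by (field; auto); rewrite Y; ring).
assert (Ex : - Ci / (- Ci / x) = x) by (field; split; auto; intro Y; apply NC; rewrite Y; ring).
assert (Hd : forall y : C, y <> 0 -> D (fun y => - Ci / y) y (Ci / y ^ 2)).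
{ intros y Hy. eapply D_eq; [|apply (@D_scal (- Ci) (fun y => / y)), D_inv_id; exact Hy]. field. auto. }
assert (cI : contC (fun y => - Ci / y) (- Ci / x)) by (eapply D_cont; apply Hd; auto).
assert (H0 := locally_self (cover_branch_holo H)). destruct H as (H1 & H2 & H3). split; [|split].
- assert (E : (- Ci / x) ^ 5 - - Ci / x = Ci * (x ^ 5 - x) / x ^ 6).
  { transitivity ((Ci / x ^ 5) * (x ^ 4 - Ci ^ 4)); [field; auto|].
    replace (Ci ^ 4) with ((Ci * Ci) * (Ci * Ci)) by ring. rewrite Ci_sq. field. auto. }
  rewrite E. apply Cmult_neq_0; [assert (N := Ci_nz); nz|]. intro Y. apply C1_nz.
  rewrite <- (Cinv_r (x ^ 6)), Y by (apply Cpow_nz; auto). ring.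
- assert (K : locally (- Ci / x) (fun y => (fun z => holo_at A z /\ ~ in_lattice L (A z) /\ wp L (A z) = cover_map z) (- Ci / y))).
  { apply (@locally_comp (fun y => - Ci / y) (fun z => holo_at A z /\ ~ in_lattice L (A z) /\ wp L (A z) = cover_map z)); auto.
    rewrite Ex. exact H2. }
  assert (K2 : locally (- Ci / x) (fun y : C => y <> 0 /\ den y <> 0)).
  { assert (Dx : den (- Ci / x) <> 0) by (apply cover_map_involution; auto; apply branch_den; auto).
    assert (cD : contC den (- Ci / x)).
    { unfold den. eapply D_cont. apply D_mult; [apply D_minus; [apply D_id|apply D_const]|apply D_plus; [apply D_id|apply D_const]]. }
    apply locally_and; apply locally_Cmod; [apply (@nonzero_near (fun y : C => y))|apply (@nonzero_near den)]; auto.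
    eapply D_cont; apply D_id. }
  generalize (@locally_and _ _ _ K K2). apply locally_imp. intros y ((Y1 & Y2 & Y3) & Y4 & Y5).
  split; [|split; auto].
  + apply holo_D in Y1. eapply D_holo. exact (D_comp (f := A) (g := fun y => - Ci / y) Y1 (Hd y Y4)).
  + rewrite Y3. apply cover_map_involution; auto.
- assert (Y1 : D A (- Ci / (- Ci / x)) (C_derive A x)) by (rewrite Ex; apply holo_D; auto).
  rewrite (D_C_derive (D_comp (f := A) (g := fun y => - Ci / y) Y1 (Hd _ Nx))).
  assert (N := Ci_nz). repeat apply Cmult_neq_0; auto.
  intro Y. apply C1_nz. rewrite <- (Cinv_r ((- Ci / x) ^ 2)), Y by (apply Cpow_nz; auto). ring.
Qed.

(** The difference of the two quadratic equations, divided by [x - y], gives the sum of the roots,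
    and the sum gives their product [- i]. *)
Lemma cover_map_fibre (x y : C) : den x <> 0 -> den y <> 0 -> cover_map x = cover_map y -> cover_map y - root2 <> 0 ->
  x = y \/ (y <> 0 /\ x = - Ci / y).
Proof.
intros Dx Dy E N. set (v := cover_map y) in *.
assert (Qx := proj1 (cover_map_quadratic v Dx) E). assert (Qy := proj1 (cover_map_quadratic v Dy) eq_refl).
set (u := v - root2) in *. set (b := (u - dlt) * (1 - Ci)) in *.
destruct (Ceq_dec (x - y) 0) as [X|X]; [left; apply Ceq_minus; auto|right].
assert (F : u * (x + y) + b = 0).
{ replace (u * (x + y) + b) with ((u * x ^ 2 + b * x - u * Ci - (u * y ^ 2 + b * y - u * Ci)) / (x - y)) by (field; auto).
  rewrite Qx, Qy. field. auto. }
assert (G : x * y = - Ci).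
{ replace (x * y) with ((y * (u * (x + y) + b) - (u * y ^ 2 + b * y - u * Ci)) / u - Ci) by (field; auto).
  rewrite F, Qy. field. auto. }
assert (Ny : y <> 0).
{ intro Y. apply Ci_nz. replace Ci with (- - Ci) by ring. rewrite <- G, Y. ring. }
split; auto. rewrite <- G. field. auto.
Qed.

(** Two branches take the value [al x0 + l]: the translate [B] at [x0], and [B] composed with the
    involution at [- i / x0]. [over_end] is prepared for both before the lifted path reveals, near
    its end, which of the two points it approaches. *)
Lemma torus_path_to_cover (g : R -> C) (F1 F2 : R -> C -> C) l : is_path g -> g 0%R = al x0 -> g 1%R = al x0 + l -> in_lattice L l ->
  continuation (solution_at q) g F1 xi1 -> continuation (solution_at q) g F2 xi2 ->
  exists x1 A f1 f2 S, conn PXL x0 (tri al psi1 psi2) x1 (tri A f1 f2) /\ A x1 = al x0 + l /\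
    changed_by A S f1 (F1 1%R) x1 /\ changed_by A S f2 (F2 1%R) x1.
Proof.
intros Hg Hg0 Hg1 Hl K1 K2.
assert (S1 : solution_at q (F1 1%R) (al x0 + l)) by (rewrite <- Hg1; apply K1, in01_1).
assert (S2 : solution_at q (F2 1%R) (al x0 + l)) by (rewrite <- Hg1; apply K2, in01_1).
set (B := fun y => al y + l). set (x' := - Ci / x0). set (B' := fun y => B (- Ci / y)).
assert (Nx0 : x0 <> 0).
{ intro X. destruct Hal as (Y & _). apply Y. rewrite X. ring. }
assert (HB : cover_branch_at L B x0) by (apply cover_branch_shift; auto).
assert (HB' : cover_branch_at L B' x') by (apply (@cover_branch_involution B x0 Nx0 HB)).
assert (Bx' : B' x' = al x0 + l).
{ unfold B', x', B. replace (- Ci / (- Ci / x0)) with x0; auto.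
  assert (N := Ci_nz). field. split; auto. }
destruct (@over_end B (F1 1%R) (F2 1%R) x0 HB S1 S2) as (r & Hr & E).
rewrite <- Bx' in S1, S2. destruct (@over_end B' (F1 1%R) (F2 1%R) x' HB' S1 S2) as (r' & Hr' & E').
destruct (branch_inverse Hg2 Hg3 Hkappa Hwp Hwp' HB) as (ri & si & h & Hri & Hsi & Bp & Inj & G).
assert (cI : contC (fun y => - Ci / y) x0).
{ eapply D_cont. apply (@D_scal (- Ci) (fun y => / y)), D_inv_id; exact Nx0. }
destruct (cI r' Hr') as (d & Hd & Kd). fold x' in Kd.
assert (G0 : h (B x0) = x0).
{ destruct (G (B x0) (ball_center _ Hsi)) as (G1 & G2 & _). apply Inj; auto. apply ball_center; auto. }
assert (ch : contC h (B x0)) by (eapply D_cont; apply (G (B x0) (ball_center _ Hsi))).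
assert (Hm : (0 < Rmin r d)%R) by (apply Rmin_pos; auto).
destruct (ch _ Hm) as (d2 & Hd2 & Kd2). rewrite G0 in Kd2.
destruct (@over_continue g F1 F2 Hg Hg0 K1 K2 (Rmin si d2)) as (p & P1 & P2 & (x & A & f1 & f2 & S & Cn & EA & C1 & C2));
  [apply Rmin_pos; auto|].
rewrite Hg1 in P1. change (al x0 + l) with (B x0) in P1.
assert (Q1 := Rlt_le_trans _ _ _ P1 (Rmin_l _ _)). assert (Q2 := Rlt_le_trans _ _ _ P1 (Rmin_r _ _)).
set (y := h p). destruct (G p Q1) as (G1 & G2 & _). specialize (Kd2 p Q2). fold y in G1, G2, Kd2.
assert (Y1 := Rlt_le_trans _ _ _ Kd2 (Rmin_l _ _)). assert (Y2 := Rlt_le_trans _ _ _ Kd2 (Rmin_r _ _)).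
assert (HA := conn_end Cn 0). simpl in HA.
assert (HBy : cover_branch_at L B y).
{ eapply branch_point_cover. apply (@locally_ball _ x0 ri y G1). exact Bp. }
destruct (not_bad_values Hg2 Hg3 Hkappa Hwp Hwp' P2) as (V1 & V2 & V3 & V4 & V5 & V6).
assert (Ex : cover_map x = Wf L 2 p).
{ destruct HA as (_ & X & _). rewrite <- EA. symmetry. apply (locally_self X). }
assert (Ey : cover_map y = Wf L 2 p).
{ destruct HBy as (_ & X & _). rewrite <- G2. symmetry. apply (locally_self X). }
destruct (@cover_map_fibre x y) as [E0|[Ny E0]].
- apply branch_den, HA.
- apply branch_den, HBy.
- congruence.
- rewrite Ey. auto.
- exists x0. exists B. subst x. destruct (E y A f1 f2 S) as (g1 & g2 & T & R1 & R2 & R3); auto; [rewrite G2; auto|congruence|].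
  exists g1, g2, T. auto.
- exists x'. exists B'.
  assert (Bx : B' x = p).
  { unfold B'. rewrite E0. replace (- Ci / (- Ci / y)) with y; auto. assert (N := Ci_nz). field. split; auto. }
  destruct (E' x A f1 f2 S) as (g1 & g2 & T & R1 & R2 & R3); auto; [rewrite E0; apply Kd; auto|rewrite Bx; auto|congruence|].
  exists g1, g2, T. auto.
Qed.

End Continue.
End Group.

Lemma locally_both (P Q : C -> Prop) z w : locally z P -> locally w Q ->
  exists eps : posreal, (forall y : C, ball z eps y -> P y) /\ (forall y : C, ball w eps y -> Q y).
Proof.
intros [e1 H1] [e2 H2].
exists (mkposreal (Rmin e1 e2) (Rmin_pos _ _ (cond_pos e1) (cond_pos e2))).
split; intros y Hy; [apply H1|apply H2]; (eapply ball_le; [|exact Hy]); [apply Rmin_l|apply Rmin_r].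
Qed.

(** * Equality of the two groups *)

Section Equivalence.
Variables (L : lattice) (kappa : C).
Hypothesis Hg2 : lattice_g2 L = RtoC (5 / 3).
Hypothesis Hg3 : lattice_g3 L = RtoC (- (7 / 27) * sqrt 2).
Hypothesis Hkappa : ~ in_lattice L kappa.
Hypothesis Hwp : wp L kappa = RtoC (- (7 / 2) - 13 / 6 * sqrt 2).
Hypothesis Hwp' : C_derive (wp L) kappa = RtoC (sqrt (sqrt 32) * (7 + 5 * sqrt 2)) * Ci.

Let q := burnside_coeff L kappa.
Let transferL := transfer Hg2 Hg3 Hkappa Hwp Hwp'.

Variables (x0 : C) (al psi1 psi2 s xi1 xi2 : C -> C).
Hypothesis Hal : cover_branch_at L al x0.
Hypothesis Hpsi1 : solution_at whittaker_coeff psi1 x0.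
Hypothesis Hpsi2 : solution_at whittaker_coeff psi2 x0.
Hypothesis Hind : independent_at psi1 psi2 x0.
Hypothesis Hc1 : changed_by al s psi1 xi1 x0.
Hypothesis Hc2 : changed_by al s psi2 xi2 x0.

Lemma changed_by_nonzero (A S f X : C -> C) (x : C) : cover_branch_at L A x -> changed_by A S f X x ->
  locally x (fun y => S y <> 0 /\ X (A y) = S y * f y).
Proof.
intros HA HC. generalize (@locally_and _ _ _ (cover_branch_near Hg2 Hg3 Hkappa Hwp Hwp' HA) HC).
apply locally_imp. intros y (((_ & _ & Y1) & _) & (_ & Y2 & Y3)). split; auto.
intro E. apply Y1. rewrite <- Y2, E. ring.
Qed.

Lemma xi_independent : independent_at xi1 xi2 (al x0).
Proof.
intros c1 c2 H. apply Hind.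
generalize (@locally_and _ _ _ (@locally_comp al _ _ (cover_branch_cont Hal) H)
  (@locally_and _ _ _ (changed_by_nonzero Hal Hc1) (changed_by_nonzero Hal Hc2))).
apply locally_imp. intros y (Y1 & (Y2 & Y3) & (_ & Y4)). rewrite Y3, Y4 in Y1.
replace (c1 * psi1 y + c2 * psi2 y) with ((c1 * (s y * psi1 y) + c2 * (s y * psi2 y)) / s y) by (field; auto).
rewrite Y1. field. auto.
Qed.

Lemma not_pm_mod_near : locally (al x0) (fun v => ~ pm_mod L kappa v).
Proof.
apply (cover_branch_open Hg2 Hg3 Hkappa Hwp Hwp' Hal).
generalize (cover_branch_near Hg2 Hg3 Hkappa Hwp Hwp' Hal). apply locally_imp. intros y (_ & B). apply B.
Qed.

Lemma xi_basis : exists r d1 d2, (0 < r)%R /\ sol_on q xi1 d1 (al x0) r /\ sol_on q xi2 d2 (al x0) r /\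
  wronsk xi1 d1 xi2 d2 (al x0) <> 0.
Proof.
assert (S1 := proj1 (transferL Hal Hc1) Hpsi1). assert (S2 := proj1 (transferL Hal Hc2) Hpsi2).
apply solution_at_iff in S1. apply solution_at_iff in S2.
destruct S1 as (r1 & d1 & Hr1 & S1), S2 as (r2 & d2 & Hr2 & S2).
assert (Hr : (0 < Rmin r1 r2)%R) by (apply Rmin_pos; auto).
apply (sol_on_shrink (r1 := Rmin r1 r2)) in S1; [|apply Rmin_l]. apply (sol_on_shrink (r1 := Rmin r1 r2)) in S2; [|apply Rmin_r].
exists (Rmin r1 r2), d1, d2. split; auto. split; auto. split; auto.
refine (independent_wronsk Hr _ S1 S2 xi_independent).
destruct (burnside_coeff_D (locally_self not_pm_mod_near)) as (d & Hd). exact (D_cont Hd).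
Qed.

Lemma torus_to_whittaker M : torus_orbifold_group L q (pm_mod L kappa) (al x0) xi1 xi2 M ->
  whittaker_orbifold_group L x0 al psi1 psi2 M.
Proof.
intros (HM & k & Hk & g & G1 & G2 & l & Hg & _ & Hl & g0 & g1 & K1 & K2 & HN). split; auto.
destruct (torus_path_to_cover Hg2 Hg3 Hkappa Hwp Hwp' Hal Hpsi1 Hpsi2 Hc1 Hc2 Hg g0 g1 Hl K1 K2)
  as (x1 & A1 & f1 & f2 & S & Cn & EA & C1 & C2).
assert (HA1 := conn_end Cn 0). simpl in HA1.
destruct Cn as (x & F & Hx & Hx0 & Hx1 & HF).
destruct (HF 0%nat) as [KA EA1]. destruct (HF 1%nat) as [KF1 EF1]. destruct (HF 2%nat) as [KF2 EF2].
(* The second coordinate of the path on the curve is a continuous root of [x ^ 5 - x], which has no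
   zero along [x]; either value at the start will do. *)
destruct (C_sqrt_exists (x 0%R ^ 5 - x 0%R)) as (y0 & Hy0).
destruct (@path_sqrt (fun t => x t ^ 5 - x t) y0) as (y & Hy & _ & Hy2); auto.
{ apply (@is_path_comp (fun z => z ^ 5 - z) x Hx). intros t _. eapply D_cont. apply D_minus; [apply D_pow, D_id|apply D_id]. }
{ intros t Ht. destruct KA as [_ KA]. destruct (KA t Ht) as [(X & _) _]. exact X. }
exists x, y, (fun t => F t 0%nat), (fun t => F t 1%nat), (fun t => F t 2%nat), l.
split; auto. split; auto. split; auto. split; auto. split; [exact KA|]. split; [exact KF1|]. split; [exact KF2|]. split; auto.
split. { rewrite Hx1. simpl in EA1. rewrite (locally_self EA1). exact EA. }
rewrite Hx1.
destruct (@locally_both _ _ _ _ (@locally_and _ _ _ (@locally_comp al _ _ (cover_branch_cont Hal) HN)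
    (@locally_and _ _ _ (changed_by_nonzero Hal Hc1) (changed_by_nonzero Hal Hc2)))
  (@locally_and _ _ _ (@locally_and _ _ _ EA1 (@locally_and _ _ _ EF1 EF2))
    (@locally_and _ _ _ (changed_by_nonzero HA1 C1) (changed_by_nonzero HA1 C2)))) as (eps & E0 & E1).
exists eps. intros z w Hz Hw E. simpl in E1.
destruct (E0 z Hz) as ((N1 & N2) & (_ & P1) & (_ & P2)). destruct (E1 w Hw) as ((W1 & W2 & W3) & (W4 & Q1) & (_ & Q2)).
rewrite W1 in E. rewrite E, N1 in Q1. rewrite E, N2 in Q2. rewrite P1, P2 in Q1, Q2. simpl in Q1, Q2.
rewrite W2, W3.
(* Both germs at [w] carry the factor [k * s z / S w], which drops out of the cross products. *)
replace (f1 w) with (S w * f1 w / S w) by (field; auto). replace (f2 w) with (S w * f2 w / S w) by (field; auto).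
rewrite <- Q1, <- Q2. field. auto.
Qed.

(** The ratio relation, rewritten in [alpha], compares the continued germs at [v + l] with [xi1],
    [xi2] at [v]. By periodicity of [q] the former are combinations of the latter, with some matrix
    [N], and [ratio_matrix] makes [N] a multiple of [M]. *)
Lemma whittaker_to_torus M : whittaker_orbifold_group L x0 al psi1 psi2 M ->
  torus_orbifold_group L q (pm_mod L kappa) (al x0) xi1 xi2 M.
Proof.
intros (HM & x & _ & A & F1 & F2 & l & Hx & _ & _ & Hx0 & KA & K1 & K2 & Hl & EA & eps & Rel). split; auto.
destruct (cover_path_to_torus Hg2 Hg3 Hkappa Hwp Hwp' Hx Hx0 KA K1 K2 Hc1 Hc2) as (X1 & X2 & S & Cn & C1 & C2).
assert (HA1 : cover_branch_at L (A 1%R) (x 1%R)) by (apply KA, in01_1).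
destruct Cn as (g & F & Hg & g0 & g1 & HF). rewrite EA in g1.
destruct (HF 0%nat) as [KS _]. destruct (HF 1%nat) as [KF1 EF1]. destruct (HF 2%nat) as [KF2 EF2]. rewrite EA in EF1, EF2.
simpl in EF1, EF2.
destruct xi_basis as (r0 & d1 & d2 & Hr0 & S1 & S2 & W).
set (Y1 := F 1%R 1%nat) in *. set (Y2 := F 1%R 2%nat) in *.
assert (T1 : solution_at q Y1 (al x0 + l)) by (rewrite <- g1; apply KF1, in01_1).
assert (T2 : solution_at q Y2 (al x0 + l)) by (rewrite <- g1; apply KF2, in01_1).
apply solution_at_iff in T1. apply solution_at_iff in T2.
destruct T1 as (r1 & e1 & Hr1 & T1), T2 as (r2 & e2 & Hr2 & T2).
destruct (locally_at not_pm_mod_near) as (r3 & Hr3 & Npm).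
assert (Hrel : locally (al x0) (fun v => Y1 (v + l) * (m21 M * xi1 v + m22 M * xi2 v) = Y2 (v + l) * (m11 M * xi1 v + m12 M * xi2 v))).
(* Each [v] near [al x0] has to be presented as [al z] with [z] in the ball where the ratio relation
   is given; the openness of [al] provides such a [z]. *)
{ set (P := fun v => exists z : C, ball x0 eps z /\ v = al z /\ xi1 v = s z * psi1 z /\ xi2 v = s z * psi2 z).
  assert (HP : locally (al x0) P).
  { apply (cover_branch_open Hg2 Hg3 Hkappa Hwp Hwp' Hal).
    assert (Hb : locally x0 (fun z : C => ball x0 eps z)) by (exists eps; auto).
    generalize (@locally_and _ _ _ Hb (@locally_and _ _ _ (changed_by_nonzero Hal Hc1) (changed_by_nonzero Hal Hc2))).
    apply locally_imp. intros z (Z1 & (_ & Z2) & (_ & Z3)). exists z. auto. }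
  assert (cS : contC (fun w => A 1%R w - l) (x 1%R)).
  { eapply D_cont. apply D_minus; [apply holo_D; exact (locally_self (cover_branch_holo HA1))|apply D_const]. }
  assert (HR : locally (A 1%R (x 1%R)) (fun v' => Y1 v' * (m21 M * xi1 (v' - l) + m22 M * xi2 (v' - l)) =
     Y2 v' * (m11 M * xi1 (v' - l) + m12 M * xi2 (v' - l)))).
  { apply (cover_branch_open Hg2 Hg3 Hkappa Hwp Hwp' HA1).
    assert (HPw : locally (x 1%R) (fun w => P (A 1%R w - l))).
    { apply (@locally_comp (fun w => A 1%R w - l) P); auto. rewrite EA. replace (al x0 + l - l) with (al x0) by ring. exact HP. }
    assert (Hb : locally (x 1%R) (fun w : C => ball (x 1%R) eps w)) by (exists eps; auto).
    assert (EY : locally (x 1%R) (fun w => Y1 (A 1%R w) = X1 (A 1%R w) /\ Y2 (A 1%R w) = X2 (A 1%R w))).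
    { apply (@locally_comp (A 1%R) (fun v => Y1 v = X1 v /\ Y2 v = X2 v)); [exact (cover_branch_cont HA1)|].
      rewrite EA. apply locally_and; auto. }
    generalize (@locally_and _ _ _ (@locally_and _ _ _ HPw Hb)
      (@locally_and _ _ _ EY (@locally_and _ _ _ (changed_by_nonzero HA1 C1) (changed_by_nonzero HA1 C2)))).
    apply locally_imp. intros w (((z & Z1 & Z2 & Z3 & Z4) & Z5) & (Z6 & Z7) & (_ & Z8) & (_ & Z9)).
    rewrite Z3, Z4, Z6, Z7, Z8, Z9.
    assert (R := Rel z w Z1 Z5 ltac:(rewrite <- Z2; ring)).
    transitivity (S w * s z * (F1 1%R w * (m21 M * psi1 z + m22 M * psi2 z))); [ring|]. rewrite R. ring. }
  rewrite EA in HR.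
  assert (cl : contC (fun v => v + l) (al x0)) by (eapply D_cont; apply D_plus; [apply D_id|apply D_const]).
  generalize (@locally_comp (fun v => v + l) _ (al x0) cl HR). apply locally_imp. intros v Hv.
  replace (v + l - l) with v in Hv by ring. exact Hv. }
destruct (locally_at Hrel) as (r4 & Hr4 & Hrel').
destruct (min3_pos Hr1 Hr2 Hr3) as (r5 & Hr5 & B1 & B2 & B3). destruct (min3_pos Hr0 Hr4 Hr5) as (r & Hr & B4 & B5 & B6).
apply (sol_on_shrink (r1 := r)) in S1; [|lra]. apply (sol_on_shrink (r1 := r)) in S2; [|lra].
assert (Sh : forall Y e rr, (r <= rr)%R -> sol_on q Y e (al x0 + l) rr -> sol_on q (fun v => Y (v + l)) (fun v => e (v + l)) (al x0) r).
{ intros Y e rr Hrr HY v Hv. destruct (HY (v + l)) as [V1 V2].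
  { replace (v + l - (al x0 + l)) with (v - al x0) by ring. lra. }
  split; [apply D_shift; exact V1|]. eapply D_eq; [|apply D_shift; exact V2]. unfold q.
  rewrite burnside_coeff_periodic; auto. apply Npm. lra. }
assert (U1 := Sh Y1 e1 r1 ltac:(lra) T1). assert (U2 := Sh Y2 e2 r2 ltac:(lra) T2).
destruct (sol_basis Hr S1 S2 U1 W) as (n11 & n12 & HN1). destruct (sol_basis Hr S1 S2 U2 W) as (n21 & n22 & HN2).
destruct (@ratio_matrix q xi1 d1 xi2 d2 (al x0) r M (Mat2 n11 n12 n21 n22) Hr S1 S2 W HM) as (k & Ek).
{ intros v Hv. simpl. destruct (HN1 v Hv) as [<- _]. destruct (HN2 v Hv) as [<- _]. apply Hrel'. lra. }
(* The determinant is the quotient of the Wronskians after and before continuation. A factor [k = 0]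
   would make it vanish. *)
assert (Dt : n11 * n22 - n12 * n21 <> 0).
{ assert (D0 : forall f d r', (0 < r')%R -> sol_on q f d (al x0) r' -> C_derive f (al x0) = d (al x0)).
  { intros f d r' Hr' Hf. apply D_C_derive. apply (Hf (al x0)). apply ball_center; auto. }
  assert (Wf0 : wronsk (F 0%R 1%nat) (C_derive (F 0%R 1%nat)) (F 0%R 2%nat) (C_derive (F 0%R 2%nat)) (g 0%R) <> 0).
  { destruct KF1 as [I1 _], KF2 as [I2 _]. rewrite g0 in I1, I2 |- *. simpl in I1, I2.
    assert (J : forall f f' (d : C -> C), sol_on q f d (al x0) r -> locally (al x0) (fun z => f' z = f z) -> C_derive f' (al x0) = d (al x0)).
    { intros f f' d Hf E. apply D_C_derive. apply D_ext_loc with f; [revert E; apply locally_imp; auto|].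
      apply (Hf (al x0)). apply ball_center; auto. }
    unfold wronsk in W |- *. rewrite (J _ _ _ S1 I1), (J _ _ _ S2 I2), (locally_self I1), (locally_self I2). exact W. }
  assert (W1 := wronsk_continuation KF1 KF2 Hg Wf0). cbv beta in W1. fold Y1 Y2 in W1. rewrite g1 in W1.
  assert (C1' : C_derive Y1 (al x0 + l) = e1 (al x0 + l)) by (apply D_C_derive, T1, ball_center; auto).
  assert (C2' : C_derive Y2 (al x0 + l) = e2 (al x0 + l)) by (apply D_C_derive, T2, ball_center; auto).
  destruct (HN1 (al x0) (ball_center _ Hr)) as [V1 V2]. destruct (HN2 (al x0) (ball_center _ Hr)) as [V3 V4].
  intro X. apply W1. unfold wronsk. rewrite C1', C2', V1, V2, V3, V4.
  transitivity ((n11 * n22 - n12 * n21) * wronsk xi1 d1 xi2 d2 (al x0)); [unfold wronsk; ring|rewrite X; ring]. }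
exists k. split.
{ intros ->. apply Dt. injection Ek. intros -> -> -> ->. ring. }
exists g, (fun t => F t 1%nat), (fun t => F t 2%nat), l.
split; auto. split; [intros t Ht; apply (proj2 KS t Ht)|]. split; auto. split; auto. split; auto.
split; [exact KF1|]. split; [exact KF2|]. rewrite <- Ek. simpl.
apply locally_Cmod. exists r. split; auto. intros v Hv. split; [apply HN1|apply HN2]; auto.
Qed.

End Equivalence.

Theorem proposition4 (L : lattice) (kappa : C)
    (Hg2 : lattice_g2 L = RtoC (5 / 3))
    (Hg3 : lattice_g3 L = RtoC (- (7 / 27) * sqrt 2))
    (Hkappa : ~ in_lattice L kappa)
    (Hwp : wp L kappa = RtoC (- (7 / 2) - 13 / 6 * sqrt 2))
    (Hwp' : C_derive (wp L) kappa
            = (RtoC (sqrt (sqrt 32) * (7 + 5 * sqrt 2)) * Ci)%C) :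
  let q := torus_coeff L kappa
             (- (RtoC (/ sqrt (sqrt 32)) * Ci))%C
             (RtoC (/ sqrt (sqrt 32)) * Ci)%C
             (- (RtoC (/ sqrt (sqrt 2)) * Ci * wzeta L kappa
                 + RtoC (sqrt 2) + 1))%C in
  let q' := torus_coeff_wp L kappa
              (RtoC (7 + 5 * sqrt 2)) (- RtoC (sqrt 2) - 1)%C in
  (* a Fuchsian equation on the torus with two singularities *)
  (fuchsian_on_torus L q (pm_mod L kappa) /\
   ~ in_lattice L (kappa - - kappa)%C) /\
  (* obtained from Whittaker's equation by the change of variables *)
  (forall (x0 : C) (al s psi xi : C -> C),
     cover_branch_at L al x0 -> changed_by al s psi xi x0 ->
     (solution_at whittaker_coeff psi x0 <-> solution_at q xi (al x0))) /\
  (* defining the orbifold of Whittaker's uniformization *)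
  (forall (x0 : C) (al s psi1 psi2 xi1 xi2 : C -> C),
     cover_branch_at L al x0 ->
     solution_at whittaker_coeff psi1 x0 ->
     solution_at whittaker_coeff psi2 x0 ->
     independent_at psi1 psi2 x0 ->
     changed_by al s psi1 xi1 x0 -> changed_by al s psi2 xi2 x0 ->
     forall M : mat2,
       whittaker_orbifold_group L x0 al psi1 psi2 M <->
       torus_orbifold_group L q (pm_mod L kappa) (al x0) xi1 xi2 M) /\
  (* the equivalent form *)
  (forall z : C, ~ in_lattice L z -> ~ pm_mod L kappa z -> q z = q' z).
Proof.
intros q q'. change q with (burnside_coeff L kappa) in *. split; [|split; [|split]].
- split; [apply q_fuchsian; auto|].
  replace (kappa - - kappa) with (2 * kappa) by ring. apply two_kappa; auto.
- intros x0 al s psi xi Hal Hch. exact (transfer Hg2 Hg3 Hkappa Hwp Hwp' Hal Hch).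
- intros x0 al s psi1 psi2 xi1 xi2 Hal Hpsi1 Hpsi2 Hind Hc1 Hc2 M. split.
  + exact (whittaker_to_torus Hg2 Hg3 Hkappa Hwp Hwp' Hal Hpsi1 Hpsi2 Hind Hc1 Hc2 (M := M)).
  + exact (torus_to_whittaker Hg2 Hg3 Hkappa Hwp Hwp' Hal Hpsi1 Hpsi2 Hc1 Hc2 (M := M)).
- intros z Hz Hpm. exact (burnside_coeff_equiv Hg2 Hg3 Hkappa Hwp Hwp' Hz Hpm).
Qed.
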